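(* Let $n\in\mathbb{N}$, $s\in(0,1)$, $p>1$. Let $K:\mathbb{R}^n\times\mathbb{R}^n\to[0,+\infty]$ be measurable with $K(x,y)=K(y,x)$ for a.a. $x,y$, and $\frac{(1-s)\chi_{B_{r_0}}(x-y)}{\Lambda|x-y|^{n+sp}}\le K(x,y)\le\frac{(1-s)\Lambda}{|x-y|^{n+sp}}$ for a.a. $x,y\in\mathbb{R}^n$, for some $\Lambda\ge1$, $r_0>0$. Let $\Omega\subset\mathbb{R}^n$ be a bounded open set, and suppose that $|F(x,t)|\le d_1+d_2|t|^q$ for a.a. $x\in\Omega$ and any $t\in\mathbb{R}$, where $d_1,d_2\ge0$, and one of the following cases holds: (i) $d_2=0$; (ii) $d_2>0$ and $1\le q\le p$; (iii) $d_2>0$, $n\ge sp$ and $p<q<p^*_s$. Let $u$ be a subminimizer of $\mathcal{E}$ in $\Omega$. Then there exist four constants $R_0\in(0,r_0/2]$, $k_0\in[-\infty,1]$, $H\ge1$ and $\varepsilon\in(0,sp/n]$ such that $$\begin{aligned}&[(u-k)_+]^p_{W^{s,p}(B_r(x_0))}+\int_{B_r(x_0)}(u(x)-k)_+\Big[\int_{B_{2R_0}(x)}\frac{(u(y)-k)_-^{p-1}}{|x-y|^{n+sp}}dy\Big]dx\\&\le\frac H{1-s}\Big[\Big(d_1+\frac{|k|^p}{R^{n\varepsilon}}\Big)|A^+(k,x_0,R)|^{1-\frac{sp}n+\varepsilon}+\frac{R^{(1-s)p}}{(R-r)^p}\|(u-k)_+\|^p_{L^p(B_R(x_0))}\\&\quad+\frac{R^{n+sp}}{(R-r)^{n+sp}}\|(u-k)_+\|_{L^1(B_R(x_0))}\overline{\operatorname{Tail}}((u-k)_+;x_0,r)^{p-1}\Big],\end{aligned}$$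 for any $x_0\in\Omega$, $0<r<R\le\min\{R_0,\operatorname{dist}(x_0,\partial\Omega)\}$ and $k\ge k_0$. Consequently, $u$ belongs to the following fractional De Giorgi classes: - in case (i), $u\in\mathrm{DG}^{s,p}_+\big(\Omega;d_1^{1/p},H,-\infty,\frac{sp}n,0,\frac{r_0}2\big)$, with $H=H(n,p,\Lambda)$; - in case (ii), $u\in\mathrm{DG}^{s,p}_+\big(\Omega;d_1^{1/p},H,1,\frac{sp}n,0,\min\{1,\frac{r_0}2\}\big)$, with $H=H(n,p,\Lambda,d_2)$; - in case (iii), $u\in\mathrm{DG}^{s,p}_+\big(\Omega;d_1^{1/p},H,0,1-\frac q{p^*_\sigma},0,R_0\big)$, with $H=H(n,p,q,\Lambda,d_2)$, $R_0=R_0(n,s,p,q,\Lambda,d_2,r_0,\|u\|_{L^{p^*_\sigma}(\Omega)})$ and for some constant $\sigma=\sigma(n,s,p,q)\in(0,s)$. When $n>sp$ we can even take $\sigma=s$, while when $n>p$ the constant $R_0$ does not blow up as $s\to1^-$. An analogous statement holds for superminimizers $u$ of $\mathcal{E}$ in $\Omega$ and the classes $\mathrm{DG}^{s,p}_-$ with the same parameters.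
   Context: Notation: $B_R(x_0)$ open ball, $B_R=B_R(0)$; $v_+=\max\{v,0\}$, $v_-=-\min\{v,0\}$; $[v]_{W^{s,p}(U)}:=\big(\int_U\int_U\frac{|v(x)-v(y)|^p}{|x-y|^{n+sp}}dx\,dy\big)^{1/p}$, $W^{s,p}(U)=\{v\in L^p(U):[v]_{W^{s,p}(U)}<\infty\}$. For $\sigma\in(0,1)$: $p^*_\sigma:=\frac{np}{n-\sigma p}$ if $n>\sigma p$, $p^*_\sigma:=+\infty$ if $n=\sigma p$. $L^{p-1}_s(\mathbb{R}^n)$ is the space of $u:\mathbb{R}^n\to\mathbb{R}$ with $\int_{\mathbb{R}^n}\frac{|u(x)|^{p-1}}{(1+|x|)^{n+sp}}dx<+\infty$. $\overline{\operatorname{Tail}}(u;x_0,R):=\big[(1-s)\int_{\mathbb{R}^n\setminus B_R(x_0)}\frac{|u(x)|^{p-1}}{|x-x_0|^{n+sp}}dx\big]^{\frac1{p-1}}$. $A^+(k,x_0,R):=B_R(x_0)\cap\{u>k\}$, $A^-(k,x_0,R):=B_R(x_0)\cap\{u<k\}$. $\mathscr{C}_\Omega:=\mathbb{R}^{2n}\setminus(\mathbb{R}^n\setminus\Omega)^2$; $\mathbb{W}^{s,p}(\Omega)$ is the space of measurable $u:\mathbb{R}^n\to\mathbb{R}$ with $u|_\Omega\in L^p(\Omega)$ and $(x,y)\mapsto\frac{|u(x)-u(y)|^p}{|x-y|^{n+sp}}\in L^1(\mathscr{C}_\Omega)$. $F:\mathbb{R}^n\times\mathbb{R}\to\mathbb{R}$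 is measurable and such that $x\mapsto F(x,v(x))$ is measurable for any measurable $v$. Energy: $\mathcal{E}(u;\Omega):=\frac1{2p}\iint_{\mathscr{C}_\Omega}|u(x)-u(y)|^pK(x,y)\,dx\,dy+\int_\Omega F(x,u(x))\,dx$. A function $u\in\mathbb{W}^{s,p}(\Omega)$ is a subminimizer (superminimizer) of $\mathcal{E}$ in $\Omega$ if $\mathcal{E}(u;\Omega)\le\mathcal{E}(u+\varphi;\Omega)$ for any non-positive (non-negative) measurable $\varphi:\mathbb{R}^n\to\mathbb{R}$ supported inside $\Omega$. Fractional De Giorgi classes: let $d\ge0$, $H\ge1$, $k_0\in\mathbb{R}$, $\varepsilon\in(0,sp/n]$, $\lambda\ge0$, $R_0\in(0,+\infty]$. A function $u\in L^{p-1}_s(\mathbb{R}^n)\cap W^{s,p}(\Omega)$ belongs to $\mathrm{DG}^{s,p}_+(\Omega;d,H,k_0,\varepsilon,\lambda,R_0)$ iff $$\begin{aligned}&[(u-k)_+]^p_{W^{s,p}(B_r(x_0))}+\int_{B_r(x_0)}(u(x)-k)_+\Big[\int_{B_{2R_0}(x)}\frac{(u(y)-k)_-^{p-1}}{|x-y|^{n+sp}}dy\Big]dx\\&\le\frac{H}{1-s}\Big[\Big(R^\lambda d^p+\frac{|k|^p}{R^{n\varepsilon}}\Big)|A^+(k,x_0,R)|^{1-\frac{sp}n+\varepsilon}+\frac{R^{(1-s)p}}{(R-r)^p}\|(u-k)_+\|^p_{L^p(B_R(x_0))}\\&\quad+\frac{R^{n+sp}}{(R-r)^{n+sp}}\|(u-k)_+\|_{L^1(B_R(x_0))}\overline{\operatorname{Tail}}((u-k)_+;x_0,r)^{p-1}\Big]\end{aligned}$$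 for any $x_0\in\Omega$, $0<r<R<\min\{R_0,\operatorname{dist}(x_0,\partial\Omega)\}$ and $k\ge k_0$. It belongs to $\mathrm{DG}^{s,p}_-(\Omega;d,H,k_0,\varepsilon,\lambda,R_0)$ iff the same inequality holds with $(u-k)_+$ and $(u-k)_-$ interchanged and $A^-$ in place of $A^+$, for all such $x_0,r,R$ and all $k\le-k_0$. Writing $-\infty$ in place of $k_0$ means that the inequality holds for all $k\in\mathbb{R}$.
   Formalization: In case (iii) the norm of u in L^{p*_σ}(Ω), on which R_0 depends, is assumed finite (it can be infinite on cusp domains, where E(u) = −∞ makes the claim false); Ω is assumed nonempty. *)

(* Defs.v *)
From HB Require Import structures.
From mathcomp Require Import all_boot all_order all_algebra.
From mathcomp Require Import all_classical all_reals all_analysis.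
From mathcomp Require Import measurable_realfun.

Set Implicit Arguments.
Unset Strict Implicit.
Unset Printing Implicit Defensive.

Import Order.TTheory GRing.Theory Num.Theory.
Import numFieldNormedType.Exports.

Local Open Scope classical_set_scope.
Local Open Scope ring_scope.

(* The library extends set functions from a semiring of sets.  With the power
   set as semiring, [mu_ext box_content] below is the infimum of the total
   volume over all countable covers by boxes (and copies of the empty set),
   since a set that is not a box has content +oo. *)
Definition powerset_rV (R : realType) (n : nat) : Type := 'rV[R]_n.

HB.instance Definition _ (R : realType) (n : nat) :=
  Pointed.copy (powerset_rV R n) 'rV[R]_n.
HB.instance Definition _ (R : realType) (n : nat) :=
  @isMeasurable.Build default_measure_display (powerset_rV R n)
    discrete_measurable discrete_measurable0
    discrete_measurableC discrete_measurableU.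

Section lebesgue_outer_measure.
Context {R : realType} {n : nat}.
Local Notation T := (powerset_rV R n).

Definition box (a b : 'rV[R]_n) : set T :=
  [set x : 'rV[R]_n | forall i, a ord0 i < x ord0 i <= b ord0 i].

Definition box_volume (a b : 'rV[R]_n) : R := \prod_i (b ord0 i - a ord0 i).

Definition box_content (A : set T) : \bar R :=
  if A == set0 then 0%E
  else ereal_inf [set (box_volume ab.1 ab.2)%:E
                 | ab in [set ab | A = box ab.1 ab.2]].

Definition lebesgue_outer : set T -> \bar R := mu_ext box_content.

Lemma box_content0 : box_content set0 = 0%E.
Proof. by rewrite /box_content eqxx. Qed.

Lemma box_volume_ge0 a b : box a b !=set0 -> 0 <= box_volume a b.
Proof.
move=> [x abx]; apply: prodr_ge0 => i _; rewrite subr_ge0.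
by have /andP[/ltW ax xb] := abx i; exact: le_trans xb.
Qed.

Lemma box_content_ge0 A : (0 <= box_content A)%E.
Proof.
rewrite /box_content; case: eqVneq => // /set0P A0.
apply: le_ereal_inf_tmp => _ [[a b] /= Aab <-].
by rewrite lee_fin box_volume_ge0// -Aab.
Qed.

Lemma box_content_le a b : box a b !=set0 ->
  (box_content (box a b) <= (box_volume a b)%:E)%E.
Proof.
move=> ab0; rewrite /box_content; case: eqVneq => _.
  by rewrite lee_fin box_volume_ge0.
by apply: ereal_inf_lbound; exists (a, b).
Qed.

HB.instance Definition _ := isOuterMeasure.Build R T lebesgue_outer
  (mu_ext0 box_content0 box_content_ge0) (mu_ext_ge0 box_content_ge0)
  (@le_mu_ext _ _ _ box_content) (mu_ext_sigma_subadditive box_content_ge0).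

Definition below (i : 'I_n) (c : R) : set T := [set x : 'rV[R]_n | x ord0 i <= c].

Lemma box_content_split (i : 'I_n) (c : R) A :
  (box_content (A `&` below i c) + box_content (A `&` ~` below i c)
   <= box_content A)%E.
Proof.
have [->|/set0P A0] := eqVneq A set0.
  by rewrite !set0I !box_content0 adde0.
rewrite [leRHS]/box_content ifF; last by apply/negbTE/set0P.
apply: le_ereal_inf_tmp => _ [[a b] /= Aab <-].
have abi x : A x -> a ord0 i < (x : 'rV[R]_n) ord0 i <= b ord0 i.
  by rewrite Aab => /(_ i).
have [bc|cb] := leP (b ord0 i) c.
  rewrite (_ : A `&` ~` _ = set0) ?box_content0 ?adde0; last first.
    rewrite -subset0 => x [/abi/andP[_ xb]] /=.
    by rewrite /below/=; apply; exact: le_trans xb bc.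
  rewrite (_ : A `&` _ = A).
    by rewrite Aab box_content_le// -Aab.
  apply/setIidl => x /abi/andP[_ xb]; rewrite /below/=; exact: le_trans xb bc.
have [ca|ac] := leP c (a ord0 i).
  rewrite (_ : A `&` below _ _ = set0) ?box_content0 ?add0e; last first.
    rewrite -subset0 => x [/abi/andP[ax _]]; rewrite /below/= => xc.
    by have := lt_le_trans (le_lt_trans ca ax) xc; rewrite ltxx.
  rewrite (_ : A `&` _ = A).
    by rewrite Aab box_content_le// -Aab.
  apply/setIidl => x /abi/andP[ax _] /=; rewrite /below/= => xc.
  by have := lt_le_trans (le_lt_trans ca ax) xc; rewrite ltxx.
pose b' : 'rV[R]_n := \row_j (if j == i then c else b ord0 j).
pose a' : 'rV[R]_n := \row_j (if j == i then c else a ord0 j).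
have E1 : A `&` below i c = box a b'.
  rewrite Aab; apply/seteqP; split => x.
    move=> [abx xc] j; rewrite mxE; case: eqP => [->|_]; last exact: abx.
    by have /andP[-> _] := abx i.
  move=> abx; split=> [j|]; last by have := abx i; rewrite mxE eqxx => /andP[].
  have := abx j; rewrite mxE; case: eqP => [-> /andP[-> xc]|//].
  by rewrite (le_trans xc (ltW cb)).
have E2 : A `&` ~` below i c = box a' b.
  rewrite Aab; apply/seteqP; split => x.
    move=> [abx xc] j; rewrite mxE; case: eqP => [->|_]; last exact: abx.
    have /andP[_ ->] := abx i; rewrite andbT ltNge; exact/negP.
  move=> abx; split=> [j|]; last first.
    by have := abx i; rewrite mxE eqxx /below /= => /andP[cx _]; apply/negP; rewrite -ltNge.
  have := abx j; rewrite mxE; case: eqP => [-> /andP[xc ->]|//].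
  by rewrite (lt_trans ac xc).
have [x0 Ax0] := A0.
have ne1 : box a b' !=set0.
  exists (\row_j (if j == i then c else (x0 : 'rV[R]_n) ord0 j)) => j; rewrite !mxE.
  case: eqP => [->|_]; first by rewrite ac lexx.
  by move: Ax0; rewrite Aab; exact.
have ne2 : box a' b !=set0.
  exists (\row_j (if j == i then b ord0 i else (x0 : 'rV[R]_n) ord0 j)) => j; rewrite !mxE.
  case: eqP => [->|_]; first by rewrite cb lexx.
  by move: Ax0; rewrite Aab; exact.
rewrite E1 E2 (le_trans (leeD (box_content_le ne1) (box_content_le ne2)))//.
rewrite -EFinD lee_fin /box_volume.
rewrite (bigD1 i)//= [X in _ + X](bigD1 i)//= [leRHS](bigD1 i)//= !mxE eqxx.
rewrite (eq_bigr (fun j => b ord0 j - a ord0 j)); last first.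
  by move=> j /negbTE ji; rewrite mxE ji.
rewrite [X in _ + _ * X](eq_bigr (fun j => b ord0 j - a ord0 j)); last first.
  by move=> j /negbTE ji; rewrite mxE ji.
by rewrite -mulrDl [c - _ + _]addrC addrA subrK.
Qed.

Lemma caratheodory_below (i : 'I_n) (c : R) :
  lebesgue_outer.-caratheodory (below i c).
Proof.
apply: le_caratheodory_measurable => X.
apply: le_ereal_inf_tmp => _ [F [mF XF] <-].
apply: (@le_trans _ _ (\sum_(k <oo) box_content (F k `&` below i c) +
                      \sum_(k <oo) box_content (F k `&` ~` below i c)))%E.
  apply: leeD; apply: ereal_inf_lbound; eexists; try reflexivity; split => //.
    by move=> x [/XF[k _ Fkx] ?]; exists k.
  by move=> x [/XF[k _ Fkx] ?]; exists k.
rewrite -nneseriesD//; try by move=> *; exact: box_content_ge0.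
apply: lee_nneseries => [k _ _|k _].
  by rewrite adde_ge0// box_content_ge0.
exact: box_content_split.
Qed.

End lebesgue_outer_measure.

(* The measurable sets of Rn R n are the Lebesgue measurable ones.  The norm
   `|x| inherited from 'rV[R]_n is the sup norm; the Euclidean one is enorm. *)
Definition Rn (R : realType) (n : nat) : Type := 'rV[R]_n.

HB.instance Definition _ (R : realType) (n : nat) :=
  NormedModule.copy (Rn R n) 'rV[R]_n.
HB.instance Definition _ (R : realType) (n : nat) :=
  Measurable.copy (Rn R n) (caratheodory_type (@lebesgue_outer R n)).

Section lebesgue_measure_Rn.
Context {R : realType} {n : nat}.

Definition lebesgue : set (Rn R n) -> \bar R := @lebesgue_outer R n.

HB.instance Definition _ := isMeasure.Build _ _ _ lebesgue
  (@caratheodory_measure0 _ _ (@lebesgue_outer R n))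
  (@caratheodory_measure_ge0 _ _ (@lebesgue_outer R n))
  (@caratheodory_measure_sigma_additive _ _ (@lebesgue_outer R n)).

Let sigma_finite_lebesgue : sigma_finite setT lebesgue.
Proof.
pose F (k : nat) : set (Rn R n) :=
  box (\row_(_ < n) (- k%:R)) (\row_(_ < n) k%:R).
exists F.
  apply/seteqP; split=> // x _.
  have [k xk] : exists k : nat, forall i, `|(x : 'rV[R]_n) ord0 i| < k%:R.
    exists (\sum_i Num.bound `|(x : 'rV[R]_n) ord0 i|)%N => i.
    apply: lt_le_trans (archi_boundP _) _ => //.
    by rewrite ler_nat (bigD1 i)//= leq_addr.
  exists k => // i; rewrite !mxE.
  by have := xk i; rewrite ltr_norml => /andP[-> /ltW ->].
move=> k; split.
  rewrite (_ : F k = \bigcap_(i in [set: 'I_n])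
      (below i k%:R `\` below i (- k%:R))); last first.
    apply/seteqP; split=> x.
      move=> Fx i _; have := Fx i; rewrite !mxE /below /= => /andP[kx xk].
      by split=> //=; apply/negP; rewrite -ltNge.
    by move=> Fx i; have [/= xk /negP] := Fx i I; rewrite !mxE -ltNge xk => ->.
  apply: fin_bigcap_measurable => // i _.
  by apply: measurableD; exact: caratheodory_below.
have [F0|/set0P F0] := eqVneq (F k) set0.
  by rewrite F0 measure0.
apply: le_lt_trans (ltry (box_volume (\row_(_ < n) (- k%:R)) (\row_(_ < n) k%:R))).
apply: le_trans (box_content_le F0).
apply: ereal_inf_lbound; exists (fun i => if i is 0%N then F k else set0).
  by split=> // x Fx; exists 0%N.
rewrite nneseries_recl => [|m _|]; rewrite ?box_content_ge0//=.
by rewrite eseries0 ?adde0// => -[|i]//= _ _; rewrite box_content0.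
Qed.

HB.instance Definition _ :=
  @Measure_isSigmaFinite.Build _ _ _ lebesgue sigma_finite_lebesgue.

End lebesgue_measure_Rn.


Section measurability.
Context d (T : measurableType d) (R : realType).

(* f is measurable for the completion of mu.  Used only on products, where
   mu \x nu is not complete; for Lebesgue measures mu and nu its completion is
   the Lebesgue measure of the product space. *)
Definition completion_measurable_fun d' (U : measurableType d')
    (mu : {measure set T -> \bar R}) (f : T -> U) : Prop :=
  exists2 g : T -> U, measurable_fun setT g & {ae mu, forall x, f x = g x}.

End measurability.

Section function_spaces.
Context {R : realType} {n : nat}.
Local Notation E := (Rn R n).
Local Notation leb := (@lebesgue R n).
Implicit Types (x y : E) (U Omega : set E) (u v : E -> R) (s p : R).

Definition enorm (x : E) : R :=
  Num.sqrt (\sum_i ((x : 'rV[R]_n) ord0 i) ^+ 2).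

Definition eball (x0 : E) (r : \bar R) : set E :=
  [set x | ((enorm (x - x0))%:E < r)%E].

Definition dist_boundary (x0 : E) Omega : \bar R :=
  ereal_inf [set (enorm (x0 - y))%:E | y in closure Omega `\` interior Omega].

Definition Lp_norm (p : \bar R) U u : \bar R :=
  Lnorm leb p ((EFin \o u) \_ U).

Definition difference_quotient s p u (z : E * E) : R :=
  `|u z.1 - u z.2| `^ p / enorm (z.1 - z.2) `^ (n%:R + s * p).

Definition gagliardo s p U u : \bar R :=
  ((\int[leb \x leb]_(z in U `*` U) (difference_quotient s p u z)%:E)
     `^ p^-1)%E.

Definition in_Wsp s p Omega u : Prop :=
  [/\ measurable_fun setT u, (Lp_norm p%:E Omega u < +oo)%E
    & (gagliardo s p Omega u < +oo)%E].

Definition in_tail_space s p u : Prop :=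
  measurable_fun setT u /\
  (\int[leb]_x (`|u x| `^ (p - 1) / (1 + enorm x) `^ (n%:R + s * p))%:E
     < +oo)%E.

Definition tail s p u (x0 : E) (r : R) : \bar R :=
  (((1 - s)%:E * \int[leb]_(x in ~` eball x0 r%:E)
      (`|u x| `^ (p - 1) / enorm (x - x0) `^ (n%:R + s * p))%:E)
     `^ (p - 1)^-1)%E.

Definition cross_set Omega : set (E * E) := ~` (~` Omega `*` ~` Omega).

Definition in_energy_space s p Omega u : Prop :=
  [/\ measurable_fun setT u, (Lp_norm p%:E Omega u < +oo)%E
    & (\int[leb \x leb]_(z in cross_set Omega) (difference_quotient s p u z)%:E
         < +oo)%E].

Definition pstar (sigma p : R) : \bar R :=
  if sigma * p < n%:R then (n%:R * p / (n%:R - sigma * p))%:E else +oo%E.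

End function_spaces.
Arguments pstar {R} n sigma p.

Section De_Giorgi_classes.
Context {R : realType} {n : nat}.
Local Notation E := (Rn R n).
Local Notation leb := (@lebesgue R n).
Implicit Types (Omega A : set E) (u w v : E -> R).
Implicit Types (s p d H eps lam k r rho : R).

(* The inequality common to both signs: w and v are the truncations (u - k)_+
   and (u - k)_-, in one order or the other, A is the corresponding level set
   and c is the constant d_1 or R^lambda d^p. *)
Definition DG_ineq s p (c : R) H eps (R0 : \bar R) (x0 : E) r rho k w v A
    : Prop :=
  (gagliardo s p (eball x0 r%:E) w `^ p
   + \int[leb]_(x in eball x0 r%:E) ((w x)%:E *
       \int[leb]_(y in eball x (2%:E * R0))
         (v y `^ (p - 1) / enorm (x - y) `^ (n%:R + s * p))%:E)
   <= (H / (1 - s))%:E *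
      ((c + `|k| `^ p / rho `^ (n%:R * eps))%:E
         * leb A `^ (1 - s * p / n%:R + eps)
       + (rho `^ ((1 - s) * p) / (rho - r) `^ p)%:E
         * Lp_norm p%:E (eball x0 rho%:E) w `^ p
       + (rho `^ (n%:R + s * p) / (rho - r) `^ (n%:R + s * p))%:E
         * Lp_norm 1 (eball x0 rho%:E) w * tail s p w x0 r `^ (p - 1)))%E.

Definition DG_ineq_plus s p (c : R) H eps (R0 : \bar R) (x0 : E) r rho k u
    : Prop :=
  DG_ineq s p c H eps R0 x0 r rho k (u \- cst k)^\+ (u \- cst k)^\-
    (eball x0 rho%:E `&` [set x | k < u x]).

Definition DG_ineq_minus s p (c : R) H eps (R0 : \bar R) (x0 : E) r rho k u
    : Prop :=
  DG_ineq s p c H eps R0 x0 r rho k (u \- cst k)^\- (u \- cst k)^\+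
    (eball x0 rho%:E `&` [set x | u x < k]).

(* Unlike in the classes below, the value rho = min(R0, dist(x0, bd Omega)) is
   allowed. *)
Definition caccioppoli_plus s p Omega (d1 : R) H (k0 : \bar R) eps (R0 : \bar R) u
    : Prop :=
  forall (x0 : E) r rho k, Omega x0 -> 0 < r -> r < rho ->
    (rho%:E <= mine R0 (dist_boundary x0 Omega))%E -> (k0 <= k%:E)%E ->
    DG_ineq_plus s p d1 H eps R0 x0 r rho k u.

Definition caccioppoli_minus s p Omega (d1 : R) H (k0 : \bar R) eps (R0 : \bar R) u
    : Prop :=
  forall (x0 : E) r rho k, Omega x0 -> 0 < r -> r < rho ->
    (rho%:E <= mine R0 (dist_boundary x0 Omega))%E -> (k%:E <= - k0)%E ->
    DG_ineq_minus s p d1 H eps R0 x0 r rho k u.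

Definition DG_parameters s p d H (k0 : \bar R) eps lam (R0 : \bar R) : Prop :=
  [/\ 0 <= d /\ 1 <= H, (k0 < +oo)%E, 0 < eps <= s * p / n%:R, 0 <= lam
    & (0 < R0)%E].

(* k0 = -oo means that there is no restriction on k. *)
Definition DG_plus s p Omega d H (k0 : \bar R) eps lam (R0 : \bar R) u
    : Prop :=
  [/\ DG_parameters s p d H k0 eps lam R0,
      in_tail_space s p u, in_Wsp s p Omega u &
      forall (x0 : E) r rho k, Omega x0 -> 0 < r -> r < rho ->
        (rho%:E < mine R0 (dist_boundary x0 Omega))%E -> (k0 <= k%:E)%E ->
        DG_ineq_plus s p (rho `^ lam * d `^ p) H eps R0 x0 r rho k u].

Definition DG_minus s p Omega d H (k0 : \bar R) eps lam (R0 : \bar R) u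
    : Prop :=
  [/\ DG_parameters s p d H k0 eps lam R0,
      in_tail_space s p u, in_Wsp s p Omega u &
      forall (x0 : E) r rho k, Omega x0 -> 0 < r -> r < rho ->
        (rho%:E < mine R0 (dist_boundary x0 Omega))%E -> (k%:E <= - k0)%E ->
        DG_ineq_minus s p (rho `^ lam * d `^ p) H eps R0 x0 r rho k u].

End De_Giorgi_classes.

Section minimizers.
Context {R : realType} {n : nat}.
Local Notation E := (Rn R n).
Local Notation leb := (@lebesgue R n).
Implicit Types (Omega : set E) (u phi : E -> R) (s p : R).
Implicit Types (K : E -> E -> \bar R) (F : E -> R -> R).

Definition kernel_assumption s p (Lambda r0 : R) K : Prop :=
  [/\ forall x y, (0 <= K x y)%E,
      completion_measurable_fun (leb \x leb)%E
        (fun z : E * E => K z.1 z.2),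
      {ae (leb \x leb)%E, forall z : E * E, K z.1 z.2 = K z.2 z.1} &
      {ae (leb \x leb)%E, forall z : E * E,
        (((1 - s) * \1_(eball 0 r0%:E) (z.1 - z.2)
            / (Lambda * enorm (z.1 - z.2) `^ (n%:R + s * p)))%:E
         <= K z.1 z.2
         <= ((1 - s) * Lambda / enorm (z.1 - z.2) `^ (n%:R + s * p))%:E)%E}].

Definition potential_assumption F : Prop :=
  completion_measurable_fun (leb \x @lebesgue_measure R)%E
    (fun z : E * R => F z.1 z.2) /\
  forall v : E -> R, measurable_fun setT v ->
    measurable_fun setT (fun x => F x (v x)).

Definition growth_assumption Omega F (d1 d2 q : R) : Prop :=
  {ae leb, forall x, Omega x -> forall t, `|F x t| <= d1 + d2 * `|t| `^ q}.

Definition growth_case_i (d2 : R) : Prop := d2 = 0.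

Definition growth_case_ii p (d2 q : R) : Prop := 0 < d2 /\ 1 <= q <= p.

Definition growth_case_iii (m : nat) s p (d2 q : R) : Prop :=
  [/\ 0 < d2, s * p <= m%:R, p < q & (q%:E < pstar m s p)%E].

Definition interaction p K Omega u : \bar R :=
  ((2 * p)^-1%:E *
   \int[leb \x leb]_(z in cross_set Omega)
     ((`|u z.1 - u z.2| `^ p)%:E * K z.1 z.2))%E.

Definition energy p K F Omega u : \bar R :=
  (interaction p K Omega u + \int[leb]_(x in Omega) (F x (u x))%:E)%E.

(* The energy of u is not of the form (+oo) - (+oo), to which the library
   would give the value -oo. *)
Definition energy_defined p K F Omega u : Prop :=
  adde_def
    (interaction p K Omega u + \int[leb]_(x in Omega) ((fun x => F x (u x))^\+ x)%:E)%E
    (- \int[leb]_(x in Omega) ((fun x => F x (u x))^\- x)%:E)%E.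

Definition supported_in phi Omega : Prop :=
  closure [set x | phi x != 0] `<=` Omega.

Definition subminimizer s p K F Omega u : Prop :=
  [/\ in_energy_space s p Omega u, energy_defined p K F Omega u &
      forall phi, measurable_fun setT phi -> (forall x, phi x <= 0) ->
        supported_in phi Omega -> energy_defined p K F Omega (u \+ phi) ->
        (energy p K F Omega u <= energy p K F Omega (u \+ phi)%R)%E].

Definition superminimizer s p K F Omega u : Prop :=
  [/\ in_energy_space s p Omega u, energy_defined p K F Omega u &
      forall phi, measurable_fun setT phi -> (forall x, 0 <= phi x) ->
        supported_in phi Omega -> energy_defined p K F Omega (u \+ phi) ->
        (energy p K F Omega u <= energy p K F Omega (u \+ phi)%R)%E].

End minimizers.

(* Main.v *)
(* Subminimality is tested with [v = u - psi^p (u - k)_+], where [psi] is a cutoff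
   between two concentric balls.  Convexity of [t^p] gives, for every pair of
   points, [|v(x) - v(y)|^p + gain <= |u(x) - u(y)|^p + loss]: the gain integrates
   to the left-hand side of the Caccioppoli inequality, and the loss, split into
   pairs inside the larger ball and pairs with one point outside, to the [L^p]
   and the tail terms.  Only the potential, of size [d1 + d2 (|u| + |k|)^q] on the
   superlevel set, remains.  For [q <= p] it is bounded directly.

   For [q > p] the integral of [w^q], [w = (u - k)_+], is absorbed by the seminorm
   of [w] without a Sobolev inequality.  At a point where [w] is about
   [lambda(t)], Chebyshev's inequality for the [L^P] norm shows that [w] is less
   than [lambda(t) / 2] on half of the ball of radius [t] around it, so [w^p] is
   controlled there by the energy of the pairs at distance less than [t]; these
   energies are summed over dyadic [t].  On balls of radius at most [R0] the
   resulting coefficient of the seminorm is so small that iterating over an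
   increasing sequence of radii removes it.

   Superminimizers are reduced to subminimizers by [u -> -u], [F(x,t) -> F(x,-t)]. *)

(* The constants [H] may not depend on [s], so every factor 1-s has to be tracked. The upper kernel
   carries one, which cancels the 1/(1-s) of the radial integral of |x-y|^((1-s)p-n). The seminorm
   to be absorbed in the supercritical case needs one as well; it is gained by averaging over about
   1/(1-s) dyadic scales, on which the normalized energies of close pairs are comparable. The
   integrability exponent [P] varies with [s] too, and is removed from the constants by crude bounds
   such as [Num.max 1 (2 / v)].

   Two more obstacles shape the proof. [Rn] carries the Lebesgue measurable sets, and the product of
   two such sigma-algebras is not complete, so a continuous map out of a product need not be
   measurable into [Rn]: functions are replaced by Borel representatives, and the kernel by a
   measurable real one obeying its bounds everywhere. Energies are extended reals and cancel only
   when finite: if the loss is infinite there is nothing to prove, and otherwise the integrated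
   pointwise inequality itself shows that the competitor has finite energy. *)
Require Import Defs.
From mathcomp Require Import all_boot all_order all_algebra.
From mathcomp Require Import all_classical all_reals all_analysis.
From mathcomp Require Import measurable_realfun ring lra.

Set Implicit Arguments.
Unset Strict Implicit.
Unset Printing Implicit Defensive.

Import Order.TTheory GRing.Theory Num.Theory.
Import numFieldNormedType.Exports.

Local Open Scope classical_set_scope.
Local Open Scope ring_scope.

(** * Euclidean norm and Lebesgue measure *)

Section enorm.
Context {R : realType} {n : nat}.
Local Notation E := (Rn R n).
Implicit Types x y z : E.

Lemma enorm_ge0 x : 0 <= enorm x.
Proof. exact: sqrtr_ge0. Qed.

Lemma sqr_enorm x : enorm x ^+ 2 = \sum_i ((x : 'rV[R]_n) ord0 i) ^+ 2.
Proof. by rewrite sqr_sqrtr// sumr_ge0// => i _; exact: sqr_ge0. Qed.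

Lemma enorm0 : enorm (0 : E) = 0.
Proof.
by rewrite /enorm big1 ?sqrtr0// => i _; rewrite mxE expr0n.
Qed.

Lemma enormZ a x : enorm (a *: x) = `|a| * enorm x.
Proof.
rewrite /enorm (eq_bigr (fun i => a ^+ 2 * ((x : 'rV[R]_n) ord0 i) ^+ 2)); last first.
  by move=> i _; rewrite mxE exprMn.
by rewrite -mulr_sumr sqrtrM ?sqr_ge0// sqrtr_sqr.
Qed.

Lemma enormN x : enorm (- x) = enorm x.
Proof. by rewrite -scaleN1r enormZ normrN1 mul1r. Qed.

Lemma enormBC x y : enorm (x - y) = enorm (y - x).
Proof. by rewrite -enormN opprB. Qed.

Lemma le_coord_enorm x i : `|(x : 'rV[R]_n) ord0 i| <= enorm x.
Proof.
rewrite -sqrtr_sqr ler_wsqrtr// (bigD1 i)//= lerDl sumr_ge0// => j _.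
exact: sqr_ge0.
Qed.

Lemma enorm_eq0 x : enorm x = 0 -> x = 0.
Proof.
move=> x0; apply/rowP => i; apply/eqP.
by rewrite mxE -normr_eq0 eq_le normr_ge0 andbT -x0 le_coord_enorm.
Qed.

Lemma enorm_triangle x y : enorm (x + y) <= enorm x + enorm y.
Proof.
pose a i : R := (x : 'rV[R]_n) ord0 i; pose b i : R := (y : 'rV[R]_n) ord0 i.
have ab : \sum_i a i * b i <= enorm x * enorm y.
  have [x0|x0] := eqVneq (enorm x) 0.
    rewrite x0 mul0r big1// => i _.
    by rewrite /a (enorm_eq0 x0) mxE mul0r.
  have [y0|y0] := eqVneq (enorm y) 0.
    rewrite y0 mulr0 big1// => i _.
    by rewrite /b (enorm_eq0 y0) mxE mulr0.
  have xy : 0 < enorm x * enorm y by rewrite mulr_gt0// lt0r ?x0 ?y0 enorm_ge0.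
  (* Cauchy-Schwarz: expanding the squares gives 2|x|^2|y|^2 - 2|x||y| times the scalar product, and
     |x||y| > 0 can be divided out. *)
  have : 0 <= \sum_i (enorm y * a i - enorm x * b i) ^+ 2.
    by rewrite sumr_ge0// => i _; exact: sqr_ge0.
  rewrite (eq_bigr (fun i => enorm y ^+ 2 * a i ^+ 2 + enorm x ^+ 2 * b i ^+ 2 -
      2 * (enorm x * enorm y) * (a i * b i))); last by move=> i _; ring.
  rewrite sumrB big_split/= -!mulr_sumr -!sqr_enorm => h.
  rewrite -(ler_pM2l xy); lra.
rewrite -ler_sqr ?nnegrE ?addr_ge0 ?enorm_ge0// sqr_enorm.
rewrite (eq_bigr (fun i => a i ^+ 2 + b i ^+ 2 + 2 * (a i * b i))); last first.
  by move=> i _; rewrite mxE /a /b; ring.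
rewrite !big_split/= -mulr_sumr -!sqr_enorm; lra.
Qed.

Lemma enorm_triangleB z x y : enorm (x - y) <= enorm (x - z) + enorm (z - y).
Proof. by rewrite -[x - y](subrKA z); exact: enorm_triangle. Qed.

(** The topology and the bounded sets of [Rn] come from the sup norm; this comparison transfers them
    to the Euclidean norm. *)
Lemma enorm_le_norm x : enorm x <= n%:R * `|x|.
Proof.
apply: (@le_trans _ _ (\sum_(i < n) `|x|)); last first.
  by rewrite sumr_const card_ord mulr_natl.
rewrite -ler_sqr ?nnegrE ?enorm_ge0 ?sumr_ge0// sqr_enorm.
apply: (@le_trans _ _ (\sum_(i < n) `|x| ^+ 2)).
  apply: ler_sum => i _; rewrite -[leLHS]real_normK ?num_real// ler_sqr ?nnegrE//.
  by rewrite [leRHS]/Num.norm/= mx_normrE (le_bigmax _ _ (ord0, i)).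
rewrite !sumr_const card_ord -[_ *+ n]mulr_natl -[`|x| *+ n]mulr_natl exprMn.
rewrite ler_wpM2r ?sqr_ge0// -natrX ler_nat expnS expn1.
by have [->//|n0] := posnP n; rewrite leq_pmulr.
Qed.

Lemma continuous_enorm : continuous (enorm : E -> R).
Proof.
move=> x; apply/(@cvgrPdist_le _ _ _ (nbhs (x : E))) => e e0.
have e'0 : 0 < e / n.+1%:R by rewrite divr_gt0.
have idx : (fun y : E => y) @ x --> x by exact: cvg_id.
apply: filterS (@cvgr_dist_le _ _ _ (nbhs (x : E)) _ id x idx _ e'0) => y /= xye.
have xy : enorm (x - y) <= e.
  apply: le_trans (enorm_le_norm _) _.
  apply: (@le_trans _ _ (n.+1%:R * `|x - y|)); first by rewrite ler_wpM2r// ler_nat.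
  by rewrite mulrC -ler_pdivlMr.
have := enorm_triangleB y x 0; have := enorm_triangleB x y 0.
rewrite !subr0 (enormBC y x) => h1 h2.
rewrite ler_norml; apply/andP; split; lra.
Qed.

End enorm.

(** * Lebesgue measure: balls and affine images *)

Section lebesgue_Rn.
Context {R : realType} {n : nat}.
Local Notation E := (Rn R n).
Local Notation leb := (@lebesgue R n).
Implicit Types x y z : E.

Lemma measurable_below i c : measurable (@below R n i c : set E).
Proof. exact: caratheodory_below. Qed.

Lemma measurable_fun_rays d (T : measurableType d) (f : T -> R) :
  (forall c, measurable [set t | c < f t]) -> measurable_fun setT f.
Proof.
move=> h; apply: (measurability _ (RGenOInfty.measurableE R)) => // _ [_ [c ->] <-].
rewrite setTI (_ : _ @^-1` _ = [set t | c < f t])//.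
by apply/seteqP; split=> t /=; rewrite in_itv/= andbT.
Qed.

Lemma measurable_coord i : measurable_fun setT (fun x : E => (x : 'rV[R]_n) ord0 i).
Proof.
apply: measurable_fun_rays => c.
rewrite (_ : [set _ | _] = ~` below i c); last first.
  by apply/seteqP; split=> x /=; rewrite /below/= ltNge => /negP.
exact: measurableC (measurable_below _ _).
Qed.

Section map_to_E.
Context d (T : measurableType d) (f g : T -> E).
Hypothesis mf : forall i, measurable_fun setT (fun t => (f t : 'rV[R]_n) ord0 i).
Hypothesis mg : forall i, measurable_fun setT (fun t => (g t : 'rV[R]_n) ord0 i).

(** Only coordinates are assumed measurable. For maps out of [E * E], such as a projection minus
    another, measurability into [E] with its Lebesgue sets can fail although every coordinate is
    measurable. *)
Lemma measurable_enormB : measurable_fun setT (fun t => enorm (f t - g t)).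
Proof.
rewrite (_ : (fun _ => _) = (fun t => (\sum_i
   ((f t : 'rV[R]_n) ord0 i - (g t : 'rV[R]_n) ord0 i) ^+ 2) `^ 2^-1)); last first.
  apply/funext => t; rewrite powR12_sqrt.
    by rewrite /enorm; congr Num.sqrt; apply: eq_bigr => i _; rewrite !mxE.
  by rewrite sumr_ge0// => i _; exact: sqr_ge0.
apply: (measurableT_comp (measurable_powR _)); apply: measurable_sum => i.
by apply: measurable_funX; exact: measurable_funB.
Qed.
End map_to_E.

Lemma measurable_enormB_cst x0 : measurable_fun setT (fun x : E => enorm (x - x0)).
Proof. by apply: measurable_enormB => i; [exact: measurable_coord|exact: measurable_cst]. Qed.

Lemma measurable_enormB_prod : measurable_fun setT (fun z : E * E => enorm (z.1 - z.2)).
Proof.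
apply: measurable_enormB => i; apply: (measurableT_comp (measurable_coord i)).
  exact: measurable_fst.
exact: measurable_snd.
Qed.

Lemma eballE x0 (r : R) : eball x0 r%:E = [set x | enorm (x - x0) < r].
Proof. by apply/seteqP; split=> x; rewrite /eball/= lte_fin. Qed.

Lemma measurable_eball x0 (r : R) : measurable (eball x0 r%:E).
Proof.
rewrite eballE (_ : [set _ | _] = setT `&` [set x | enorm (x - x0) < r]) ?setTI//.
rewrite -(_ : (fun x : E => enorm (x - x0)) @^-1` `]-oo, r[ = [set x | enorm (x - x0) < r]).
  rewrite -[_ @^-1` _]setTI; exact: measurable_enormB_cst.
by apply/seteqP; split=> x; rewrite /= in_itv.
Qed.

Lemma lebesgue_box (a b : 'rV[R]_n) : (forall i, a ord0 i <= b ord0 i) ->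
  (leb (box a b) <= (box_volume a b)%:E)%E.
Proof.
move=> ab.
have [->|/set0P F0] := eqVneq (box a b) set0.
  rewrite measure0 lee_fin; apply: prodr_ge0 => i _; rewrite subr_ge0; exact: ab.
apply: le_trans (box_content_le F0).
apply: ereal_inf_lbound; exists (fun i => if i is 0%N then box a b else set0).
  by split=> // x Fx; exists 0%N.
rewrite nneseries_recl => [|m _|]; rewrite ?box_content_ge0//=.
by rewrite eseries0 ?adde0// => -[|i]//= _ _; rewrite box_content0.
Qed.

Lemma measurable_box (a b : 'rV[R]_n) : measurable (box a b : set E).
Proof.
rewrite (_ : box a b = \bigcap_(i in [set: 'I_n])
    (below i (b ord0 i) `\` below i (a ord0 i))); last first.
  apply/seteqP; split=> x.
    move=> Fx i _; have /andP[kx xk] := Fx i; rewrite /below /=.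
    by split=> //=; apply/negP; rewrite -ltNge.
  by move=> Fx i; have [/= xk /negP] := Fx i I; rewrite -ltNge xk => ->.
apply: fin_bigcap_measurable => // i _.
by apply: measurableD; exact: measurable_below.
Qed.

(** The ball lies in a half-open cube of side 2r. This crude bound is what the dyadic sums use; the
    exact scaling is needed only where halves of balls are compared. *)
Lemma lebesgue_eball_le x0 (r : R) : 0 <= r ->
  (leb (eball x0 r%:E) <= ((2 * r) ^+ n)%:E)%E.
Proof.
move=> r0.
pose a : 'rV[R]_n := \row_i ((x0 : 'rV[R]_n) ord0 i - r).
pose b : 'rV[R]_n := \row_i ((x0 : 'rV[R]_n) ord0 i + r).
have -> : (2 * r) ^+ n = box_volume a b.
  rewrite /box_volume (eq_bigr (fun=> 2 * r)) ?prodr_const ?card_ord// => i _.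
  by rewrite !mxE; ring.
apply: le_trans (lebesgue_box _); last by move=> i; rewrite !mxE; lra.
apply: le_measure; rewrite ?inE; [exact: measurable_eball|exact: measurable_box|].
rewrite eballE => x /= xr i; rewrite !mxE.
have := le_lt_trans (le_coord_enorm (x - x0) i) xr.
rewrite !mxE ltr_norml => /andP[? ?]; apply/andP; split; lra.
Qed.

Definition affine (a : R) (b : 'rV[R]_n) (y : E) : E := a *: y + b.

Lemma affineK a b : a != 0 -> cancel (affine a b) (affine a^-1 (- (a^-1 *: b))).
Proof. by move=> a0 x; rewrite /affine scalerDr scalerA mulVf// scale1r addrK. Qed.

Lemma affineVK a b : a != 0 -> cancel (affine a^-1 (- (a^-1 *: b))) (affine a b).
Proof.
by move=> a0 x; rewrite /affine scalerDr scalerN !scalerA mulfV// !scale1r subrK.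
Qed.

Lemma box_content_affine a b (A : set (powerset_rV R n)) : 0 < a ->
  (box_content (affine a b @` A) <= (a ^+ n)%:E * box_content A)%E.
Proof.
move=> a0; rewrite -lee_pdivrMl ?exprn_gt0//.
rewrite [leRHS]/box_content; case: eqVneq => [->|/set0P[x0 Ax0]].
  by rewrite image_set0 box_content0 mule0.
apply: le_ereal_inf_tmp => _ [[l u] /= Alu <-].
rewrite lee_pdivrMl ?exprn_gt0//.
have Alu' : affine a b @` A = box (affine a b l) (affine a b u).
  rewrite Alu; apply/seteqP; split=> [_ [x xlu <-] i|x xlu].
    have /andP[? ?] := xlu i; rewrite /affine !mxE.
    by rewrite ltrD2r lerD2r ltr_pM2l// ler_pM2l//; apply/andP.
  exists (affine a^-1 (- (a^-1 *: b)) x); last by rewrite affineVK// gt_eqF.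
  move=> i; have /andP[? ?] := xlu i; move: (xlu i); rewrite /affine !mxE => /andP[? ?].
  by rewrite -mulrBr ltr_pdivlMl// ler_pdivrMl// ltrBrDr lerBlDr; apply/andP.
have ne : box (affine a b l) (affine a b u) !=set0.
  by rewrite -Alu'; exists (affine a b x0); exists x0.
rewrite Alu' (le_trans (box_content_le ne))// -EFinM lee_fin /box_volume.
rewrite (eq_bigr (fun i => a * (u ord0 i - l ord0 i))).
  by rewrite big_split/= prodr_const card_ord.
by move=> i _; rewrite !mxE; ring.
Qed.

Lemma lebesgue_outer_affine_le a b (A : set (powerset_rV R n)) : 0 < a ->
  (lebesgue_outer (affine a b @` A) <= (a ^+ n)%:E * lebesgue_outer A)%E.
Proof.
move=> a0; rewrite -lee_pdivrMl ?exprn_gt0//.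
apply: le_ereal_inf_tmp => _ [F [mF AF] <-].
rewrite lee_pdivrMl ?exprn_gt0//.
apply: (@le_trans _ _ (\sum_(k <oo) box_content (affine a b @` F k))%E).
  apply: ereal_inf_lbound; eexists; try reflexivity; split => //.
  by move=> _ [x /AF[k _ Fkx] <-]; exists k => //; exists x.
rewrite -nneseriesZl//.
apply: lee_nneseries => [k _ _|k _]; first exact: box_content_ge0.
  exact: box_content_affine.
by move=> i _; exact: box_content_ge0.
Qed.

(** The reverse inequality is the forward one applied to the inverse map, which is affine with ratio
    1/a. *)
Lemma lebesgue_outer_affine a b (A : set (powerset_rV R n)) : 0 < a ->
  lebesgue_outer (affine a b @` A) = ((a ^+ n)%:E * lebesgue_outer A)%E.
Proof.
move=> a0; apply/eqP; rewrite eq_le lebesgue_outer_affine_le//=.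
rewrite -lee_pdivlMl ?exprn_gt0//.
have a'0 : 0 < a^-1 by rewrite invr_gt0.
have := lebesgue_outer_affine_le (- (a^-1 *: b)) (affine a b @` A) a'0.
rewrite image_comp (_ : _ \o _ = id) ?image_id ?exprVn//.
by apply/funext => x /=; rewrite affineK// gt_eqF.
Qed.

(** The map multiplies outer measure by a constant, so the Carathéodory splitting of the preimage of
    a test set by [A] becomes the splitting of the test set by the image. *)
Lemma measurable_affine_image a b (A : set E) : 0 < a ->
  measurable A -> measurable (affine a b @` A).
Proof.
move=> a0 mA; have aN0 : a != 0 by rewrite gt_eqF.
have img X : X = affine a b @` (affine a b @^-1` X).
  apply/seteqP; split=> [x Xx|_ [y Xy <-]//].
  by exists (affine a^-1 (- (a^-1 *: b)) x); rewrite /= affineVK.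
have h (X : set (powerset_rV R n)) : lebesgue_outer X =
    ((a ^+ n)%:E * lebesgue_outer (affine a b @^-1` X))%E.
  by rewrite -(lebesgue_outer_affine b)// -img.
move=> X; change (lebesgue_outer X = (lebesgue_outer (X `&` (affine a b @` A)) +
  lebesgue_outer (X `&` ~` (affine a b @` A)))%E).
rewrite (h X) (h (X `&` _)) (h (X `&` ~` _)).
rewrite -ge0_muleDr ?outer_measure_ge0//.
congr (_ * _)%E; rewrite (mA (affine a b @^-1` X)).
congr (_ + _)%E; congr lebesgue_outer; apply/seteqP; split=> x /=.
- by move=> [Xx Ax]; split=> //; exists x.
- by move=> [Xx [y Ay yx]]; rewrite -(can_inj (affineK b aN0) yx); split=> //; rewrite /= yx.
- move=> [Xx Ax]; split=> // -[y Ay yx].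
  by apply: Ax; rewrite -(can_inj (affineK b aN0) yx).
- by move=> [Xx nA]; split=> // Ax; apply: nA; exists x.
Qed.

Lemma measurable_affine a b : 0 < a -> measurable_fun setT (affine a b).
Proof.
move=> a0 _ A mA; rewrite setTI.
rewrite (_ : _ @^-1` _ = affine a^-1 (- (a^-1 *: b)) @` A).
  by apply: measurable_affine_image; rewrite ?invr_gt0.
apply/seteqP; split=> [x Ax|_ [y Ay <-]].
  by exists (affine a b x) => //; rewrite affineK// gt_eqF.
by rewrite /= affineVK// gt_eqF.
Qed.

Lemma lebesgue_affine_preimage a b (A : set E) : 0 < a ->
  leb (affine a b @^-1` A) = ((a ^- n)%:E * leb A)%E.
Proof.
move=> a0.
rewrite (_ : _ @^-1` _ = affine a^-1 (- (a^-1 *: b)) @` A).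
  by rewrite /lebesgue lebesgue_outer_affine ?invr_gt0// exprVn.
apply/seteqP; split=> [x Ax|_ [y Ay <-]].
  by exists (affine a b x) => //; rewrite affineK// gt_eqF.
by rewrite /= affineVK// gt_eqF.
Qed.

Lemma integral_affine a b (f : E -> \bar R) : 0 < a ->
  measurable_fun setT f -> (forall x, 0 <= f x)%E ->
  (\int[leb]_y f (affine a b y) = (a ^- n)%:E * \int[leb]_y f y)%E.
Proof.
move=> a0 mf f0.
have maff := measurable_affine b a0.
have := @ge0_integral_pushforward _ _ _ _ _ _ maff leb setT f measurableT mf (fun x _ => f0 x).
rewrite preimage_setT => <-.
have a'0 : 0 <= a ^- n by rewrite invr_ge0 exprn_ge0// ltW.
rewrite (eq_measure_integral (mscale (NngNum a'0) leb)).
  by rewrite ge0_integral_mscale.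
by move=> A mA _; rewrite /pushforward /mscale/=; exact: lebesgue_affine_preimage.
Qed.

(** Only nonnegativity is established. Where a positive value matters, the value 0 is treated apart:
    then every measurable set is null and the estimates are trivial. *)
Definition unit_ball_volume : R := fine (leb (eball (0 : E) 1%:E)).

Lemma unit_ball_volume_ge0 : 0 <= unit_ball_volume.
Proof. exact: fine_ge0. Qed.

Lemma lebesgue_eball x0 (r : R) : 0 < r ->
  leb (eball x0 r%:E) = (unit_ball_volume * r ^+ n)%:E.
Proof.
move=> r0; rewrite mulrC EFinM fineK; last first.
  rewrite ge0_fin_numE//; apply: le_lt_trans (ltry _).
  exact: (lebesgue_eball_le (0 : E) ler01).
rewrite /lebesgue -(lebesgue_outer_affine x0 _ r0); congr lebesgue_outer.
rewrite !eballE; apply/seteqP; split=> [x /= xr|_ [y /= yr <-]].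
  exists (r^-1 *: (x - x0)).
    by rewrite /= subr0 enormZ gtr0_norm ?invr_gt0// mulrC ltr_pdivrMr// mul1r.
  by rewrite /affine scalerA mulfV ?gt_eqF// scale1r subrK.
rewrite /affine addrK enormZ gtr0_norm// gtr_pMr//.
by rewrite subr0 in yr.
Qed.

End lebesgue_Rn.

(** * Open sets, balls and the distance to the boundary *)

Section topology_Rn.
Context {R : realType} {n : nat}.
Local Notation E := (Rn R n).
Local Notation leb := (@lebesgue R n).
Implicit Types x y z : E.

(** Rational corners leave countably many boxes, which is what makes open sets measurable. *)
Lemma open_box (O : set E) x : open O -> O x ->
  exists ab : 'rV[rat]_n * 'rV[rat]_n,
    box (map_mx ratr ab.1) (map_mx ratr ab.2) `<=` O /\
    (box (map_mx ratr ab.1) (map_mx ratr ab.2) : set E) x.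
Proof.
move=> oO Ox.
have [e /= e0 xeO] : exists2 e : R, 0 < e & ball x e `<=` O.
  by have /nbhs_ballP[e /= e0 xe] := open_nbhs_nbhs (conj oO Ox); exists e.
have /choice[a ha] i : exists a : rat,
    (x : 'rV[R]_n) ord0 i - e < ratr a < (x : 'rV[R]_n) ord0 i.
  have /rat_in_itvoo[a] : (x : 'rV[R]_n) ord0 i - e < (x : 'rV[R]_n) ord0 i by lra.
  by rewrite in_itv; exists a.
have /choice[b hb] i : exists b : rat,
    (x : 'rV[R]_n) ord0 i < ratr b < (x : 'rV[R]_n) ord0 i + e.
  have /rat_in_itvoo[b] : (x : 'rV[R]_n) ord0 i < (x : 'rV[R]_n) ord0 i + e by lra.
  by rewrite in_itv; exists b.
exists (\row_i a i, \row_i b i) => /=; split.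
  move=> y aby; apply: xeO; split; first by [].
  move=> j i; rewrite ord1.
  have := aby i; rewrite !mxE => /andP[? ?].
  have /andP[? ?] := ha i; have /andP[? ?] := hb i.
  rewrite -ball_normE/= ltr_norml; apply/andP; split; lra.
move=> i; rewrite !mxE; have /andP[? ?] := ha i; have /andP[? ?] := hb i.
by apply/andP; split; lra.
Qed.

Lemma open_measurable_Rn (O : set E) : open O -> measurable O.
Proof.
move=> oO.
pose P (ab : 'rV[rat]_n * 'rV[rat]_n) : set E :=
  if pselect (box (map_mx ratr ab.1) (map_mx ratr ab.2) `<=` O)
  then box (map_mx ratr ab.1) (map_mx ratr ab.2) else set0.
rewrite (_ : O = \bigcup_ab P ab); last first.
  apply/seteqP; split=> [x Ox|x [ab _]].
    have [ab [abO abx]] := open_box oO Ox.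
    by exists ab => //; rewrite /P; case: pselect.
  by rewrite /P; case: pselect => // h; exact: h.
apply: countable_bigcupT_measurable => [|ab]; first exact: countableP.
by rewrite /P; case: pselect => [a|a]; [exact: measurable_box|exact: measurable0].
Qed.

Lemma nbhs_eball (B : set E) x : nbhs x B ->
  exists2 e : R, 0 < e & eball x e%:E `<=` B.
Proof.
move=> /nbhs_ballP[e /= e0 xe].
exists e => // y; rewrite eballE => /= yxe; apply: xe; split; first by [].
  move=> j i; rewrite ord1.
rewrite -ball_normE/=; apply: le_lt_trans yxe; rewrite enormBC.
by have := le_coord_enorm (x - y) i; rewrite !mxE.
Qed.

Lemma continuous_enormB x : continuous (fun y : E => enorm (y - x)).
Proof.
move=> y.
apply: (@continuous_comp _ _ _ (fun y : E => y - x) enorm); last exact: continuous_enorm.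
have idy : (fun y : E => y) @ y --> y by exact: cvg_id.
have cy : (fun=> x) @ nbhs (y : E) --> x by exact: cvg_cst.
exact: (cvgB idy cy).
Qed.

Lemma closed_ceball x (r : R) : closed [set y : E | enorm (y - x) <= r].
Proof.
rewrite (_ : [set _ | _] = (fun y => enorm (y - x)) @^-1` [set t | t <= r])//.
apply: closed_comp; last exact: closed_le.
by move=> y _; exact: continuous_enormB.
Qed.

Lemma bounded_sub_eball (O : set E) : bounded_set O ->
  exists2 r : R, 0 < r & O `<=` eball 0 r%:E.
Proof.
move=> [M [Mr OM]].
exists (n.+1%:R * (`|M| + 2)); first by rewrite mulr_gt0// ltr_wpDl.
move=> x Ox; rewrite eballE/= subr0.
apply: le_lt_trans (enorm_le_norm _) _.
have M1 : M < `|M| + 1 by rewrite (le_lt_trans (ler_norm _))// ltrDl.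
have /= xM := OM _ M1 _ Ox.
apply: (@le_lt_trans _ _ (n.+1%:R * `|x|)); first by rewrite ler_wpM2r// ler_nat.
rewrite ltr_pM2l//; lra.
Qed.

Lemma bounded_lebesgue_fin (O : set E) : measurable O -> bounded_set O ->
  (leb O < +oo)%E.
Proof.
move=> mO /bounded_sub_eball[r r0 Or].
apply: (@le_lt_trans _ _ (leb (eball 0 r%:E))).
  by apply: le_measure; rewrite ?inE//; exact: measurable_eball.
by rewrite lebesgue_eball// ltry.
Qed.

Lemma lebesgue0 (A : set E) : @unit_ball_volume R n = 0 -> measurable A ->
  leb A = 0%E.
Proof.
move=> v0 mA.
have lT : leb setT = 0%E.
  have -> : [set: E] = \bigcup_k eball (0 : E) (k.+1%:R : R)%:E.
    apply/seteqP; split=> // x _; exists (Num.bound (enorm x)) => //.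
    rewrite eballE/= subr0; apply: lt_le_trans (archi_boundP (enorm_ge0 _)) _.
    by rewrite ler_nat.
  apply/eqP; rewrite eq_le measure_ge0 andbT.
  apply: le_trans (measure_sigma_subadditive _ _ _ (@subset_refl _ _)) _.
  - by move=> k; exact: measurable_eball.
  - by apply: bigcup_measurable => k _; exact: measurable_eball.
  rewrite eseries0// => k _ _; apply: etrans (lebesgue_eball _ _) _ => //.
  by rewrite v0 mul0r.
apply/eqP; rewrite eq_le measure_ge0 andbT -lT.
by apply: le_measure; rewrite ?inE.
Qed.

Lemma open_lebesgue_gt0 (O : set E) : 0 < @unit_ball_volume R n -> open O ->
  O !=set0 -> (0 < leb O)%E.
Proof.
move=> v0 oO [x Ox]; have [e e0 xeO] := nbhs_eball (open_nbhs_nbhs (conj oO Ox)).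
apply: (@lt_le_trans _ _ (leb (eball x e%:E))).
  by rewrite lebesgue_eball// lte_fin mulr_gt0// exprn_gt0.
apply: le_measure; rewrite ?inE//; [exact: measurable_eball|exact: open_measurable_Rn].
Qed.

(* A segment from [x0] to a point outside [O] meets the boundary of [O]. *)
Lemma eball_sub_dist_boundary (O : set E) x0 (r : R) : open O -> O x0 ->
  (r%:E <= dist_boundary x0 O)%E -> eball x0 r%:E `<=` O.
Proof.
move=> oO Ox0 rd y; rewrite eballE/= => yr; apply: contrapT => Oy.
pose g (t : R) : E := x0 + t *: (y - x0).
have g0 : g 0 = x0 by rewrite /g scale0r addr0.
have g1 : g 1 = y by rewrite /g scale1r addrC subrK.
have eg t t' : enorm (g t - g t') = `|t - t'| * enorm (y - x0).
  by rewrite /g opprD addrACA subrr add0r -scalerBl enormZ.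
(* [B] collects the times at which the segment is outside [O]. Its infimum is not a time in [O],
   because [O] is open, yet it is a limit of times in [O]: there the segment meets the boundary, at
   distance less than [r] from [x0]. *)
pose B := [set t : R | 0 <= t <= 1 /\ ~ O (g t)].
have B1 : B 1 by split; rewrite ?lexx ?ler01// g1.
have infB : has_inf B by split; [exists 1|exists 0 => t [/andP[]]].
pose t := inf B.
have t0 : 0 <= t by apply: lb_le_inf; [exists 1|move=> ? [/andP[]]].
have t1 : t <= 1 by apply: ge_inf => //; exact: (proj2 infB).
(* The summand 1 makes the later divisions legitimate without a separate case [y = x0]. *)
have yx : 0 < enorm (y - x0) + 1 by rewrite ltr_wpDl ?enorm_ge0.
have nOt : ~ O (g t).
  move=> Ot; have [e e0 eO] := nbhs_eball (open_nbhs_nbhs (conj oO Ot)).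
  have d0 : 0 < e / (enorm (y - x0) + 1) by rewrite divr_gt0.
  have [t' [/andP[t'0 t'1] nOt'] t't] := inf_adherent d0 infB.
  have tt' : t <= t'.
    by apply: ge_inf; [exact: (proj2 infB)|split=> //; apply/andP].
  apply: nOt'; apply: eO; rewrite eballE/= eg ger0_norm ?subr_ge0//.
  apply: (@le_lt_trans _ _ ((t' - t) * (enorm (y - x0) + 1))).
    by rewrite ler_wpM2l ?subr_ge0// lerDl.
  by rewrite -ltr_pdivlMr// ltrBlDl.
have Ot' t' : 0 <= t' -> t' < t -> O (g t').
  move=> t'0 t't; apply: contrapT => nO.
  suff : t <= t' by rewrite leNgt t't.
  apply: ge_inf; first exact: (proj2 infB).
  by split=> //; rewrite t'0 (ltW (lt_le_trans t't t1)).
have {}t0 : 0 < t.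
  by rewrite lt_neqAle t0 andbT; apply/eqP => t0'; apply: nOt; rewrite -t0' g0.
have cl : closure O (g t).
  move=> C /nbhs_eball[e e0 eC].
  pose t' := Num.max 0 (t - e / (enorm (y - x0) + 1) / 2).
  have d0 : 0 < e / (enorm (y - x0) + 1) by rewrite divr_gt0.
  have t't : t' < t by rewrite /t' gt_max t0/=; lra.
  exists (g t'); split; first by apply: Ot' => //; rewrite /t' le_max lexx.
  apply: eC; rewrite eballE/= eg ler0_norm ?subr_le0 1?ltW// opprB.
  apply: (@le_lt_trans _ _ ((t - t') * (enorm (y - x0) + 1))).
    by rewrite ler_wpM2l ?lerDl// subr_ge0 ltW.
  rewrite -ltr_pdivlMr// ltrBlDl -ltrBlDr.
  by rewrite /t' lt_max; apply/orP; right; lra.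
have : (dist_boundary x0 O <= (enorm (x0 - g t))%:E)%E.
  apply: ereal_inf_lbound; exists (g t) => //; split=> //.
  by move=> /interior_subset.
rewrite -[in enorm _]g0 eg sub0r normrN gtr0_norm// => dt.
have := le_trans rd dt; rewrite lee_fin; apply/negP; rewrite -ltNge.
by apply: le_lt_trans yr; rewrite ler_piMl ?enorm_ge0.
Qed.
End topology_Rn.

(** * Borel hulls and Borel representatives *)

Section borel_representative.
Context {R : realType} {n : nat}.
Local Notation E := (Rn R n).
Local Notation leb := (@lebesgue R n).

(** These generate the Borel sets, and their preimages are sublevel sets of coordinates; hence
    [borel_preimage] asks only for measurable coordinates. *)
Definition half_spaces : set (set E) := [set A | exists i c, A = below i c].

Local Notation borel := (half_spaces.-sigma.-measurable).

Lemma borel_preimage d (T : measurableType d) (m : T -> E) (A : set E) :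
  (forall i, measurable_fun setT (fun t => (m t : 'rV[R]_n) ord0 i)) ->
  borel A -> measurable (m @^-1` A).
Proof.
move=> mm; apply: (@smallest_sub _ _ _ [set A | measurable (m @^-1` A)]).
  split=> [|B mB|F mF].
  - by rewrite /= preimage_set0; exact: measurable0.
  - by rewrite /= setTD preimage_setC; exact: measurableC.
  - by rewrite /= preimage_bigcup; exact: bigcupT_measurable.
move=> _ [i [c ->]] /=.
rewrite (_ : _ @^-1` _ = setT `&` (fun t => (m t : 'rV[R]_n) ord0 i) @^-1` `]-oo, c]).
  exact: mm.
by rewrite setTI; apply/seteqP; split=> t; rewrite /below /= in_itv.
Qed.

Lemma borel_measurable (A : set E) : borel A -> measurable A.
Proof. by move/(borel_preimage measurable_coord). Qed.

Lemma borel_box (a b : 'rV[R]_n) : borel (box a b).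
Proof.
rewrite (_ : box a b = \bigcap_(i in [set: 'I_n])
    (below i (b ord0 i) `\` below i (a ord0 i))); last first.
  apply/seteqP; split=> x.
    move=> Fx i _; have /andP[kx xk] := Fx i; rewrite /below /=.
    by split=> //=; apply/negP; rewrite -ltNge.
  by move=> Fx i; have [/= xk /negP] := Fx i I; rewrite -ltNge xk => ->.
apply: fin_bigcap_measurable => // i _.
by apply: measurableD; apply: sub_sigma_algebra; do 2 eexists.
Qed.

Lemma borel_box_content (A : set (powerset_rV R n)) :
  (box_content A < +oo)%E -> borel A.
Proof.
rewrite /box_content; case: eqVneq => [->|_ h]; first by move=> _; exact: measurable0.
have [[ab ->]|no] := pselect (exists ab, A = box ab.1 ab.2).
  exact: borel_box.
move: h; rewrite (_ : [set _ | _ in _] = set0) ?ereal_inf0// -subset0 => _ [ab /= Aab _].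
by apply: no; exists ab.
Qed.

(** The outer measure is an infimum over countable covers by boxes; the intersection of covers that
    are optimal up to 1/(k+1) is a Borel hull. *)
Lemma borel_superset (A : set E) : (leb A < +oo)%E ->
  exists B : set E, [/\ borel B, A `<=` B & leb B = leb A].
Proof.
move=> Afin.
have Afn : leb A \is a fin_num by rewrite ge0_fin_numE// outer_measure_ge0.
have /choice[F hF] (k : nat) : exists F : nat -> set (powerset_rV R n),
    [/\ forall j, borel (F j), A `<=` \bigcup_j F j
      & (\sum_(j <oo) box_content (F j) < leb A + (k.+1%:R^-1)%:E)%E].
  have k0 : 0 < k.+1%:R^-1 :> R by rewrite invr_gt0.
  have [_ [F [mF AF] <-] h] := @lb_ereal_inf_adherent _ _ _ k0 Afn.
  (* A cover of finite total content consists of boxes and empty sets only, since any other set has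
     content +oo. *)
  exists F; split=> // j; apply: borel_box_content.
  apply: le_lt_trans (lt_trans h _); last first.
    by rewrite lte_add_pinfty// ltry.
  by rewrite (nneseriesD1 (n := j))// ?leeDl// ?nneseries_ge0// => i *; exact: box_content_ge0.
exists (\bigcap_k \bigcup_j F k j); split.
- apply: bigcapT_measurable => k; apply: bigcupT_measurable => j.
  by have [] := hF k.
- by move=> x Ax k _; have [_ + _] := hF k; apply.
- apply/eqP; rewrite eq_le; apply/andP; split; last first.
    by apply: le_outer_measure => x Ax k _; have [_ + _] := hF k; apply.
  apply/lee_addgt0Pr => e e0.
  have [k ke] : exists k : nat, k.+1%:R^-1 <= e.
    exists (Num.bound e^-1); rewrite -[leRHS]invrK lef_pV2 ?posrE ?invr_gt0//.
    by rewrite ltW// (lt_trans (archi_boundP _))// ?ltr_nat// invr_ge0 ltW.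
  have [_ AF hk] := hF k.
  apply: (@le_trans _ _ (leb (\bigcup_j F k j))).
    by apply: le_outer_measure; exact: bigcap_inf.
  apply: (@le_trans _ _ (\sum_(j <oo) box_content (F k j))%E).
    by apply: ereal_inf_lbound; exists (F k) => //; split.
  by rewrite (le_trans (ltW hk))// leeD2l// lee_fin.
Qed.

(** For a measurable set of finite measure, a hull of equal measure differs from it by a null set.
    The general case exhausts [A] by balls and takes the union of the hulls. *)
Lemma borel_ae_superset (A : set E) : measurable A ->
  exists B : set E, [/\ borel B, A `<=` B & leb (B `\` A) = 0%E].
Proof.
move=> mA.
pose D k : set E := eball 0 (k.+1%:R : R)%:E.
have mD k : measurable (D k) by exact: measurable_eball.
have Dfin k : (leb (A `&` D k) < +oo)%E.
  apply: (@le_lt_trans _ _ (leb (D k))); last by rewrite lebesgue_eball// ltry.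
  by apply: le_measure; rewrite ?inE//; exact: measurableI.
have /choice[B hB] k := borel_superset (Dfin k).
exists (\bigcup_k B k); split.
- by apply: bigcupT_measurable => k; have [] := hB k.
- move=> x Ax; exists (Num.bound (enorm x)) => //.
  have [_ + _] := hB (Num.bound (enorm x)); apply; split=> //.
  rewrite /D eballE/= subr0; apply: lt_trans (archi_boundP (enorm_ge0 _)) _.
  by rewrite ltr_nat.
- apply/eqP; rewrite eq_le outer_measure_ge0 andbT.
  have null k : leb (B k `\` (A `&` D k)) = 0%E.
    have [/borel_measurable mB AB lB] := hB k.
    have Bfin : (leb (B k) < +oo)%E by rewrite lB; exact: Dfin.
    have -> : leb (B k `\` (A `&` D k)) = (leb (B k) - leb (B k `&` (A `&` D k)))%E.
      exact: (measureD mB (measurableI _ _ mA (mD k)) Bfin).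
    by rewrite (setIidr AB) lB subee// ge0_fin_numE ?outer_measure_ge0// Dfin.
  apply: (@le_trans _ _ (\sum_(k <oo) leb (B k `\` (A `&` D k)))%E); last first.
    by rewrite eseries0.
  apply: le_trans (outer_measure_sigma_subadditive _ _).
  apply: le_outer_measure => x [[k _ Bx] nA]; exists k => //; split=> // -[].
  by move/nA.
Qed.

(* Needed because preimages of Lebesgue measurable sets under the continuous map
   [midpoint] below need not be measurable. *)
Lemma borel_representative (f : E -> R) : measurable_fun setT f ->
  exists2 g : E -> R, (forall c, borel [set x | c < g x])
    & {ae leb, forall x, f x = g x}.
Proof.
move=> mf.
have mE (q : rat) : measurable [set x | ratr q < f x].
  rewrite (_ : [set _ | _] = setT `&` f @^-1` `]ratr q, +oo[); first exact: mf.
  by rewrite setTI; apply/seteqP; split=> x; rewrite /= in_itv/= andbT.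
have /choice[B hB] q := borel_ae_superset (mE q).
have Z0 : leb (\bigcup_q (B q `\` [set x | ratr q < f x])) = 0%E.
  apply/eqP; rewrite eq_le outer_measure_ge0 andbT.
  pose F k := oapp (fun q => B q `\` [set x | ratr q < f x]) set0 (unpickle k).
  apply: (@le_trans _ _ (\sum_(k <oo) leb (F k))%E); last first.
    rewrite eseries0// => k _ _; rewrite /F; case: unpickle => [q|] /=.
      by have [] := hB q.
    exact: outer_measure0.
  apply: le_trans (outer_measure_sigma_subadditive _ _).
  apply: le_outer_measure => x [q _ h].
  have Fq : F (pickle q) = B q `\` [set x | ratr q < f x] by rewrite /F pickleK.
  move: (pickle q) Fq => k Fk; exists k; [exact: I|by rewrite Fk].
(* One Borel null set [N] contains the errors of all hulls at rational heights. With value 0 on [N],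
   the set where the new function exceeds [c] is, off [N], the union of the hulls at rational
   heights above [c]; [N] itself belongs to it exactly when c < 0. *)
have [|N [bN ZN N0]] := @borel_superset (\bigcup_q (B q `\` [set x | ratr q < f x])).
  by rewrite Z0.
rewrite Z0 in N0.
exists (fun x => if x \in N then 0 else f x); last first.
  exists N; split=> //; first exact: borel_measurable.
  by move=> x /=; apply: contra_notP => Nx; rewrite memNset.
move=> c.
rewrite (_ : [set _ | _] = (if c < 0 then N else set0) `|`
   \bigcup_q (if c < ratr q then B q `\` N else set0)).
  apply: measurableU; first by case: ifP => _; [exact: bN|exact: measurable0].
  apply: bigcupT_measurable_rat => q; case: ifP => _; last exact: measurable0.
  by apply: measurableD => //; have [] := hB q.
apply/seteqP; split=> x /=.
  case: ifPn => [/set_mem Nx ->|/negP xN cf]; first by left.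
  right; have /rat_in_itvoo[q] := cf; rewrite in_itv/= => /andP[cq qf].
  exists q => //; rewrite cq; split; last by move=> Nx; apply: xN; rewrite inE.
  by have [_ + _] := hB q; apply.
move=> [|[q _]].
  by case: ifP => // c0 /mem_set ->.
case: ifP => // cq [Bx Nx]; rewrite memNset// (lt_trans cq)//.
by apply: contrapT => qf; apply: Nx; apply: ZN; exists q.
Qed.
End borel_representative.

(** * Dyadic sums and inequalities for powers *)

Section integral_ge0.
Local Open Scope ereal_scope.
Context d (T : measurableType d) (R : realType).
Variable mu : {measure set T -> \bar R}.
Implicit Types (D : set T) (f g : T -> \bar R).

(** The integral of a nonnegative function is a supremum over the simple functions below it, so
    monotonicity requires no measurability. *)
Lemma le_integral_ge0 D f g : (forall x, D x -> 0 <= f x) ->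
  (forall x, D x -> f x <= g x) ->
  \int[mu]_(x in D) f x <= \int[mu]_(x in D) g x.
Proof.
move=> f0 fg; have g0 x : D x -> 0 <= g x.
  by move=> Dx; exact: le_trans (f0 x Dx) (fg x Dx).
rewrite !ge0_integralE//; apply: le_ereal_sup => _ [h hf <-]; exists h => //.
by move=> x; apply: le_trans (hf x) _; exact: lee_restrict.
Qed.

(** [f] lies between two measurable functions, equal to [g] off the null set and to 0 or +oo on it,
    both with the integral of [g]. Meant for the kernel [K], which agrees only almost everywhere
    with a measurable function. *)
Lemma ae_eq_integral_ge0 D f g : measurable D -> measurable_fun D g ->
  (forall x, D x -> 0 <= f x) -> (forall x, D x -> 0 <= g x) ->
  {ae mu, forall x, D x -> f x = g x} ->
  \int[mu]_(x in D) f x = \int[mu]_(x in D) g x.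
Proof.
move=> mD mg f0 g0 [N [mN N0 fgN]].
have fg x : D x -> ~ N x -> f x = g x.
  by move=> Dx Nx; apply: contrapT => h; apply: Nx; apply: fgN => /(_ Dx).
have ms (b : \bar R) : measurable_fun D (fun x => if x \in N then b else g x).
  apply: measurable_fun_if => //.
  - apply: (measurable_fun_bool true).
    rewrite (_ : _ @^-1` _ = N); first exact: measurableI.
    by apply/seteqP; split=> x /=; [move/set_mem|move/mem_set].
  - exact: measurable_funS mg.
have e (b : \bar R) : 0 <= b ->
    \int[mu]_(x in D) (if x \in N then b else g x) = \int[mu]_(x in D) g x.
  move=> b0; apply: ge0_ae_eq_integral => //.
    by move=> x Dx; case: ifPn => // _; exact: g0.
  by exists N; split=> // x /=; apply: contra_notP => Nx _; rewrite memNset.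
apply/eqP; rewrite eq_le; apply/andP; split.
  rewrite -(e +oo)//; apply: le_integral_ge0 => // x Dx.
  by case: ifPn => [_|/negP xN]; rewrite ?leey// fg// => Nx; apply: xN; rewrite inE.
rewrite -(e 0)//; apply: le_integral_ge0 => x Dx.
  by case: ifPn => // _; exact: g0.
case: ifPn => [_|/negP xN]; first exact: f0.
by rewrite fg// => Nx; apply: xN; rewrite inE.
Qed.
End integral_ge0.

Section geometric.
Context {R : realType}.
Lemma nneseries_geometric_le (A th : R) : 0 <= A -> 0 < th < 1 ->
  (\sum_(j <oo) (A * th ^+ j)%:E <= (A / (1 - th))%:E)%E.
Proof.
move=> A0 /andP[th0 th1].
have Ath j : 0 <= A * th ^+ j by rewrite mulr_ge0// exprn_ge0// ltW.
apply: lime_le; first by apply: is_cvg_nneseries => j _ _; rewrite lee_fin.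
apply: nearW => k; rewrite sumEFin lee_fin.
by have := @geometric_le_lim R k A th A0 th0; apply; rewrite ger0_norm// ltW.
Qed.

Lemma dyadic_small (r t : R) : 0 < t -> t < r ->
  exists j : nat, 2^-1 ^+ j.+1 * r <= t < 2^-1 ^+ j * r.
Proof.
move=> t0 tr.
have r0 : 0 < r by apply: lt_trans tr.
have ex : exists j, 2^-1 ^+ j.+1 * r <= t.
  have [k hk] : exists k : nat, r / t < k%:R by exists (Num.bound (r / t)); rewrite archi_boundP// divr_ge0// ltW.
  exists k; rewrite exprVn -ler_pdivlMl ?invr_gt0 ?exprn_gt0// invrK.
  rewrite -ler_pdivrMr// (le_trans (ltW hk))// -natrX ler_nat.
  by rewrite ltnW// (ltn_trans (ltnSn k))// ltn_expl.
exists (ex_minn ex); case: ex_minnP => [[|j] hj mj]; rewrite hj/=.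
  by rewrite expr0 mul1r.
by rewrite ltNge; apply/negP => /mj; rewrite ltnn.
Qed.

Lemma dyadic_large (t : R) : 1 <= t -> exists j : nat, 2 ^+ j <= t < 2 ^+ j.+1.
Proof.
move=> t1.
have ex : exists j, t < 2 ^+ j.+1.
  exists (Num.bound t); rewrite (lt_trans (archi_boundP _))// ?(le_trans _ t1)//.
  by rewrite -natrX ltr_nat (ltn_trans (ltnSn _))// ltn_expl.
exists (ex_minn ex); case: ex_minnP => [[|j] hj mj]; rewrite hj andbT ?expr0//.
by rewrite leNgt; apply/negP => /mj; rewrite ltnn.
Qed.
End geometric.

Section radial.
Context {R : realType} {n : nat}.
Local Notation E := (Rn R n).
Local Notation leb := (@lebesgue R n).

(** At each point [f] is at most one term of the series of the [c j] times indicators of balls, so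
    the series dominates it. The lemma serves both shrinking shells around a singularity and growing
    shells at infinity. *)
Lemma dyadic_integral_bound (f : E -> R) (c rho : nat -> R) (x0 : E) (A th : R) :
  (forall x, 0 <= f x) -> (forall j, 0 <= c j) -> (forall j, 0 <= rho j) ->
  0 <= A -> 0 < th < 1 ->
  (forall x, f x = 0 \/ exists j, eball x0 (rho j)%:E x /\ f x <= c j) ->
  (forall j, c j * (2 * rho j) ^+ n <= A * th ^+ j) ->
  (\int[leb]_x (f x)%:E <= (A / (1 - th))%:E)%E.
Proof.
move=> f0 c0 rho0 A0 th01 fc cA.
pose g j (x : E) : \bar R := (c j * \1_(eball x0 (rho j)%:E) x)%:E.
have g0 j x : (0 <= g j x)%E by rewrite lee_fin mulr_ge0// indicE ler0n.
apply: (@le_trans _ _ (\int[leb]_x \sum_(j <oo) g j x)%E).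
  apply: le_integral_ge0 => x _; first by rewrite lee_fin.
  have [->|[j [xj fxc]]] := fc x; first by rewrite nneseries_ge0.
  apply: (@le_trans _ _ (g j x)).
    by rewrite /g indicE mem_set// mulr1 lee_fin.
  by rewrite (nneseriesD1 (n := j))// leeDl// nneseries_ge0.
have mI j : measurable_fun setT (\1_(eball x0 (rho j)%:E) : E -> R).
  exact: measurable_indic (measurable_eball _ _).
have mg j : measurable_fun setT (g j).
  apply/measurable_EFinP; exact: (measurable_funM (measurable_cst _) (mI j)).
rewrite (integral_nneseries _ measurableT mg (fun j x _ => g0 j x)).
apply: le_trans (nneseries_geometric_le A0 th01).
apply: lee_nneseries => j _; first by rewrite integral_ge0.
rewrite /g; under eq_integral do rewrite EFinM.
rewrite (ge0_integralZl_EFin _ measurableT _ _ (c0 j)); first last.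
  exact/measurable_EFinP.
  by move=> x _; rewrite lee_fin indicE ler0n.
rewrite integral_indic ?setIT//; last exact: measurable_eball.
apply: (@le_trans _ _ ((c j)%:E * ((2 * rho j) ^+ n)%:E)%E).
  by rewrite lee_wpmul2l ?lee_fin//; exact: lebesgue_eball_le.
by rewrite -EFinM lee_fin.
Qed.
End radial.

Section powR_inequalities.
Context {R : realType}.
Implicit Types a b p t x y : R.

(** Young's inequality for the conjugate exponents p/(p-1) and p, multiplied by p. *)
Lemma powR_tangent p a b : 1 < p -> 0 <= a -> 0 <= b ->
  p * (a `^ (p - 1) * b) <= b `^ p + (p - 1) * a `^ p.
Proof.
move=> p1 a0 b0; have p0 : 0 < p by lra.
have q0 : 0 < p - 1 by lra.
have e : (p / (p - 1))^-1 + p^-1 = 1.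
  by rewrite invf_div -[X in _ + X]mul1r -mulrDl subrK divff// gt_eqF.
have := @conjugate_powR _ (a `^ (p - 1)) b (p / (p - 1)) p (powR_ge0 _ _) b0 _ p0 e.
rewrite divr_gt0// => /(_ isT).
rewrite -powRrM mulrCA divff ?gt_eqF// mulr1 => h.
have := ler_wpM2l (ltW p0) h; rewrite mulrDr.
rewrite [p * (b `^ p / p)]mulrCA divff ?gt_eqF// mulr1 invf_div.
rewrite [p * (a `^ p * _)]mulrCA [p * (_ / p)]mulrCA divff ?gt_eqF// mulr1.
by lra.
Qed.

Lemma powR_tangentB p a b : 1 < p -> 0 <= a -> 0 <= b ->
  a `^ p + p * (a `^ (p - 1) * (b - a)) <= b `^ p.
Proof.
move=> p1 a0 b0; have := powR_tangent p1 a0 b0.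
have := mulr_powRB1 a0 (lt_trans ltr01 p1).
by rewrite mulrBr mulrBr [_ * a]mulrC => ->; lra.
Qed.

(** Add the tangent inequalities at the barycentre with weights 1-t and t: the linear terms
    cancel. *)
Lemma powR_convex p t x y : 1 < p -> 0 <= t <= 1 -> 0 <= x -> 0 <= y ->
  ((1 - t) * x + t * y) `^ p <= (1 - t) * x `^ p + t * y `^ p.
Proof.
move=> p1 /andP[t0 t1] x0 y0; set m := (1 - t) * x + t * y.
have m0 : 0 <= m by rewrite addr_ge0// mulr_ge0// subr_ge0.
have hx := powR_tangentB p1 m0 x0; have hy := powR_tangentB p1 m0 y0.
have t1' : 0 <= 1 - t by rewrite subr_ge0.
have := lerD (ler_wpM2l t1' hx) (ler_wpM2l t0 hy).
apply: le_trans; rewrite le_eqVlt; apply/orP; left; apply/eqP.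
rewrite /m; ring.
Qed.

Lemma powR_superadd p a b : 1 <= p -> 0 <= a -> 0 <= b ->
  a `^ p + b `^ p <= (a + b) `^ p.
Proof.
move=> p1 a0 b0; have p0 : 0 < p by lra.
rewrite -!(mulr_powRB1 _ p0)// ?addr_ge0// mulrDl.
have q0 : 0 <= p - 1 by lra.
by apply: lerD; apply: ler_wpM2l => //; apply: ge0_ler_powR => //;
  rewrite ?nnegrE ?addr_ge0 ?lerDl ?lerDr.
Qed.

Lemma powRD_le p a b : 1 < p -> 0 <= a -> 0 <= b ->
  (a + b) `^ p <= 2 `^ p / 2 * (a `^ p + b `^ p).
Proof.
move=> p1 a0 b0.
have h2 : 0 <= (2^-1 : R) <= 1 by apply/andP; split; lra.
have := powR_convex p1 h2 a0 b0.
rewrite (_ : (1 - 2^-1) * a + 2^-1 * b = 2^-1 * (a + b)); last by field.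
rewrite powRM ?addr_ge0 ?invr_ge0// => h.
have e : 2 `^ p * 2^-1 `^ p = 1 by rewrite -powRM ?invr_ge0// mulfV// powR1.
have := ler_wpM2l (powR_ge0 2 p) h; rewrite mulrA e mul1r.
by move=> /le_trans; apply; rewrite -mulrA ler_wpM2l ?powR_ge0//; lra.
Qed.

Lemma ler_powR2r p a b : 0 <= p -> 0 <= a -> a <= b -> a `^ p <= b `^ p.
Proof.
by move=> p0 a0 ab; apply: ge0_ler_powR; rewrite ?nnegrE ?(le_trans a0 ab).
Qed.

Lemma powR_bernoulli t x : 0 < t <= 1 -> 0 <= x -> x `^ t <= 1 - t + t * x.
Proof.
move=> /andP[t0]; rewrite le_eqVlt => /predU1P[-> x0|t1 x0].
  by rewrite powRr1// mul1r subrr add0r.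
have p1 : 1 < t^-1 by rewrite invf_gt1.
have := powR_tangent p1 ler01 (powR_ge0 x t).
rewrite !powR1 -powRrM mulfV ?gt_eqF// powRr1// mul1r mulr1 => h.
have := ler_wpM2l (ltW t0) h.
by rewrite mulrA mulfV ?gt_eqF// mul1r mulrDr mulrBr mulfV ?gt_eqF//; lra.
Qed.

End powR_inequalities.

(** * Effect of the cutoff on one pair of points *)

Section cutoff_pointwise.
Context {R : realType}.
Variable p : R.
Hypothesis p1 : 1 < p.
Let p0 : 0 < p. Proof. exact: lt_trans ltr01 p1. Qed.
Let pB1 : 0 < p - 1. Proof. by rewrite subr_gt0. Qed.
Local Notation pos t := (Num.max t 0).
Local Notation neg t := (Num.max (- t) 0).
Implicit Types a b al be x y : R.

(* The case in which exactly one of the two points lies above the level. *)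
Lemma cut_one_above a c al : 0 <= a -> 0 <= c -> 0 <= al <= 1 ->
  ((1 - al) * a + c) `^ p + al / 2 * (a `^ p + a * c `^ (p - 1)) <= (a + c) `^ p.
Proof.
move=> a0 c0 al01; have ac0 : 0 <= a + c by rewrite addr_ge0.
have := powR_convex p1 al01 ac0 c0.
rewrite (_ : (1 - al) * (a + c) + al * c = (1 - al) * a + c); last by ring.
(* Convexity yields a gain of al times (a+c)^p - c^p. Both a^p (superadditivity) and a c^(p-1)
   (tangent at c) are at most this difference, hence the factor 1/2 for their sum. *)
have h1 := powR_superadd (ltW p1) a0 c0.
have h2 := powR_tangentB p1 c0 ac0; rewrite addrK in h2.
have h3 : a * c `^ (p - 1) <= p * (c `^ (p - 1) * a).
    rewrite [a * _]mulrC ler_peMl//; [by rewrite mulr_ge0// powR_ge0|exact: ltW].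
have /andP[al0 al1] := al01.
have h4 : al * (a `^ p + a * c `^ (p - 1)) <= 2 * (al * ((a + c) `^ p - c `^ p)).
  by rewrite mulrCA ler_wpM2l//; lra.
lra.
Qed.

Lemma powRB_le x y : 0 <= y <= x -> x `^ p - y `^ p <= p * (x `^ (p - 1) * (x - y)).
Proof.
move=> /andP[y0 yx]; have := powR_tangentB p1 (le_trans y0 yx) y0.
by rewrite -[y - x]opprB !mulrN; lra.
Qed.

(** With d = (x^p - y^p) b / x^p the new difference is at most (1-x^p)|a-b| + x^p d, a convex
    combination, so its p-th power is at most (1-x^p)|a-b|^p + x^p d^p. Since d <= p (x-y) b / x,
    the power p on the cutoff exactly compensates the division by x. *)
Lemma cut_both_above a b x y : 0 <= a -> 0 <= b -> 0 <= y <= x -> x <= 1 ->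
  `|(1 - x `^ p) * a - (1 - y `^ p) * b| `^ p + x `^ p * `|a - b| `^ p
  <= `|a - b| `^ p + p `^ p * (x - y) `^ p * b `^ p.
Proof.
move=> a0 b0 /andP[y0 yx] x1; have x0 : 0 <= x := le_trans y0 yx.
have [x00|xn0] := eqVneq x 0.
  have y00 : y = 0 by lra.
  rewrite x00 y00 powR0 ?gt_eqF// !subr0 !mul1r mul0r addr0 lerDl.
  by rewrite !mulr_ge0 ?powR_ge0.
have {}xn0 : 0 < x by rewrite lt0r xn0.
have xp : 0 < x `^ p by rewrite powR_gt0.
have e1 : 1 `^ p = 1 :> R by rewrite powR1.
have xp1 : x `^ p <= 1 by rewrite -[leRHS]e1 ler_powR2r// ltW.
have yp : y `^ p <= x `^ p by rewrite ler_powR2r// ltW.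
have [d dE] : exists d, d = (x `^ p - y `^ p) * b / x `^ p by eexists.
have d0 : 0 <= d by rewrite dE divr_ge0 ?mulr_ge0 ?subr_ge0// ltW.
have e : `|(1 - x `^ p) * a - (1 - y `^ p) * b| <= (1 - x `^ p) * `|a - b| + x `^ p * d.
  rewrite (_ : _ - _ = (1 - x `^ p) * (a - b) - x `^ p * d); last first.
    by rewrite dE [x `^ p * (_ / _)]mulrC divfK ?gt_eqF//; ring.
  by rewrite (le_trans (ler_normB _ _))// !normrM (ger0_norm d0) (ger0_norm (ltW xp)) (@ger0_norm _ (1 - _)) ?subr_ge0 ?lexx.
have := ler_powR2r (ltW p0) (normr_ge0 _) e.
have h01 : 0 <= x `^ p <= 1 by rewrite ltW.
move=> /le_trans /(_ (powR_convex p1 h01 (normr_ge0 _) d0)) h.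
suff : x `^ p * d `^ p <= p `^ p * (x - y) `^ p * b `^ p by lra.
have hd : d <= p * (x - y) * b / x.
  rewrite dE ler_pdivrMr//.
  have -> : p * (x - y) * b / x * x `^ p = p * (x `^ (p - 1) * (x - y)) * b.
    by rewrite -(mulr_powRB1 x0 p0); field; rewrite gt_eqF.
  by rewrite ler_wpM2r// powRB_le// y0.
have xy0 : 0 <= x - y by rewrite subr_ge0.
apply: (@le_trans _ _ (x `^ p * (p * (x - y) * b / x) `^ p)).
  by apply: (ler_wpM2l (ltW xp)); exact: (ler_powR2r (ltW p0)).
have pp := ltW p0.
have hh : 0 <= p * (x - y) * b / x by rewrite divr_ge0 ?mulr_ge0.
rewrite -powRM// mulrC divfK ?gt_eqF//.
by rewrite (powRM _ (mulr_ge0 pp xy0) b0) (powRM _ pp xy0).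
Qed.

(** The difference can grow only if (1-al)a < b. It is then at most b and grows by at most al a, so
    the tangent inequality bounds the growth of the p-th power. *)
Lemma cut_far_above a b al : 0 <= a -> 0 <= b -> 0 <= al <= 1 ->
  `|(1 - al) * a - b| `^ p <= `|a - b| `^ p + p * (al * (a * b `^ (p - 1))).
Proof.
move=> a0 b0 /andP[al0 al1].
have [h|h] := leP `|(1 - al) * a - b| `|a - b|.
  rewrite ler_wpDr//; last exact: (ler_powR2r (ltW p0)).
  by rewrite !mulr_ge0 ?powR_ge0// ltW.
have ala : al * a <= a by rewrite ler_piMl.
have ala0 : 0 <= al * a by rewrite mulr_ge0.
have neg : (1 - al) * a - b < 0.
  rewrite ltNge; apply/negP => h0; move: h.
  rewrite (ger0_norm h0) ltNge => /negP; apply.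
  by apply: le_trans (ler_norm _); lra.
have e : `|(1 - al) * a - b| = b - (1 - al) * a by rewrite ltr0_norm// opprB.
have hb := powRB_le (x := `|(1 - al) * a - b|) (y := `|a - b|).
rewrite normr_ge0 ltW//= in hb; have {}hb := hb isT.
rewrite -lerBlDl; apply: le_trans hb _; apply: (ler_wpM2l (ltW p0)).
rewrite mulrA [X in _ <= X]mulrC; apply: ler_pM; rewrite ?powR_ge0 ?subr_ge0 ?(ltW h)//.
  rewrite ler_powR2r//; [exact: ltW|rewrite e; lra].
by rewrite e; have := ler_norm (- (a - b)); rewrite normrN; lra.
Qed.


(* The points are [x] and [y], at heights [a] and [b] above the level; [rx],
   [mx], [Rx] say whether [x] lies in the balls of radius r < m < R, and [fx] is
   the value at [x] of a cutoff between r and m. *)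
Lemma cut_energy_le (rx ry mx my Rx Ry : bool) a b fx fy :
  0 <= fx <= 1 -> 0 <= fy <= 1 ->
  (rx -> fx = 1) -> (ry -> fy = 1) -> (~~ mx -> fx = 0) -> (~~ my -> fy = 0) ->
  (rx -> mx) -> (ry -> my) -> (mx -> Rx) -> (my -> Ry) ->
  `|(a - fx `^ p * pos a) - (b - fy `^ p * pos b)| `^ p +
    2^-1 * ((rx && ry)%:R * `|pos a - pos b| `^ p +
            rx%:R * (pos a * neg b `^ (p - 1)))
  <= `|a - b| `^ p +
    ((Rx && Ry)%:R * (p `^ p * `|fx - fy| `^ p * (pos a `^ p + pos b `^ p)) +
     p * ((mx && ~~ Ry)%:R * (pos a * pos b `^ (p - 1)) +
          (my && ~~ Rx)%:R * (pos b * pos a `^ (p - 1)))).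
Proof.
move=> fx01 fy01 rx1 ry1 mx0 my0 rmx rmy mRx mRy.
have fp01 (f : R) : 0 <= f <= 1 -> 0 <= f `^ p <= 1.
  move=> /andP[f0 f1]; rewrite powR_ge0/=.
  have e1 : 1 `^ p = 1 :> R by rewrite powR1.
  by rewrite -[leRHS]e1 ler_powR2r// ltW.
have fr (r : bool) (f : R) : (r -> f = 1) -> 0 <= f <= 1 -> r%:R <= f `^ p.
  by move=> rf f01; case: r rf => [->//|_]; rewrite ?powR1 ?powR_ge0.
have err0 : 0 <= (Rx && Ry)%:R * (p `^ p * `|fx - fy| `^ p * (pos a `^ p + pos b `^ p)).
  by rewrite !mulr_ge0 ?addr_ge0 ?powR_ge0.
have pos0 (t : R) : 0 <= pos t by rewrite le_max lexx orbT.
have far0 (c d : R) (e : bool) : 0 <= e%:R * (pos c * pos d `^ (p - 1)).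
  by rewrite !mulr_ge0 ?powR_ge0.
have pp := ltW p0.
have leA2 (r1 r2 : bool) : (r1 && r2)%:R <= r2%:R :> R by rewrite ler_nat; case: r1 r2 => -[].
have leA1 (r1 r2 : bool) : (r1 && r2)%:R <= r1%:R :> R by rewrite ler_nat; case: r1 r2 => -[].
have z1 : 0 `^ p = 0 :> R by rewrite powR0// gt_eqF.
have z2 : 0 `^ (p - 1) = 0 :> R by rewrite powR0// gt_eqF.
(* Two points below the level are not moved; with exactly one above, [cut_one_above] applies; with
   both above, there is no contribution of [neg], and the position relative to the outer ball
   decides. *)
have [a0|a0] := leP a 0; have [b0|b0] := leP b 0.
- rewrite ?(max_r a0) ?(max_r b0) !(mulr0, mul0r, subr0) normr0 powR0 ?gt_eqF//.
  by rewrite !(mulr0, mul0r, addr0).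
- have b0' := ltW b0.
  rewrite ?(max_r a0) ?(max_l b0') !(mulr0, mul0r, subr0, sub0r, addr0) normrN (gtr0_norm b0).
  rewrite !(z1, z2) !(mulr0, mul0r, add0r, addr0).
  have na : 0 <= - a by rewrite oppr_ge0.
  have := cut_one_above b0' na (fp01 _ fy01).
  have -> : (1 - fy `^ p) * b - a = `|a - (b - fy `^ p * b)|.
    rewrite ler0_norm; first by ring.
    have : 0 <= (1 - fy `^ p) * b.
      by rewrite mulr_ge0// subr_ge0; have /andP[] := fp01 _ fy01.
    lra.
  have -> : b - a = `|a - b| by rewrite ler0_norm; lra.
  move=> h; apply: (@le_trans _ _ (`|a - b| `^ p)).
    apply: le_trans h; rewrite lerD2l.
    have h1 : (rx && ry)%:R <= fy `^ p.
      exact: le_trans (leA2 _ _) (fr ry _ ry1 fy01).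
    have h2 : 0 <= b `^ p by exact: powR_ge0.
    have h3 : 0 <= b * (- a) `^ (p - 1) by rewrite mulr_ge0 ?powR_ge0.
    have h4 : 0 <= fy `^ p by exact: powR_ge0.
    have := ler_wpM2r h2 h1; have := mulr_ge0 h4 h3; lra.
  by rewrite lerDl !mulr_ge0 ?powR_ge0.
- have a0' := ltW a0.
  rewrite ?(max_l a0') ?(max_r b0) !(mulr0, mul0r, subr0, addr0) (gtr0_norm a0).
  rewrite !(z1, z2) !(mulr0, mul0r, add0r, addr0).
  rewrite (@max_l _ _ (- b)) ?oppr_ge0//.
  have nb : 0 <= - b by rewrite oppr_ge0.
  have := cut_one_above a0' nb (fp01 _ fx01).
  have -> : (1 - fx `^ p) * a - b = `|a - fx `^ p * a - b|.
    rewrite ger0_norm; first by ring.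
    have : 0 <= (1 - fx `^ p) * a.
      by rewrite mulr_ge0// subr_ge0; have /andP[] := fp01 _ fx01.
    lra.
  have -> : (a - b) `^ p = `|a - b| `^ p by rewrite ger0_norm//; lra.
  move=> h; apply: (@le_trans _ _ (`|a - b| `^ p)).
    apply: le_trans h; rewrite lerD2l.
    have h1 : (rx && ry)%:R <= fx `^ p.
      exact: le_trans (leA1 _ _) (fr rx _ rx1 fx01).
    have h1' := fr rx _ rx1 fx01.
    have h2 : 0 <= a `^ p by exact: powR_ge0.
    have h3 : 0 <= a * (- b) `^ (p - 1) by rewrite mulr_ge0 ?powR_ge0.
    have := ler_wpM2r h2 h1; have := ler_wpM2r h3 h1'; lra.
  by rewrite lerDl !mulr_ge0 ?powR_ge0.
- have a0' := ltW a0; have b0' := ltW b0.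
  rewrite ?(max_l a0') ?(max_l b0') ?(@max_r _ _ (- b)) ?oppr_le0//.
  rewrite [0 `^ (p - 1)]powR0 ?gt_eqF// !mulr0 addr0.
  move: err0 (far0 a b (mx && ~~ Ry)) (far0 b a (my && ~~ Rx)).
  rewrite ?(max_l a0') ?(max_l b0') => err0 far1 far2.
  have pow0 : 0 <= `|a - b| `^ p by exact: powR_ge0.
  have -> : (a - fx `^ p * a) - (b - fy `^ p * b) =
    (1 - fx `^ p) * a - (1 - fy `^ p) * b by ring.
  (* A point outside the outer ball is outside the middle one, so its cutoff vanishes and
     [cut_far_above] applies to the other point. If both are in the outer ball, [cut_both_above] is
     applied with the larger cutoff value in first place. *)
  case: (boolP Rx) => HRx; case: (boolP Ry) => HRy; last first.
  + have Hmx : ~~ mx by apply: contra HRx.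
    have Hmy : ~~ my by apply: contra HRy.
    have Hrx : ~~ rx by apply: contra Hmx.
    rewrite (negbTE Hrx) mx0// my0// powR0 ?gt_eqF// (negbTE Hmx) (negbTE Hmy)/=.
    by rewrite !subr0 !mul1r !mul0r !(addr0, mulr0).
  + have Hmx : ~~ mx by apply: contra HRx.
    have Hrx : ~~ rx by apply: contra Hmx.
    rewrite (negbTE Hrx) (mx0 Hmx) powR0 ?gt_eqF// (negbTE Hmx)/= !mul0r mulr0 !addr0 !add0r.
    rewrite subr0 mul1r andbT -[in leLHS]normrN opprB.
    have := cut_far_above b0' a0' (fp01 _ fy01).
    rewrite [`|b - a|]distrC => /le_trans; apply; rewrite lerD2l ler_wpM2l//.
    have [/negbTE Hmy|Hmy] := boolP (~~ my).
      by rewrite my0 ?Hmy// powR0 ?gt_eqF// mul0r.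
    rewrite negbK in Hmy; rewrite Hmy.
    by rewrite ler_wpM2r ?mulr_ge0 ?powR_ge0//; have /andP[] := fp01 _ fy01.
  + have Hmy : ~~ my by apply: contra HRy.
    have Hry : ~~ ry by apply: contra Hmy.
    rewrite (negbTE Hry) (my0 Hmy) powR0 ?gt_eqF// (negbTE Hmy)/= andbF !mul0r mulr0 !addr0 !add0r.
    rewrite subr0 mul1r andbT.
    have := cut_far_above a0' b0' (fp01 _ fx01).
    move=> /le_trans; apply; rewrite lerD2l ler_wpM2l//.
    have [/negbTE Hmx|Hmx] := boolP (~~ mx).
      by rewrite mx0 ?Hmx// powR0 ?gt_eqF// mul0r.
    rewrite negbK in Hmx; rewrite Hmx.
    by rewrite ler_wpM2r ?mulr_ge0 ?powR_ge0//; have /andP[] := fp01 _ fx01.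
  + rewrite !andbF /= !mul0r addr0 mulr0 addr0 mul1r.
    have hr (f : R) (r1 r2 : bool) : (r1 -> f = 1) -> 0 <= f <= 1 -> r1 && r2 = rx && ry ->
      2^-1 * ((rx && ry)%:R * `|a - b| `^ p) <= f `^ p * `|a - b| `^ p.
      move=> rf f01 <-; have h1 : (r1 && r2)%:R <= f `^ p.
        exact: le_trans (leA1 _ _) (fr r1 _ rf f01).
      have h2 : 0 <= (r1 && r2)%:R :> R by [].
      have := ler_wpM2r pow0 h1; have := mulr_ge0 h2 pow0; lra.
    have [fyx|fxy] := leP fy fx.
      have /andP[fy0 _] := fy01; have /andP[fx0 fx1] := fx01.
      have := @cut_both_above a b fx fy a0' b0' _ fx1; rewrite fy0 fyx => /(_ isT).
      have := hr fx rx ry rx1 fx01 erefl.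
      rewrite (ger0_norm (_ : 0 <= fx - fy)) ?subr_ge0//.
      have : 0 <= p `^ p * (fx - fy) `^ p * a `^ p by rewrite !mulr_ge0 ?powR_ge0.
      rewrite mulrDr; lra.
    have {}fxy := ltW fxy.
    have /andP[fx0 _] := fx01; have /andP[fy0 fy1] := fy01.
    have := @cut_both_above b a fy fx b0' a0' _ fy1; rewrite fx0 fxy => /(_ isT).
    have := hr fy ry rx ry1 fy01 (andbC _ _).
    rewrite [`|b - a|]distrC [`|fx - fy|]distrC (ger0_norm (_ : 0 <= fy - fx)) ?subr_ge0//.
    rewrite [`|(1 - fy `^ p) * b - _|]distrC.
    have : 0 <= p `^ p * (fy - fx) `^ p * b `^ p by rewrite !mulr_ge0 ?powR_ge0.
    rewrite mulrDr; lra.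
Qed.

End cutoff_pointwise.

Section integral_indicator.
Context d (T : measurableType d) (R : realType) (mu : {measure set T -> \bar R}).
Lemma integral_indicR (D : set T) (f : T -> R) :
  (\int[mu]_(x in D) (f x)%:E = \int[mu]_x (\1_D x * f x)%:E)%E.
Proof.
rewrite integral_mkcond; apply: eq_integral => x _.
by rewrite patchE indicE; case: ifP => _; rewrite ?mul1r ?mul0r.
Qed.
End integral_indicator.

Section radial.
Context {R : realType} {n : nat}.
Local Notation E := (Rn R n).
Local Notation leb := (@lebesgue R n).
Variables (s p : R).
Hypotheses (s01 : 0 < s < 1) (p1 : 1 < p).

Let p0 : 0 < p. Proof. exact: lt_trans ltr01 p1. Qed.
Let s0 : 0 < s. Proof. by have /andP[] := s01. Qed.
Let s1 : 0 < 1 - s. Proof. by rewrite subr_gt0; have /andP[] := s01. Qed.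

Lemma half_powR_lt1 (b : R) : 0 < b -> 0 < (2^-1 : R) `^ b < 1.
Proof.
move=> b0; rewrite powR_gt0 ?invr_gt0//=.
have e1 : 1 `^ b = 1 :> R by rewrite powR1.
by rewrite -[ltRHS]e1 gt0_ltr_powR ?nnegrE ?invr_ge0// invf_lt1// ltr1n.
Qed.

Lemma powR_expn (x b : R) j : 0 <= x -> (x ^+ j) `^ b = (x `^ b) ^+ j.
Proof.
move=> x0; rewrite -powR_mulrn// -powRrM mulrC powRrM.
by rewrite powR_mulrn// powR_ge0.
Qed.

(** One factor 2^n comes from comparing the two ends of a dyadic shell, the other from the cube
    around the ball; the denominator is what [one_sub_half_powR] leaves of the geometric series. *)
Definition radial_constant : R := 4 ^+ n / (1 - 2^-1 `^ p).

Lemma radial_constant_gt0 : 0 < radial_constant.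
Proof.
have /andP[_ h] := half_powR_lt1 p0.
by rewrite divr_gt0 ?exprn_gt0 ?subr_gt0.
Qed.

(** Bernoulli's inequality for the exponent 1-s. It lets the geometric series of ratio 2^(-(1-s)p)
    cost only 1/(1-s), with a constant that does not involve [s]. *)
Lemma one_sub_half_powR : (1 - s) * (1 - 2^-1 `^ p) <= 1 - 2^-1 `^ ((1 - s) * p).
Proof.
have h01 : 0 < 1 - s <= 1 by rewrite s1/=; have := s0; lra.
have := powR_bernoulli h01 (powR_ge0 2^-1 p).
by rewrite -powRrM [p * _]mulrC; lra.
Qed.

Lemma radial_bound (x : E) (r : R) : 0 < r ->
  (\int[leb]_(y in eball x r%:E)
     (enorm (x - y) `^ p / enorm (x - y) `^ (n%:R + s * p))%:E
   <= (radial_constant * (r `^ ((1 - s) * p) / (1 - s)))%:E)%E.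
Proof.
move=> r0; set b := (1 - s) * p; have b0 : 0 < b by rewrite mulr_gt0.
have th01 := half_powR_lt1 b0.
rewrite integral_indicR.
pose rho j : R := 2^-1 ^+ j * r.
have rho0 j : 0 < rho j by rewrite mulr_gt0// exprn_gt0// invr_gt0.
pose c j : R := 2 ^+ n * (rho j `^ b / rho j ^+ n).
have c0 j : 0 <= c j.
  by apply: mulr_ge0; [exact: exprn_ge0|rewrite divr_ge0 ?powR_ge0// exprn_ge0// ltW].
pose A : R := 4 ^+ n * r `^ b.
have A0 : 0 <= A by rewrite mulr_ge0 ?powR_ge0// exprn_ge0.
apply: le_trans (@dyadic_integral_bound _ _ _ c rho x A (2^-1 `^ b) _ c0
  (fun j => ltW (rho0 j)) A0 th01 _ _) _.
- by move=> y; rewrite mulr_ge0 ?divr_ge0 ?powR_ge0// indicE ler0n.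
- move=> y; rewrite indicE; have [|] := boolP (y \in _); last by rewrite mul0r; left.
  rewrite mul1r inE eballE/= => yr; rewrite enormBC in yr.
  (* At the centre, which no dyadic shell contains, the integrand is 0 because 0^p = 0. *)
  have [xy0|xy0] := eqVneq (enorm (x - y)) 0.
    by left; rewrite xy0 powR0 ?gt_eqF// mul0r.
  have {}xy0 : 0 < enorm (x - y) by rewrite lt0r xy0 enorm_ge0.
  right; have [j /andP[j1 j2]] := dyadic_small xy0 yr.
  exists j; split; first by rewrite eballE/= enormBC.
  set t := enorm (x - y) in xy0 j1 j2 *.
  have -> : t `^ p / t `^ (n%:R + s * p) = t `^ b / t ^+ n.
    rewrite -(powR_mulrn _ (ltW xy0)).
    rewrite -!powRB ?(gt_eqF xy0) ?implybT//; congr (_ `^ _).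
    by rewrite /b; ring.
  have -> : c j = rho j `^ b / (2^-1 * rho j) ^+ n.
    by rewrite /c [(2^-1 * _) ^+ n]exprMn invfM -(exprVn (2^-1 : R)) invrK; ring.
  apply: ler_pM; rewrite ?powR_ge0 ?invr_ge0 ?exprn_ge0 ?(ltW xy0)//.
    by apply: ler_powR2r; rewrite ?(ltW b0) ?(ltW xy0)// ltW.
  rewrite lef_pV2 ?posrE ?exprn_gt0 ?mulr_gt0 ?invr_gt0//.
  have h : 2^-1 * rho j <= t by rewrite /rho mulrA -exprS.
  have h0 : 0 <= 2^-1 * rho j by rewrite mulr_ge0 ?invr_ge0// ltW.
  by apply: lerXn2r; rewrite ?nnegrE// ltW.
- move=> j; rewrite /c /A.
  have -> : 2 ^+ n * (rho j `^ b / rho j ^+ n) * (2 * rho j) ^+ n = 4 ^+ n * rho j `^ b.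
    have gen (x' y' : R) : y' != 0 ->
        2 ^+ n * (x' / y' ^+ n) * (2 * y') ^+ n = 4 ^+ n * x'.
      move=> y'0; rewrite exprMn (_ : 4 = 2 * 2 :> R); last by ring.
      by rewrite [(2 * 2) ^+ n]exprMn; field; rewrite expf_neq0.
    by rewrite gen// gt_eqF.
  rewrite /rho powRM ?exprn_ge0 ?invr_ge0 ?(ltW r0)// powR_expn ?invr_ge0//.
  by rewrite le_eqVlt; apply/orP; left; apply/eqP; ring.
rewrite lee_fin /A /radial_constant.
have /andP[_ q1] := half_powR_lt1 p0.
have h := one_sub_half_powR.
have -> : 4 ^+ n / (1 - 2^-1 `^ p) * (r `^ b / (1 - s)) =
   4 ^+ n * r `^ b / ((1 - s) * (1 - 2^-1 `^ p)).
  by field; rewrite !gt_eqF// subr_gt0.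
rewrite ler_wpM2l// lef_pV2// posrE.
  by rewrite subr_gt0; have /andP[] := th01.
by rewrite mulr_gt0// subr_gt0.
Qed.

Lemma tail_weight_fin (b : R) : 0 < b ->
  (\int[leb]_x (((1 + enorm x) `^ (n%:R + b))^-1)%:E < +oo)%E.
Proof.
move=> b0; have th01 := half_powR_lt1 b0.
have p2 j : 0 < 2 ^+ j :> R by exact: exprn_gt0.
pose c j : R := ((2 ^+ j) `^ (n%:R + b))^-1.
apply: le_lt_trans (@dyadic_integral_bound _ _ _ c (fun j => 2 ^+ j.+1) 0
  (4 ^+ n) (2^-1 `^ b) _ _ (fun j => ltW (p2 j.+1)) _ th01 _ _) (ltry _).
- by move=> x; rewrite invr_ge0 powR_ge0.
- by move=> j; rewrite invr_ge0 powR_ge0.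
- exact: exprn_ge0.
- move=> x; right; have x1 : 1 <= 1 + enorm x by rewrite lerDl enorm_ge0.
  have [j /andP[j1 j2]] := dyadic_large x1.
  exists j; split.
    by rewrite eballE/= subr0 (le_lt_trans _ j2)// lerDr.
  rewrite lef_pV2 ?posrE ?powR_gt0//; last by rewrite (lt_le_trans _ x1).
  by apply: ler_powR2r => //; rewrite ?addr_ge0 ?(ltW b0)// ltW.
- move=> j; rewrite /c powRD; last by rewrite (gt_eqF (p2 j)) implybT.
  rewrite powR_mulrn ?(ltW (p2 _))// -powR_expn ?invr_ge0//.
  have e : (2^-1 ^+ j) `^ b * (2 ^+ j) `^ b = 1 :> R.
    rewrite -powRM ?exprn_ge0 ?invr_ge0// -exprMn mulVf// expr1n.
    by rewrite (_ : 1 `^ b = 1)// powR1.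
  have pb : 0 < (2 ^+ j : R) `^ b by rewrite powR_gt0.
  rewrite (_ : 2 * 2 ^+ j.+1 = 4 * 2 ^+ j :> R); last by rewrite exprS; ring.
  rewrite [(4 * _) ^+ n]exprMn le_eqVlt; apply/orP; left; apply/eqP.
  have pbn : (2 ^+ j : R) `^ b != 0 by rewrite gt_eqF.
  apply: (mulIf pbn).
  rewrite -[RHS]mulrA e mulr1; field.
  by rewrite (gt_eqF pb) expf_neq0// gt_eqF.
Qed.
End radial.

(** * Energies at small distance and level sets *)

Section near_diagonal.
Context {R : realType} {n : nat}.
Local Notation E := (Rn R n).
Local Notation leb := (@lebesgue R n).
Local Notation lebleb := (leb \x leb)%E.
Variables (p : R) (x0 : E) (rad : R).
Hypothesis p1 : 1 < p.
Let p0 : 0 < p. Proof. exact: lt_trans ltr01 p1. Qed.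
Local Notation B := (eball x0 rad%:E).

Lemma measurable_sqr_eball : measurable (B `*` B).
Proof. by apply: measurableX; exact: measurable_eball. Qed.

Definition strip (t : R) : set (E * E) := [set z | enorm (z.1 - z.2) < t].

Lemma measurable_strip t : measurable (strip t).
Proof.
rewrite -[strip t]setTI (_ : strip t =
  (fun z : E * E => enorm (z.1 - z.2)) @^-1` `]-oo, t[).
  exact: (measurable_enormB_prod measurableT).
by apply/seteqP; split=> z; rewrite /strip /= in_itv.
Qed.

Definition strip_fun (w : E -> R) t (z : E * E) : R :=
  \1_(B `*` B) z * \1_(strip t) z * `|w z.1 - w z.2| `^ p.

Lemma strip_fun_ge0 w t z : 0 <= strip_fun w t z.
Proof. by rewrite /strip_fun !indicE !mulr_ge0 ?powR_ge0 ?ler0n. Qed.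

Definition strip_energy w t : \bar R := (\int[lebleb]_z (strip_fun w t z)%:E)%E.

Lemma measurable_diff_powR d (T : measurableType d) (f g : T -> R) (a : R) :
  measurable_fun setT f -> measurable_fun setT g ->
  measurable_fun setT (fun z => `|f z - g z| `^ a).
Proof.
move=> mf mg; apply: (measurableT_comp (measurable_powR _)).
apply: (measurableT_comp (@normr_measurable R setT)).
exact: measurable_funB.
Qed.

Lemma measurable_enormB_powRV (a : R) :
  measurable_fun setT (fun z : E * E => (enorm (z.1 - z.2) `^ a)^-1).
Proof.
rewrite (_ : (fun _ => _) = (fun z : E * E => enorm (z.1 - z.2) `^ (- a))).
  exact: measurableT_comp (measurable_powR _) measurable_enormB_prod.
by apply/funext => z; rewrite powRN.
Qed.

Lemma measurable_difference_quotient s (w : E -> R) : measurable_fun setT w ->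
  measurable_fun setT (difference_quotient s p w).
Proof.
move=> mw; apply: measurable_funM; last exact: measurable_enormB_powRV.
by apply: measurable_diff_powR; apply: (measurableT_comp mw);
  [exact: measurable_fst|exact: measurable_snd].
Qed.

(** Stated for maps with measurable coordinates, and with the measurability of [g \o a] and [g \o b]
    as premises, in order to cover the midpoint. *)
Lemma measurable_strip_fun_comp d (T : measurableType d) (a b : T -> E) g t :
  (forall i, measurable_fun setT (fun z => (a z : 'rV[R]_n) ord0 i)) ->
  (forall i, measurable_fun setT (fun z => (b z : 'rV[R]_n) ord0 i)) ->
  measurable_fun setT (g \o a) -> measurable_fun setT (g \o b) ->
  measurable_fun setT (fun z => strip_fun g t (a z, b z)).
Proof.
move=> ma mb mga mgb.
have mlt (h : T -> R) r : measurable_fun setT h -> measurable [set z | h z < r].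
  move=> mh; rewrite -[[set _ | _]]setTI (_ : [set _ | _] = h @^-1` `]-oo, r[).
    exact: (mh measurableT).
  by apply/seteqP; split=> z; rewrite /= in_itv.
have mc i : measurable_fun setT (fun _ : T => (x0 : 'rV[R]_n) ord0 i).
  exact: measurable_cst.
have mA := mlt _ rad (measurable_enormB ma mc).
have mB := mlt _ rad (measurable_enormB mb mc).
have mC := mlt _ t (measurable_enormB ma mb).
rewrite (_ : (fun z => _) = (fun z => \1_[set z | enorm (a z - x0) < rad] z *
   \1_[set z | enorm (b z - x0) < rad] z * \1_[set z | enorm (a z - b z) < t] z *
   `|(g \o a) z - (g \o b) z| `^ p)).
  apply: measurable_funM; last exact: measurable_diff_powR.
  apply: measurable_funM; last exact: measurable_indic.
  by apply: measurable_funM; exact: measurable_indic.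
apply/funext => z; rewrite /strip_fun !indicE; congr (_ * _ * _).
rewrite -natrM mulnb; congr (nat_of_bool _)%:R.
by apply/idP/andP; rewrite !inE !eballE /= => -[].
Qed.

Lemma measurable_strip_fun w t : measurable_fun setT w ->
  measurable_fun setT (strip_fun w t).
Proof.
move=> mw.
have m1 i : measurable_fun setT (fun z : E * E => (z.1 : 'rV[R]_n) ord0 i).
  exact: measurableT_comp (measurable_coord i) measurable_fst.
have m2 i : measurable_fun setT (fun z : E * E => (z.2 : 'rV[R]_n) ord0 i).
  exact: measurableT_comp (measurable_coord i) measurable_snd.
have := measurable_strip_fun_comp t m1 m2 (measurableT_comp mw measurable_fst)
  (measurableT_comp mw measurable_snd).
by congr measurable_fun; apply/funext => -[].
Qed.

Lemma ae_prod_eq (f g : E -> R) : {ae leb, forall x, f x = g x} ->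
  {ae lebleb, forall z : E * E, f z.1 = g z.1 /\ f z.2 = g z.2}.
Proof.
move=> [N [mN N0 fgN]].
have h1 : {ae lebleb, forall z : E * E, f z.1 = g z.1}.
  exists (N `*` setT); split; first exact: measurableX mN measurableT.
    rewrite (product_measure1E leb leb mN measurableT).
    by change (leb N * leb setT = 0)%E; rewrite N0 mul0e.
  by move=> z /= h; split=> //; apply: fgN.
have h2 : {ae lebleb, forall z : E * E, f z.2 = g z.2}.
  exists (setT `*` N); split; first exact: measurableX measurableT mN.
    rewrite (product_measure1E leb leb measurableT mN).
    by change (leb setT * leb N = 0)%E; rewrite N0 mule0.
  by move=> z /= h; split=> //; apply: fgN.
by apply: filterS2 h1 h2 => z; split.
Qed.

(** Allows [w] to be replaced by a Borel representative before the midpoint is inserted. *)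
Lemma strip_energy_ae w g t : measurable_fun setT w -> measurable_fun setT g ->
  {ae leb, forall x, w x = g x} -> strip_energy w t = strip_energy g t.
Proof.
move=> mw mg /ae_prod_eq wg; apply: ge0_ae_eq_integral.
- exact: measurableT.
- by apply/measurable_EFinP; exact: (measurable_strip_fun _ mw).
- by apply/measurable_EFinP; exact: (measurable_strip_fun _ mg).
- by move=> z _; rewrite lee_fin strip_fun_ge0.
- by move=> z _; rewrite lee_fin strip_fun_ge0.
- by apply: filterS wg => z [w1 w2] _; rewrite /strip_fun w1 w2.
Qed.

Definition midpoint (z : E * E) : E := 2^-1 *: z.2 + 2^-1 *: z.1.

Lemma midpointB1 z : z.1 - midpoint z = 2^-1 *: (z.1 - z.2).
Proof. by apply/rowP => i; rewrite !mxE; field. Qed.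

Lemma midpointB2 z : midpoint z - z.2 = 2^-1 *: (z.1 - z.2).
Proof. by apply/rowP => i; rewrite !mxE; field. Qed.

Lemma midpoint_eball z : B z.1 -> B z.2 -> B (midpoint z).
Proof.
rewrite !eballE/= => z1 z2.
have -> : midpoint z - x0 = 2^-1 *: (z.1 - x0) + 2^-1 *: (z.2 - x0).
  by apply/rowP => i; rewrite !mxE; field.
apply: le_lt_trans (enorm_triangle _ _) _; rewrite !enormZ ger0_norm ?invr_ge0//; lra.
Qed.

(** The ball is convex, so the midpoint stays inside; each half of the segment is shorter than t,
    and the constant is that of the convexity bound for the p-th power of a sum. *)
Lemma strip_fun_midpoint g t z :
  strip_fun g (2 * t) z <= 2 `^ p / 2 *
    (strip_fun g t (z.1, midpoint z) + strip_fun g t (midpoint z, z.2)).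
Proof.
rewrite {1}/strip_fun !indicE.
have c0 : 0 <= 2 `^ p / 2 :> R by rewrite divr_ge0 ?powR_ge0.
have r0 := addr_ge0 (strip_fun_ge0 g t (z.1, midpoint z)) (strip_fun_ge0 g t (midpoint z, z.2)).
case: (boolP (z \in B `*` B)) => [|_]; last by rewrite !mul0r mulr_ge0.
rewrite inE => -[z1 z2].
case: (boolP (z \in strip _)) => [|_]; last by rewrite mulr0 mul0r mulr_ge0.
rewrite inE /strip/= => zt; rewrite !mul1r.
have half : enorm (2^-1 *: (z.1 - z.2)) < t.
  by rewrite enormZ ger0_norm ?invr_ge0//; lra.
have mB := midpoint_eball z1 z2.
rewrite /strip_fun !indicE !mem_set ?mul1r//=; last 2 first.
- by rewrite /strip/= midpointB2.
- by rewrite /strip/= midpointB1.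
apply: le_trans (powRD_le p1 (normr_ge0 _) (normr_ge0 _)).
apply: ler_powR2r; rewrite ?(ltW p0)//.
by rewrite -[in leLHS](subrKA (g (midpoint z))) ler_normD.
Qed.

(* Insert the midpoint of the two points, which lies at half their distance
   from each of them. *)
Lemma strip_energy_double w t : measurable_fun setT w ->
  (strip_energy w (2 * t) <= (2 `^ p * 2 ^+ n)%:E * strip_energy w t)%E.
Proof.
move=> mw; have [g bg wg] := borel_representative mw.
have mg : measurable_fun setT g.
  by apply: measurable_fun_rays => c; exact: borel_measurable.
rewrite !(strip_energy_ae _ mw mg wg) => {w mw wg}.
have mm : forall i, measurable_fun setT (fun z => (midpoint z : 'rV[R]_n) ord0 i).
  move=> i; under eq_fun do rewrite !mxE.
  by apply: measurable_funD; apply: measurable_funM => //;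
    apply: (measurableT_comp (measurable_coord i));
    [exact: measurable_snd|exact: measurable_fst].
have mgm : measurable_fun setT (g \o midpoint).
  apply: measurable_fun_rays => c.
  exact: (borel_preimage mm (bg c)).
have m1 i : measurable_fun setT (fun z : E * E => (z.1 : 'rV[R]_n) ord0 i).
  exact: measurableT_comp (measurable_coord i) measurable_fst.
have m2 i : measurable_fun setT (fun z : E * E => (z.2 : 'rV[R]_n) ord0 i).
  exact: measurableT_comp (measurable_coord i) measurable_snd.
pose F1 z := strip_fun g t (z.1, midpoint z).
pose F2 z := strip_fun g t (midpoint z, z.2).
have mF1 : measurable_fun setT F1.
  exact: measurable_strip_fun_comp m1 mm (measurableT_comp mg measurable_fst) mgm.
have mF2 : measurable_fun setT F2.
  exact: measurable_strip_fun_comp mm m2 mgm (measurableT_comp mg measurable_snd).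
have F10 z : (0 <= (F1 z)%:E)%E by rewrite lee_fin strip_fun_ge0.
have F20 z : (0 <= (F2 z)%:E)%E by rewrite lee_fin strip_fun_ge0.
have mS : measurable_fun setT (EFin \o strip_fun g t).
  by apply/measurable_EFinP; exact: measurable_strip_fun.
have S0 z : (0 <= (EFin \o strip_fun g t) z)%E by rewrite lee_fin strip_fun_ge0.
have half0 : 0 < 2^-1 :> R by rewrite invr_gt0.
have c2 : 0 <= 2 ^+ n :> R by rewrite exprn_ge0.
have h2n : (2^-1 : R) ^- n = 2 ^+ n by rewrite -exprVn invrK.
(* For fixed [x] the midpoint is affine in [y] with ratio 1/2, so the substitution multiplies the
   inner integral by 2^n. The second half of the segment is treated in the same way with [y]
   fixed. *)
have eF1 : (\int[lebleb]_z (F1 z)%:E = (2 ^+ n)%:E * strip_energy g t)%E.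
  rewrite (fubini_tonelli1 (EFin \o F1) _ F10); last exact/measurable_EFinP.
  rewrite /strip_energy (fubini_tonelli1 _ mS S0).
  rewrite -(ge0_integralZl_EFin _ measurableT _ _ c2); first last.
    exact: measurable_fun_fubini_tonelli_F.
    by move=> x _; apply: integral_ge0 => y _; exact: S0.
  apply: eq_integral => x _; rewrite /fubini_F -h2n.
  exact: (@integral_affine _ _ 2^-1 (2^-1 *: x) (fun y => (strip_fun g t (x, y))%:E)
    half0 (measurableT_comp mS (pair1_measurable x)) (fun y => S0 (x, y))).
have eF2 : (\int[lebleb]_z (F2 z)%:E = (2 ^+ n)%:E * strip_energy g t)%E.
  rewrite (fubini_tonelli2 (EFin \o F2) _ F20); last exact/measurable_EFinP.
  rewrite /strip_energy (fubini_tonelli2 _ mS S0).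
  rewrite -(ge0_integralZl_EFin _ measurableT _ _ c2); first last.
    exact: measurable_fun_fubini_tonelli_G.
    by move=> x _; apply: integral_ge0 => y _; exact: S0.
  apply: eq_integral => y _; rewrite /fubini_G -h2n.
  rewrite -(@integral_affine _ _ 2^-1 (2^-1 *: y) (fun x => (strip_fun g t (x, y))%:E)
    half0 (measurableT_comp mS (pair2_measurable y)) (fun x => S0 (x, y))).
  by apply: eq_integral => x _; rewrite /F2 /midpoint /affine /= addrC.
have c0 : 0 <= 2 `^ p / 2 :> R by rewrite divr_ge0 ?powR_ge0.
apply: (@le_trans _ _ (\int[lebleb]_z ((2 `^ p / 2)%:E * ((F1 z)%:E + (F2 z)%:E)))%E).
  apply: le_integral_ge0 => z _; first by rewrite lee_fin strip_fun_ge0.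
  by rewrite -EFinD -EFinM lee_fin strip_fun_midpoint.
rewrite (ge0_integralZl_EFin _ measurableT _ _ c0); first last.
  by apply/measurable_EFinP; exact: measurable_funD.
  by move=> z _; exact: adde_ge0.
rewrite ge0_integralD//; first last.
  exact/measurable_EFinP.
  exact/measurable_EFinP.
have S0' : (0 <= strip_energy g t)%E by apply: integral_ge0 => z _; exact: S0.
rewrite eF1 eF2 -ge0_muleDl ?lee_fin// muleA -EFinD -EFinM le_eqVlt.
by apply/orP; left; apply/eqP; congr (_%:E * _)%E; field.
Qed.

Lemma strip_energy_ge0 w t : (0 <= strip_energy w t)%E.
Proof. by apply: integral_ge0 => z _; rewrite lee_fin strip_fun_ge0. Qed.

Lemma strip_energy_iter w t i : measurable_fun setT w ->
  (strip_energy w t <= ((2 `^ p * 2 ^+ n) ^+ i)%:E * strip_energy w (2^-1 ^+ i * t))%E.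
Proof.
move=> mw; elim: i => [|i ih]; first by rewrite !expr0 mul1e mul1r.
apply: le_trans ih _; rewrite exprSr EFinM -muleA lee_wpmul2l//.
have -> : 2^-1 ^+ i * t = 2 * (2^-1 ^+ i.+1 * t) by rewrite exprS; field.
exact: strip_energy_double.
Qed.

Lemma dyadic_sum_le (q X : R) I : 2 <= q -> 0 <= X ->
  \sum_(i < I) (q ^+ i < X)%R%:R * q ^+ i <= 2 * X.
Proof.
move=> q2 X0; have q0 : 0 < q by apply: lt_le_trans q2.
(* The second bound carries the induction: when q^I < X, the earlier terms add up to at most q^I, so
   the new sum is at most 2 q^I. *)
suff : \sum_(i < I) (q ^+ i < X)%R%:R * q ^+ i <= 2 * X /\
    \sum_(i < I) (q ^+ i < X)%R%:R * q ^+ i <= q ^+ I by case.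
elim: I => [|I [ih1 ih2]].
  by rewrite big_ord0 expr0 mulr_ge0.
have qI : 0 < q ^+ I by rewrite exprn_gt0.
have qS : 2 * q ^+ I <= q ^+ I.+1 by rewrite exprS ler_wpM2r// ltW.
rewrite big_ord_recr/=; case: ltP => h; rewrite ?mul1r ?mul0r; split; lra.
Qed.

(* The factor [1 - s] comes from summing about [1 / (1 - s)] dyadic scales below [t],
   on which the strip energies are comparable by doubling. *)
Lemma strip_energy_le (s : R) w t : (0 < n)%N -> 0 < s < 1 -> 0 < t ->
  measurable_fun setT w ->
  (strip_energy w t <= (2 `^ p * 2 * t `^ (n%:R + s * p) * (1 - s))%:E *
    \int[lebleb]_(z in B `*` B) (difference_quotient s p w z)%:E)%E.
Proof.
move=> n0 /andP[s0 s1] t0 mw; set a := n%:R + s * p.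
have a1 : 1 <= a.
  by rewrite /a (le_trans (_ : 1 <= n%:R))// ?ler1n// lerDl mulr_ge0// ltW.
have s1' : 0 < 1 - s by rewrite subr_gt0.
set D := integral _ _ _.
pose q : R := 2 `^ a.
have q2 : 2 <= q.
  rewrite /q -[leLHS](powRr1 (ler0n R 2)); apply: ler_powR => //; exact: ler1n.
have q0 : 0 < q by apply: lt_le_trans q2.
have ex : exists k : nat, (1 - s)^-1 <= k%:R.
  by exists (Num.bound (1 - s)^-1); rewrite ltW// archi_boundP// invr_ge0 ltW.
(* The least number of scales with I(1-s) >= 1: enough for I to supply the factor 1/(1-s), few
   enough for iterated doubling to lose only 2^p. *)
have [I hI1 hI2] : exists2 I : nat, (1 - s)^-1 <= I%:R &
    forall i, (i < I)%N -> i%:R < (1 - s)^-1.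
  exists (ex_minn ex); case: ex_minnP => // I hI mI i iI.
  by rewrite ltNge; apply/negP => /mI; rewrite leqNgt iI.
have I0 : 0 < I%:R :> R by apply: lt_le_trans hI1; rewrite invr_gt0.
have ta : 0 < t `^ a by rewrite powR_gt0.
pose c i : R := q ^+ i / t `^ a.
have c0 i : 0 <= c i by rewrite divr_ge0 ?exprn_ge0// ltW.
(* A pair at distance d contributes only for 2^(-i) t > d, that is q^i < (t/d)^a. The powers q^i
   below (t/d)^a sum to at most twice that number, which after division by t^a is 2/d^a. *)
have pw z : \sum_(i < I) c i * strip_fun w (2^-1 ^+ i * t) z <=
    2 * (\1_(B `*` B) z * difference_quotient s p w z).
  rewrite /strip_fun /difference_quotient.
  set d := enorm (z.1 - z.2); set e := `|w z.1 - w z.2| `^ p.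
  set b := \1_(B `*` B) z.
  have ind r : \1_(strip r) z = (d < r)%R%:R :> R.
    by rewrite indicE; congr (nat_of_bool _)%:R; apply/idP/idP; rewrite inE.
  have [d0|d0] := eqVneq d 0.
    have -> : e = 0.
      have /subr0_eq z12 := enorm_eq0 d0.
      by rewrite /e z12 subrr normr0 powR0// gt_eqF.
    by rewrite mul0r !mulr0 big1// => i _; rewrite !mulr0.
  have {}d0 : 0 < d by rewrite lt0r d0 enorm_ge0.
  have da : 0 < d `^ a by rewrite powR_gt0.
  have be0 : 0 <= b * e / t `^ a.
    by rewrite divr_ge0 ?(ltW ta)// mulr_ge0 ?powR_ge0// /b indicE ler0n.
  have X0 : 0 <= (t / d) `^ a by exact: powR_ge0.
  have eX : (t / d) `^ a / t `^ a = (d `^ a)^-1.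
    have h : (t / d) `^ a * d `^ a = t `^ a.
      by rewrite -powRM ?divfK ?gt_eqF// ?divr_ge0// ltW.
    by rewrite -h invfM mulrA mulfV ?mul1r// gt_eqF// powR_gt0// divr_gt0.
  apply: (@le_trans _ _ (\sum_(i < I) b * e / t `^ a *
      ((q ^+ i < (t / d) `^ a)%R%:R * q ^+ i))).
    apply: ler_sum => i _; rewrite ind.
    have -> : c i * (b * (d < 2^-1 ^+ i * t)%R%:R * e) =
        b * e / t `^ a * ((d < 2^-1 ^+ i * t)%R%:R * q ^+ i) by rewrite /c; ring.
    apply: ler_wpM2l => //; apply: ler_wpM2r; first by rewrite exprn_ge0// ltW.
    case: ltP => // h; suff -> : q ^+ i < (t / d) `^ a by [].
    rewrite /q -powR_expn//; apply: gt0_ltr_powR; rewrite ?nnegrE ?exprn_ge0//.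
    - by apply: lt_le_trans a1.
    - by rewrite divr_ge0// ltW.
    - by rewrite ltr_pdivlMr// -ltr_pdivlMl ?exprn_gt0// -exprVn.
  rewrite -mulr_sumr; apply: le_trans (ler_wpM2l be0 (dyadic_sum_le I q2 X0)) _.
  by rewrite -eX le_eqVlt; apply/orP; left; apply/eqP; ring.
have up : (\sum_(i < I) (c i)%:E * strip_energy w (2^-1 ^+ i * t) <= 2%:E * D)%E.
  have mS i : measurable_fun setT (fun z => (strip_fun w (2^-1 ^+ i * t) z)%:E).
    by apply/measurable_EFinP; exact: measurable_strip_fun.
  have S0 i z : (0 <= (strip_fun w (2^-1 ^+ i * t) z)%:E)%E.
    by rewrite lee_fin strip_fun_ge0.
  rewrite /D integral_indicR -(ge0_integralZl_EFin _ measurableT); first last.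
  - exact: ler0n.
  - apply/measurable_EFinP; apply: measurable_funM.
      exact: measurable_indic measurable_sqr_eball.
    exact: measurable_difference_quotient.
  - by move=> z _; rewrite lee_fin mulr_ge0 ?divr_ge0 ?powR_ge0.
  under eq_bigr => i _.
    rewrite -(ge0_integralZl_EFin _ measurableT (fun z _ => S0 i z) (mS i) (c0 i)).
    over.
  rewrite -ge0_integral_sum; first last.
  - by move=> i z _; apply: mule_ge0; [rewrite lee_fin|exact: S0].
  - move=> i; apply/measurable_EFinP; apply: measurable_funM.
      exact: measurable_cst.
    exact: measurable_strip_fun.
  - exact: measurableT.
  apply: le_integral_ge0 => z _.
    by rewrite sume_ge0// => i _; apply: mule_ge0; [rewrite lee_fin|exact: S0].
  by rewrite -EFinM (eq_bigr (fun i : 'I_I => (c i * strip_fun w (2^-1 ^+ i * t) z)%:E)) ?sumEFin ?lee_fin.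
(* Doubling i times costs 2^((n+p)i), while [c i] grows like 2^((n+sp)i). The quotient 2^((1-s)pi)
   is at most 2^p because i(1-s) < 1. *)
have lo i : (i < I)%N -> (((2 `^ p)^-1 / t `^ a)%:E * strip_energy w t <=
    (c i)%:E * strip_energy w (2^-1 ^+ i * t))%E.
  move=> iI; set S := strip_energy w (2^-1 ^+ i * t).
  have k0 : 0 <= (2 `^ p)^-1 / t `^ a by rewrite divr_ge0 ?invr_ge0 ?powR_ge0.
  apply: (@le_trans _ _ (((2 `^ p)^-1 / t `^ a)%:E * (((2 `^ p * 2 ^+ n) ^+ i)%:E * S))%E).
    apply: lee_wpmul2l; first by rewrite lee_fin.
    exact: strip_energy_iter.
  rewrite muleA -EFinM; apply: lee_wpmul2r; first exact: strip_energy_ge0.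
  rewrite lee_fin /c.
  rewrite mulrAC ler_wpM2r ?invr_ge0 ?powR_ge0//.
  have p2 : 0 < 2 `^ p :> R by rewrite powR_gt0.
  rewrite mulrC ler_pdivrMr// -(powR_mulrn n (ler0n R 2)) -powRD ?pnatr_eq0 ?implybT//.
  rewrite /q -(powR_mulrn i (powR_ge0 _ _)) -(powR_mulrn i (powR_ge0 2 a)) -!powRrM.
  rewrite -powRD ?pnatr_eq0 ?implybT//; apply: ler_powR; first exact: ler1n.
  have := ltW (hI2 _ iI); rewrite -(ler_pM2l s1') mulfV ?gt_eqF// => h.
  have := ler_wpM2l (ltW p0) h; rewrite /a; lra.
have c20 : 0 < (2 `^ p)^-1 / t `^ a by rewrite divr_gt0 ?invr_gt0 ?powR_gt0.
have : ((I%:R * ((2 `^ p)^-1 / t `^ a))%:E * strip_energy w t <= 2%:E * D)%E.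
  apply: le_trans up; rewrite EFinM -muleA.
  rewrite (_ : I%:R%:E * _ = \sum_(i < I) (((2 `^ p)^-1 / t `^ a)%:E * strip_energy w t))%E.
    by apply: lee_sum => i _; exact: lo.
  by rewrite sumr_const card_ord mule_natl.
rewrite -lee_pdivlMl; last exact: mulr_gt0.
move=> /le_trans; apply.
rewrite muleA -EFinM; apply: lee_wpmul2r.
  by apply: integral_ge0 => z _; rewrite lee_fin divr_ge0 ?powR_ge0.
rewrite lee_fin !invfM !invrK.
have hI : I%:R^-1 <= 1 - s by rewrite -[leRHS]invrK lef_pV2 ?posrE ?invr_gt0.
have : 0 <= 2 `^ p * 2 * t `^ a by rewrite !mulr_ge0 ?powR_ge0.
by move=> /(ler_wpM2l) /(_ _ _ hI); lra.
Qed.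
End near_diagonal.

(** * Integrals of higher powers through level sets *)

Section level_sets.
Context {R : realType} {n : nat}.
Local Notation E := (Rn R n).
Local Notation leb := (@lebesgue R n).
Local Notation lebleb := (leb \x leb)%E.
Local Notation v := (@unit_ball_volume R n).
Variables (p q s P M : R) (x0 : E) (m T tau : R) (w : E -> R).
Hypotheses (n0 : (0 < n)%N) (p1 : 1 < p) (pq : p < q) (qpP : q - p <= P).
Hypotheses (s01 : 0 < s < 1) (v0 : 0 < v) (M0 : 0 < M).
Hypotheses (T0 : 0 < T) (mTtau : m + T <= tau).
Hypotheses (mw : measurable_fun setT w) (w0 : forall x, 0 <= w x).
Hypothesis wM : (\int[leb]_(x in eball x0 tau%:E) (w x `^ P)%:E <= (M `^ P)%:E)%E.

Let p0 : 0 < p. Proof. exact: lt_trans ltr01 p1. Qed.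
Let qp0 : 0 < q - p. Proof. by rewrite subr_gt0. Qed.
Let P0 : 0 < P. Proof. exact: lt_le_trans qp0 qpP. Qed.

(* By Chebyshev, [w] exceeds [level t / 2] on at most half of any ball of radius [t]. *)
Definition level (t : R) : R := 2 * M * (v * t ^+ n / 2) `^ (- P^-1).

Let vt0 t : 0 < t -> 0 < v * t ^+ n / 2.
Proof. by move=> t0; rewrite divr_gt0// mulr_gt0// exprn_gt0. Qed.

Lemma level_gt0 t : 0 < t -> 0 < level t.
Proof. by move=> t0; rewrite mulr_gt0 ?powR_gt0 ?vt0// mulr_gt0. Qed.

(** The calibration behind [level]: the [P]-mass M^P can sustain the height level(t)/2 on at most
    half of a ball of radius [t]. *)
Lemma level_powR t : 0 < t -> (level t / 2) `^ P * (v * t ^+ n / 2) = M `^ P.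
Proof.
move=> t0; have vt := vt0 t0.
have -> : level t / 2 = M * (v * t ^+ n / 2) `^ (- P^-1).
  by rewrite /level; field.
rewrite powRM ?powR_ge0 ?(ltW M0)// -powRrM mulNr mulVf ?gt_eqF//.
by rewrite powR_inv1 ?(ltW vt)// -mulrA mulVf ?mulr1 ?gt_eqF.
Qed.

Lemma level_le t t' : 0 < t -> t <= t' -> level t' <= level t.
Proof.
move=> t0 tt'; have t'0 := lt_le_trans t0 tt'.
rewrite ler_wpM2l ?mulr_ge0 ?(ltW M0)// !powRN lef_pV2 ?posrE ?powR_gt0 ?vt0//.
apply: ler_powR2r; rewrite ?invr_ge0 ?(ltW P0) ?(ltW (vt0 t0))//.
rewrite ler_wpM2r// ler_wpM2l ?(ltW v0)//.
by apply: lerXn2r; rewrite ?nnegrE ?(ltW t0) ?(ltW t'0).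
Qed.

(** Associates with a height the scale at which it is critical; the dyadic decomposition is made in
    this scale. *)
Lemma level_surj y : 0 < y -> exists2 t, 0 < t & level t = y.
Proof.
move=> y0; pose c := 2 / v * (2 * M / y) `^ P.
have My : 0 < 2 * M / y by rewrite divr_gt0// mulr_gt0.
have c0 : 0 < c by rewrite mulr_gt0 ?powR_gt0// divr_gt0.
exists (c `^ n%:R^-1); first exact: powR_gt0.
rewrite /level -powR_mulrn ?powR_ge0// -powRrM mulVf ?pnatr_eq0 -?lt0n// powRr1 ?(ltW c0)//.
have -> : v * c / 2 = (2 * M / y) `^ P by rewrite /c; field; rewrite gt_eqF.
rewrite -powRrM mulrN mulfV ?gt_eqF// powR_inv1 ?(ltW My)//; field.
by rewrite !gt_eqF.
Qed.

Let mwP a : measurable_fun setT (fun x => w x `^ a).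
Proof. exact: measurableT_comp (measurable_powR _) mw. Qed.

Let measurable_above c : measurable [set y | c < w y].
Proof.
rewrite -[[set _ | _]]setTI (_ : [set y | c < w y] = w @^-1` `]c, +oo[).
  exact: (mw measurableT).
by apply/seteqP; split=> z; rewrite /= in_itv/= andbT.
Qed.

Lemma lebesgue_above_level x t : 0 < t -> eball x t%:E `<=` eball x0 tau%:E ->
  (leb (eball x t%:E `&` [set y | (level t / 2 < w y)%R]) <= (v * t ^+ n / 2)%:E)%E.
Proof.
move=> t0 sub; set A := _ `&` _.
have mA : measurable A by apply: measurableI; [exact: measurable_eball|exact: measurable_above].
have l0 : 0 < level t / 2 by rewrite divr_gt0// level_gt0.
have lP : 0 < (level t / 2) `^ P by rewrite powR_gt0.
rewrite -(@lee_pmul2l _ ((level t / 2) `^ P)%:E)//.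
rewrite -[leRHS]EFinM level_powR//; apply: le_trans wM.
rewrite -(integral_cst leb mA).
apply: (@le_trans _ _ (\int[leb]_(x in A) (w x `^ P)%:E)%E).
  apply: le_integral_ge0 => y [_ /= yl]; rewrite lee_fin ?powR_ge0//.
  by apply: ler_powR2r; rewrite ?(ltW P0) ?(ltW l0)// ltW.
have mwPE : measurable_fun (eball x0 tau%:E) (fun x => (w x `^ P)%:E).
  by apply: measurable_funTS; apply/measurable_EFinP.
apply: (ge0_subset_integral leb mA (measurable_eball _ _) mwPE); last by move=> y [/sub].
by move=> y _; rewrite lee_fin powR_ge0.
Qed.

(** On at least half of the ball of radius [t] around [x] the values are at most level(t)/2 <=
    w(x)/2, so |w(x)-w(y)| >= w(x)/2 there. The ball stays in that of radius [tau] because m + T <=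
    tau. *)
Lemma powR_le_strip x t : 0 < t -> t <= T -> eball x0 m%:E x -> level t <= w x ->
  ((w x `^ p * (v * t ^+ n / (2 * 2 `^ p)))%:E <=
   \int[leb]_y (strip_fun p x0 tau w t (x, y))%:E)%E.
Proof.
move=> t0 tT xm lx.
have sub : eball x t%:E `<=` eball x0 tau%:E.
  move=> y; rewrite !eballE/= in xm * => yt.
  by apply: le_lt_trans (enorm_triangleB x y x0) _; have := mTtau; lra.
pose A := eball x t%:E `&` [set y | (level t / 2 < w y)%R].
have mA : measurable A by apply: measurableI; [exact: measurable_eball|exact: measurable_above].
pose G := eball x t%:E `\` A.
have mG : measurable G by apply: measurableD => //; exact: measurable_eball.
have lA : (leb A <= (v * t ^+ n / 2)%:E)%E by exact: lebesgue_above_level.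
have lG : ((v * t ^+ n / 2)%:E <= leb G)%E.
  have -> : leb G = (leb (eball x t%:E) - leb (eball x t%:E `&` A))%E.
    apply: (measureD (measurable_eball _ _) mA).
    by change (leb (eball x t%:E) < +oo)%E; rewrite lebesgue_eball// ltry.
  rewrite setIA setIid lebesgue_eball//.
  have Afin : leb A \is a fin_num.
    by rewrite ge0_fin_numE ?outer_measure_ge0// (le_lt_trans lA)// ltry.
  rewrite -(fineK Afin) -EFinB lee_fin lerBrDr.
  have : fine (leb A) <= v * t ^+ n / 2 by rewrite -lee_fin fineK.
  lra.
have wx0 : 0 <= w x / 2 by rewrite divr_ge0.
apply: (@le_trans _ _ (((w x / 2) `^ p)%:E * leb G)%E).
  apply: (@le_trans _ _ (((w x / 2) `^ p)%:E * (v * t ^+ n / 2)%:E)%E).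
    rewrite -EFinM lee_fin powRM ?invr_ge0//.
    have e : 2 `^ p * 2^-1 `^ p = 1 :> R by rewrite -powRM ?invr_ge0// mulfV// powR1.
    have h2 : 0 < 2 `^ p :> R by rewrite powR_gt0.
    have -> : (2^-1 : R) `^ p = (2 `^ p)^-1.
      have hn : 2 `^ p != 0 :> R by rewrite gt_eqF.
      by apply: (mulfI hn); rewrite e mulfV.
    by rewrite le_eqVlt; apply/orP; left; apply/eqP; field; rewrite gt_eqF.
  by apply: lee_wpmul2l => //; rewrite lee_fin powR_ge0.
rewrite -(integral_cst leb mG).
apply: (@le_trans _ _ (\int[leb]_(y in G) (strip_fun p x0 tau w t (x, y))%:E)%E).
  apply: le_integral_ge0 => y; first by rewrite lee_fin powR_ge0.
  move=> [yt nA]; rewrite lee_fin /strip_fun !indicE.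
  have wy : w y <= level t / 2 by rewrite leNgt; apply/negP => h; apply: nA; split.
  rewrite mem_set; last first.
    split=> /=; last exact: sub.
    by apply: sub; rewrite eballE/= subrr enorm0.
  rewrite mem_set; last by rewrite /strip/= enormBC; move: yt; rewrite eballE.
  rewrite !mul1r; apply: ler_powR2r => //; first exact: ltW.
  by apply: le_trans (ler_norm _) => /=; lra.
have mS : measurable_fun setT (fun y => (strip_fun p x0 tau w t (x, y))%:E).
  apply/measurable_EFinP.
  exact: (measurableT_comp (measurable_strip_fun _ _ _ _ mw) (pair1_measurable x)).
apply: ge0_subset_integral => //.
by move=> y _; rewrite lee_fin strip_fun_ge0.
Qed.

(** The first two factors bound a power of [level]. In the last one, 2^n is the price of passing
    from one dyadic scale to the next, and (2^p 2)^2 / v combines [powR_le_strip] with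
    [strip_energy_le]. Neither [P] nor [s] enters. *)
Definition level_constant : R :=
  2 `^ (q - p) * Num.max 1 (2 / v) * (1 + 2 ^+ n * (2 `^ p * 2) ^+ 2 / v).

Lemma level_constant_gt0 : 0 < level_constant.
Proof.
rewrite !mulr_gt0 ?powR_gt0//; first by rewrite lt_max ltr01.
by rewrite ltr_wpDr// divr_ge0 ?unit_ball_volume_ge0// mulr_ge0 ?exprn_ge0.
Qed.

Let theta : R := n%:R * (q - p) / P.

Lemma level_powRB t : 0 < t ->
  level t `^ (q - p) <= 2 `^ (q - p) * Num.max 1 (2 / v) * M `^ (q - p) * t `^ (- theta).
Proof.
move=> t0; have vv : 0 < v / 2 by rewrite divr_gt0.
have -> : level t `^ (q - p) =
    2 `^ (q - p) * M `^ (q - p) * ((v / 2) `^ (P^-1 * (q - p)))^-1 * t `^ (- theta).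
  rewrite /level (_ : v * t ^+ n / 2 = v / 2 * t ^+ n); last by ring.
  rewrite (powRM _ (ltW vv)) ?exprn_ge0 ?(ltW t0)//.
  rewrite powRM ?mulr_ge0 ?powR_ge0 ?(ltW M0)// (powRM _ (ler0n _ 2) (ltW M0)).
  rewrite powRM ?powR_ge0// -!powRrM -!mulrA; congr (_ * (_ * (_ * _))).
    by rewrite mulNr powRN.
  rewrite -powR_mulrn ?(ltW t0)// -powRrM; congr (_ `^ _); rewrite /theta; ring.
rewrite ler_wpM2r ?powR_ge0// [leRHS]mulrAC ler_wpM2l ?mulr_ge0 ?powR_ge0//.
(* The exponent (q-p)/P lies in [0,1], so the power of v/2 can be replaced by [Num.max 1 (2 / v)],
   which is free of [P]. *)
have h1 : 0 <= P^-1 * (q - p) by rewrite mulr_ge0 ?invr_ge0 ?ltW.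
have h2 : P^-1 * (q - p) <= 1 by rewrite mulrC ler_pdivrMr// mul1r.
rewrite le_max; have [v1|v1] := leP 1 (v / 2).
  apply/orP; left; rewrite invf_le1 ?powR_gt0//.
  by have := ler_powR v1 h1; rewrite powRr0.
apply/orP; right; rewrite -[leRHS]invf_div lef_pV2 ?posrE ?powR_gt0//.
by apply: ger1_powR => //; rewrite vv ltW.
Qed.

(** Below level(T) simply w^q <= level(T)^(q-p) w^p. A higher value is critical at some scale u < T,
    and w^p is then controlled by the energy of pairs closer than the next dyadic scale. The sum
    over scales converges because theta < s p. *)
Lemma level_set_bound : theta < s * p ->
  (\int[leb]_(x in eball x0 m%:E) (w x `^ q)%:E <=
   (level_constant * M `^ (q - p) * T `^ (- theta))%:E *
     \int[leb]_(x in eball x0 m%:E) (w x `^ p)%:E +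
   (level_constant * M `^ (q - p) * (T `^ (s * p - theta) /
       (1 - 2^-1 `^ (s * p - theta))) * (1 - s))%:E *
     \int[lebleb]_(z in eball x0 tau%:E `*` eball x0 tau%:E)
        (difference_quotient s p w z)%:E)%E.
Proof.
move=> thsp; set D := integral _ (_ `*` _) _.
pose t j : R := 2^-1 ^+ j * T.
have t0 j : 0 < t j by rewrite mulr_gt0// exprn_gt0// invr_gt0.
have tT j : t j <= T.
  by rewrite /t ler_piMl ?(ltW T0)// exprn_ile1// ?invr_ge0// invf_le1// ler1n.
pose a j : R := 2 * 2 `^ p / (v * t j ^+ n).
have a0 j : 0 < a j by rewrite divr_gt0 ?mulr_gt0 ?powR_gt0 ?exprn_gt0.
pose g j x : \bar R := (\int[leb]_y (strip_fun p x0 tau w (t j) (x, y))%:E)%E.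
have g0 j x : (0 <= g j x)%E by apply: integral_ge0 => y _; rewrite lee_fin strip_fun_ge0.
have mg j : measurable_fun setT (g j).
  apply: (@measurable_fun_fubini_tonelli_F _ _ _ _ _ leb (EFin \o strip_fun p x0 tau w (t j))).
  - by apply/measurable_EFinP; exact: measurable_strip_fun.
  - by move=> z; rewrite lee_fin strip_fun_ge0.
have ig j : (\int[leb]_x g j x = strip_energy p x0 tau w (t j))%E.
  rewrite /strip_energy (fubini_tonelli1 (EFin \o strip_fun p x0 tau w (t j)))//.
  - by apply/measurable_EFinP; exact: measurable_strip_fun.
  - by move=> z; rewrite lee_fin strip_fun_ge0.
(* If the critical scale lies between t(j+1) and t(j), then w is at most level(t(j+1)), which bounds
   w^(q-p), and at least level(t(j)), which makes [powR_le_strip] available at scale t(j); [a j]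
   inverts its constant. *)
pose k j : R := level (t j.+1) `^ (q - p) * a j.
have k0 j : 0 <= k j by rewrite mulr_ge0 ?powR_ge0// ltW.
have kg0 j x : (0 <= (k j)%:E * g j x)%E by rewrite mule_ge0// lee_fin.
have pw x : eball x0 m%:E x -> ((w x `^ q)%:E <=
   (level T `^ (q - p))%:E * (w x `^ p)%:E + \sum_(j <oo) (k j)%:E * g j x)%E.
  move=> xm.
  have s0 : (0 <= \sum_(j <oo) (k j)%:E * g j x)%E by exact: nneseries_ge0.
  have wq : w x `^ q = w x `^ (q - p) * w x `^ p.
    have qn0 : (q == 0) = false by rewrite gt_eqF// (lt_trans p0).
    by rewrite -powRD subrK// qn0.
  have [wT|Tw] := leP (w x) (level T).
    apply: (@le_trans _ _ ((level T `^ (q - p))%:E * (w x `^ p)%:E)%E); last by rewrite leeDl.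
    rewrite -EFinM lee_fin wq ler_wpM2r ?powR_ge0//.
    by apply: ler_powR2r => //; exact: ltW.
  have [u u0 lu] := level_surj (lt_trans (level_gt0 T0) Tw).
  have uT : u < T.
    by rewrite ltNge; apply/negP => Tu; move: Tw; rewrite -lu ltNge level_le.
  have [j /andP[j1 j2]] := dyadic_small u0 uT.
  have lw : level (t j) <= w x by rewrite -lu level_le// ltW.
  have wl : w x <= level (t j.+1) by rewrite -lu level_le.
  apply: (@le_trans _ _ ((k j)%:E * g j x)%E); last first.
    apply: (@le_trans _ _ (\sum_(j <oo) (k j)%:E * g j x)%E).
      by rewrite (nneseriesD1 (n := j))// leeDl// nneseries_ge0.
    by rewrite leeDr// mule_ge0// lee_fin powR_ge0.
  apply: le_trans (lee_wpmul2l (_ : (0 <= (k j)%:E)%E) (powR_le_strip (t0 j) (tT j) xm lw)); last first.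
    by rewrite lee_fin.
  rewrite -EFinM lee_fin wq /k.
  have -> : level (t j.+1) `^ (q - p) * a j * (w x `^ p * (v * t j ^+ n / (2 * 2 `^ p))) =
     level (t j.+1) `^ (q - p) * w x `^ p.
    rewrite /a; set y := t j ^+ n; field.
    by rewrite /y !gt_eqF// ?exprn_gt0// powR_gt0.
  by rewrite ler_wpM2r ?powR_ge0//; apply: ler_powR2r => //; exact: ltW.
have mwPE b : measurable_fun setT (fun x => (w x `^ b)%:E) by apply/measurable_EFinP.
have mball := measurable_eball x0 m.
have mkg j : measurable_fun setT (fun x => (k j)%:E * g j x)%E.
  exact: measurable_funeM.
apply: (@le_trans _ _ (\int[leb]_(x in eball x0 m%:E)
  ((level T `^ (q - p))%:E * (w x `^ p)%:E + \sum_(j <oo) (k j)%:E * g j x))%E).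
  by apply: le_integral_ge0 => x xm; [rewrite lee_fin powR_ge0|exact: pw].
have sum0 x : eball x0 m%:E x -> (0 <= \sum_(j <oo) (k j)%:E * g j x)%E.
  by move=> _; apply: nneseries_ge0 => j _ _; exact: kg0.
have msum : measurable_fun (eball x0 m%:E) (fun x => \sum_(j <oo) (k j)%:E * g j x)%E.
  apply: measurable_funTS; exact: (@ge0_emeasurable_sum _ _ _ setT
    (fun j x => (k j)%:E * g j x)%E xpredT (fun j x _ _ => kg0 j x) (fun j _ => mkg j)).
have mfst : measurable_fun (eball x0 m%:E)
    (fun x => (level T `^ (q - p))%:E * (w x `^ p)%:E)%E.
  by apply: measurable_funTS; exact: measurable_funeM.
have fst0 x : eball x0 m%:E x -> (0 <= (level T `^ (q - p))%:E * (w x `^ p)%:E)%E.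
  by rewrite -EFinM lee_fin mulr_ge0 ?powR_ge0.
rewrite (ge0_integralD leb mball fst0 mfst sum0 msum).
apply: leeD.
  rewrite (ge0_integralZl_EFin _ mball); first last.
  - exact: powR_ge0.
  - exact: measurable_funTS.
  - by move=> x _; rewrite lee_fin powR_ge0.
  apply: lee_wpmul2r; first by apply: integral_ge0 => x _; rewrite lee_fin powR_ge0.
  rewrite lee_fin; apply: le_trans (level_powRB T0) _.
  rewrite ler_wpM2r ?powR_ge0// ler_wpM2r ?powR_ge0// /level_constant.
  rewrite ler_peMr ?mulr_ge0 ?powR_ge0//; first by rewrite le_max ler01.
  by rewrite lerDl divr_ge0 ?(ltW v0)// mulr_ge0 ?exprn_ge0.
rewrite (integral_nneseries _ mball (fun j => measurable_funTS (mkg j)) (fun j x _ => kg0 j x)).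
have s1 : 0 < 1 - s by rewrite subr_gt0; have /andP[] := s01.
set del := s * p - theta; have del0 : 0 < del by rewrite subr_gt0.
have /andP[th0 th1] := half_powR_lt1 del0.
pose A : R := level_constant * M `^ (q - p) * T `^ del * (1 - s).
have A0 : 0 <= A.
  exact: mulr_ge0 (mulr_ge0 (mulr_ge0 (ltW level_constant_gt0) (powR_ge0 _ _)) (powR_ge0 _ _)) (ltW s1).
have D0 : (0 <= D)%E by apply: integral_ge0 => z _; rewrite lee_fin divr_ge0 ?powR_ge0.
(* Powers of the scale: -theta from the level, -n from [a j], and n + s p from [strip_energy_le].
   What remains is t(j)^(s p - theta), a geometric sequence. *)
have term j : (\int[leb]_(x in eball x0 m%:E) ((k j)%:E * g j x) <=
    (A * (2^-1 `^ del) ^+ j)%:E * D)%E.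
  rewrite (ge0_integralZl_EFin _ mball); first last.
  - exact: k0.
  - exact: measurable_funTS.
  - by move=> x _; exact: g0.
  apply: (@le_trans _ _ ((k j)%:E * strip_energy p x0 tau w (t j))%E).
    apply: lee_wpmul2l; first by rewrite lee_fin.
    rewrite -ig; apply: ge0_subset_integral => //; exact: measurableT.
  apply: (@le_trans _ _ ((k j)%:E * ((2 `^ p * 2 * t j `^ (n%:R + s * p) * (1 - s))%:E * D))%E).
    apply: lee_wpmul2l; first by rewrite lee_fin.
    exact: strip_energy_le.
  rewrite muleA -EFinM; apply: lee_wpmul2r => //; rewrite lee_fin.
  have hth : theta <= n%:R.
    by rewrite /theta ler_pdivrMr// ler_wpM2l.
  have th2 : t j.+1 `^ (- theta) <= 2 ^+ n * t j `^ (- theta).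
    have -> : t j.+1 = 2^-1 * t j by rewrite /t exprS mulrA.
    rewrite powRM ?invr_ge0 ?(ltW (t0 j))// ler_wpM2r ?powR_ge0// powRN.
    have -> : 2 ^+ n = (2^-1 `^ n%:R)^-1 :> R by rewrite powR_mulrn ?invr_ge0// exprVn invrK.
    rewrite lef_pV2 ?posrE ?powR_gt0 ?invr_gt0//.
    by apply: ger_powR => //; rewrite invr_gt0// invf_le1// ltr0n ler1n.
  have tdel : t j `^ (- theta) * t j `^ (s * p) = T `^ del * (2^-1 `^ del) ^+ j.
    rewrite -powRD; last by rewrite (gt_eqF (t0 j)) implybT.
    rewrite addrC -/del /t powRM ?exprn_ge0 ?invr_ge0 ?(ltW T0)// powR_expn ?invr_ge0//.
    by rewrite mulrC.
  have tn : t j `^ (n%:R + s * p) = t j ^+ n * t j `^ (s * p).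
    rewrite powRD; last by rewrite (gt_eqF (t0 j)) implybT.
    by rewrite powR_mulrn// ltW.
  have hl := level_powRB (t0 j.+1).
  have c0 : 0 <= 2 `^ (q - p) * Num.max 1 (2 / v) * M `^ (q - p).
    by rewrite mulr_ge0 ?powR_ge0// mulr_ge0 ?powR_ge0// le_max ler01.
  have {}hl := le_trans hl (ler_wpM2l c0 th2).
  rewrite /k tn; set c1 := 2 `^ (q - p) * Num.max 1 (2 / v) * M `^ (q - p) in hl c0 *.
  have b0 : 0 <= a j * (2 `^ p * 2 * (t j ^+ n * t j `^ (s * p)) * (1 - s)).
    have tn0 : 0 <= t j ^+ n by rewrite exprn_ge0// ltW.
    exact: mulr_ge0 (ltW (a0 j)) (mulr_ge0 (mulr_ge0 (mulr_ge0 (powR_ge0 _ _) (ler0n _ 2))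
      (mulr_ge0 tn0 (powR_ge0 _ _))) (ltW s1)).
  rewrite -[leLHS]mulrA; apply: le_trans (ler_wpM2r b0 hl) _.
  have -> : c1 * (2 ^+ n * t j `^ (- theta)) *
       (a j * (2 `^ p * 2 * (t j ^+ n * t j `^ (s * p)) * (1 - s))) =
     c1 * (2 ^+ n * (2 `^ p * 2) ^+ 2 / v) *
       (t j `^ (- theta) * t j `^ (s * p)) * (1 - s).
    rewrite /a; field; rewrite expf_neq0 ?gt_eqF//.
  have r0 : 0 <= T `^ del * (2^-1 `^ del) ^+ j * (1 - s).
    by rewrite mulr_ge0 ?(ltW s1)// mulr_ge0 ?powR_ge0// exprn_ge0// powR_ge0.
  have c2 : 0 <= 2 ^+ n * (2 `^ p * 2) ^+ 2 / v.
    by rewrite divr_ge0 ?(ltW v0)// mulr_ge0 ?exprn_ge0.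
  rewrite tdel /A /level_constant; move: c0 r0 c2; rewrite /c1.
  set x1 := 2 `^ (q - p); set x2 := Num.max _ _; set x3 := M `^ _.
  set x4 := T `^ del; set x5 := _ ^+ j; set x6 := 2 ^+ n * _ / v.
  move=> c0 r0 c2; have := mulr_ge0 c0 r0; lra.
have lim j : (0 <= j)%N -> true -> (0 <= \int[leb]_(x in eball x0 m%:E) ((k j)%:E * g j x))%E.
  by move=> _ _; apply: integral_ge0 => x _; exact: kg0.
apply: lime_le; first exact: is_cvg_nneseries.
apply: nearW => N.
apply: (@le_trans _ _ (\sum_(0 <= j < N) ((A * (2^-1 `^ del) ^+ j)%:E * D))%E).
  by apply: lee_sum => j _; exact: term.
rewrite -ge0_sume_distrl; last first.
  by move=> j _; rewrite lee_fin mulr_ge0// exprn_ge0// ltW.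
apply: lee_wpmul2r => //; rewrite sumEFin lee_fin.
have := @geometric_le_lim R N A (2^-1 `^ del) A0 th0.
rewrite ger0_norm ?(ltW th0)// => /(_ th1) /le_trans; apply.
by rewrite /A le_eqVlt; apply/orP; left; apply/eqP; ring.
Qed.
End level_sets.

(** * Caccioppoli inequality for subminimizers *)

Section product_integrals.
Context {R : realType} {n : nat}.
Local Notation E := (Rn R n).
Local Notation leb := (@lebesgue R n).
Local Notation lebleb := (leb \x leb)%E.

Lemma measurable_swap : measurable_fun setT (fun z : E * E => (z.2, z.1)).
Proof. by apply/measurable_fun_pairP; split; [exact: measurable_snd|exact: measurable_fst]. Qed.

Lemma integral_swap (f : E * E -> \bar R) : measurable_fun setT f ->
  (forall z, 0 <= f z)%E ->
  (\int[lebleb]_z f (z.2, z.1) = \int[lebleb]_z f z)%E.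
Proof.
move=> mf f0.
rewrite (fubini_tonelli2 (fun z : E * E => f (z.2, z.1)) (measurableT_comp mf measurable_swap) (fun z => f0 _)).
by rewrite (fubini_tonelli1 f mf f0).
Qed.

Lemma integral_prod_mull (a : E -> R) (h : E * E -> R) :
  measurable_fun setT a -> measurable_fun setT h ->
  (forall x, 0 <= a x) -> (forall z, 0 <= h z) ->
  (\int[lebleb]_z (a z.1 * h z)%:E =
   \int[leb]_x ((a x)%:E * \int[leb]_y (h (x, y))%:E))%E.
Proof.
move=> ma mh a0 h0.
have mah : measurable_fun setT (fun z : E * E => (a z.1 * h z)%:E).
  apply/measurable_EFinP; apply: measurable_funM => //.
  exact: measurableT_comp ma measurable_fst.
have ah0 z : (0 <= (a z.1 * h z)%:E)%E by rewrite lee_fin mulr_ge0.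
rewrite (fubini_tonelli1 _ mah ah0); apply: eq_integral => x _; rewrite /fubini_F.
under eq_integral do rewrite EFinM.
have mhx : measurable_fun setT (fun y => (h (x, y))%:E).
  by apply/measurable_EFinP; exact: measurableT_comp mh (pair1_measurable x).
by rewrite (ge0_integralZl_EFin leb measurableT _ mhx (a0 x))// => y _; rewrite lee_fin.
Qed.

End product_integrals.

Section cutoff.
Context {R : realType} {n : nat}.
Local Notation E := (Rn R n).
Variables (x0 : E) (r m : R).
Hypothesis rm : r < m.

Definition cutoff (x : E) : R :=
  Num.max 0 (Num.min 1 ((m - enorm (x - x0)) / (m - r))).

Let mr0 : 0 < m - r. Proof. by rewrite subr_gt0. Qed.

Lemma cutoff_itv x : 0 <= cutoff x <= 1.
Proof. by rewrite /cutoff le_max lexx ge_max ler01 ge_min lexx. Qed.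

Lemma cutoff1 x : eball x0 r%:E x -> cutoff x = 1.
Proof.
rewrite eballE/= => xr; rewrite /cutoff min_l ?max_r//.
by rewrite ler_pdivlMr// mul1r; lra.
Qed.

Lemma cutoff0 x : ~ eball x0 m%:E x -> cutoff x = 0.
Proof.
rewrite eballE/= => /negP; rewrite -leNgt => xm; rewrite /cutoff max_l//.
by rewrite ge_min; apply/orP; right; rewrite pmulr_lle0 ?invr_gt0// subr_le0.
Qed.

Lemma cutoff_lip x y : `|cutoff x - cutoff y| <= enorm (x - y) / (m - r).
Proof.
pose h z : R := (m - enorm (z - x0)) / (m - r).
have hl a b : h a - h b <= enorm (a - b) / (m - r).
  rewrite /h -mulrBl ler_wpM2r ?invr_ge0 ?(ltW mr0)//.
  by have := enorm_triangleB a b x0; rewrite [enorm (b - a)]enormBC; lra.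
have hl1 := hl x y; have := hl y x; rewrite [enorm (y - x)]enormBC => hl2.
have e0 : 0 <= enorm (x - y) / (m - r) by rewrite divr_ge0 ?enorm_ge0// ltW.
rewrite /cutoff -/(h x) -/(h y) ler_norml.
move: (enorm _ / _) hl1 hl2 e0 => e hl1 hl2 e0.
by case: (leP 1 (h x)); case: (leP 1 (h y)) => ? ?;
  case: (leP 0 (h x)); case: (leP 0 (h y)) => ? ?; 
  rewrite ?ler01 ?ltr01 ?(max_r ler01);
  repeat (case: leP => ?); apply/andP; split; lra.
Qed.

Lemma measurable_cutoff : measurable_fun setT cutoff.
Proof.
apply: measurable_maxr; first exact: measurable_cst.
apply: measurable_minr; first exact: measurable_cst.
apply: measurable_funM; last exact: measurable_cst.
by apply: measurable_funB; [exact: measurable_cst|exact: measurable_enormB_cst].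
Qed.
End cutoff.

Section real_kernel.
Context {R : realType} {n : nat}.
Local Notation E := (Rn R n).
Local Notation leb := (@lebesgue R n).
Local Notation lebleb := (leb \x leb)%E.
Variables (s p Lambda r0 : R).
Hypotheses (s01 : 0 < s < 1) (L1 : 1 <= Lambda).
Local Notation a := (n%:R + s * p).

Definition lower_kernel (z : E * E) : R :=
  (1 - s) * \1_(eball 0 r0%:E) (z.1 - z.2) / (Lambda * enorm (z.1 - z.2) `^ a).

Definition upper_kernel (z : E * E) : R :=
  (1 - s) * Lambda / enorm (z.1 - z.2) `^ a.

Let s1 : 0 < 1 - s. Proof. by rewrite subr_gt0; have /andP[] := s01. Qed.
Let L0 : 0 < Lambda. Proof. exact: lt_le_trans L1. Qed.

Lemma lower_kernel_ge0 z : 0 <= lower_kernel z.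
Proof.
rewrite /lower_kernel indicE divr_ge0// mulr_ge0 ?(ltW s1) ?(ltW L0) ?powR_ge0//.
Qed.

Lemma lower_kernelE z : lower_kernel z =
  (1 - s) / Lambda * (\1_(strip r0) z * (enorm (z.1 - z.2) `^ a)^-1).
Proof.
rewrite /lower_kernel invfM !indicE.
have -> : (z.1 - z.2 \in eball 0 r0%:E) = (z \in strip r0).
  by apply/idP/idP; rewrite !inE eballE /strip/= subr0.
ring.
Qed.

Lemma lower_upper z : lower_kernel z <= upper_kernel z.
Proof.
rewrite lower_kernelE /upper_kernel mulrA ler_wpM2r ?invr_ge0 ?powR_ge0//.
rewrite indicE -mulrA ler_wpM2l ?(ltW s1)//.
apply: le_trans L1; case: (_ \in _); rewrite ?mulr1 ?mulr0 ?invf_le1//.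
Qed.

Lemma measurable_lower_kernel : measurable_fun setT lower_kernel.
Proof.
rewrite (_ : lower_kernel = fun z => (1 - s) / Lambda *
  (\1_(strip r0) z * (enorm (z.1 - z.2) `^ a)^-1)); last first.
  by apply/funext => z; rewrite lower_kernelE.
apply: measurable_funM; first exact: measurable_cst.
apply: measurable_funM; last exact: measurable_enormB_powRV.
exact: measurable_indic (measurable_strip _).
Qed.

Lemma measurable_upper_kernel : measurable_fun setT upper_kernel.
Proof.
apply: measurable_funM; [exact: measurable_cst|exact: measurable_enormB_powRV].
Qed.

Lemma measurable_fine d (T : measurableType d) (h : T -> \bar R) :
  measurable_fun setT h -> (forall x, h x \is a fin_num) ->
  measurable_fun setT (fine \o h).
Proof.
move=> mh hfin; apply: measurable_fun_rays => c.
rewrite (_ : [set _ | _] = setT `&` h @^-1` `]c%:E, +oo[); last first.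
  by rewrite setTI; apply/seteqP; split=> x; rewrite /= in_itv/= andbT -lte_fin fineK.
apply: (mh measurableT); exact: emeasurable_itv.
Qed.

(** Clamp a measurable representative of [K] between the two bounds. This changes it only on a null
    set and makes it real valued and bounded by both kernels at every point. *)
Lemma real_kernel (K : E -> E -> \bar R) : kernel_assumption s p Lambda r0 K ->
  exists k : E * E -> R, [/\ measurable_fun setT k,
    forall z, lower_kernel z <= k z <= upper_kernel z &
    {ae lebleb, forall z, K z.1 z.2 = (k z)%:E}].
Proof.
move=> [K0 [g mg Kg] _ Kb].
pose h z : \bar R := maxe (lower_kernel z)%:E (mine (g z) (upper_kernel z)%:E).
have mh : measurable_fun setT h.
  apply: measurable_maxe; first by apply/measurable_EFinP; exact: measurable_lower_kernel.
  by apply: (measurable_mine mg); apply/measurable_EFinP; exact: measurable_upper_kernel.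
have lh z : ((lower_kernel z)%:E <= h z <= (upper_kernel z)%:E)%E.
  by rewrite /h le_max lexx/= ge_max lee_fin lower_upper ge_min lexx orbT.
have hfin z : h z \is a fin_num.
  have /andP[h1 h2] := lh z; rewrite fin_numElt (lt_le_trans _ h1) ?ltNyr//.
  by rewrite (le_lt_trans h2)// ltry.
exists (fine \o h); split; first exact: measurable_fine.
  by move=> z; rewrite -!lee_fin fineK.
apply: filterS2 Kg Kb => z Kgz /andP[b1 b2] /=.
by rewrite fineK// /h -Kgz min_l// max_r.
Qed.
End real_kernel.

Lemma indicR_ge0 {T : Type} {R : realType} (A : set T) x : 0 <= \1_A x :> R.
Proof. by rewrite indicE ler0n. Qed.

(** * Integrals of the gain and of the loss *)

Section gain_and_loss.
Context {R : realType} {n : nat}.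
Local Notation E := (Rn R n).
Local Notation leb := (@lebesgue R n).
Local Notation lebleb := (leb \x leb)%E.
Variables (s p Lambda : R) (x0 : E) (r rho : R) (w wm : E -> R).
Hypotheses (s01 : 0 < s < 1) (p1 : 1 < p) (L1 : 1 <= Lambda).
Hypotheses (r_gt0 : 0 < r) (r_rho : r < rho).
Hypotheses (w_ge0 : forall x, 0 <= w x) (wm_ge0 : forall x, 0 <= wm x).
Hypotheses (mw : measurable_fun setT w) (mwm : measurable_fun setT wm).

Local Notation a := (n%:R + s * p).
Local Notation B t := (eball x0 t%:E).
Local Notation m := ((r + rho) / 2).
Local Notation eta := (cutoff x0 r m).

Let p0 : 0 < p. Proof. exact: lt_trans ltr01 p1. Qed.
Let s0 : 0 < s. Proof. by have /andP[] := s01. Qed.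
Let s1 : 0 < 1 - s. Proof. by rewrite subr_gt0; have /andP[] := s01. Qed.
Let L0 : 0 < Lambda. Proof. exact: lt_le_trans L1. Qed.
Let rm : r < m. Proof. by have := r_rho; lra. Qed.
Let m_rho : m < rho. Proof. by have := r_rho; lra. Qed.
Let rho0 : 0 < rho. Proof. exact: lt_trans r_rho. Qed.
Let a0 : 0 <= a. Proof. by rewrite addr_ge0// mulr_ge0// ltW. Qed.

(** The factor 1/2 is that of [cut_one_above]. In the second term the other point ranges over the
    whole space: it becomes the mixed integral of the Caccioppoli inequality once the range of the
    lower kernel is taken into account. *)
Definition energy_gain (z : E * E) : R :=
  2^-1 * (\1_(B r) z.1 * \1_(B r) z.2 * `|w z.1 - w z.2| `^ p +
          \1_(B r) z.1 * (w z.1 * wm z.2 `^ (p - 1))).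

Definition near_loss (z : E * E) : R :=
  \1_(B rho) z.1 * \1_(B rho) z.2 *
    (p `^ p * `|eta z.1 - eta z.2| `^ p * (w z.1 `^ p + w z.2 `^ p)).

Definition far_loss (z : E * E) : R :=
  \1_(B m) z.1 * \1_(~` B rho) z.2 * (w z.1 * w z.2 `^ (p - 1)).

Definition energy_loss (z : E * E) : R :=
  near_loss z + p * (far_loss z + far_loss (z.2, z.1)).

Lemma energy_gain_ge0 z : 0 <= energy_gain z.
Proof.
rewrite /energy_gain mulr_ge0 ?invr_ge0// addr_ge0//.
  by rewrite !mulr_ge0 ?powR_ge0// indicE ler0n.
Qed.

Lemma near_loss_ge0 z : 0 <= near_loss z.
Proof.
apply: mulr_ge0; first by rewrite mulr_ge0 ?indicE ?ler0n.
by rewrite !mulr_ge0 ?powR_ge0// addr_ge0 ?powR_ge0.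
Qed.

Lemma far_loss_ge0 z : 0 <= far_loss z.
Proof.
apply: mulr_ge0; first by rewrite mulr_ge0 ?indicE ?ler0n.
by apply: mulr_ge0; [exact: w_ge0|exact: powR_ge0].
Qed.

Lemma energy_loss_ge0 z : 0 <= energy_loss z.
Proof.
apply: addr_ge0; first exact: near_loss_ge0.
by apply: mulr_ge0; [exact: ltW|apply: addr_ge0; exact: far_loss_ge0].
Qed.

Let m1 (f : E -> R) : measurable_fun setT f ->
  measurable_fun setT (fun z : E * E => f z.1).
Proof. by move=> mf; exact: measurableT_comp mf measurable_fst. Qed.

Let m2 (f : E -> R) : measurable_fun setT f ->
  measurable_fun setT (fun z : E * E => f z.2).
Proof. by move=> mf; exact: measurableT_comp mf measurable_snd. Qed.

Let mball t : measurable_fun setT (\1_(B t) : E -> R).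
Proof. exact: measurable_indic (measurable_eball _ _). Qed.

Let mcball t : measurable_fun setT (\1_(~` B t) : E -> R).
Proof. exact: measurable_indic (measurableC (measurable_eball _ _)). Qed.

Let mpow d (T : measurableType d) (f : T -> R) b : measurable_fun setT f ->
  measurable_fun setT (fun x => f x `^ b).
Proof. by move=> mf; exact: measurableT_comp (measurable_powR _) mf. Qed.

Lemma measurable_energy_gain : measurable_fun setT energy_gain.
Proof.
apply: measurable_funM; first exact: measurable_cst.
apply: measurable_funD; apply: measurable_funM.
- by apply: measurable_funM; [exact: m1|exact: m2].
- apply: measurable_diff_powR; [exact: m1 mw|exact: m2 mw].
- exact: m1.
- by apply: measurable_funM; [exact: m1 mw|apply: mpow; exact: m2 mwm].
Qed.

Lemma measurable_near_loss : measurable_fun setT near_loss.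
Proof.
apply: measurable_funM; first by apply: measurable_funM; [exact: m1|exact: m2].
apply: measurable_funM.
  apply: measurable_funM; first exact: measurable_cst.
  apply: measurable_diff_powR; [exact: m1 (measurable_cutoff _ _ _)|exact: m2 (measurable_cutoff _ _ _)].
by apply: measurable_funD; apply: mpow; [exact: m1 mw|exact: m2 mw].
Qed.

Lemma measurable_far_loss : measurable_fun setT far_loss.
Proof.
apply: measurable_funM; first by apply: measurable_funM; [exact: m1|exact: m2].
by apply: measurable_funM; [exact: m1 mw|apply: mpow; exact: m2 mw].
Qed.

Local Notation up := (@upper_kernel R n s p Lambda).

Lemma upper_kernel_ge0 z : 0 <= up z.
Proof. by rewrite /upper_kernel divr_ge0 ?powR_ge0// mulr_ge0// ltW. Qed.

(** Half of the near loss, with the weight on the first variable so that the inner integral is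
    radial. The other half is its mirror image. *)
Let S1 (z : E * E) : R := (\1_(B rho) z.1 * w z.1 `^ p) *
  (\1_(strip (2 * rho)) z * (enorm (z.1 - z.2) `^ p / enorm (z.1 - z.2) `^ a)).

Let S1_ge0 z : 0 <= S1 z.
Proof. by rewrite /S1 !mulr_ge0 ?invr_ge0 ?powR_ge0// indicE ler0n. Qed.

Let mS1 : measurable_fun setT S1.
Proof.
apply: measurable_funM.
  by apply: measurable_funM; [exact: m1|apply: mpow; exact: m1 mw].
apply: measurable_funM; first exact: measurable_indic (measurable_strip _).
apply: measurable_funM; last exact: measurable_enormB_powRV.
by apply: mpow; exact: measurable_enormB_prod.
Qed.

Lemma near_loss_le z : near_loss z * up z <=
  p `^ p * (2 / (rho - r)) `^ p * ((1 - s) * Lambda) * (S1 z + S1 (z.2, z.1)).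
Proof.
have c0 : 0 <= p `^ p * (2 / (rho - r)) `^ p * ((1 - s) * Lambda).
  by rewrite !mulr_ge0 ?powR_ge0 ?ltW.
have [z1|z1] := pselect (B rho z.1); last first.
  rewrite /near_loss (_ : \1_(B rho) z.1 = 0) ?mul0r.
    by apply: mulr_ge0 => //; apply: addr_ge0; exact: S1_ge0.
  by rewrite indicE memNset.
have [z2|z2] := pselect (B rho z.2); last first.
  rewrite /near_loss (_ : \1_(B rho) z.2 = 0) ?mulr0 ?mul0r.
    by apply: mulr_ge0 => //; apply: addr_ge0; exact: S1_ge0.
  by rewrite indicE memNset.
have zs : enorm (z.1 - z.2) < 2 * rho.
  rewrite !eballE/= in z1 z2.
  apply: le_lt_trans (enorm_triangleB x0 _ _) _; rewrite [enorm (x0 - _)]enormBC; lra.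
have h1 : \1_(B rho) z.1 = 1 :> R by rewrite indicE mem_set.
have h2 : \1_(B rho) z.2 = 1 :> R by rewrite indicE mem_set.
have h3 : \1_(strip (2 * rho)) z = 1 :> R by rewrite indicE mem_set.
have h4 : \1_(strip (2 * rho)) (z.2, z.1) = 1 :> R.
  by rewrite indicE mem_set// /strip/= enormBC.
rewrite /near_loss /S1 h3 h4; cbn [fst snd]; rewrite h1 h2.
rewrite [enorm (_ - z.1)]enormBC /upper_kernel.
set e := enorm _; set W := w z.1 `^ p; set W' := w z.2 `^ p.
have W0 : 0 <= W + W' by rewrite addr_ge0 ?powR_ge0.
have he : `|eta z.1 - eta z.2| `^ p <= (2 / (rho - r)) `^ p * e `^ p.
  rewrite -powRM ?enorm_ge0 ?divr_ge0 ?subr_ge0 ?(ltW r_rho)//.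
  apply: ler_powR2r; rewrite ?(ltW p0)//.
  apply: le_trans (cutoff_lip x0 rm z.1 z.2) _.
  rewrite (_ : m - r = (rho - r) / 2); last by field.
  by rewrite invf_div mulrC.
have d0 : 0 <= p `^ p * (W + W') * ((1 - s) * Lambda) * (e `^ a)^-1.
  by rewrite !mulr_ge0 ?invr_ge0 ?powR_ge0// ltW.
have := ler_wpM2l d0 he.
have gen1 (pp X W1 W2 c ea : R) :
  1 * 1 * (pp * X * (W1 + W2)) * (c / ea) = pp * (W1 + W2) * c * ea^-1 * X by ring.
have gen2 (pp Y c W1 W2 ea ep : R) :
  pp * Y * c * (1 * W1 * (1 * (ep / ea)) + 1 * W2 * (1 * (ep / ea))) =
  pp * (W1 + W2) * c * ea^-1 * (Y * ep) by ring.
by rewrite gen1 gen2.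
Qed.

Lemma integral_S1 : (\int[lebleb]_z (S1 z)%:E <=
  (@radial_constant R n p * ((2 * rho) `^ ((1 - s) * p) / (1 - s)))%:E *
  \int[leb]_(x in B rho) (w x `^ p)%:E)%E.
Proof.
have rc0 := ltW (@radial_constant_gt0 R n p p1).
set c := radial_constant p * _.
have c0 : 0 <= c by rewrite mulr_ge0// divr_ge0 ?powR_ge0// ltW.
have ma : measurable_fun setT (fun x => \1_(B rho) x * w x `^ p).
  exact: measurable_funM (mball rho) (mpow p mw).
have a_ge0 x : 0 <= \1_(B rho) x * w x `^ p by exact: mulr_ge0 (indicR_ge0 _ _) (powR_ge0 _ _).
have mh : measurable_fun setT (fun z : E * E => \1_(strip (2 * rho)) z *
    (enorm (z.1 - z.2) `^ p / enorm (z.1 - z.2) `^ a)).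
  apply: measurable_funM; first exact: measurable_indic (measurable_strip _).
  apply: measurable_funM; last exact: measurable_enormB_powRV.
  by apply: mpow; exact: measurable_enormB_prod.
rewrite (integral_prod_mull ma mh a_ge0); last first.
  by move=> z; exact: mulr_ge0 (indicR_ge0 _ _) (divr_ge0 (powR_ge0 _ _) (powR_ge0 _ _)).
rewrite integral_indicR -(ge0_integralZl_EFin leb measurableT _ _ c0); first last.
- exact/measurable_EFinP.
- by move=> x _; rewrite lee_fin.
apply: le_integral_ge0 => x _.
  rewrite mule_ge0 ?lee_fin//; apply: integral_ge0 => y _.
  by rewrite lee_fin; exact: mulr_ge0 (indicR_ge0 _ _) (divr_ge0 (powR_ge0 _ _) (powR_ge0 _ _)).
rewrite [leRHS]muleC; apply: lee_wpmul2l; first by rewrite lee_fin.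
have rho2 : 0 < 2 * rho by rewrite mulr_gt0.
apply: le_trans (@radial_bound R n s p s01 p1 x _ rho2).
rewrite [leRHS]integral_indicR le_eqVlt; apply/orP; left; apply/eqP.
apply: eq_integral => y _; rewrite !indicE; congr ((nat_of_bool _)%:R * _)%:E.
by apply/idP/idP; rewrite !inE eballE /strip/= enormBC.
Qed.

(** Here 2 counts the two mirror halves, and 4^p is the product of the 2^p from the slope 2/(rho-r)
    of the cutoff and the 2^p that bounds 2^((1-s)p), since pairs in the ball are at distance less
    than 2 rho. *)
Definition near_constant : R := 2 * p `^ p * Lambda * @radial_constant R n p * 4 `^ p.

(** The factor 1-s of the upper kernel cancels the 1/(1-s) of [radial_bound]. *)
Lemma near_bound : (\int[lebleb]_z (near_loss z * up z)%:E <=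
  (near_constant * (rho `^ ((1 - s) * p) / (rho - r) `^ p))%:E *
  \int[leb]_(x in B rho) (w x `^ p)%:E)%E.
Proof.
have rc0 := ltW (@radial_constant_gt0 R n p p1).
set c1 := p `^ p * (2 / (rho - r)) `^ p * ((1 - s) * Lambda).
have c10 : 0 <= c1 by rewrite !mulr_ge0 ?powR_ge0 ?ltW.
have mS1E : measurable_fun setT (EFin \o S1) by apply/measurable_EFinP.
have S1E0 z : (0 <= (EFin \o S1) z)%E by rewrite lee_fin.
have mS1s : measurable_fun setT (fun z : E * E => (EFin \o S1) (z.2, z.1)).
  exact: measurableT_comp mS1E measurable_swap.
have W0 : (0 <= \int[leb]_(x in B rho) (w x `^ p)%:E)%E.
  by apply: integral_ge0 => x _; rewrite lee_fin powR_ge0.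
apply: (@le_trans _ _ (\int[lebleb]_z (c1%:E * ((EFin \o S1) z + (EFin \o S1) (z.2, z.1))))%E).
  apply: le_integral_ge0 => z _.
    by rewrite lee_fin mulr_ge0 ?near_loss_ge0 ?upper_kernel_ge0.
  by rewrite /= -EFinD -EFinM lee_fin; exact: near_loss_le.
rewrite (ge0_integralZl_EFin lebleb measurableT _ _ c10); first last.
- exact: emeasurable_funD mS1E mS1s.
- by move=> z _; exact: adde_ge0 (S1E0 _) (S1E0 _).
have -> : (\int[lebleb]_z ((EFin \o S1) z + (EFin \o S1) (z.2, z.1)) =
    \int[lebleb]_z (EFin \o S1) z + \int[lebleb]_z (EFin \o S1) z)%E.
  apply: etrans (ge0_integralD lebleb measurableT (fun z _ => S1E0 z) mS1E
    (fun z _ => S1E0 (z.2, z.1)) mS1s) _.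
  have sw := integral_swap mS1E S1E0.
  apply: (f_equal (fun y => (\int[lebleb]_z (EFin \o S1) z + y)%E)).
  exact: sw.
apply: (@le_trans _ _ (c1%:E * (2%:E * ((radial_constant p * ((2 * rho) `^ ((1 - s) * p) / (1 - s)))%:E *
    \int[leb]_(x in B rho) (w x `^ p)%:E)))%E).
  apply: lee_wpmul2l; first by rewrite lee_fin.
  rewrite (_ : 2%:E = 1%:E + 1%:E :> \bar R)%E; last by rewrite -EFinD; congr EFin; ring.
  rewrite ge0_muleDl ?lee_fin// !mul1e; apply: leeD; exact: integral_S1.
rewrite !muleA -!EFinM; apply: lee_wpmul2r => //; rewrite lee_fin.
have rr : 0 < rho - r by rewrite subr_gt0.
have rp : 0 < (rho - r) `^ p by rewrite powR_gt0.
have e1 : (2 / (rho - r)) `^ p = 2 `^ p / (rho - r) `^ p.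
  have h : (2 / (rho - r)) `^ p * (rho - r) `^ p = 2 `^ p.
    by rewrite -powRM ?divr_ge0 ?(ltW rr)// divfK// gt_eqF.
  by rewrite -h mulfK// gt_eqF.
have e2 : (2 * rho) `^ ((1 - s) * p) <= 2 `^ p * rho `^ ((1 - s) * p).
  rewrite powRM ?(ltW rho0)//; apply: ler_wpM2r; first exact: powR_ge0.
  apply: ler_powR; first exact: ler1n.
  by rewrite ler_piMl ?(ltW p0)//; have := s0; lra.
have e4 : 4 `^ p = 2 `^ p * 2 `^ p :> R.
  by rewrite -powRM//; congr (_ `^ _); ring.
have d0 : 0 <= p `^ p * (2 `^ p / (rho - r) `^ p) * Lambda * 2 * radial_constant p (n := n).
  apply: mulr_ge0 => //; apply: mulr_ge0 => //; apply: mulr_ge0; last exact: ltW.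
  by apply: mulr_ge0; [exact: powR_ge0|exact: divr_ge0 (powR_ge0 _ _) (powR_ge0 _ _)].
have := ler_wpM2l d0 e2.
rewrite /c1 /near_constant e1 e4.
move: (p `^ p) (2 `^ p) ((rho - r) `^ p) rp (radial_constant p)
  ((2 * rho) `^ ((1 - s) * p)) (rho `^ ((1 - s) * p)).
move=> pp t2 rrp rrp0 rc X Y h.
have s1n : 1 - s != 0 by rewrite gt_eqF.
have -> : pp * (t2 / rrp) * ((1 - s) * Lambda) * 2 * (rc * (X / (1 - s))) =
  pp * (t2 / rrp) * Lambda * 2 * rc * X by field; rewrite s1n gt_eqF.
by apply: le_trans h _; rewrite le_eqVlt; apply/orP; left; apply/eqP; ring.
Qed.

Let A (x : E) : R := \1_(B m) x * w x.
Let T (y : E) : R := \1_(~` B rho) y * (w y `^ (p - 1) / enorm (y - x0) `^ a).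

Let mA : measurable_fun setT A.
Proof. exact: measurable_funM (mball m) mw. Qed.

Let A_ge0 x : 0 <= A x. Proof. exact: mulr_ge0 (indicR_ge0 _ _) (w_ge0 _). Qed.

Let mweight : measurable_fun setT (fun y : E => w y `^ (p - 1) / enorm (y - x0) `^ a).
Proof.
apply: (measurable_funM (mpow (p - 1) mw)).
rewrite (_ : (fun _ => _) = (fun y : E => enorm (y - x0) `^ (- a))).
  exact: mpow (measurable_enormB_cst x0).
by apply/funext => y; rewrite powRN.
Qed.

Let mT : measurable_fun setT T.
Proof. exact: measurable_funM (mcball rho) mweight. Qed.

Let T_ge0 y : 0 <= T y.
Proof. exact: mulr_ge0 (indicR_ge0 _ _) (divr_ge0 (powR_ge0 _ _) (powR_ge0 _ _)). Qed.

(** For |x-x0| < m and |y-x0| >= rho one has |x-y| >= (1 - m/rho)|y-x0|, and 1 - m/rho = (rho-r)/(2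
    rho). This is why the cutoff ends halfway between [r] and [rho]. *)
Lemma far_loss_le z : far_loss z * up z <=
  (1 - s) * Lambda * (2 * rho / (rho - r)) `^ a * (A z.1 * T z.2).
Proof.
have c0 : 0 <= (1 - s) * Lambda * (2 * rho / (rho - r)) `^ a.
  exact: mulr_ge0 (mulr_ge0 (ltW s1) (ltW L0)) (powR_ge0 _ _).
have [z1|z1] := pselect (B m z.1); last first.
  rewrite /far_loss (_ : \1_(B m) z.1 = 0) ?mul0r; last by rewrite indicE memNset.
  by apply: mulr_ge0 => //; exact: mulr_ge0.
have [z2|z2] := pselect ((~` B rho) z.2); last first.
  rewrite /far_loss (_ : \1_(~` B rho) z.2 = 0) ?mulr0 ?mul0r; last by rewrite indicE memNset.
  by apply: mulr_ge0 => //; exact: mulr_ge0.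
have h1 : \1_(B m) z.1 = 1 :> R by rewrite indicE mem_set.
have h2 : \1_(~` B rho) z.2 = 1 :> R by rewrite indicE mem_set.
rewrite /far_loss /A /T h1 h2 /upper_kernel.
have rr : 0 < rho - r by rewrite subr_gt0.
have z1m : enorm (z.1 - x0) < m by move: z1; rewrite eballE.
have z2r : rho <= enorm (z.2 - x0) by rewrite leNgt; apply/negP => h; apply: z2; rewrite eballE.
have d0 : 0 < enorm (z.2 - x0) by exact: lt_le_trans z2r.
have e0 : enorm (z.2 - x0) * ((rho - r) / (2 * rho)) <= enorm (z.1 - z.2).
  have tri := enorm_triangleB z.1 z.2 x0; rewrite [enorm (z.2 - z.1)]enormBC in tri.
  have h : m <= enorm (z.2 - x0) * (m / rho).
    by rewrite mulrA ler_pdivlMr// mulrC ler_wpM2r//; have := r_gt0; have := rho0; lra.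
  have e : (rho - r) / (2 * rho) = 1 - m / rho by field; rewrite gt_eqF.
  rewrite e mulrBr mulr1; lra.
have q0 : 0 < (rho - r) / (2 * rho) by rewrite divr_gt0// mulr_gt0.
have e00 : 0 < enorm (z.1 - z.2) by apply: lt_le_trans e0; rewrite mulr_gt0.
have key : (enorm (z.1 - z.2) `^ a)^-1 <=
    (2 * rho / (rho - r)) `^ a * (enorm (z.2 - x0) `^ a)^-1.
  have := ler_powR2r a0 (ltW (mulr_gt0 d0 q0)) e0.
  rewrite (powRM _ (ltW d0) (ltW q0)) => h.
  have inv : (2 * rho / (rho - r)) `^ a * ((rho - r) / (2 * rho)) `^ a = 1.
    have q'0 : 0 <= 2 * rho / (rho - r).
      exact: divr_ge0 (mulr_ge0 (ler0n _ 2) (ltW rho0)) (ltW rr).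
    rewrite -(powRM _ q'0 (ltW q0)) (_ : _ * _ = 1); first by rewrite powR1.
    by field; rewrite !gt_eqF.
  have da : 0 < enorm (z.2 - x0) `^ a by rewrite powR_gt0.
  have qa : 0 < ((rho - r) / (2 * rho)) `^ a by rewrite powR_gt0.
  have ea : 0 < enorm (z.1 - z.2) `^ a by rewrite powR_gt0.
  have gen (X q D : R) : q != 0 -> X * q = 1 -> X * D^-1 = (D * q)^-1.
    move=> qn h1'; have -> : X = q^-1 by apply: (mulIf qn); rewrite h1' mulVf.
    by rewrite invfM mulrC.
  have qn : ((rho - r) / (2 * rho)) `^ a != 0 by rewrite (gt_eqF qa).
  rewrite (gen _ _ _ qn inv).
  have pD := mulr_gt0 da qa.
  rewrite lef_pV2; [exact: h|by rewrite posrE; exact: ea|by rewrite posrE; exact: pD].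
have c1 : 0 <= w z.1 * w z.2 `^ (p - 1) * ((1 - s) * Lambda).
  exact: mulr_ge0 (mulr_ge0 (w_ge0 _) (powR_ge0 _ _)) (mulr_ge0 (ltW s1) (ltW L0)).
have := ler_wpM2l c1 key.
have gen1 (W1 W2 c ea : R) : 1 * 1 * (W1 * W2) * (c / ea) = W1 * W2 * c * ea^-1 by ring.
have gen2 (c Y W1 W2 da : R) : c * Y * (1 * W1 * (1 * (W2 / da))) =
  W1 * W2 * c * (Y * da^-1) by ring.
by rewrite gen1 gen2.
Qed.

(** The majorant is a product of a function of each variable. Enlarging the two domains gives the
    L^1 norm over the ball of radius [rho] and the tail outside that of radius [r]; 2^(n+p) replaces
    2^(n+sp). *)
Lemma far_bound : (\int[lebleb]_z (far_loss z * up z)%:E <=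
  (Lambda * 2 `^ (n%:R + p) * (rho `^ a / (rho - r) `^ a))%:E *
  \int[leb]_(x in B rho) (w x)%:E *
  ((1 - s)%:E * \int[leb]_(y in ~` B r) (w y `^ (p - 1) / enorm (y - x0) `^ a)%:E))%E.
Proof.
set c2 := (1 - s) * Lambda * (2 * rho / (rho - r)) `^ a.
have c20 : 0 <= c2.
  exact: mulr_ge0 (mulr_ge0 (ltW s1) (ltW L0)) (powR_ge0 _ _).
have mTz : measurable_fun setT (fun z : E * E => T z.2) by exact: m2 mT.
have AT0 z : (0 <= (A z.1 * T z.2)%:E)%E by rewrite lee_fin mulr_ge0.
have mAT : measurable_fun setT (fun z : E * E => (A z.1 * T z.2)%:E).
  by apply/measurable_EFinP; exact: measurable_funM (m1 mA) mTz.
apply: (@le_trans _ _ (\int[lebleb]_z (c2%:E * (A z.1 * T z.2)%:E))%E).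
  apply: le_integral_ge0 => z _.
    by rewrite lee_fin; exact: mulr_ge0 (far_loss_ge0 _) (upper_kernel_ge0 _).
  by rewrite -EFinM lee_fin; exact: far_loss_le.
rewrite (ge0_integralZl_EFin lebleb measurableT (fun z _ => AT0 z) mAT c20).
rewrite (integral_prod_mull mA mTz A_ge0 (fun z => T_ge0 z.2)).
have mAE : measurable_fun setT (EFin \o A) by apply/measurable_EFinP.
have A0 x : setT x -> (0 <= (EFin \o A) x)%E by move=> _; rewrite lee_fin.
have IT0 : (0 <= \int[leb]_y (T y)%:E)%E by apply: integral_ge0 => y _; rewrite lee_fin.
rewrite (ge0_integralZr leb measurableT mAE A0 IT0).
have IA : (\int[leb]_x (EFin \o A) x <= \int[leb]_(x in B rho) (w x)%:E)%E.
  rewrite [leRHS]integral_indicR; apply: le_integral_ge0 => x _; first by rewrite lee_fin.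
  rewrite lee_fin /A; apply: ler_wpM2r => //; rewrite !indicE ler_nat.
  case: (boolP (x \in B m)) => // xm; rewrite mem_set// eballE/=.
  by move: xm; rewrite inE eballE/= => h; exact: lt_trans h m_rho.
have W0 : (0 <= \int[leb]_(x in B rho) (w x)%:E)%E.
  by apply: integral_ge0 => x _; rewrite lee_fin.
set TL := (\int[leb]_(y in ~` B r) _)%E.
have ITL : (\int[leb]_y (T y)%:E <= TL)%E.
  rewrite /TL [leRHS]integral_indicR; apply: le_integral_ge0 => y _; first by rewrite lee_fin.
  rewrite lee_fin /T; apply: ler_wpM2r; first exact: divr_ge0 (powR_ge0 _ _) (powR_ge0 _ _).
  rewrite !indicE ler_nat; case: (boolP (y \in ~` B rho)) => // yr; rewrite mem_set// => yr'.
  move: yr; rewrite inE; apply; move: yr'; rewrite !eballE/= => h; exact: lt_trans h r_rho.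
have TL0 : (0 <= TL)%E by exact: le_trans IT0 ITL.
apply: (@le_trans _ _ (c2%:E * (\int[leb]_(x in B rho) (w x)%:E * TL))%E).
  apply: lee_wpmul2l; first by rewrite lee_fin.
  by apply: lee_pmul => //; apply: integral_ge0 => x _; exact: A0.
have c2le : c2 <= Lambda * 2 `^ (n%:R + p) * (rho `^ a / (rho - r) `^ a) * (1 - s).
  have rr : 0 < rho - r by rewrite subr_gt0.
  have ra : 0 < (rho - r) `^ a by rewrite powR_gt0.
  have e : (2 * rho / (rho - r)) `^ a = 2 `^ a * rho `^ a / (rho - r) `^ a.
    have h : (2 * rho / (rho - r)) `^ a * (rho - r) `^ a = 2 `^ a * rho `^ a.
      rewrite -(powRM _ _ (ltW rr)) ?divfK ?(gt_eqF rr)//; last first.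
        exact: divr_ge0 (mulr_ge0 (ler0n _ 2) (ltW rho0)) (ltW rr).
      by rewrite (powRM _ (ler0n _ 2) (ltW rho0)).
    by rewrite -h mulfK// (gt_eqF ra).
  have h2 : 2 `^ a <= 2 `^ (n%:R + p) :> R.
    apply: ler_powR; first exact: ler1n.
    by rewrite lerD2l ler_piMl ?(ltW p0)//; have := s1; lra.
  have d0 : 0 <= (1 - s) * Lambda * (rho `^ a / (rho - r) `^ a).
    exact: mulr_ge0 (mulr_ge0 (ltW s1) (ltW L0)) (divr_ge0 (powR_ge0 _ _) (powR_ge0 _ _)).
  have := ler_wpM2l d0 h2; rewrite /c2 e.
  have gen1 (c X Y Z : R) : c * (X * Y / Z) = c * (Y / Z) * X by ring.
  have gen2 (L X Y c : R) : L * X * Y * c = c * L * Y * X by ring.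
  by rewrite gen1 gen2.
apply: (@le_trans _ _ ((Lambda * 2 `^ (n%:R + p) * (rho `^ a / (rho - r) `^ a) * (1 - s))%:E *
  (\int[leb]_(x in B rho) (w x)%:E * TL))%E).
  by apply: lee_wpmul2r; [exact: mule_ge0|rewrite lee_fin].
rewrite [in leLHS]EFinM -!muleA le_eqVlt; apply/orP; left; apply/eqP.
by congr (_ * _)%E; rewrite muleCA.
Qed.
End gain_and_loss.

Section competitor.
Context {R : realType} {n : nat}.
Local Notation E := (Rn R n).
Variables (s p Lambda : R) (x0 : E) (r rho k : R) (u : E -> R).
Hypotheses (p1 : 1 < p) (r_rho : r < rho) (mu : measurable_fun setT u).

Local Notation B t := (eball x0 t%:E).
Local Notation m := ((r + rho) / 2).
Local Notation w := (u \- cst k)^\+.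
Local Notation wm := (u \- cst k)^\-.
Local Notation eta := (cutoff x0 r m).
Let rm : r < m. Proof. by have := r_rho; lra. Qed.
Let m_rho : m < rho. Proof. by have := r_rho; lra. Qed.

Lemma truncE x : w x = Num.max (u x - k) 0. Proof. by []. Qed.
Lemma truncNE x : wm x = Num.max (- (u x - k)) 0. Proof. by []. Qed.
Lemma trunc_ge0 x : 0 <= w x. Proof. by rewrite truncE le_max lexx orbT. Qed.
Lemma truncN_ge0 x : 0 <= wm x. Proof. by rewrite truncNE le_max lexx orbT. Qed.

Lemma measurable_trunc : measurable_fun setT w.
Proof. by apply: measurable_funrpos; exact: measurable_funB mu (measurable_cst _). Qed.

Lemma measurable_truncN : measurable_fun setT wm.
Proof. by apply: measurable_funrneg; exact: measurable_funB mu (measurable_cst _). Qed.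

Definition competitor (x : E) : R := u x - eta x `^ p * w x.

Lemma measurable_competitor : measurable_fun setT competitor.
Proof.
apply: (measurable_funB mu); apply: measurable_funM; last exact: measurable_trunc.
by apply: (measurableT_comp (measurable_powR _)); exact: measurable_cutoff.
Qed.

Lemma competitor_energy z :
  `|competitor z.1 - competitor z.2| `^ p + energy_gain p x0 r w wm z
  <= `|u z.1 - u z.2| `^ p + energy_loss p x0 r rho w z.
Proof.
have eB t t' (tt' : t <= t') x : x \in B t -> x \in B t'.
  by rewrite !inE !eballE/= => h; exact: lt_le_trans h tt'.
have e1 x : x \in B r -> eta x = 1 by rewrite inE; exact: cutoff1.
have e0 x : x \notin B m -> eta x = 0.
  by move=> xm; apply: cutoff0 => // h; move/negP : xm; apply; rewrite inE.
have := @cut_energy_le R p p1 (z.1 \in B r) (z.2 \in B r) (z.1 \in B m) (z.2 \in B m)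
  (z.1 \in B rho) (z.2 \in B rho) (u z.1 - k) (u z.2 - k) (eta z.1) (eta z.2)
  (cutoff_itv _ _ _ _) (cutoff_itv _ _ _ _) (e1 _) (e1 _) (e0 _) (e0 _)
  (eB _ _ (ltW rm) _) (eB _ _ (ltW rm) _) (eB _ _ (ltW m_rho) _) (eB _ _ (ltW m_rho) _).
rewrite -!truncE -!truncNE.
rewrite /energy_gain /energy_loss /near_loss /far_loss /competitor !indicE /=.
rewrite !in_setC -!natrM !mulnb.
have gen (U V K A C : R) : U - K - A - (V - K - C) = U - A - (V - C) by ring.
have gen0 (U V K : R) : U - K - (V - K) = U - V by ring.
by rewrite gen gen0.
Qed.

End competitor.

Section gain_bound.
Context {R : realType} {n : nat}.
Local Notation E := (Rn R n).
Local Notation leb := (@lebesgue R n).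
Local Notation lebleb := (leb \x leb)%E.
Variables (s p Lambda r0 R0 : R) (x0 : E) (r : R) (Omega : set E) (w wm : E -> R).
Hypotheses (s01 : 0 < s < 1) (p1 : 1 < p) (L1 : 1 <= Lambda).
Hypotheses (r_R0 : r <= R0) (R0_r0 : 2 * R0 <= r0).
Hypotheses (mO : measurable Omega) (BO : eball x0 r%:E `<=` Omega).
Hypotheses (w_ge0 : forall x, 0 <= w x) (wm_ge0 : forall x, 0 <= wm x).
Hypotheses (mw : measurable_fun setT w) (mwm : measurable_fun setT wm).

Local Notation a := (n%:R + s * p).
Local Notation B t := (eball x0 t%:E).
Local Notation low := (@lower_kernel R n s p Lambda r0).
Let s1 : 0 < 1 - s. Proof. by rewrite subr_gt0; have /andP[] := s01. Qed.
Let L0 : 0 < Lambda. Proof. exact: lt_le_trans L1. Qed.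

Lemma measurable_cross_set : measurable (cross_set Omega).
Proof. by apply: measurableC; apply: measurableX; exact: measurableC. Qed.

Let G1 (z : E * E) : R := \1_(B r `*` B r) z * difference_quotient s p w z.
Let G2 (z : E * E) : R := (\1_(B r) z.1 * w z.1) *
  (\1_(strip (2 * R0)) z * (wm z.2 `^ (p - 1) / enorm (z.1 - z.2) `^ a)).

Let G1_ge0 z : 0 <= G1 z.
Proof. exact: mulr_ge0 (indicR_ge0 _ _) (divr_ge0 (powR_ge0 _ _) (powR_ge0 _ _)). Qed.

Let G2_ge0 z : 0 <= G2 z.
Proof.
exact: mulr_ge0 (mulr_ge0 (indicR_ge0 _ _) (w_ge0 _))
  (mulr_ge0 (indicR_ge0 _ _) (divr_ge0 (powR_ge0 _ _) (powR_ge0 _ _))).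
Qed.

Let mball : measurable_fun setT (\1_(B r) : E -> R).
Proof. exact: measurable_indic (measurable_eball _ _). Qed.

Let mA : measurable_fun setT (fun x => \1_(B r) x * w x).
Proof. exact: measurable_funM mball mw. Qed.

Let mH : measurable_fun setT (fun z : E * E =>
  \1_(strip (2 * R0)) z * (wm z.2 `^ (p - 1) / enorm (z.1 - z.2) `^ a)).
Proof.
apply: measurable_funM; first exact: measurable_indic (measurable_strip _).
apply: measurable_funM; last exact: measurable_enormB_powRV.
exact: measurableT_comp (measurable_powR _) (measurableT_comp mwm measurable_snd).
Qed.

Let mG1 : measurable_fun setT G1.
Proof.
apply: measurable_funM; last exact: measurable_difference_quotient.
exact: measurable_indic (measurable_sqr_eball _ _).
Qed.

Let mG2 : measurable_fun setT G2.
Proof. exact: measurable_funM (measurableT_comp mA measurable_fst) mH. Qed.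

(** Since r <= R0 and 2 R0 <= r0, pairs in the small ball and pairs at distance less than 2 R0 are
    within the range of the lower kernel. *)
Lemma gain_pointwise z : (1 - s) / (2 * Lambda) * (G1 z + G2 z) <=
  \1_(cross_set Omega) z * (energy_gain p x0 r w wm z * low z).
Proof.
have rhs0 : 0 <= \1_(cross_set Omega) z * (energy_gain p x0 r w wm z * low z).
  apply: mulr_ge0; first exact: indicR_ge0.
  by apply: mulr_ge0; [exact: energy_gain_ge0|exact: lower_kernel_ge0].
have [z1|z1] := pselect (B r z.1); last first.
  have -> : G1 z = 0.
    by rewrite /G1 (_ : \1_(B r `*` B r) z = 0) ?mul0r// indicE memNset// => -[].
  have -> : G2 z = 0.
    by rewrite /G2 (_ : \1_(B r) z.1 = 0) ?mul0r// indicE memNset.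
  by rewrite addr0 mulr0.
have h1 : \1_(B r) z.1 = 1 :> R by rewrite indicE mem_set.
have hC : \1_(cross_set Omega) z = 1 :> R.
  rewrite indicE mem_set//= /cross_set /= => -[/= zO _]; apply: zO; exact: BO.
rewrite hC mul1r lower_kernelE /energy_gain /G1 /G2 h1 /difference_quotient.
set e := enorm _; set D := `|_| `^ p; set V := wm z.2 `^ (p - 1).
have D0 : 0 <= D by exact: powR_ge0.
have V0 : 0 <= V by exact: powR_ge0.
have ea : 0 <= (e `^ a)^-1 by rewrite invr_ge0; exact: powR_ge0.
have WV : 0 <= w z.1 * V by exact: mulr_ge0.
have i0 := @indicR_ge0 _ R (strip r0) z.
have b1 : \1_(B r `*` B r) z <= \1_(B r) z.2 * \1_(strip r0) z :> R.
  rewrite !indicE -natrM ler_nat; case: (boolP (z \in B r `*` B r)) => //.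
  rewrite inE => -[/= _ z2]; rewrite (mem_set z2) mem_set//.
  rewrite !eballE/= in z1 z2; rewrite /strip/=.
  apply: lt_le_trans R0_r0; apply: le_lt_trans (enorm_triangleB x0 _ _) _.
  rewrite [enorm (x0 - _)]enormBC; have := r_R0; lra.
have b2 : \1_(strip (2 * R0)) z <= \1_(strip r0) z :> R.
  rewrite !indicE ler_nat; case: (boolP (z \in strip (2 * R0))) => // zs.
  by rewrite mem_set//; move: zs; rewrite inE /strip/= => /lt_le_trans; apply.
have c0 : 0 <= (1 - s) / Lambda / 2.
  by rewrite divr_ge0// divr_ge0 ?ltW.
have -> : (1 - s) / (2 * Lambda) = (1 - s) / Lambda / 2 by field; rewrite gt_eqF.
move: b1 b2 i0 {hC h1 rhs0}.
move: (\1_(B r `*` B r) z) (\1_(B r) z.2) (\1_(strip r0) z) (\1_(strip (2 * R0)) z).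
move: ((1 - s) / Lambda) c0 => c c0 b1 b2 i1 i2 h1 h2 i0.
have t1 : b1 * (D * (e `^ a)^-1) <= b2 * i1 * (D * (e `^ a)^-1).
  by apply: ler_wpM2r => //; exact: mulr_ge0.
have t2 : i2 * (w z.1 * V * (e `^ a)^-1) <= i1 * (w z.1 * V * (e `^ a)^-1).
  by apply: ler_wpM2r => //; exact: mulr_ge0.
have := ler_wpM2l c0 (lerD t1 t2).
move: (e `^ a)^-1 {ea t1 t2} => f.
have gen1 (W : R) : c / 2 * (b1 * (D * f) + i2 * (W * V * f)) =
  c / 2 * (b1 * (D * f) + 1 * W * (i2 * (V * f))) by ring.
have gen2 (W : R) : c / 2 * (b2 * i1 * (D * f) + i1 * (W * V * f)) =
  2^-1 * (1 * b2 * D + 1 * (W * V)) * (c * (i1 * f)) by ring.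
by rewrite gen1 gen2.
Qed.

Lemma gain_bound :
  (((1 - s) / (2 * Lambda))%:E *
    (\int[lebleb]_(z in B r `*` B r) (difference_quotient s p w z)%:E +
     \int[leb]_(x in B r) ((w x)%:E * \int[leb]_(y in eball x (2%:E * R0%:E))
        (wm y `^ (p - 1) / enorm (x - y) `^ a)%:E))
   <= \int[lebleb]_(z in cross_set Omega) (energy_gain p x0 r w wm z * low z)%:E)%E.
Proof.
have c0 : 0 <= (1 - s) / (2 * Lambda).
  exact: divr_ge0 (ltW s1) (mulr_ge0 (ler0n _ 2) (ltW L0)).
have G1E z : (0 <= (G1 z)%:E)%E by rewrite lee_fin.
have G2E z : (0 <= (G2 z)%:E)%E by rewrite lee_fin.
have mG1E : measurable_fun setT (fun z => (G1 z)%:E) by apply/measurable_EFinP.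
have mG2E : measurable_fun setT (fun z => (G2 z)%:E) by apply/measurable_EFinP.
have -> : (\int[leb]_(x in B r) ((w x)%:E * \int[leb]_(y in eball x (2%:E * R0%:E))
        (wm y `^ (p - 1) / enorm (x - y) `^ a)%:E) = \int[lebleb]_z (G2 z)%:E)%E.
  have A0 x : 0 <= \1_(B r) x * w x by exact: mulr_ge0 (indicR_ge0 _ _) (w_ge0 _).
  have H0 (z : E * E) : 0 <= \1_(strip (2 * R0)) z * (wm z.2 `^ (p - 1) / enorm (z.1 - z.2) `^ a).
    exact: mulr_ge0 (indicR_ge0 _ _) (divr_ge0 (powR_ge0 _ _) (powR_ge0 _ _)).
  rewrite (integral_prod_mull mA mH A0 H0) integral_mkcond.
  apply: eq_integral => x _; rewrite patchE indicE; case: ifPn => xr; last by rewrite mul0r mul0e.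
  rewrite mul1r; congr (_ * _)%E; rewrite -EFinM [LHS]integral_indicR.
  apply: eq_integral => y _; congr (_ * _)%:E; rewrite !indicE; congr (nat_of_bool _)%:R.
  by apply/idP/idP; rewrite !inE eballE /strip/= enormBC.
rewrite [X in (X + _)%E]integral_indicR.
have -> : (\int[lebleb]_z (G1 z)%:E + \int[lebleb]_z (G2 z)%:E =
    \int[lebleb]_z ((G1 z)%:E + (G2 z)%:E))%E.
  exact: (esym (ge0_integralD lebleb measurableT (fun z _ => G1E z) mG1E (fun z _ => G2E z) mG2E)).
have mG := emeasurable_funD mG1E mG2E.
rewrite -(ge0_integralZl_EFin lebleb measurableT (fun z _ => adde_ge0 (G1E z) (G2E z)) mG c0).
rewrite [leRHS]integral_indicR; apply: le_integral_ge0 => z _.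
  by rewrite -EFinD -EFinM lee_fin; exact: mulr_ge0 c0 (addr_ge0 (G1_ge0 _) (G2_ge0 _)).
by rewrite -EFinD -EFinM lee_fin; exact: gain_pointwise.
Qed.
End gain_bound.

Section ae_le_integral.
Local Open Scope ereal_scope.
Context d (T : measurableType d) (R : realType).
Variable mu : {measure set T -> \bar R}.

Lemma ae_le_integral (D : set T) (f g : T -> \bar R) : measurable D ->
  mu.-integrable D f -> mu.-integrable D g ->
  {ae mu, forall x, D x -> f x <= g x} ->
  \int[mu]_(x in D) f x <= \int[mu]_(x in D) g x.
Proof.
move=> mD fi gi [N [mN N0 fgN]].
rewrite (negligible_integral mN mD fi N0) (negligible_integral mN mD gi N0).
have mDN : measurable (D `\` N) by exact: measurableD.
apply: le_integral => //.
- by apply: (integrableS mD mDN) => // x [].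
- by apply: (integrableS mD mDN) => // x [].
- move=> x; rewrite inE => -[Dx Nx]; apply: contrapT => fg; apply: Nx.
  by apply: fgN => /(_ Dx).
Qed.

End ae_le_integral.

(** Minimality multiplied by 2p bounds the pairwise energy of [u] by that of the competitor plus 4p
    times the potential bound; both pairwise energies then cancel against the integrated pointwise
    inequality. *)
Lemma energy_cancel (R : realType) (p : R) (Ju Jv gain loss FU FV G : \bar R) :
  0 < p -> Ju \is a fin_num -> Jv \is a fin_num -> gain \is a fin_num ->
  loss \is a fin_num -> FU \is a fin_num -> FV \is a fin_num -> G \is a fin_num ->
  ((2 * p)^-1%:E * Ju + FU <= (2 * p)^-1%:E * Jv + FV)%E ->
  (FV <= FU + 2%:E * G)%E -> (Jv + gain <= Ju + loss)%E ->
  (gain <= (4 * p)%:E * G + loss)%E.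
Proof.
move=> p0; case: Ju => // ju _; case: Jv => // jv _; case: gain => // gn _.
case: loss => // ls _; case: FU => // fu _; case: FV => // fv _; case: G => // ag _.
rewrite -!EFinM -!EFinD !lee_fin => en pd main.
have p2 : 0 < 2 * p by rewrite mulr_gt0.
have : 2 * p * ((2 * p)^-1 * ju + fu) <= 2 * p * ((2 * p)^-1 * jv + fv).
  by rewrite ler_wpM2l// ltW.
rewrite !mulrDr !mulVKf ?gt_eqF// => en'.
have : 2 * p * fv <= 2 * p * (fu + 2 * ag) by rewrite ler_wpM2l// ltW.
rewrite mulrDr; lra.
Qed.

(** * Minimality tested with the competitor *)

Section caccioppoli_core.
Context {R : realType} {n : nat}.
Local Notation E := (Rn R n).
Local Notation leb := (@lebesgue R n).
Local Notation lebleb := (leb \x leb)%E.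
Variables (s p Lambda r0 R0 : R) (x0 : E) (r rho k : R) (Omega : set E).
Variables (K : E -> E -> \bar R) (F : E -> R -> R) (u g : E -> R).
Hypotheses (s01 : 0 < s < 1) (p1 : 1 < p) (L1 : 1 <= Lambda).
Hypothesis (hK : kernel_assumption s p Lambda r0 K).
Hypotheses (r_gt0 : 0 < r) (r_rho : r < rho) (rho_R0 : rho <= R0) (R0_r0 : 2 * R0 <= r0).
Hypotheses (oO : open Omega) (BO : eball x0 rho%:E `<=` Omega).
Hypothesis mF : forall v : E -> R, measurable_fun setT v -> measurable_fun setT (fun x => F x (v x)).
Hypotheses (mg : measurable_fun setT g) (g0 : forall x, 0 <= g x).
Hypothesis gfin : (\int[leb]_(x in Omega) (g x)%:E < +oo)%E.
Hypothesis Fg : {ae leb, forall x, Omega x -> forall t, `|t| <= `|u x| + `|k| -> `|F x t| <= g x}.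
Hypothesis hu : subminimizer s p K F Omega u.

Local Notation a := (n%:R + s * p).
Local Notation B t := (eball x0 t%:E).
Local Notation m := ((r + rho) / 2).
Local Notation w := (u \- cst k)^\+.
Local Notation wm := (u \- cst k)^\-.
Local Notation v := (competitor p x0 r rho k u).
Local Notation low := (@lower_kernel R n s p Lambda r0).
Local Notation up := (@upper_kernel R n s p Lambda).

Let p0 : 0 < p. Proof. exact: lt_trans ltr01 p1. Qed.
Let s1 : 0 < 1 - s. Proof. by rewrite subr_gt0; have /andP[] := s01. Qed.
Let mu : measurable_fun setT u. Proof. by case: hu => -[]. Qed.
Let mO : measurable Omega. Proof. exact: open_measurable_Rn. Qed.
Let mC : measurable (cross_set Omega). Proof. exact: measurable_cross_set. Qed.
Let mv : measurable_fun setT v. Proof. exact: measurable_competitor. Qed.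

Lemma competitorE x : v x = u x - cutoff x0 r m x `^ p * w x. Proof. by []. Qed.

Lemma cutoff_powR_itv x : 0 <= cutoff x0 r m x `^ p <= 1.
Proof.
have /andP[c0 c1] := cutoff_itv x0 r m x.
have e1 : 1 `^ p = 1 :> R by rewrite powR1.
by rewrite powR_ge0/= -[leRHS]e1; exact: ler_powR2r (ltW p0) c0 c1.
Qed.

(** Above the level, the competitor is a convex combination of [u] and [k]; so [g], which bounds the
    potential for arguments up to |u|+|k|, serves both functions. *)
Lemma competitor_norm_le x : `|v x| <= `|u x| + `|k|.
Proof.
have /andP[e0 e1] := cutoff_powR_itv x; rewrite competitorE truncE.
case: (leP (u x - k) 0) => h; first by rewrite mulr0 subr0 lerDl.
move: (cutoff x0 r m x `^ p) e0 e1 => e e0 e1.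
have -> : u x - e * (u x - k) = (1 - e) * u x + e * k by ring.
apply: le_trans (ler_normD _ _) _; rewrite !normrM (ger0_norm e0) ger0_norm ?subr_ge0//.
by apply: lerD; rewrite ler_piMl//; lra.
Qed.

Lemma competitor_eq x : ~ (B rho `&` [set x | k < u x]) x -> v x = u x.
Proof.
move=> h; rewrite competitorE truncE.
case: (leP (u x - k) 0) => hu'; first by rewrite mulr0 subr0.
have nm : ~ B m x.
  move=> xm; apply: h; split; last by rewrite /= -subr_gt0.
  by move: xm; rewrite !eballE/= => /lt_trans; apply; have := r_rho; lra.
rewrite cutoff0 ?powR0 ?mul0r ?subr0//; first by rewrite gt_eqF.
by have := r_rho; lra.
Qed.

(** The cutoff ends at the radius [m] < [rho], so even the closure of the support, inside a closed
    ball of radius [m], lies in the open ball of radius [rho]. *)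
Lemma competitor_supported : supported_in (fun x => v x - u x) Omega.
Proof.
apply: subset_trans BO; apply: (@subset_trans _ [set x | enorm (x - x0) <= m]); last first.
  by move=> x /=; rewrite eballE/= => /le_lt_trans; apply; have := r_rho; lra.
rewrite closureE; apply: smallest_sub; first exact: closed_ceball.
move=> x /= vu; rewrite leNgt; apply/negP => xm; move/eqP : vu; apply.
rewrite competitorE cutoff0; last 2 first.
- by have := r_rho; lra.
- by rewrite eballE/= => h; have := lt_trans xm h; rewrite ltxx.
by rewrite powR0 ?gt_eqF// mul0r subr0 subrr.
Qed.

Lemma competitor_le x : v x - u x <= 0.
Proof.
have /andP[e0 e1] := cutoff_powR_itv x; rewrite competitorE.
have := mulr_ge0 e0 (trunc_ge0 k u x); lra.
Qed.

Lemma F_integrable (f : E -> R) : measurable_fun setT f ->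
  (forall x, `|f x| <= `|u x| + `|k|) ->
  leb.-integrable Omega (fun x => (F x (f x))%:E).
Proof.
move=> mf fu; have mFf := mF mf.
have mFE : measurable_fun Omega (fun x => (F x (f x))%:E).
  by apply/measurable_EFinP; exact: measurable_funTS mFf.
have mgE : measurable_fun Omega (fun x => (g x)%:E).
  by apply/measurable_EFinP; exact: measurable_funTS mg.
apply/integrableP; split; first exact: mFE.
apply: le_lt_trans gfin; apply: ae_ge0_le_integral.
- exact: mO.
- by move=> x _; exact: abse_ge0.
- by apply: (measurableT_comp _ mFE); exact: abse_measurable.
- by move=> x _; rewrite lee_fin.
- exact: mgE.
- by apply: filterS Fg => x h Ox; rewrite /= lee_fin; exact: h.
Qed.

Let A : set E := B rho `&` [set x | k < u x].

Let mA : measurable A.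
Proof.
apply: measurableI; first exact: measurable_eball.
rewrite -[[set _ | _]]setTI (_ : [set x | k < u x] = u @^-1` `]k, +oo[).
  exact: (mu measurableT).
by apply/seteqP; split=> z; rewrite /= in_itv/= andbT.
Qed.

Let AO : A `<=` Omega. Proof. by move=> x [/BO]. Qed.

(** Both functions agree off the superlevel set; on it the two potentials differ by at most twice
    [g]. *)
Lemma potential_difference :
  (\int[leb]_(x in Omega) (F x (v x))%:E <=
   \int[leb]_(x in Omega) (F x (u x))%:E + 2%:E * \int[leb]_(x in A) (g x)%:E)%E.
Proof.
have uk x : `|u x| <= `|u x| + `|k| by rewrite lerDl.
have iu := F_integrable mu uk.
have iv := F_integrable mv competitor_norm_le.
have mgE D : measurable_fun D (fun x => (g x)%:E).
  by apply/measurable_EFinP; exact: measurable_funTS mg.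
have g0E x : (0 <= (g x)%:E)%E by rewrite lee_fin.
have mIg : measurable_fun setT (fun x => (\1_A x * g x)%:E).
  by apply/measurable_EFinP; apply: measurable_funM mg; exact: measurable_indic mA.
have Ig0 x : (0 <= (\1_A x * g x)%:E)%E.
  by rewrite lee_fin; exact: mulr_ge0 (indicR_ge0 _ _) (g0 _).
have ig : leb.-integrable Omega (EFin \o g).
  apply/integrableP; split; first exact: mgE.
  rewrite (eq_integral (EFin \o g))// => x _.
  by rewrite /= ger0_norm.
have igA : leb.-integrable Omega (fun x => (2 * (\1_A x * g x))%:E).
  apply/integrableP; split.
    apply/measurable_EFinP; apply: measurable_funTS; apply: measurable_funM.
      exact: measurable_cst.
    apply: measurable_funM => //; exact: measurable_indic mA.
  apply: (@le_lt_trans _ _ (\int[leb]_(x in Omega) (2%:E * (g x)%:E))%E).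
    apply: le_integral_ge0 => x _; first exact: abse_ge0.
    rewrite lee_fin ger0_norm; last first.
      by apply: mulr_ge0 => //; exact: mulr_ge0 (indicR_ge0 _ _) (g0 _).
    apply: ler_wpM2l => //; rewrite ler_piMl// indicE; by case: (_ \in _).
  rewrite (ge0_integralZl_EFin leb mO (fun x _ => g0E x) (mgE _) (ler0n _ 2)).
  by apply: lte_mul_pinfty; rewrite ?lee_fin.
have -> : (2%:E * \int[leb]_(x in A) (g x)%:E =
    \int[leb]_(x in Omega) (2 * (\1_A x * g x))%:E)%E.
  rewrite [X in (_ * X)%E]integral_indicR [RHS]integral_indicR.
  rewrite -(ge0_integralZl_EFin leb measurableT (fun x _ => Ig0 x) mIg (ler0n _ 2)).
  apply: eq_integral => x _; rewrite -EFinM; congr EFin.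
  have [Ax|Ax] := pselect (A x).
    have -> : \1_Omega x = 1 :> R by rewrite indicE mem_set//; exact: AO.
    by rewrite mul1r.
  have -> : \1_A x = 0 :> R by rewrite indicE memNset.
  by rewrite mul0r !mulr0.
rewrite -(integralD mO iu igA).
apply: (ae_le_integral mO iv (integrableD mO iu igA)).
apply: filterS Fg => x h Ox; rewrite /= lee_fin.
have [Ax|Ax] := pselect (A x); last first.
  rewrite (competitor_eq Ax) lerDl; apply: mulr_ge0 => //.
  exact: mulr_ge0 (indicR_ge0 _ _) (g0 _).
rewrite indicE mem_set//= mul1r.
have := h Ox _ (uk x); have := h Ox _ (competitor_norm_le x).
by rewrite !ler_norml => /andP[? ?] /andP[? ?]; lra.
Qed.

Let pairwise_energy (h : E * E -> R) (f : E -> R) : \bar R :=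
  (\int[lebleb]_(z in cross_set Omega) (`|f z.1 - f z.2| `^ p * h z)%:E)%E.

Let mdiff (f : E -> R) : measurable_fun setT f ->
  measurable_fun setT (fun z : E * E => `|f z.1 - f z.2| `^ p).
Proof.
move=> mf; apply: measurable_diff_powR.
  exact: measurableT_comp mf measurable_fst.
exact: measurableT_comp mf measurable_snd.
Qed.

Lemma interaction_real (h : E * E -> R) (f : E -> R) : measurable_fun setT h ->
  (forall z, 0 <= h z) -> {ae lebleb, forall z, K z.1 z.2 = (h z)%:E} ->
  measurable_fun setT f ->
  interaction p K Omega f = ((2 * p)^-1%:E * pairwise_energy h f)%E.
Proof.
move=> mh h0 Kh mf; rewrite /interaction /pairwise_energy; congr (_ * _)%E.
have [K0 _ _ _] := hK.
apply: ae_eq_integral_ge0.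
- exact: mC.
- by apply/measurable_EFinP; apply: measurable_funTS; exact: measurable_funM (mdiff mf) mh.
- by move=> z _; apply: mule_ge0 (K0 _ _); rewrite lee_fin; exact: powR_ge0.
- by move=> z _; rewrite lee_fin; exact: mulr_ge0 (powR_ge0 _ _) (h0 _).
- by apply: filterS Kh => z Kz _; rewrite Kz EFinM.
Qed.

(** The domination by [g] makes the negative part of the potential integrable, so the form oo - oo
    cannot occur. *)
Lemma energy_definedP (f : E -> R) : measurable_fun setT f ->
  (forall x, `|f x| <= `|u x| + `|k|) -> energy_defined p K F Omega f.
Proof.
move=> mf fu; rewrite /energy_defined.
have iF := F_integrable mf fu.
have nf := integrable_neg_fin_num mO iF.
have e : (\int[leb]_(x in Omega) ((fun x => F x (f x))^\- x)%:E =
          \int[leb]_(x in Omega) (fun x => (F x (f x))%:E)^\- x)%E.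
  by apply: eq_integral => x _; rewrite funerneg.
have nf' : (\int[leb]_(x in Omega) ((fun x => F x (f x))^\- x)%:E)%E \is a fin_num.
  by rewrite e.
rewrite /adde_def; move: nf'; case: (integral _ _ _) => // z _.
by rewrite /= !andbF.
Qed.

Definition caccioppoli_loss : \bar R :=
  ((@near_constant R n p Lambda * (rho `^ ((1 - s) * p) / (rho - r) `^ p))%:E *
     \int[leb]_(x in B rho) (w x `^ p)%:E +
   (2 * p * (Lambda * 2 `^ (n%:R + p)) * (rho `^ a / (rho - r) `^ a))%:E *
     \int[leb]_(x in B rho) (w x)%:E *
     ((1 - s)%:E * \int[leb]_(y in ~` B r) (w y `^ (p - 1) / enorm (y - x0) `^ a)%:E))%E.

Let w_ge0 x : 0 <= w x. Proof. exact: trunc_ge0. Qed.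
Let wm_ge0 x : 0 <= wm x. Proof. exact: truncN_ge0. Qed.
Let mw : measurable_fun setT w. Proof. exact: measurable_trunc. Qed.
Let mwm : measurable_fun setT wm. Proof. exact: measurable_truncN. Qed.
Let L0 : 0 < Lambda. Proof. exact: lt_le_trans L1. Qed.

Local Notation loss := (energy_loss p x0 r rho w).
Local Notation gain := (energy_gain p x0 r w wm).

Lemma loss_bound :
  (\int[lebleb]_(z in cross_set Omega) (loss z * up z)%:E <= caccioppoli_loss)%E.
Proof.
pose N z := near_loss p x0 r rho w z * up z.
pose H z := far_loss p x0 r rho w z * up z.
have up0 z : 0 <= up z by exact: upper_kernel_ge0.
have N0 z : (0 <= (N z)%:E)%E by rewrite lee_fin; exact: mulr_ge0 (near_loss_ge0 _ _ _ _ _ _) (up0 _).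
have H0 z : (0 <= (H z)%:E)%E by rewrite lee_fin; exact: mulr_ge0 (far_loss_ge0 _ _ _ _ w_ge0 _) (up0 _).
have mup : measurable_fun setT up by exact: measurable_upper_kernel.
have mN : measurable_fun setT (fun z => (N z)%:E).
  by apply/measurable_EFinP; apply: measurable_funM mup; exact: measurable_near_loss.
have mH : measurable_fun setT (fun z => (H z)%:E).
  by apply/measurable_EFinP; apply: measurable_funM mup; exact: measurable_far_loss.
have mHs : measurable_fun setT (fun z : E * E => (H (z.2, z.1))%:E).
  exact: measurableT_comp mH measurable_swap.
have ups z : up (z.2, z.1) = up z by rewrite /upper_kernel /= enormBC.
have HH0 z : (0 <= (H z)%:E + (H (z.2, z.1))%:E)%E by exact: adde_ge0.
have mHH := emeasurable_funD mH mHs.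
have pp : 0 <= p by exact: ltW.
apply: (@le_trans _ _ (\int[lebleb]_z ((N z)%:E + p%:E * ((H z)%:E + (H (z.2, z.1))%:E)))%E).
  rewrite integral_mkcond; apply: le_integral_ge0 => z _.
    rewrite patchE; case: ifP => _; last exact: lexx.
    rewrite lee_fin.
    by apply: mulr_ge0 (up0 _); apply: energy_loss_ge0.
  have l0 : (0 <= (loss z * up z)%:E)%E.
    by rewrite lee_fin; apply: mulr_ge0 (up0 _); apply: energy_loss_ge0.
  have e : ((loss z * up z)%:E = (N z)%:E + p%:E * ((H z)%:E + (H (z.2, z.1))%:E))%E.
    have gen (x1 x2 x3 y : R) : ((x1 + p * (x2 + x3)) * y)%:E =
        ((x1 * y)%:E + p%:E * ((x2 * y)%:E + (x3 * y)%:E))%E.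
      by transitivity (x1 * y + p * (x2 * y + x3 * y))%:E; [congr EFin; ring|].
    rewrite /N /H ups; exact: gen.
  apply: (@le_trans _ _ (loss z * up z)%:E).
    by rewrite patchE; case: ifP => _; [exact: lexx|exact: l0].
  rewrite le_eqVlt; apply/orP; left; apply/eqP; exact: e.
have pHH0 z : (0 <= p%:E * ((H z)%:E + (H (z.2, z.1))%:E))%E by apply: mule_ge0.
rewrite (ge0_integralD lebleb measurableT (fun z _ => N0 z) mN (fun z _ => pHH0 z)
  (measurable_funeM p%:E mHH)).
rewrite (ge0_integralZl_EFin lebleb measurableT (fun z _ => HH0 z) mHH pp).
rewrite (ge0_integralD lebleb measurableT (fun z _ => H0 z) mH (fun z _ => H0 (z.2, z.1)) mHs).
(* The two far terms are mirror images of each other, whence the factor 2p in [caccioppoli_loss]. *)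
have es := integral_swap mH H0.
rewrite [X in (_ + p%:E * (_ + X))%E]es.
rewrite /caccioppoli_loss; apply: leeD.
  exact: near_bound.
have fb := @far_bound R n s p Lambda x0 r rho w s01 p1 L1 r_gt0 r_rho w_ge0 mw.
have I0 : (0 <= \int[lebleb]_z (H z)%:E)%E by apply: integral_ge0 => z _.
have two (X : \bar R) : (X + X = 2%:E * X)%E by rewrite -mule2n -mule_natl.
rewrite two.
rewrite muleA -EFinM.
have p20 : 0 <= p * 2 by exact: mulr_ge0 pp (ler0n _ 2).
apply: le_trans (lee_wpmul2l (_ : (0 <= (p * 2)%:E)%E) fb) _; first by rewrite lee_fin.
rewrite !muleA -EFinM le_eqVlt; apply/orP; left; apply/eqP.
congr (_ * _ * _ * _)%E; congr EFin.
have gen (x1 x2 : R) : p * 2 * (Lambda * x1 * x2) = 2 * p * (Lambda * x1) * x2 by ring.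
exact: gen.
Qed.

Theorem caccioppoli_core :
  (((1 - s) / (2 * Lambda))%:E *
    (\int[lebleb]_(z in B r `*` B r) (difference_quotient s p w z)%:E +
     \int[leb]_(x in B r) ((w x)%:E * \int[leb]_(y in eball x (2%:E * R0%:E))
        (wm y `^ (p - 1) / enorm (x - y) `^ a)%:E))
   <= (4 * p)%:E * \int[leb]_(x in A) (g x)%:E + caccioppoli_loss)%E.
Proof.
have [h [mh hb Kh]] := real_kernel s01 L1 hK.
have low0 z : 0 <= low z by exact: lower_kernel_ge0.
have up0 z : 0 <= up z by exact: upper_kernel_ge0.
have h0 z : 0 <= h z by have /andP[hz _] := hb z; exact: le_trans (low0 z) hz.
have Br : B r `<=` Omega.
  by move=> x; rewrite eballE/= => xr; apply: BO; rewrite eballE/=; exact: lt_trans xr r_rho.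
have rR0 : r <= R0 by exact: le_trans (ltW r_rho) rho_R0.
have gb := @gain_bound R n s p Lambda r0 R0 x0 r Omega w wm s01 L1 rR0 R0_r0 Br w_ge0 mw mwm.
apply: le_trans gb _.
set Gn := (\int[lebleb]_(z in cross_set Omega) (gain z * low z)%:E)%E.
have Ag0 : (0 <= \int[leb]_(x in A) (g x)%:E)%E.
  by apply: integral_ge0 => x _; rewrite lee_fin.
apply: (@le_trans _ _ ((4 * p)%:E * \int[leb]_(x in A) (g x)%:E +
   \int[lebleb]_(z in cross_set Omega) (loss z * up z)%:E)%E); last first.
  by apply: leeD => //; exact: loss_bound.
set Ls := (\int[lebleb]_(z in cross_set Omega) (loss z * up z)%:E)%E.
pose Ju := pairwise_energy h u; pose Jv := pairwise_energy h v.
have pm1 (f : E -> R) z : (cross_set Omega) z -> (0 <= (`|f z.1 - f z.2| `^ p * h z)%:E)%E.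
  by move=> _; rewrite lee_fin; exact: mulr_ge0 (powR_ge0 _ _) (h0 _).
have mpe (f : E -> R) : measurable_fun setT f ->
    measurable_fun (cross_set Omega) (fun z => (`|f z.1 - f z.2| `^ p * h z)%:E).
  move=> mf; apply/measurable_EFinP; apply: measurable_funTS.
  exact: measurable_funM (mdiff mf) mh.
have ga0 z : (cross_set Omega) z -> (0 <= (gain z * low z)%:E)%E.
  by move=> _; rewrite lee_fin; apply: mulr_ge0 (low0 _); exact: energy_gain_ge0.
have lo0 z : (cross_set Omega) z -> (0 <= (loss z * up z)%:E)%E.
  by move=> _; rewrite lee_fin; apply: mulr_ge0 (up0 _); exact: energy_loss_ge0.
have mga : measurable_fun (cross_set Omega) (fun z => (gain z * low z)%:E).
  apply/measurable_EFinP; apply: measurable_funTS.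
  by apply: measurable_funM; [exact: measurable_energy_gain|exact: measurable_lower_kernel].
have mlo : measurable_fun (cross_set Omega) (fun z => (loss z * up z)%:E).
  apply/measurable_EFinP; apply: measurable_funTS.
  apply: measurable_funM; last exact: measurable_upper_kernel.
  apply: measurable_funD; first exact: measurable_near_loss.
  have mfl := @measurable_far_loss R n p x0 r rho w mw.
  apply: measurable_funM; first exact: measurable_cst.
  apply: (measurable_funD mfl); exact: measurableT_comp mfl measurable_swap.
(* The kernel [h] is replaced by its lower bound in the gain and by its upper bound in the loss, but
   kept in both energies, which must be those of the minimality inequality. *)
have main : (Jv + Gn <= Ju + Ls)%E.
  rewrite /Jv /Gn /Ju /Ls /pairwise_energy.
  rewrite -(ge0_integralD lebleb mC (pm1 v) (mpe _ mv) ga0 mga).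
  rewrite -(ge0_integralD lebleb mC (pm1 u) (mpe _ mu) lo0 mlo).
  apply: le_integral_ge0 => z zC; first by apply: adde_ge0; [exact: pm1|exact: ga0].
  rewrite -!EFinD lee_fin.
  have ce := competitor_energy x0 k u p1 r_rho z.
  have /andP[h1 h2] := hb z.
  have gn := energy_gain_ge0 p x0 r wm w_ge0 z.
  have ls := energy_loss_ge0 x0 r rho p1 w_ge0 z.
  have t1 := ler_wpM2l gn h1; have t2 := ler_wpM2l ls h2.
  have t3 := ler_wpM2r (h0 z) ce.
  move: t1 t2 t3.
  move: (gain z) (loss z) (low z) (up z) (h z) (`|v z.1 - v z.2| `^ p) (`|u z.1 - u z.2| `^ p).
  by move=> G L lw U H V W t1 t2; rewrite !mulrDl; lra.
have Jufin : (Ju < +oo)%E.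
  have [[_ _ ufin] _ _] := hu.
  have mdq : measurable_fun (cross_set Omega) (fun z => (difference_quotient s p u z)%:E).
    by apply/measurable_EFinP; apply: measurable_funTS; exact: measurable_difference_quotient.
  have dq0 z : (cross_set Omega) z -> (0 <= (difference_quotient s p u z)%:E)%E.
    by move=> _; rewrite lee_fin; exact: divr_ge0 (powR_ge0 _ _) (powR_ge0 _ _).
  have c0 : 0 <= (1 - s) * Lambda by exact: mulr_ge0 (ltW s1) (ltW L0).
  apply: (@le_lt_trans _ _ (((1 - s) * Lambda)%:E *
      \int[lebleb]_(z in cross_set Omega) (difference_quotient s p u z)%:E)%E).
    rewrite -(ge0_integralZl_EFin lebleb mC dq0 mdq c0).
    apply: le_integral_ge0 => z zC; first exact: pm1.
    rewrite -EFinM lee_fin /difference_quotient.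
    have /andP[_ h2] := hb z.
    have := ler_wpM2l (powR_ge0 `|u z.1 - u z.2| p) h2.
    have gen (D c ea : R) : D * (c / ea) = c * (D / ea) by ring.
    by rewrite /upper_kernel gen.
  by apply: lte_mul_pinfty; rewrite ?lee_fin.
have Ju0 : (0 <= Ju)%E by apply: integral_ge0 => z; exact: pm1.
have Jv0 : (0 <= Jv)%E by apply: integral_ge0 => z; exact: pm1.
have Gn0 : (0 <= Gn)%E by apply: integral_ge0 => z; exact: ga0.
have Ls0 : (0 <= Ls)%E by apply: integral_ge0 => z; exact: lo0.
have p4 : 0 <= 4 * p by exact: mulr_ge0 (ler0n _ 4) (ltW p0).
(* An infinite loss makes the claim trivial. Otherwise [main] bounds the energy of the competitor
   and the gain, and everything can be computed in the reals. *)
have [Lsfin|] := ltP Ls +oo%E; last first.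
  rewrite leye_eq => /eqP ->; rewrite addey ?leey// gt_eqF//.
  by rewrite (lt_le_trans (ltNyr 0))// mule_ge0 ?lee_fin.
have JvGn : (Jv + Gn < +oo)%E by exact: le_lt_trans main (lte_add_pinfty Jufin Lsfin).
have Jvfin : (Jv < +oo)%E by apply: le_lt_trans JvGn; exact: leeDl.
have Gnfin : (Gn < +oo)%E by apply: le_lt_trans JvGn; exact: leeDr.
have Agfin : (\int[leb]_(x in A) (g x)%:E < +oo)%E.
  have mgO : measurable_fun Omega (fun x => (g x)%:E).
    by apply/measurable_EFinP; exact: measurable_funTS mg.
  have g0E x : (0 <= (g x)%:E)%E by rewrite lee_fin.
  exact: le_lt_trans (ge0_subset_integral leb mA mO mgO (fun x _ => g0E x) AO) gfin.
have uk x : `|u x| <= `|u x| + `|k| by rewrite lerDl.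
have FUfin := integrable_fin_num mO (F_integrable mu uk).
have FVfin := integrable_fin_num mO (F_integrable mv competitor_norm_le).
have en : (energy p K F Omega u <= energy p K F Omega v)%E.
  have [_ _ min] := hu.
  have uv : (u \+ (fun x => v x - u x))%R = v.
    by apply/funext => x /=; rewrite addrC subrK.
  rewrite -[in leRHS]uv; apply: min; rewrite ?uv.
  - exact: measurable_funB mv mu.
  - exact: competitor_le.
  - exact: competitor_supported.
  - exact: energy_definedP mv competitor_norm_le.
rewrite /energy (interaction_real mh h0 Kh mu) (interaction_real mh h0 Kh mv) in en.
have pd := potential_difference.
rewrite -/Ju -/Jv in en; move: en pd main.
move: FUfin FVfin; set FU := integral _ Omega _; set FV := integral _ Omega _.
move=> FUfin FVfin en pd main.
have Jufn : Ju \is a fin_num by rewrite (ge0_fin_numE Ju0); exact: Jufin.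
have Jvfn : Jv \is a fin_num by rewrite (ge0_fin_numE Jv0); exact: Jvfin.
have Gnfn : Gn \is a fin_num by rewrite ge0_fin_numE.
have Lsfn : Ls \is a fin_num by rewrite ge0_fin_numE.
have Agfn : (\int[leb]_(x in A) (g x)%:E)%E \is a fin_num by rewrite ge0_fin_numE.
exact: (energy_cancel p0 Jufn Jvfn Gnfn Lsfn FUfin FVfin Agfn en pd main).
Qed.

End caccioppoli_core.

(** * Membership in the function spaces *)

Section norms.
Context {R : realType} {n : nat}.
Local Notation E := (Rn R n).
Local Notation leb := (@lebesgue R n).
Local Notation lebleb := (leb \x leb)%E.
Implicit Types (s p : R) (U : set E) (u w : E -> R).

Lemma gagliardo_powR s p U u : 0 < p -> (gagliardo s p U u `^ p =
  \int[lebleb]_(z in U `*` U) (difference_quotient s p u z)%:E)%E.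
Proof.
move=> p0; rewrite /gagliardo -poweRrM mulVf ?gt_eqF// poweRe1//.
apply: integral_ge0 => z _; rewrite lee_fin.
exact: divr_ge0 (powR_ge0 _ _) (powR_ge0 _ _).
Qed.

Lemma Lp_norm_powR p U u : 0 < p ->
  (Lp_norm p%:E U u `^ p = \int[leb]_(x in U) (`|u x| `^ p)%:E)%E.
Proof.
move=> p0; rewrite /Lp_norm poweR_Lnorm ?gt_eqF// [RHS]integral_mkcond.
apply: eq_integral => x _; rewrite !patchE; case: ifP => _ //=.
by rewrite normr0 powR0// gt_eqF.
Qed.

Lemma Lp_norm1 U u : (Lp_norm 1 U u = \int[leb]_(x in U) `|u x|%:E)%E.
Proof.
rewrite /Lp_norm Lnorm1 [RHS]integral_mkcond.
by apply: eq_integral => x _; rewrite !patchE; case: ifP => _ //=; rewrite normr0.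
Qed.

Lemma tail_powR s p u x0 r : 0 < s < 1 -> 1 < p -> (tail s p u x0 r `^ (p - 1) =
  (1 - s)%:E * \int[leb]_(x in ~` eball x0 r%:E)
    (`|u x| `^ (p - 1) / enorm (x - x0) `^ (n%:R + s * p))%:E)%E.
Proof.
move=> /andP[_ s1] p1; rewrite /tail -poweRrM mulVf ?poweRe1//; last first.
  by rewrite gt_eqF// subr_gt0.
apply: mule_ge0; first by rewrite lee_fin subr_ge0 ltW.
apply: integral_ge0 => z _; rewrite lee_fin.
exact: divr_ge0 (powR_ge0 _ _) (powR_ge0 _ _).
Qed.

Lemma DG_ineqE s p c H eps (R0 : R) x0 r rho k w v (A : set E) :
  0 < s < 1 -> 1 < p -> (forall x, 0 <= w x) ->
  DG_ineq s p c H eps R0%:E x0 r rho k w v A =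
  (\int[lebleb]_(z in eball x0 r%:E `*` eball x0 r%:E) (difference_quotient s p w z)%:E
   + \int[leb]_(x in eball x0 r%:E) ((w x)%:E *
       \int[leb]_(y in eball x (2%:E * R0%:E))
         (v y `^ (p - 1) / enorm (x - y) `^ (n%:R + s * p))%:E)
   <= (H / (1 - s))%:E *
      ((c + `|k| `^ p / rho `^ (n%:R * eps))%:E
         * leb A `^ (1 - s * p / n%:R + eps)
       + (rho `^ ((1 - s) * p) / (rho - r) `^ p)%:E
         * \int[leb]_(x in eball x0 rho%:E) (w x `^ p)%:E
       + (rho `^ (n%:R + s * p) / (rho - r) `^ (n%:R + s * p))%:E
         * \int[leb]_(x in eball x0 rho%:E) (w x)%:E
         * ((1 - s)%:E * \int[leb]_(y in ~` eball x0 r%:E)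
             (w y `^ (p - 1) / enorm (y - x0) `^ (n%:R + s * p))%:E)))%E.
Proof.
move=> s01 p1 w0; have p0 : 0 < p by exact: lt_trans ltr01 p1.
have wE x : `|w x| = w x by rewrite ger0_norm.
rewrite /DG_ineq (gagliardo_powR _ _ _ p0) (Lp_norm_powR _ _ p0) Lp_norm1.
rewrite (tail_powR _ _ _ s01 p1).
have e1 U : (\int[leb]_(x in U) (`|w x| `^ p)%:E = \int[leb]_(x in U) (w x `^ p)%:E)%E.
  by apply: eq_integral => x _; rewrite wE.
have e2 U : (\int[leb]_(x in U) `|w x|%:E = \int[leb]_(x in U) (w x)%:E)%E.
  by apply: eq_integral => x _; rewrite wE.
have e3 U : (\int[leb]_(x in U) (`|w x| `^ (p - 1) / enorm (x - x0) `^ (n%:R + s * p))%:E =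
    \int[leb]_(x in U) (w x `^ (p - 1) / enorm (x - x0) `^ (n%:R + s * p))%:E)%E.
  by apply: eq_integral => x _; rewrite wE.
by rewrite e1 e2 e3.
Qed.

End norms.

Lemma powR_le1D (R : realType) (t a b : R) : 0 <= t -> 0 <= a <= b ->
  t `^ a <= 1 + t `^ b.
Proof.
move=> t0 /andP[a0 ab]; have [t1|t1] := leP t 1.
  have := ler_powR2r a0 t0 t1; rewrite powR1 => h; apply: le_trans h _.
  by rewrite lerDl; exact: powR_ge0.
apply: (@le_trans _ _ (t `^ b)); last by rewrite lerDr.
by apply: ler_powR ab; exact: ltW.
Qed.

Section membership.
Context {R : realType} {n : nat}.
Local Notation E := (Rn R n).
Local Notation leb := (@lebesgue R n).
Local Notation lebleb := (leb \x leb)%E.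
Variables (s p : R) (Omega : set E) (u : E -> R).
Hypotheses (n0 : (0 < n)%N) (s01 : 0 < s < 1) (p1 : 1 < p).
Hypotheses (oO : open Omega) (O0 : Omega !=set0).
Hypothesis hu : in_energy_space s p Omega u.
Local Notation a := (n%:R + s * p).

Let mO : measurable Omega. Proof. exact: open_measurable_Rn. Qed.
Let mu : measurable_fun setT u. Proof. by case: hu. Qed.
Let p0 : 0 < p. Proof. exact: lt_trans ltr01 p1. Qed.
Let a0 : 0 < a.
Proof. by apply: addr_gt0; rewrite ?ltr0n// mulr_gt0//; have /andP[] := s01. Qed.

Let mC : measurable (cross_set Omega). Proof. exact: measurable_cross_set. Qed.

Lemma difference_quotient_ge0 w (z : E * E) : 0 <= difference_quotient s p w z.
Proof. exact: divr_ge0 (powR_ge0 _ _) (powR_ge0 _ _). Qed.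

Lemma energy_space_sub (D : set (E * E)) : D `<=` cross_set Omega ->
  (\int[lebleb]_(z in D) (difference_quotient s p u z)%:E < +oo)%E.
Proof.
move=> DC; have [_ _ fin] := hu; apply: le_lt_trans fin.
rewrite integral_mkcond [leRHS]integral_mkcond; apply: le_integral_ge0 => z _.
  by rewrite patchE; case: ifP => _ //; rewrite lee_fin; exact: difference_quotient_ge0.
rewrite !patchE; case: ifPn => [|_].
  by rewrite inE => /DC zC; rewrite mem_set//; exact: lexx.
by case: ifP => _ //; rewrite lee_fin; exact: difference_quotient_ge0.
Qed.

Lemma energy_space_in_Wsp : in_Wsp s p Omega u.
Proof.
have [mu' lp _] := hu; split => //; rewrite /gagliardo; apply: poweR_lty.
by apply: energy_space_sub => z [z1 _] [/= h _].
Qed.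

(** By Tonelli: if every section over [Omega] were infinite, so would be the integral over [Omega]
    times the whole space, as a nonempty open set has positive measure here. *)
Lemma energy_space_section : 0 < @unit_ball_volume R n ->
  exists2 x, Omega x & (\int[leb]_y (difference_quotient s p u (x, y))%:E < +oo)%E.
Proof.
move=> v0; apply: contrapT => h.
have inf x : Omega x -> (\int[leb]_y (difference_quotient s p u (x, y))%:E = +oo)%E.
  by move=> Ox; apply/eqP; rewrite -leye_eq leNgt; apply/negP => fin; apply: h; exists x.
have mI : measurable_fun setT (\1_Omega : E -> R) by exact: measurable_indic mO.
have mD := measurable_difference_quotient p s mu.
have fin : (\int[lebleb]_(z in Omega `*` setT) (difference_quotient s p u z)%:E < +oo)%E.
  by apply: energy_space_sub => z [z1 _] [/= /(_ z1)].
move: fin; rewrite integral_indicR.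
have -> : (\int[lebleb]_z (\1_(Omega `*` setT) z * difference_quotient s p u z)%:E =
    \int[lebleb]_z (\1_Omega z.1 * difference_quotient s p u z)%:E)%E.
  apply: eq_integral => z _; congr (_ * _)%:E; rewrite !indicE; congr (nat_of_bool _)%:R.
  by apply/idP/idP; rewrite !inE => // -[].
have I0 x := @indicR_ge0 _ R Omega x.
rewrite (integral_prod_mull mI mD I0 (difference_quotient_ge0 u)).
apply/negP; rewrite -leNgt.
have vO := open_lebesgue_gt0 v0 oO O0.
apply: (@le_trans _ _ (\int[leb]_(x in Omega) +oo)%E).
  by rewrite (integral_cst leb mO) gt0_mulye.
rewrite integral_mkcond; apply: le_integral_ge0 => x _.
  by rewrite patchE; case: ifP.
rewrite patchE; case: ifPn => [|_]; first by rewrite inE => Ox; rewrite inf// indicE mem_set// mul1e.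
apply: mule_ge0; first by rewrite lee_fin.
by apply: integral_ge0 => y _; rewrite lee_fin; exact: difference_quotient_ge0.
Qed.

(** First |u(x)|^(p-1) <= 1 + |u(x)|^p, then |u(x)|^p is split through the value at [y]. Since |y-x|
    <= (1+|y|)(1+|x|), the tail weight is at most a multiple, depending on [y], of the weight of the
    difference quotient. *)
Lemma tail_pointwise (x y : E) :
  `|u x| `^ (p - 1) / (1 + enorm x) `^ a <=
  2 `^ p / 2 * (1 + enorm y) `^ a * difference_quotient s p u (y, x) +
  (1 + 2 `^ p / 2 * `|u y| `^ p) * ((1 + enorm x) `^ a)^-1.
Proof.
have X0 : 0 < 1 + enorm x by have := enorm_ge0 x; lra.
have Y0 : 0 < 1 + enorm y by have := enorm_ge0 y; lra.
have Xa : 0 < (1 + enorm x) `^ a by exact: powR_gt0.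
have Ya : 0 < (1 + enorm y) `^ a by exact: powR_gt0.
have c0 : 0 <= 2 `^ p / 2 :> R by apply: divr_ge0 => //; exact: powR_ge0.
have dq : `|u y - u x| `^ p * ((1 + enorm x) `^ a)^-1 <=
    (1 + enorm y) `^ a * difference_quotient s p u (y, x).
  rewrite /difference_quotient/=.
  have [e0|e0] := eqVneq (enorm (y - x)) 0.
    rewrite (subr0_eq (enorm_eq0 e0)).
    rewrite subrr normr0 powR0 ?gt_eqF// !mul0r mulr0//.
  have e1 : 0 < enorm (y - x) by rewrite lt_neqAle eq_sym e0 enorm_ge0.
  have ea : 0 < enorm (y - x) `^ a by exact: powR_gt0.
  have le : enorm (y - x) `^ a <= (1 + enorm y) `^ a * (1 + enorm x) `^ a.
    rewrite -(powRM _ (ltW Y0) (ltW X0)); apply: (ler_powR2r (ltW a0) (enorm_ge0 _)).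
    have := enorm_triangleB 0 y x; rewrite subr0 sub0r enormN.
    have := mulr_ge0 (enorm_ge0 y) (enorm_ge0 x); rewrite mulrDr mulrDl; lra.
  rewrite mulrCA; apply: ler_wpM2l; first exact: powR_ge0.
  by rewrite -[leLHS]mul1r ler_pdivrMr// mulrAC ler_pdivlMr// mul1r.
have up : `|u x| `^ (p - 1) <=
    1 + 2 `^ p / 2 * (`|u y - u x| `^ p + `|u y| `^ p).
  have pp : 0 <= p - 1 <= p by rewrite subr_ge0 ltW//= gerBl.
  apply: le_trans (powR_le1D (normr_ge0 _) pp) _; rewrite lerD2l.
  apply: le_trans _ (powRD_le p1 (normr_ge0 _) (normr_ge0 _)).
  apply: (ler_powR2r (ltW p0) (normr_ge0 _)).
  by rewrite -(normrN (u y - u x)) opprB; have := ler_normD (u x - u y) (u y); rewrite subrK.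
apply: (@le_trans _ _ ((1 + 2 `^ p / 2 * (`|u y - u x| `^ p + `|u y| `^ p)) /
   (1 + enorm x) `^ a)).
  by apply: ler_wpM2r up; rewrite invr_ge0 ltW.
have := ler_wpM2l c0 dq.
move: (2 `^ p / 2) (`|u y - u x| `^ p) (`|u y| `^ p) ((1 + enorm x) `^ a)^-1.
move: ((1 + enorm y) `^ a) (difference_quotient _ _ _ _) => A D c d e f h.
have gen1 : (1 + c * (d + e)) * f = c * (d * f) + (1 + c * e) * f by ring.
by rewrite gen1 lerD2r -mulrA.
Qed.

Lemma energy_space_in_tail_space : in_tail_space s p u.
Proof.
split => //.
have mT : measurable_fun setT (fun x : E => ((1 + enorm x) `^ a)^-1).
  have me : measurable_fun setT (fun x : E => enorm x).
    have := @measurable_enormB_cst R n 0.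
    by under eq_fun do rewrite subr0.
  have m1 : measurable_fun setT (fun x : E => 1 + enorm x).
    by apply: (@measurable_funD _ E R setT (cst 1) (fun x => enorm x)).
  under eq_fun do rewrite -powRN.
  exact: (measurableT_comp (measurable_powR (- a)) m1).
(* If the unit ball had volume 0, the integral would vanish; otherwise some section is finite. *)
have [v0|v0] := ltP 0 (@unit_ball_volume R n); last first.
  have v00 : @unit_ball_volume R n = 0.
    by apply/eqP; rewrite eq_le v0 unit_ball_volume_ge0.
  rewrite (_ : integral _ _ _ = 0%E)//.
  apply: null_set_integral; first exact: measurableT.
    apply/measurable_EFinP; apply: measurable_funM.
      exact: measurableT_comp (measurable_powR _) (measurableT_comp (@normr_measurable R setT) mu).
    exact: mT.
  exact: (lebesgue0 v00 measurableT).
have [y Oy fin] := energy_space_section v0.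
have sp0 : 0 < s * p by apply: mulr_gt0 => //; have /andP[] := s01.
have tw := @tail_weight_fin R n (s * p) sp0.
pose c1 := 2 `^ p / 2 * (1 + enorm y) `^ a.
pose c2 := 1 + 2 `^ p / 2 * `|u y| `^ p.
have c10 : 0 <= c1 by exact: mulr_ge0 (divr_ge0 (powR_ge0 _ _) (ler0n _ 2)) (powR_ge0 _ _).
have c20 : 0 <= c2 by exact: addr_ge0 ler01 (mulr_ge0 (divr_ge0 (powR_ge0 _ _) (ler0n _ 2)) (powR_ge0 _ _)).
have D0 x : (0 <= (difference_quotient s p u (y, x))%:E)%E.
  by rewrite lee_fin; exact: difference_quotient_ge0.
have W0 (x : E) : (0 <= (((1 + enorm x) `^ a)^-1)%:E)%E.
  by rewrite lee_fin invr_ge0; exact: powR_ge0.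
have mD : measurable_fun setT (fun x => (difference_quotient s p u (y, x))%:E).
  apply/measurable_EFinP.
  exact: (measurableT_comp (measurable_difference_quotient p s mu) (measurable_pair1 y)).
have mW : measurable_fun setT (fun x : E => (((1 + enorm x) `^ a)^-1)%:E).
  by apply/measurable_EFinP; exact: mT.
apply: (@le_lt_trans _ _ (\int[leb]_x (c1%:E * (difference_quotient s p u (y, x))%:E +
    c2%:E * (((1 + enorm x) `^ a)^-1)%:E))%E).
  apply: le_integral_ge0 => x _.
    by rewrite lee_fin; exact: divr_ge0 (powR_ge0 _ _) (powR_ge0 _ _).
  by rewrite -!EFinM -EFinD lee_fin; exact: tail_pointwise.
have cD0 x : (0 <= c1%:E * (difference_quotient s p u (y, x))%:E)%E by exact: mule_ge0.
have cW0 (x : E) : (0 <= c2%:E * (((1 + enorm x) `^ a)^-1)%:E)%E by exact: mule_ge0.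
rewrite (ge0_integralD leb measurableT (fun x _ => cD0 x) (measurable_funeM _ mD)
  (fun x _ => cW0 x) (measurable_funeM _ mW)).
rewrite (ge0_integralZl_EFin leb measurableT (fun x _ => D0 x) mD c10).
rewrite (ge0_integralZl_EFin leb measurableT (fun x _ => W0 x) mW c20).
by apply: lte_add_pinfty; apply: lte_mul_pinfty; rewrite ?lee_fin.
Qed.

End membership.

(** * Growth of order at most p *)

Lemma combine_bounds (R : realType) (A B C near far H : R) (SN G Q P Z : \bar R) :
  0 <= A -> 0 <= B -> 0 <= C -> 0 <= near -> 0 <= far ->
  (0 <= G)%E -> (0 <= Q)%E -> (0 <= P)%E -> (0 <= Z)%E ->
  (G <= C%:E * (Q + P))%E ->
  (SN <= A%:E * (B%:E * G + (near%:E * P + far%:E * Z)))%E ->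
  A * (B * C + near + far) <= H ->
  (SN <= H%:E * (Q + P + Z))%E.
Proof.
move=> A0 B0 C0 n0 f0 G0 Q0 P0 Z0 GQ SNle AH.
have QP0 : (0 <= Q + P)%E by exact: adde_ge0.
have W0 : (0 <= Q + P + Z)%E by exact: adde_ge0.
have QPW : (Q + P <= Q + P + Z)%E by exact: leeDl.
have PW : (P <= Q + P + Z)%E by apply: le_trans QPW; exact: leeDr.
have ZW : (Z <= Q + P + Z)%E by exact: leeDr.
have t0 : (B%:E * G <= (B * C)%:E * (Q + P + Z))%E.
  rewrite EFinM -muleA; apply: lee_wpmul2l; first by rewrite lee_fin.
  by apply: le_trans GQ _; apply: lee_wpmul2l; rewrite ?lee_fin.
have t1 : (near%:E * P <= near%:E * (Q + P + Z))%E by apply: lee_wpmul2l; rewrite ?lee_fin.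
have t2 : (far%:E * Z <= far%:E * (Q + P + Z))%E by apply: lee_wpmul2l; rewrite ?lee_fin.
apply: le_trans SNle _.
apply: (@le_trans _ _ (A%:E * ((B * C + near + far)%:E * (Q + P + Z)))%E).
  apply: lee_wpmul2l; first by rewrite lee_fin.
  apply: le_trans (leeD t0 (leeD t1 t2)) _; rewrite addeA.
  have BC0 : 0 <= B * C by exact: mulr_ge0.
  rewrite 2!EFinD ge0_muleDl ?adde_ge0 ?lee_fin//.
  by rewrite ge0_muleDl ?lee_fin.
by rewrite muleA -EFinM; apply: lee_wpmul2r; rewrite ?lee_fin.
Qed.

(** The factor 2 Lambda inverts the coefficient of the gain, whose 1-s goes into H/(1-s). The three
    terms come from the potential, the near loss and the far loss, and 1 is added to have H >= 1. *)
Definition caccioppoli_constant {R : realType} (n : nat) (p Lambda C : R) : R :=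
  2 * Lambda * (4 * p * C + @near_constant R n p Lambda + 2 * p * (Lambda * 2 `^ (n%:R + p))) + 1.

Lemma measurable_superlevel (R : realType) (n : nat) (u : Rn R n -> R) x0 (rho k : R) :
  measurable_fun setT u -> measurable (eball x0 rho%:E `&` [set x | k < u x]).
Proof.
move=> mu; apply: measurableI; first exact: measurable_eball.
rewrite -[[set _ | _]]setTI (_ : [set x | k < u x] = u @^-1` `]k, +oo[).
  exact: (mu measurableT).
by apply/seteqP; split=> z; rewrite /= in_itv/= andbT.
Qed.

Section growth.
Context {R : realType} {n : nat}.
Local Notation E := (Rn R n).
Local Notation leb := (@lebesgue R n).
Local Notation lebleb := (leb \x leb)%E.
Variables (s p Lambda r0 d1 d2 q : R) (Omega : set E).
Variables (K : E -> E -> \bar R) (F : E -> R -> R) (u : E -> R).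
Hypotheses (n0 : (0 < n)%N) (s01 : 0 < s < 1) (p1 : 1 < p) (L1 : 1 <= Lambda).
Hypothesis hK : kernel_assumption s p Lambda r0 K.
Hypotheses (oO : open Omega) (bO : bounded_set Omega).
Hypothesis mF : forall v : E -> R, measurable_fun setT v -> measurable_fun setT (fun x => F x (v x)).
Hypotheses (d10 : 0 <= d1) (d20 : 0 <= d2).
Hypothesis hF : growth_assumption Omega F d1 d2 q.
Hypothesis hu : subminimizer s p K F Omega u.

Local Notation a := (n%:R + s * p).
Local Notation B x0 t := (eball x0 t%:E).
Local Notation w k := ((u \- cst k)^\+)%R.
Local Notation wm k := ((u \- cst k)^\-)%R.

Let mu : measurable_fun setT u. Proof. by case: hu => -[]. Qed.
Let mO : measurable Omega. Proof. exact: open_measurable_Rn. Qed.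
Let p0 : 0 < p. Proof. exact: lt_trans ltr01 p1. Qed.
Let s1 : 0 < 1 - s. Proof. by rewrite subr_gt0; have /andP[] := s01. Qed.
Let L0 : 0 < Lambda. Proof. exact: lt_le_trans L1. Qed.

Definition growth_bound (k : R) (x : E) : R := d1 + d2 * (`|u x| + `|k|) `^ q.

Lemma growth_bound_ge0 k x : 0 <= growth_bound k x.
Proof. exact: addr_ge0 d10 (mulr_ge0 d20 (powR_ge0 _ _)). Qed.

Let mabs (k : R) : measurable_fun setT (fun x : E => `|u x| + `|k|).
Proof.
apply: (@measurable_funD _ E R setT (fun x => `|u x|) (cst `|k|)); last exact: measurable_cst.
exact: (measurableT_comp (@normr_measurable R setT) mu).
Qed.

Lemma measurable_growth_bound k : measurable_fun setT (growth_bound k).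
Proof.
have m1 : measurable_fun setT (fun x : E => (`|u x| + `|k|) `^ q).
  exact: (measurableT_comp (measurable_powR q) (mabs k)).
apply: (@measurable_funD _ E R setT (cst d1) (fun x => d2 * (`|u x| + `|k|) `^ q)).
  exact: measurable_cst.
exact: (@measurable_funM _ E R setT (cst d2) _ (measurable_cst _) m1).
Qed.

(** What makes the growth bound integrable over the bounded set [Omega]; [P] will be [p] up to
    growth [p], and the Sobolev exponent above it. *)
Definition growth_integrable : Prop := d2 = 0 \/
  0 <= q /\ exists2 P, 1 < P /\ q <= P & (\int[leb]_(x in Omega) (`|u x| `^ P)%:E < +oo)%E.

Lemma growth_bound_fin k : growth_integrable ->
  (\int[leb]_(x in Omega) (growth_bound k x)%:E < +oo)%E.
Proof.
have Ofin : (leb Omega < +oo)%E by exact: bounded_lebesgue_fin.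
move=> [d2E|[q0 [P [P1 qP] uP]]].
  have -> : (\int[leb]_(x in Omega) (growth_bound k x)%:E =
      \int[leb]_(x in Omega) (cst d1%:E x))%E.
    by apply: eq_integral => x _; rewrite /growth_bound d2E mul0r addr0.
  rewrite (integral_cst leb mO); apply: lte_mul_pinfty; rewrite ?lee_fin//.
pose c1 := d1 + d2 * (1 + 2 `^ P / 2 * `|k| `^ P); pose c2 := d2 * (2 `^ P / 2).
have c0 : 0 <= 2 `^ P / 2 :> R by apply: divr_ge0 => //; exact: powR_ge0.
have c10 : 0 <= c1.
  apply: addr_ge0 d10 (mulr_ge0 d20 (addr_ge0 ler01 (mulr_ge0 c0 (powR_ge0 _ _)))).
have c20 : 0 <= c2 by exact: mulr_ge0 d20 c0.
have c10E (x : E) : Omega x -> (0 <= c1%:E)%E by rewrite lee_fin.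
have uP0 x : Omega x -> (0 <= (`|u x| `^ P)%:E)%E by rewrite lee_fin => _; exact: powR_ge0.
have muP : measurable_fun Omega (fun x => (`|u x| `^ P)%:E).
  apply/measurable_EFinP; apply: measurable_funTS.
  exact: measurableT_comp (measurable_powR _) (measurableT_comp (@normr_measurable R setT) mu).
have c2uP0 x : Omega x -> (0 <= c2%:E * (`|u x| `^ P)%:E)%E.
  by move=> Ox; apply: mule_ge0; [rewrite lee_fin|exact: uP0].
apply: (@le_lt_trans _ _ (\int[leb]_(x in Omega) (c1%:E + c2%:E * (`|u x| `^ P)%:E))%E).
  apply: le_integral_ge0 => x _; first by rewrite lee_fin; exact: growth_bound_ge0.
  rewrite -EFinM -EFinD lee_fin /growth_bound /c1 /c2.
  have t0 : 0 <= `|u x| + `|k| by exact: addr_ge0.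
  have qP' : 0 <= q <= P by rewrite q0.
  have h := le_trans (powR_le1D t0 qP') (lerD (lexx 1) (powRD_le P1 (normr_ge0 (u x)) (normr_ge0 k))).
  have := ler_wpM2l d20 h.
  move: (2 `^ P / 2) (`|u x| `^ P) (`|k| `^ P) => c e f h'.
  by move: h'; rewrite !mulrDr; lra.
rewrite (ge0_integralD leb mO c10E (measurable_cst _) c2uP0 (measurable_funeM _ muP)).
rewrite (ge0_integralZl_EFin leb mO uP0 muP c20).
apply: lte_add_pinfty; last by apply: lte_mul_pinfty; rewrite ?lee_fin.
by rewrite (integral_cst leb mO); apply: lte_mul_pinfty; rewrite ?lee_fin.
Qed.

Lemma growth_caccioppoli R0 x0 r rho k : growth_integrable ->
  0 < r -> r < rho -> rho <= R0 -> 2 * R0 <= r0 -> B x0 rho `<=` Omega ->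
  (\int[lebleb]_(z in B x0 r `*` B x0 r) (difference_quotient s p (w k) z)%:E +
     \int[leb]_(x in B x0 r) ((w k x)%:E * \int[leb]_(y in eball x (2%:E * R0%:E))
        (wm k y `^ (p - 1) / enorm (x - y) `^ a)%:E)
   <= (2 * Lambda / (1 - s))%:E * ((4 * p)%:E *
     \int[leb]_(x in B x0 rho `&` [set x | (k < u x)%R]) (growth_bound k x)%:E +
     caccioppoli_loss s p Lambda x0 r rho k u))%E.
Proof.
move=> gi r_gt0 r_rho rhoR0 R0r0 BO.
have Fg : {ae leb, forall x, Omega x -> forall t, `|t| <= `|u x| + `|k| -> `|F x t| <= growth_bound k x}.
  apply: filterS hF => x h Ox t tu; apply: le_trans (h Ox t) _.
  rewrite /growth_bound lerD2l; case: gi => [->|[q0 _]]; first by rewrite !mul0r.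
  by apply: ler_wpM2l => //; exact: ler_powR2r.
have := @caccioppoli_core R n s p Lambda r0 R0 x0 r rho k Omega K F u (growth_bound k)
  s01 p1 L1 hK r_gt0 r_rho rhoR0 R0r0 oO BO mF (measurable_growth_bound k) (growth_bound_ge0 k)
  (growth_bound_fin k gi) Fg hu.
set X := (X in (_ * X <= _)%E -> _) => h.
have c0 : 0 <= 2 * Lambda / (1 - s).
  by apply: divr_ge0 (ltW s1); apply: mulr_ge0 (ltW L0).
have := lee_wpmul2l (_ : (0 <= (2 * Lambda / (1 - s))%:E)%E) h.
rewrite lee_fin => /(_ c0); rewrite muleA -EFinM.
by rewrite (_ : 2 * Lambda / (1 - s) * _ = 1) ?mul1e//; field; rewrite !gt_eqF.
Qed.

End growth.

Section subcritical_growth.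
Context {R : realType} {n : nat}.
Local Notation E := (Rn R n).
Local Notation leb := (@lebesgue R n).
Local Notation lebleb := (leb \x leb)%E.
Variables (s p Lambda r0 d1 d2 q : R) (Omega : set E).
Variables (K : E -> E -> \bar R) (F : E -> R -> R) (u : E -> R).
Hypotheses (n0 : (0 < n)%N) (s01 : 0 < s < 1) (p1 : 1 < p) (L1 : 1 <= Lambda).
Hypothesis r00 : 0 < r0.
Hypothesis hK : kernel_assumption s p Lambda r0 K.
Hypotheses (oO : open Omega) (bO : bounded_set Omega) (O0 : Omega !=set0).
Hypothesis mF : forall v : E -> R, measurable_fun setT v -> measurable_fun setT (fun x => F x (v x)).
Hypotheses (d10 : 0 <= d1) (d20 : 0 <= d2).
Hypothesis hF : growth_assumption Omega F d1 d2 q.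
Hypothesis hu : subminimizer s p K F Omega u.

Local Notation a := (n%:R + s * p).
Local Notation B x0 t := (eball x0 t%:E).
Local Notation w k := ((u \- cst k)^\+)%R.
Local Notation wm k := ((u \- cst k)^\-)%R.
Local Notation A x0 rho k := (eball x0 rho%:E `&` [set x | (k < u x)%R]).

Let mu : measurable_fun setT u. Proof. by case: hu => -[]. Qed.
Let p0 : 0 < p. Proof. exact: lt_trans ltr01 p1. Qed.
Let s1 : 0 < 1 - s. Proof. by rewrite subr_gt0; have /andP[] := s01. Qed.
Let L0 : 0 < Lambda. Proof. exact: lt_le_trans L1. Qed.

Lemma near_constant_ge0 : 0 <= @near_constant R n p Lambda.
Proof.
rewrite /near_constant; apply: mulr_ge0; last exact: powR_ge0.
apply: mulr_ge0; last by apply: ltW; exact: radial_constant_gt0.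
by apply: mulr_ge0 (ltW L0); apply: mulr_ge0; [|exact: powR_ge0].
Qed.

Lemma far_constant_ge0 : 0 <= 2 * p * (Lambda * 2 `^ (n%:R + p)).
Proof.
by apply: mulr_ge0 (mulr_ge0 (ltW L0) (powR_ge0 _ _)); apply: mulr_ge0 (ltW p0).
Qed.

Lemma caccioppoli_constant_ge1 C : 0 <= C -> 1 <= caccioppoli_constant n p Lambda C.
Proof.
move=> C0; rewrite /caccioppoli_constant lerDr; apply: mulr_ge0.
  by apply: mulr_ge0 (ltW L0).
apply: addr_ge0 far_constant_ge0; apply: addr_ge0 near_constant_ge0.
by apply: mulr_ge0 C0; apply: mulr_ge0 (ltW p0).
Qed.

Lemma caccioppoli_of_growth (C eps R0 : R) x0 r rho (k : R) : 0 <= C ->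
  growth_integrable d2 q Omega u ->
  0 < r -> r < rho -> rho <= R0 -> 2 * R0 <= r0 -> B x0 rho `<=` Omega ->
  (\int[leb]_(x in A x0 rho k) (growth_bound d1 d2 q u k x)%:E <=
   C%:E * ((d1 + `|k| `^ p / rho `^ (n%:R * eps))%:E
            * leb (A x0 rho k) `^ (1 - s * p / n%:R + eps)
       + (rho `^ ((1 - s) * p) / (rho - r) `^ p)%:E
         * \int[leb]_(x in B x0 rho) (w k x `^ p)%:E))%E ->
  DG_ineq_plus s p d1 (caccioppoli_constant n p Lambda C) eps R0%:E x0 r rho k u.
Proof.
move=> C0 gi r_gt0 r_rho rhoR0 R0r0 BO hG.
have wk0 x : 0 <= w k x by exact: trunc_ge0.
rewrite /DG_ineq_plus (DG_ineqE _ _ _ _ _ _ _ _ _ _ s01 p1 wk0).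
have h := growth_caccioppoli s01 p1 L1 hK oO bO mF d10 d20 hF hu k gi r_gt0 r_rho rhoR0 R0r0 BO.
apply: (combine_bounds (A := 2 * Lambda / (1 - s)) (B := 4 * p) _ _ C0
  near_constant_ge0 far_constant_ge0 _ _ _ _ hG).
- by apply: divr_ge0 (ltW s1); apply: mulr_ge0 (ltW L0).
- by apply: mulr_ge0 (ltW p0).
- by apply: integral_ge0 => x _; rewrite lee_fin; exact: growth_bound_ge0.
- apply: mule_ge0; last exact: poweR_ge0.
  by rewrite lee_fin; exact: addr_ge0 d10 (divr_ge0 (powR_ge0 _ _) (powR_ge0 _ _)).
- apply: mule_ge0; first by rewrite lee_fin; exact: divr_ge0 (powR_ge0 _ _) (powR_ge0 _ _).
  by apply: integral_ge0 => x _; rewrite lee_fin; exact: powR_ge0.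
- apply: mule_ge0; last first.
    apply: mule_ge0; first by rewrite lee_fin ltW.
    by apply: integral_ge0 => x _; rewrite lee_fin; exact: divr_ge0 (powR_ge0 _ _) (powR_ge0 _ _).
  apply: mule_ge0; first by rewrite lee_fin; exact: divr_ge0 (powR_ge0 _ _) (powR_ge0 _ _).
  by apply: integral_ge0 => x _; rewrite lee_fin.
- by move: h; rewrite /caccioppoli_loss !EFinM !muleA.
- rewrite /caccioppoli_constant mulrAC; apply: ler_wpM2r; first by rewrite invr_ge0 ltW.
  by rewrite lerDl.
Qed.

Lemma caccioppoli_case_i : d2 = 0 ->
  caccioppoli_plus s p Omega d1 (caccioppoli_constant n p Lambda 1) -oo (s * p / n%:R) (r0 / 2)%:E u.
Proof.
move=> d2E x0 r rho k Ox0 r_gt0 r_rho; rewrite le_min => /andP[rhoR0 rhod] _.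
have BO := eball_sub_dist_boundary oO Ox0 rhod.
have R0r0 : 2 * (r0 / 2) <= r0 by rewrite mulrC divfK.
apply: (caccioppoli_of_growth ler01 (or_introl d2E) r_gt0 r_rho _ R0r0 BO); first by rewrite -lee_fin.
have mA : measurable (A x0 rho k).
  exact: measurable_superlevel.
(* With eps = s p / n the exponent of the measure is 1, so the integral of the constant d1 over the
   superlevel set already has the form of the first term. *)
rewrite mul1e subrK poweRe1//.
have -> : (\int[leb]_(x in A x0 rho k) (growth_bound d1 d2 q u k x)%:E =
      \int[leb]_(x in A x0 rho k) (cst d1%:E x))%E.
    by apply: eq_integral => x _; rewrite /growth_bound d2E mul0r addr0.
rewrite (integral_cst leb mA).
apply: (@le_trans _ _ ((d1 + `|k| `^ p / rho `^ (n%:R * (s * p / n%:R)))%:E * leb (A x0 rho k))%E).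
  apply: lee_wpmul2r; first exact: measure_ge0.
  by rewrite lee_fin lerDl; exact: divr_ge0 (powR_ge0 _ _) (powR_ge0 _ _).
apply: leeDl; apply: mule_ge0; first by rewrite lee_fin; exact: divr_ge0 (powR_ge0 _ _) (powR_ge0 _ _).
by apply: integral_ge0 => x _; rewrite lee_fin; exact: powR_ge0.
Qed.

Lemma superlevel_growth_integral (e c : R) x0 rho (k : R) : 0 <= c ->
  (forall x, k < u x -> growth_bound d1 d2 q u k x <= d1 + c * `|k| `^ e + c * w k x `^ e) ->
  (\int[leb]_(x in A x0 rho k) (growth_bound d1 d2 q u k x)%:E <=
   (d1 + c * `|k| `^ e)%:E * leb (A x0 rho k) +
   c%:E * \int[leb]_(x in B x0 rho) (w k x `^ e)%:E)%E.
Proof.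
move=> c0 hG; have mA : measurable (A x0 rho k) by exact: measurable_superlevel.
have mw : measurable_fun setT (w k) by exact: measurable_trunc.
have mwe D : measurable_fun D (fun x => (w k x `^ e)%:E).
  apply/measurable_EFinP; apply: measurable_funTS.
  exact: measurableT_comp (measurable_powR _) mw.
have we0 x : (0 <= (w k x `^ e)%:E)%E by rewrite lee_fin; exact: powR_ge0.
have cwe0 x : (0 <= c%:E * (w k x `^ e)%:E)%E by apply: mule_ge0.
have dc0 : 0 <= d1 + c * `|k| `^ e by exact: addr_ge0 d10 (mulr_ge0 c0 (powR_ge0 _ _)).
have dc0E (x : E) : A x0 rho k x -> (0 <= (d1 + c * `|k| `^ e)%:E)%E by rewrite lee_fin.
apply: (@le_trans _ _ (\int[leb]_(x in A x0 rho k)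
    ((d1 + c * `|k| `^ e)%:E + c%:E * (w k x `^ e)%:E))%E).
  apply: le_integral_ge0 => x Ax; first by rewrite lee_fin; exact: growth_bound_ge0.
  by rewrite -EFinM -EFinD lee_fin; apply: hG; case: Ax.
rewrite (ge0_integralD leb mA dc0E (measurable_cst _) (fun x _ => cwe0 x) (measurable_funeM _ (mwe _))).
rewrite (ge0_integralZl_EFin leb mA (fun x _ => we0 x) (mwe _) c0) (integral_cst leb mA).
apply: leeD; first exact: lexx.
apply: lee_wpmul2l; first by rewrite lee_fin.
by apply: (ge0_subset_integral leb mA (measurable_eball _ _) (mwe _) (fun x _ => we0 x)) => x [].
Qed.

(** For k >= 0 the sum |u|+|k| equals w + 2k above the level; 4^e is twice the factor 2^e, one for
    splitting the sum and one for 2k. *)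
Lemma superlevel_powR_le (e k : R) x : 1 < e -> 0 <= k -> k < u x ->
  (`|u x| + `|k|) `^ e <= 4 `^ e * (`|k| `^ e + w k x `^ e).
Proof.
move=> e1 k0 ku; have e0 : 0 < e by exact: lt_trans ltr01 e1.
have u0 : 0 < u x by exact: le_lt_trans ku.
have wE : w k x = u x - k by rewrite truncE; apply/max_idPl; rewrite subr_ge0 ltW.
have -> : `|u x| + `|k| = w k x + 2 * k.
  by rewrite wE !ger0_norm ?(ltW u0)//; ring.
have w0 : 0 <= w k x by exact: trunc_ge0.
have k20 : 0 <= 2 * k by rewrite mulr_ge0.
apply: le_trans (powRD_le e1 w0 k20) _.
rewrite (powRM _ (ler0n _ 2) k0) (ger0_norm k0).
have -> : 4 `^ e = 2 `^ e * 2 `^ e :> R.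
  by rewrite -powRM; [congr (_ `^ _); ring|exact: ler0n|exact: ler0n].
have t1 : 1 <= 2 `^ e :> R.
  have := ler_powR2r (ltW e0) ler01 (ler1n R 2); rewrite powR1; exact.
have ke := powR_ge0 k e; have we := powR_ge0 (w k x) e.
move: (2 `^ e) (k `^ e) (w k x `^ e) t1 ke we => t K' W t1 ke we.
have t0 : 0 <= t by lra.
have h1 : t / 2 * W <= t * t * W.
  apply: ler_wpM2r => //; apply: ler_wpM2l => //; lra.
have h2 : t / 2 * (t * K') <= t * t * K'.
  by rewrite mulrA; apply: ler_wpM2r => //; rewrite -mulrA; apply: ler_wpM2l => //; lra.
by rewrite !mulrDr; lra.
Qed.

(** On radii at most 1 the weight of the L^p term is at least 1 and so dominates the bare integral
    of w^p coming from the potential. *)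
Lemma scale_ge1 r rho : 0 < r -> r < rho -> rho <= 1 ->
  1 <= rho `^ ((1 - s) * p) / (rho - r) `^ p.
Proof.
move=> r_gt0 r_rho rho1; have rr : 0 < rho - r by rewrite subr_gt0.
have rho0 : 0 < rho by exact: lt_trans r_rho.
rewrite ler_pdivlMr ?powR_gt0// mul1r.
apply: (@le_trans _ _ (rho `^ p)).
  by apply: (ler_powR2r (ltW p0) (ltW rr)); rewrite gerBl ltW.
have sp : (1 - s) * p <= p by rewrite ler_piMl ?(ltW p0)// gerBl; have /andP[/ltW] := s01.
by have := @ger_powR _ rho _ _ _ sp; apply; rewrite rho0.
Qed.

Lemma caccioppoli_case_ii : 1 <= q <= p -> (\int[leb]_(x in Omega) (`|u x| `^ p)%:E < +oo)%E ->
  caccioppoli_plus s p Omega d1 (caccioppoli_constant n p Lambda (1 + d2 * 4 `^ p)) 1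
    (s * p / n%:R) (Num.min 1 (r0 / 2))%:E u.
Proof.
move=> /andP[q1 qp] up x0 r rho k Ox0 r_gt0 r_rho; rewrite le_min => /andP[rhoR0 rhod].
rewrite lee_fin => k1.
have BO := eball_sub_dist_boundary oO Ox0 rhod.
have R0r0 : 2 * Num.min 1 (r0 / 2) <= r0.
  by rewrite mulrC -ler_pdivlMr// ge_min lexx orbT.
rewrite lee_fin in rhoR0.
have rho1 : rho <= 1 by apply: le_trans rhoR0 _; rewrite ge_min lexx.
have rho0 : 0 < rho by exact: lt_trans r_rho.
have q0 : 0 <= q by exact: le_trans ler01 q1.
have gi : growth_integrable d2 q Omega u by right; split => //; exists p.
have k0 : 0 <= k by exact: le_trans k1.
have c0 : 0 <= d2 * 4 `^ p by exact: mulr_ge0 d20 (powR_ge0 _ _).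
have C0 : 0 <= 1 + d2 * 4 `^ p by exact: addr_ge0.
apply: (caccioppoli_of_growth C0 gi r_gt0 r_rho rhoR0 R0r0 BO).
have hG x : k < u x ->
    growth_bound d1 d2 q u k x <= d1 + d2 * 4 `^ p * `|k| `^ p + d2 * 4 `^ p * w k x `^ p.
  move=> ku; rewrite /growth_bound -addrA lerD2l -mulrDr -mulrA.
  apply: ler_wpM2l => //; apply: le_trans _ (superlevel_powR_le p1 k0 ku).
  (* Here k >= 1 is used: the base |u|+|k| is at least 1, so the exponent may be raised from [q] to
     [p]. *)
  apply: ler_powR qp; rewrite -[leLHS]add0r; apply: lerD => //.
  by rewrite ger0_norm.
apply: le_trans (superlevel_growth_integral _ _ c0 hG) _.
have leA : (leb (A x0 rho k) `^ (1 - s * p / n%:R + s * p / n%:R) = leb (A x0 rho k))%E.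
  by rewrite subrK poweRe1.
rewrite leA.
set Q := (X in (_ <= _ * (X + _))%E); set P := (X in (_ <= _ * (_ + X))%E).
have Q0 : (0 <= Q)%E.
  apply: mule_ge0; last exact: measure_ge0.
  by rewrite lee_fin; exact: addr_ge0 d10 (divr_ge0 (powR_ge0 _ _) (powR_ge0 _ _)).
have P0 : (0 <= P)%E.
  apply: mule_ge0; first by rewrite lee_fin; exact: divr_ge0 (powR_ge0 _ _) (powR_ge0 _ _).
  by apply: integral_ge0 => x _; rewrite lee_fin; exact: powR_ge0.
rewrite (ge0_muleDr _ Q0 P0) /Q /P.
rewrite !muleA -!EFinM; apply: leeD.
  apply: lee_wpmul2r; first exact: measure_ge0.
  rewrite lee_fin.
  have kr : `|k| `^ p <= `|k| `^ p / rho `^ (n%:R * (s * p / n%:R)).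
    rewrite ler_pdivlMr ?powR_gt0//; apply: ler_piMr; first exact: powR_ge0.
    have e0 : 0 <= n%:R * (s * p / n%:R) :> R.
      apply: mulr_ge0 => //; apply: divr_ge0 => //; apply: mulr_ge0 (ltW p0).
      by have /andP[/ltW] := s01.
    by have := ler_powR2r e0 (ltW rho0) rho1; rewrite powR1.
  have := ler_wpM2l c0 kr; have := mulr_ge0 c0 d10.
  have := powR_ge0 `|k| p; move: kr.
  move: (_ / _) (`|k| `^ p) (d2 * 4 `^ p) => X Y c h h0 h1 h2.
  by rewrite mulrDl !mulrDr; lra.
apply: lee_wpmul2r; first by apply: integral_ge0 => x _; rewrite lee_fin; exact: powR_ge0.
rewrite lee_fin; have X1 := scale_ge1 r_gt0 r_rho rho1.
move: (_ / _) X1 (d2 * 4 `^ p) c0 => X X1 c c0.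
have := ler_wpM2l c0 X1; rewrite mulrDl; lra.
Qed.

End subcritical_growth.

(** * Supercritical growth *)

Section iteration.
Variable R : realType.
Implicit Types (Phi Psi : R -> \bar R).

(** Moving halfway to [rad] multiplies the error terms by at most 2^N, and kappa 2^N <= 1/2 turns
    this into a contraction. [Phi], which is absorbed, must be bounded beforehand; [Psi] may contain
    further terms. *)
Lemma absorption_iteration Phi Psi (N a p kappa a1 a2 a3 f r rad : R) :
  0 <= p -> p <= N -> 0 <= a -> a <= N -> 0 <= kappa -> kappa * 2 `^ N <= 2^-1 ->
  0 <= a1 -> 0 <= a2 -> 0 <= a3 -> 0 <= f -> r < rad ->
  (forall rho, (Phi rho <= Psi rho)%E) ->
  (forall rho, r <= rho -> rho < rad -> (Phi rho <= f%:E)%E) ->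
  (forall rho tau, r <= rho -> rho < tau -> tau < rad ->
    (Psi rho <= kappa%:E * Phi tau +
       (a1 + a2 / (tau - rho) `^ p + a3 / (tau - rho) `^ a)%:E)%E) ->
  (Psi r <= (2 * 2 `^ N * (a1 + a2 / (rad - r) `^ p + a3 / (rad - r) `^ a))%:E)%E.
Proof.
move=> p0 pN a0 aN k0 kN a10 a20 a30 f0 r_rad PP Pf step.
pose b rho := a1 + a2 / (rad - rho) `^ p + a3 / (rad - rho) `^ a.
have T1 : 1 <= 2 `^ N :> R.
  have := ler_powR2r (le_trans p0 pN) ler01 (ler1n R 2); rewrite powR1; exact.
have bhalf (e c d : R) : 0 <= e -> e <= N -> 0 <= c -> 0 < d ->
    c / (d / 2) `^ e <= 2 `^ N * (c / d `^ e).
  move=> e0 eN c0 d0.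
  rewrite (_ : c / (d / 2) `^ e = 2 `^ e * (c / d `^ e)); last first.
    rewrite (powRM _ (ltW d0)) ?invr_ge0//.
    have -> : (2^-1 : R) `^ e = (2 `^ e)^-1 by rewrite -powR_inv1 ?ler0n// -powRrM mulN1r powRN.
    by rewrite invfM invrK; ring.
  apply: ler_wpM2r; first by rewrite divr_ge0 ?powR_ge0.
  by apply: ler_powR => //; exact: ler1n.
have b_half rho : rho < rad -> a1 + a2 / ((rad - rho) / 2) `^ p + a3 / ((rad - rho) / 2) `^ a
    <= 2 `^ N * b rho.
  move=> h; have d0 : 0 < rad - rho by rewrite subr_gt0.
  have h1 := bhalf p a2 _ p0 pN a20 d0; have h2 := bhalf a a3 _ a0 aN a30 d0.
  have h3 : a1 <= 2 `^ N * a1 by rewrite ler_peMl.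
  by rewrite /b !mulrDr; lra.
have b0 rho : 0 <= b rho.
  by rewrite /b !addr_ge0// divr_ge0 ?powR_ge0.
(* The multiple 2 2^N of [b] is reproduced: one step returns kappa 2 2^N 2^N b, at most 2^N b, and
   adds 2^N b, while the a priori bound [f] is at least halved. *)
have claim j : forall rho, r <= rho -> rho < rad ->
    (Psi rho <= (2^-1 ^+ j * f + 2 * 2 `^ N * b rho)%:E)%E.
  elim: j => [|j IHj] rho rrho rhorad.
    have h1 : rho < (rho + rad) / 2 by lra.
    have h2 : (rho + rad) / 2 < rad by lra.
    apply: le_trans (step _ _ rrho h1 h2) _.
    apply: (@le_trans _ _ (kappa%:E * f%:E + (2 `^ N * b rho)%:E)%E).
      apply: leeD; last first.
        by rewrite lee_fin (_ : (rho + rad) / 2 - rho = (rad - rho) / 2) ?b_half//; lra.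
      by apply: lee_wpmul2l; rewrite ?lee_fin// Pf//; lra.
    rewrite -EFinM -EFinD lee_fin expr0 mul1r; apply: lerD.
      rewrite ler_piMl//; have : kappa <= kappa * 2 `^ N by rewrite ler_peMr.
      by lra.
    by rewrite ler_wpM2r//; lra.
  have h1 : rho < (rho + rad) / 2 by lra.
  have h2 : (rho + rad) / 2 < rad by lra.
  apply: le_trans (step _ _ rrho h1 h2) _.
  have h3 : r <= (rho + rad) / 2 by lra.
  have IH := le_trans (PP _) (IHj _ h3 h2).
  apply: (@le_trans _ _ (kappa%:E * (2^-1 ^+ j * f + 2 * 2 `^ N * b ((rho + rad) / 2))%:E +
      (2 `^ N * b rho)%:E)%E).
    apply: leeD; last first.
      by rewrite lee_fin (_ : (rho + rad) / 2 - rho = (rad - rho) / 2) ?b_half//; lra.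
    by apply: lee_wpmul2l; rewrite ?lee_fin.
  rewrite -EFinM -EFinD lee_fin.
  have bb : b ((rho + rad) / 2) <= 2 `^ N * b rho.
    by rewrite {1}/b (_ : rad - (rho + rad) / 2 = (rad - rho) / 2) ?b_half//; lra.
  have kk : kappa <= 2^-1 by apply: le_trans kN; rewrite ler_peMr.
  have j0 : 0 <= 2^-1 ^+ j * f by rewrite mulr_ge0// exprn_ge0// invr_ge0.
  have t1 : kappa * (2^-1 ^+ j * f) <= 2^-1 * (2^-1 ^+ j * f) by rewrite ler_wpM2r.
  have t2 : kappa * (2 * 2 `^ N * b ((rho + rad) / 2)) <= kappa * (2 * 2 `^ N * (2 `^ N * b rho)).
    by rewrite ler_wpM2l// ler_wpM2l// mulr_ge0 ?powR_ge0.
  have t3 : (kappa * 2 `^ N) * (2 * (2 `^ N * b rho)) <= 2^-1 * (2 * (2 `^ N * b rho)).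
    by rewrite ler_wpM2r// mulr_ge0// mulr_ge0 ?powR_ge0.
  have -> : 2^-1 ^+ j.+1 * f = 2^-1 * (2^-1 ^+ j * f) by rewrite exprS mulrA.
  move: t1 t2 t3.
  move: (2^-1 ^+ j * f) (b _) (b _) (2 `^ N) => J b1 b2 T t1 t2 t3.
  have e2 : kappa * (2 * T * (T * b2)) = kappa * T * (2 * (T * b2)) by ring.
  by rewrite mulrDr; lra.
have lim : (fun j => (2^-1 ^+ j * f + 2 * 2 `^ N * b r)%:E) @ \oo -->
    (2 * 2 `^ N * b r)%:E.
  apply: cvg_EFin; first by near=> j.
  rewrite -[X in _ --> X]add0r -[X in _ --> X + _](mul0r f).
  apply: cvgD; last exact: cvg_cst.
  apply: cvgM; last exact: cvg_cst.
  by apply: cvg_expr; rewrite ger0_norm ?invr_ge0// invf_lt1// ltr1n.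
rewrite -(cvg_lim (@ereal_hausdorff R) lim); apply: lime_ge.
  by apply/cvg_ex; eexists; exact: lim.
by near=> j; apply: claim.
Unshelve. all: by end_near.
Qed.

End iteration.

Section exponents.
Variable R : realType.
Variables (n : nat) (s p q tau : R).
Hypotheses (n0 : (0 < n)%N) (s01 : 0 < s < 1) (p1 : 1 < p) (pq : p < q).

(* The order at which the fractional Sobolev exponent [n p / (n - sigma p)] equals [q]. *)
Definition critical_order : R := n%:R * (q - p) / (q * p).

Let p0 : 0 < p. Proof. exact: lt_trans ltr01 p1. Qed.
Let q0 : 0 < q. Proof. exact: lt_trans p0 pq. Qed.
Let nR0 : 0 < n%:R :> R. Proof. by rewrite ltr0n. Qed.

Lemma critical_order_gt0 : 0 < critical_order.
Proof. by rewrite divr_gt0 ?mulr_gt0 ?subr_gt0. Qed.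

Lemma critical_order_lt : s * p <= n%:R -> (q%:E < pstar n s p)%E -> critical_order < s.
Proof.
move=> spn; rewrite /pstar /critical_order ltr_pdivrMr ?mulr_gt0//; case: ifPn => [sp'|sp'] qP.
  move: qP; rewrite lte_fin ltr_pdivlMr ?subr_gt0// => h; nra.
(* An infinite Sobolev exponent, together with s p <= n, leaves only n = s p; then the critical
   order is s(q-p)/q. *)
have -> : n%:R = s * p by apply/eqP; rewrite eq_le spn andbT leNgt.
have /andP[s0 _] := s01; have spp : 0 < s * p * p by rewrite !mulr_gt0.
rewrite mulrBr; lra.
Qed.

Hypotheses (ct : critical_order < tau) (tpn : tau * p < n%:R).

Let P : R := n%:R * p / (n%:R - tau * p).
Let D0 : 0 < n%:R - tau * p. Proof. by rewrite subr_gt0. Qed.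

Lemma fine_pstar : pstar n tau p = P%:E.
Proof. by rewrite /pstar tpn. Qed.

Lemma pstar_gt0 : 0 < P. Proof. by rewrite divr_gt0 ?mulr_gt0. Qed.

(** Measures how far the order [tau] exceeds the critical one; this gives a positive parameter eps
    for the class. *)
Lemma deficit_exponent : n%:R * (1 - q / P) = q * (tau - critical_order).
Proof. by rewrite /P /critical_order; field; rewrite !gt_eqF. Qed.

Lemma deficit_exponent_gt0 : 0 < 1 - q / P.
Proof.
by rewrite -(pmulr_rgt0 _ nR0) deficit_exponent mulr_gt0// subr_gt0.
Qed.

Lemma lt_pstar : q < P.
Proof. by have := deficit_exponent_gt0; rewrite subr_gt0 ltr_pdivrMr ?pstar_gt0// mul1r. Qed.

Lemma level_exponent : s * p - n%:R * (q - p) / P =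
  p * (s - critical_order) + (q - p) * (tau - critical_order).
Proof. by rewrite /P /critical_order; field; rewrite !gt_eqF. Qed.

(** A lower bound free of [tau], and the reason why one radius serves all admissible Sobolev orders.
    It stays positive as [s] tends to 1 when the critical order is less than 1. *)
Lemma level_exponent_ge : p * (s - critical_order) <= s * p - n%:R * (q - p) / P.
Proof.
by rewrite level_exponent lerDl mulr_ge0// subr_ge0 ltW.
Qed.

(** Nonnegative for tau <= s. This is the room needed to trade powers of the measure for powers of
    the radius. *)
Lemma exponent_gap : s * p - n%:R * (q - p) / P - n%:R * (1 - q / P) = p * (s - tau).
Proof. by rewrite /P; field; rewrite !gt_eqF. Qed.

Hypothesis ts : tau <= s.

Lemma deficit_exponent_le : 1 - q / P <= s * p / n%:R.
Proof.
rewrite ler_pdivlMr// mulrC; have := exponent_gap.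
have h0 : 0 <= p * (s - tau) by apply: (mulr_ge0 (ltW p0)); rewrite subr_ge0.
move: h0.
have : 0 <= n%:R * (q - p) / P.
  by rewrite divr_ge0 ?(ltW pstar_gt0)// mulr_ge0// subr_ge0 ltW.
lra.
Qed.

End exponents.

Section superlevel_measure.
Variable R : realType.
Variables (n : nat) (s p q P eps M alpha k rad : R).
Hypotheses (n0 : (0 < n)%N) (s01 : 0 < s < 1) (p1 : 1 < p) (pq : p < q) (P0 : 0 < P).
Hypotheses (eps0 : 0 <= eps) (epsle : eps <= s * p / n%:R).
Hypothesis epsd : n%:R * eps <= s * p - n%:R * (q - p) / P.
Hypotheses (M0 : 0 < M) (k0 : 0 <= k) (rad0 : 0 < rad) (rad1 : rad <= 1).
Hypotheses (al0 : 0 <= alpha) (alr : alpha <= (2 * rad) ^+ n).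

Let p0 : 0 < p. Proof. exact: lt_trans ltr01 p1. Qed.
Let nR0 : 0 < n%:R :> R. Proof. by rewrite ltr0n. Qed.
Let spp : s * p <= p.
Proof. by rewrite ler_piMl ?(ltW p0)//; have /andP[_ /ltW] := s01. Qed.

Lemma powR_measure_le (b : R) : 0 <= b -> alpha `^ b <= (2 * rad) `^ (n%:R * b).
Proof.
move=> b0; have r20 : 0 <= 2 * rad by rewrite mulr_ge0 ?ltW.
apply: le_trans (ler_powR2r b0 al0 alr) _.
by rewrite -powR_mulrn// -powRrM.
Qed.

(** The missing power of the measure is at most that of (2 rad)^n, hence at most 2^p on radii up to
    1. *)
Lemma measure_le_powR : alpha <= 2 `^ p * alpha `^ (1 - s * p / n%:R + eps).
Proof.
have [->|aN0] := eqVneq alpha 0; first by rewrite mulr_ge0 ?powR_ge0.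
have g0 : 0 <= s * p / n%:R - eps by rewrite subr_ge0.
have e1 : alpha = alpha `^ (1 - s * p / n%:R + eps) * alpha `^ (s * p / n%:R - eps).
  by rewrite -powRD ?aN0 ?implybT//; rewrite -[LHS]powRr1//; congr (_ `^ _); ring.
rewrite {1}e1 mulrC; apply: ler_wpM2r; first exact: powR_ge0.
apply: le_trans (powR_measure_le g0) _.
have r20 : 0 <= 2 * rad by rewrite mulr_ge0 ?ltW.
have ng0 : 0 <= n%:R * (s * p / n%:R - eps) by rewrite mulr_ge0.
apply: (@le_trans _ _ (2 `^ (n%:R * (s * p / n%:R - eps)))).
  by apply: ler_powR2r => //; rewrite ler_piMr.
apply: ler_powR; first exact: ler1n.
rewrite mulrBr mulrC divfK ?gt_eqF//.
have : 0 <= n%:R * eps by rewrite mulr_ge0.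
by have := spp; lra.
Qed.

(** The Chebyshev bound raised to the power (q-p)/P trades k^(q-p) for M^(q-p) and a negative power
    of the measure. The power of the measure left over is nonnegative and is bounded by a power of
    the radius. *)
Lemma level_measure_le : k `^ P * alpha <= M `^ P ->
  k `^ q * alpha <= M `^ (q - p) * rad `^ (s * p - n%:R * (q - p) / P) *
    (2 `^ p * (k `^ p / rad `^ (n%:R * eps) * alpha `^ (1 - s * p / n%:R + eps))).
Proof.
move=> kM; set delta := s * p - _.
have qp0 : 0 < q - p by rewrite subr_gt0.
have q0 : 0 < q by exact: lt_trans pq.
have rhs0 : 0 <= M `^ (q - p) * rad `^ delta *
    (2 `^ p * (k `^ p / rad `^ (n%:R * eps) * alpha `^ (1 - s * p / n%:R + eps))).
  by rewrite !mulr_ge0 ?powR_ge0// ?invr_ge0 ?powR_ge0.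
have [aE|aN0] := eqVneq alpha 0; first by rewrite {1}aE mulr0.
have agt : 0 < alpha by rewrite lt_neqAle eq_sym aN0.
have kM1 : k `^ (q - p) <= M `^ (q - p) * alpha `^ (- ((q - p) / P)).
  have e : 0 <= (q - p) / P by rewrite divr_ge0 ?ltW.
  have kPa : 0 <= k `^ P * alpha by rewrite mulr_ge0 ?powR_ge0.
  have := ler_powR2r e kPa kM.
  rewrite powRM ?powR_ge0 ?(ltW agt)// -!powRrM.
  rewrite (_ : P * ((q - p) / P) = q - p); last by field; rewrite gt_eqF.
  by rewrite powRN ler_pdivlMr// powR_gt0.
have g0 : 0 <= s * p / n%:R - eps - (q - p) / P.
  rewrite -(pmulr_rge0 _ nR0).
  rewrite (_ : n%:R * _ = s * p - n%:R * (q - p) / P - n%:R * eps) ?subr_ge0//.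
  by field; rewrite !gt_eqF.
have kq : k `^ q = k `^ p * k `^ (q - p).
  have [->|kN0] := eqVneq k 0.
    by rewrite !powR0 ?mul0r// gt_eqF.
  by rewrite -powRD ?kN0 ?implybT//; congr (_ `^ _); ring.
have aE : alpha `^ (- ((q - p) / P)) * alpha =
    alpha `^ (1 - s * p / n%:R + eps) * alpha `^ (s * p / n%:R - eps - (q - p) / P).
  rewrite -{2}(powRr1 al0) -!powRD ?aN0 ?implybT//; congr (_ `^ _); ring.
have h1 : k `^ q * alpha <= k `^ p * (M `^ (q - p) *
    (alpha `^ (1 - s * p / n%:R + eps) * alpha `^ (s * p / n%:R - eps - (q - p) / P))).
  rewrite kq -aE -mulrA; apply: ler_wpM2l; first exact: powR_ge0.
  by rewrite [leRHS]mulrA; apply: ler_wpM2r kM1.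
apply: le_trans h1 _.
have h2 : alpha `^ (s * p / n%:R - eps - (q - p) / P) <=
    2 `^ p * (rad `^ delta * (rad `^ (n%:R * eps))^-1).
  apply: le_trans (powR_measure_le g0) _.
  have -> : n%:R * (s * p / n%:R - eps - (q - p) / P) = delta - n%:R * eps.
    by rewrite /delta; field; rewrite !gt_eqF.
  rewrite powRM ?ler0n ?(ltW rad0)//.
  rewrite -powRN -powRD ?(gt_eqF rad0) ?implybT//.
  apply: ler_wpM2r; first exact: powR_ge0.
  apply: ler_powR; first exact: ler1n.
  have : 0 <= n%:R * eps by rewrite mulr_ge0.
  have : 0 <= n%:R * (q - p) / P by rewrite divr_ge0 ?(ltW P0)// mulr_ge0 ?(ltW qp0).
  by rewrite /delta; have := spp; lra.
have c0 : 0 <= k `^ p * (M `^ (q - p) * alpha `^ (1 - s * p / n%:R + eps)).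
  by rewrite !mulr_ge0 ?powR_ge0.
have := ler_wpM2l c0 h2.
move: (k `^ p) (M `^ (q - p)) (alpha `^ (1 - _ + _)) (alpha `^ (_ - _ - _)) => a b c d.
move: (2 `^ p) (rad `^ delta) (_^-1) => e f g h.
have e1 : a * (b * (c * d)) = a * (b * c) * d by ring.
have e2 : b * f * (e * (a * g * c)) = a * (b * c) * (e * (f * g)) by ring.
by rewrite e1 e2.
Qed.

End superlevel_measure.

(** The product in parentheses is the coefficient with which the energy of [w] returns, apart from
    powers of [M] and of the radius; 2 2^(n+p) is the reciprocal of the [kappa] allowed by the
    iteration. *)
Definition supercritical_constant {R : realType} (n : nat) (p q Lambda d2 : R) : R :=
  1 + 2 * 2 `^ (n%:R + p) * (2 * Lambda * (4 * p) * (d2 * 4 `^ q) * @level_constant R n p q).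

(** The last entry solves C (M+1)^(q-p) R^d = 1 - 2^(-d), with C the constant above, so that the
    geometric series over scales is small too. Using [M + 1] avoids division by 0, and the other
    entries keep 2 R0 <= r0 and R0 <= 1. *)
Definition supercritical_radius {R : realType} (n : nat) (s p q Lambda d2 r0 M : R) : R :=
  let d := p * (s - critical_order n p q) in
  Num.min (r0 / 2) (Num.min 1
   (((1 - 2^-1 `^ d) / (supercritical_constant n p q Lambda d2 * (M + 1) `^ (q - p))) `^ d^-1)).

Section scaling.
Variables (R : realType) (n : nat) (s p q P M Rmax dmin C : R).
Hypotheses (s01 : 0 < s < 1) (p1 : 1 < p) (pq : p < q).
Hypotheses (M0 : 0 < M) (Rmax0 : 0 < Rmax) (Rmax1 : Rmax <= 1).
Let delta := s * p - n%:R * (q - p) / P.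
Hypotheses (dmin0 : 0 < dmin) (dmin_le : dmin <= delta).
Hypothesis C1 : 1 <= C.
Hypothesis hC : C * (M `^ (q - p) * Rmax `^ dmin) <= 1 - 2^-1 `^ dmin.

Let p0 : 0 < p. Proof. exact: lt_trans ltr01 p1. Qed.

Lemma half_powRV (e t : R) : 0 < t -> ((t / 2) `^ e)^-1 = 2 `^ e / t `^ e.
Proof.
move=> t0; rewrite powRM ?invr_ge0 ?(ltW t0)//.
have -> : (2^-1 : R) `^ e = (2 `^ e)^-1 by rewrite -powR_inv1 ?ler0n// -powRrM mulN1r powRN.
by rewrite invfM invrK mulrC.
Qed.

Lemma powR_radius_le t : 0 < t -> t <= Rmax -> t `^ delta <= Rmax `^ dmin.
Proof.
move=> t0 tR; apply: le_trans (ler_powR2r (ltW dmin0) (ltW t0) tR).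
by apply: ger_powR => //; rewrite t0 (le_trans tR).
Qed.

Lemma small_radius t : 0 < t -> t <= Rmax -> C * (M `^ (q - p) * t `^ delta) <= 1.
Proof.
move=> t0 tR; apply: (@le_trans _ _ (1 - 2^-1 `^ dmin)); last by rewrite gerBl powR_ge0.
apply: le_trans hC; apply: ler_wpM2l; first exact: le_trans C1.
by apply: ler_wpM2l; [exact: powR_ge0|exact: powR_radius_le].
Qed.

(** On radii at most 1 replacing [delta] by the smaller [dmin] only enlarges the power of the radius
    and the reciprocal of 1 - 2^(-delta). *)
Lemma small_radius_geometric t : 0 < t -> t <= Rmax ->
  C * (M `^ (q - p) * (t `^ delta / (1 - 2^-1 `^ delta))) <= 1.
Proof.
move=> t0 tR.
have d0 : 0 < delta by exact: lt_le_trans dmin_le.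
have h0 : 0 < 1 - 2^-1 `^ dmin by rewrite subr_gt0; have /andP[] := half_powR_lt1 dmin0.
have hd : 2^-1 `^ delta <= 2^-1 `^ dmin :> R.
  by apply: ger_powR => //; rewrite invr_gt0 ltr0n invf_le1 ?ler1n.
have h1 : 1 - 2^-1 `^ dmin <= 1 - 2^-1 `^ delta by rewrite lerD2l lerN2.
have h2 : 0 < 1 - 2^-1 `^ delta by exact: lt_le_trans h1.
rewrite !mulrA ler_pdivrMr// mul1r; apply: le_trans h1; apply: le_trans hC.
rewrite -mulrA; apply: ler_wpM2l; first exact: le_trans C1.
by apply: ler_wpM2l; [exact: powR_ge0|exact: powR_radius_le].
Qed.

(** Rewrites the mass coefficient as t^delta, made small by the choice of the radius, times the
    weight of the L^p term. *)
Lemma powR_level_exponent t rad : 0 < t -> t <= rad ->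
  t `^ (- (n%:R * (q - p) / P)) <= t `^ delta * (rad `^ ((1 - s) * p) / t `^ p).
Proof.
move=> t0 tr; have -> : - (n%:R * (q - p) / P) = delta + ((1 - s) * p + - p).
  by rewrite /delta; ring.
rewrite powRD ?(gt_eqF t0) ?implybT//; apply: ler_wpM2l; first exact: powR_ge0.
rewrite powRD ?(gt_eqF t0) ?implybT// powRN; apply: ler_wpM2r.
  by rewrite invr_ge0 powR_ge0.
apply: ler_powR2r (ltW t0) tr; apply: mulr_ge0 (ltW p0).
by rewrite subr_ge0; have /andP[_ /ltW] := s01.
Qed.

End scaling.

Lemma max0_lip (R : realDomainType) (a b : R) :
  `|Num.max a 0 - Num.max b 0| <= `|a - b|.
Proof.
rewrite ler_norml; have h1 := ler_norm (a - b); have h2 := ler_norm (b - a).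
rewrite distrC in h2; have h3 := normr_ge0 (a - b).
by case: (leP a 0) => ha; case: (leP b 0) => hb; apply/andP; split; lra.
Qed.

(** The factor 2 2^(n+p) is the price of the iteration. The three summands belong to the superlevel
    set, the L^p term (where 1 + accounts for the mass term of the level estimate) and the tail. *)
Definition supercritical_caccioppoli_constant {R : realType} (n : nat) (p q Lambda d2 : R) : R :=
  2 * 2 `^ (n%:R + p) * (2 * Lambda * (4 * p) * ((1 + d2 * 4 `^ q) * 2 `^ p) +
    (1 + 2 * Lambda * @near_constant R n p Lambda) * 2 `^ p +
    2 * Lambda * (2 * p * (Lambda * 2 `^ (n%:R + p))) * 2 `^ (n%:R + p)) + 1.

(** * Caccioppoli inequality for growth above p *)

Section supercritical_growth.
Context {R : realType} {n : nat}.
Local Notation E := (Rn R n).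
Local Notation leb := (@lebesgue R n).
Local Notation lebleb := (leb \x leb)%E.
Variables (s p Lambda r0 d1 d2 q : R) (Omega : set E).
Variables (K : E -> E -> \bar R) (F : E -> R -> R) (u : E -> R).
Hypotheses (n0 : (0 < n)%N) (s01 : 0 < s < 1) (p1 : 1 < p) (L1 : 1 <= Lambda).
Hypothesis hK : kernel_assumption s p Lambda r0 K.
Hypotheses (oO : open Omega) (bO : bounded_set Omega).
Hypothesis mF : forall v : E -> R, measurable_fun setT v -> measurable_fun setT (fun x => F x (v x)).
Hypotheses (d10 : 0 <= d1) (d20 : 0 <= d2).
Hypothesis hF : growth_assumption Omega F d1 d2 q.
Hypothesis hu : subminimizer s p K F Omega u.
Variables (P M R0 dmin : R).
Hypotheses (pq : p < q) (qP : q < P) (M0 : 0 < M).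
Hypothesis uM : (\int[leb]_(x in Omega) (`|u x| `^ P)%:E <= (M `^ P)%:E)%E.
Hypotheses (R00 : 0 < R0) (R01 : R0 <= 1) (R0r0 : 2 * R0 <= r0).
Local Notation eps := (1 - q / P).
Local Notation delta := (s * p - n%:R * (q - p) / P).
Hypotheses (dmin0 : 0 < dmin) (dmin_le : dmin <= delta).
Hypotheses (epsd : n%:R * eps <= delta) (epsle : eps <= s * p / n%:R).
Local Notation C3 := (supercritical_constant n p q Lambda d2).
Hypothesis hC : C3 * (M `^ (q - p) * R0 `^ dmin) <= 1 - 2^-1 `^ dmin.

Variables (x0 : E) (r rad k : R).
Hypotheses (r_gt0 : 0 < r) (r_rad : r < rad) (rad_R0 : rad <= R0).
Hypothesis BO : eball x0 rad%:E `<=` Omega.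
Hypothesis k0 : 0 <= k.

Local Notation a := (n%:R + s * p).
Local Notation B t := (eball x0 t%:E).
Local Notation w := ((u \- cst k)^\+)%R.
Local Notation wm := ((u \- cst k)^\-)%R.
Local Notation A t := (eball x0 t%:E `&` [set x | (k < u x)%R]).
Local Notation S t := (\int[lebleb]_(z in B t `*` B t) (difference_quotient s p w z)%:E)%E.
Local Notation Nx t := (\int[leb]_(x in B t) ((w x)%:E *
   \int[leb]_(y in eball x (2%:E * R0%:E)) (wm y `^ (p - 1) / enorm (x - y) `^ a)%:E))%E.
Local Notation Wp t := (\int[leb]_(x in B t) (w x `^ p)%:E)%E.
Local Notation W1 t := (\int[leb]_(x in B t) (w x)%:E)%E.
Local Notation Tl t := ((1 - s)%:E *
   \int[leb]_(y in ~` B t) (w y `^ (p - 1) / enorm (y - x0) `^ a)%:E)%E.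
Local Notation near := (@near_constant R n p Lambda).
Local Notation far := (2 * p * (Lambda * 2 `^ (n%:R + p))).
Local Notation c := (d2 * 4 `^ q).
Local Notation lc := (@level_constant R n p q).
Local Notation T2 := (2 `^ (n%:R + p)).

Let mu : measurable_fun setT u. Proof. by case: hu => -[]. Qed.
Let p0 : 0 < p. Proof. exact: lt_trans ltr01 p1. Qed.
Let q0 : 0 < q. Proof. exact: lt_trans p0 pq. Qed.
Let P0 : 0 < P. Proof. exact: lt_trans q0 qP. Qed.
Let s1 : 0 < 1 - s. Proof. by rewrite subr_gt0; have /andP[] := s01. Qed.
Let L0 : 0 < Lambda. Proof. exact: lt_le_trans L1. Qed.
Let mO : measurable Omega. Proof. exact: open_measurable_Rn. Qed.
Let mw : measurable_fun setT w. Proof. exact: measurable_trunc. Qed.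
Let w0 x : 0 <= w x. Proof. exact: trunc_ge0. Qed.
Let rad0 : 0 < rad. Proof. exact: lt_trans r_rad. Qed.
Let rad1 : rad <= 1. Proof. exact: le_trans R01. Qed.
Let c0 : 0 <= c. Proof. exact: mulr_ge0 d20 (powR_ge0 _ _). Qed.
Let lc0 : 0 < lc. Proof. exact: level_constant_gt0. Qed.
Let sp0 : 0 < s * p. Proof. by apply: mulr_gt0; have /andP[] := s01. Qed.
Let a0 : 0 <= a. Proof. by apply: addr_ge0 (ltW sp0). Qed.
Let aN : a <= n%:R + p.
Proof. by rewrite lerD2l ler_piMl ?(ltW p0)//; have /andP[_ /ltW] := s01. Qed.

Let wu x : w x <= `|u x|.
Proof.
rewrite truncE ge_max normr_ge0 andbT; apply: le_trans (ler_norm _).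
by rewrite gerBl.
Qed.

Let mwe (e : R) D : measurable_fun D (fun x => (w x `^ e)%:E).
Proof.
apply/measurable_EFinP; apply: measurable_funTS.
exact: measurableT_comp (measurable_powR _) mw.
Qed.

Let mue (e : R) D : measurable_fun D (fun x => (`|u x| `^ e)%:E).
Proof.
apply/measurable_EFinP; apply: measurable_funTS.
exact: measurableT_comp (measurable_powR _) (measurableT_comp (@normr_measurable R setT) mu).
Qed.

Lemma trunc_powR_integral_le (e t : R) : 0 <= e -> t <= rad ->
  (\int[leb]_(x in B t) (w x `^ e)%:E <= \int[leb]_(x in Omega) (`|u x| `^ e)%:E)%E.
Proof.
move=> e0 trad; have BtO : B t `<=` Omega.
  by move=> x; rewrite eballE/= => xt; apply: BO; rewrite eballE/=; exact: lt_le_trans trad.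
apply: (@le_trans _ _ (\int[leb]_(x in B t) (`|u x| `^ e)%:E)%E).
  apply: le_integral_ge0 => x _; rewrite lee_fin; first exact: powR_ge0.
  exact: ler_powR2r.
have u0 x : (0 <= (`|u x| `^ e)%:E)%E by rewrite lee_fin; exact: powR_ge0.
exact: (ge0_subset_integral leb (measurable_eball _ _) mO (@mue e Omega) (fun x _ => u0 x) BtO).
Qed.

Lemma superlevel_chebyshev : ((k `^ P)%:E * leb (A rad) <= (M `^ P)%:E)%E.
Proof.
have mA : measurable (A rad) by exact: measurable_superlevel.
rewrite -(integral_cst leb mA); apply: le_trans uM.
apply: (@le_trans _ _ (\int[leb]_(x in A rad) (`|u x| `^ P)%:E)%E).
  apply: le_integral_ge0 => x; rewrite /cst lee_fin; first by move=> _; exact: powR_ge0.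
  move=> [_ /= ku]; apply: ler_powR2r (ltW P0) k0 _.
  exact: le_trans (ltW ku) (ler_norm _).
have u0 x : (0 <= (`|u x| `^ P)%:E)%E by rewrite lee_fin; exact: powR_ge0.
by apply: (ge0_subset_integral leb mA mO (@mue P Omega) (fun x _ => u0 x)) => x [/BO].
Qed.

Lemma superlevel_le t : t <= rad -> (leb (A t) <= leb (A rad))%E.
Proof.
move=> trad; apply: le_measure; rewrite ?inE; try exact: measurable_superlevel.
move=> x [xt ku]; split => //; move: xt; rewrite !eballE/= => xt; exact: lt_le_trans trad.
Qed.

Lemma superlevel_measure_le : (leb (A rad) <= ((2 * rad) ^+ n)%:E)%E.
Proof.
apply: le_trans (lebesgue_eball_le x0 (ltW rad0)).
apply: le_measure; rewrite ?inE; [exact: measurable_superlevel|exact: measurable_eball|].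
by move=> x [].
Qed.

(** The level estimate on the ball of radius m = (rho+tau)/2 with largest scale T = (tau-rho)/2, so
    that m + T = tau. *)
Lemma trunc_level_bound rho tau : r <= rho -> rho < tau -> tau <= rad ->
  (\int[leb]_(x in B ((rho + tau) / 2)) (w x `^ q)%:E <=
   (lc * M `^ (q - p) * ((tau - rho) / 2) `^ (- (n%:R * (q - p) / P)))%:E *
     Wp ((rho + tau) / 2) +
   (lc * M `^ (q - p) * (((tau - rho) / 2) `^ delta / (1 - 2^-1 `^ delta)) * (1 - s))%:E *
     S tau)%E.
Proof.
move=> rrho rhotau taurad.
have T0 : 0 < (tau - rho) / 2 by lra.
have dl0 : 0 < delta by exact: lt_le_trans dmin_le.
have [v0|v0] := ltP 0 (@unit_ball_volume R n).
  apply: (level_set_bound n0 p1 pq _ s01 v0 M0 T0 _ mw w0).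
  - by apply: le_trans (ltW qP); rewrite gerBl ltW.
  - by lra.
  - by apply: le_trans uM; apply: trunc_powR_integral_le taurad; exact: ltW.
  - by rewrite -subr_gt0.
have v00 : @unit_ball_volume R n = 0.
  by apply/eqP; rewrite eq_le v0 unit_ball_volume_ge0.
rewrite (null_set_integral (measurable_eball _ _) (@mwe q _) (lebesgue0 v00 (measurable_eball _ _))).
have h2 : 0 < 1 - 2^-1 `^ delta by rewrite subr_gt0; have /andP[] := half_powR_lt1 dl0.
apply: adde_ge0; apply: mule_ge0.
- rewrite lee_fin; apply: mulr_ge0 (powR_ge0 _ _); exact: mulr_ge0 (ltW lc0) (powR_ge0 _ _).
- by apply: integral_ge0 => x _; rewrite lee_fin; exact: powR_ge0.
- rewrite lee_fin; apply: mulr_ge0 (ltW s1); apply: mulr_ge0 (divr_ge0 (powR_ge0 _ _) (ltW h2)).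
  exact: mulr_ge0 (ltW lc0) (powR_ge0 _ _).
- by apply: integral_ge0 => z _; rewrite lee_fin; exact: difference_quotient_ge0.
Qed.

(** Supplies the a priori bound for the iteration: truncation is 1-Lipschitz and [u] has finite
    energy. *)
Lemma seminorm_fin : exists2 f : R, 0 <= f & forall t, t <= rad -> (S t <= f%:E)%E.
Proof.
have [hes _ _] := hu.
have BBO t : t <= rad -> (B t `*` B t) `<=` cross_set Omega.
  move=> trad z [/= z1 _] [/= h _]; apply: h; apply: BO.
  by move: z1; rewrite !eballE/= => z1; exact: lt_le_trans trad.
have fin := energy_space_sub hes (BBO _ (lexx rad)).
set I := integral _ _ _ in fin.
have I0 : (0 <= I)%E by apply: integral_ge0 => z _; rewrite lee_fin; exact: difference_quotient_ge0.
exists (fine I); first exact: fine_ge0.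
move=> t trad; rewrite fineK ?ge0_fin_numE//.
rewrite integral_mkcond /I [leRHS]integral_mkcond; apply: le_integral_ge0 => z _.
  by rewrite patchE; case: ifP => _ //; rewrite lee_fin; exact: difference_quotient_ge0.
rewrite !patchE; case: ifPn => [|_]; last first.
  by case: ifP => _ //; rewrite lee_fin; exact: difference_quotient_ge0.
rewrite inE => -[/= z1 z2]; rewrite mem_set; last first.
  by split; move: z1 z2; rewrite !eballE/= => h1 h2; [exact: lt_le_trans h1 trad|exact: lt_le_trans h2 trad].
rewrite lee_fin; apply: ler_wpM2r; first by rewrite invr_ge0 powR_ge0.
apply: ler_powR2r (ltW p0) (normr_ge0 _) _; rewrite !truncE.
apply: le_trans (max0_lip _ _) _.
by rewrite opprB addrA subrK.
Qed.

Let Q0 : 0 <= 2 * Lambda * (4 * p) * c * lc.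
Proof.
apply: mulr_ge0 (ltW lc0); apply: mulr_ge0 c0; apply: mulr_ge0; first exact: mulr_ge0 (ltW L0).
exact: mulr_ge0 (ltW p0).
Qed.

Let T21 : 1 <= T2 :> R.
Proof.
have e : 0 <= n%:R + p by apply: addr_ge0 (ltW p0).
by have := ler_powR2r e ler01 (ler1n R 2); rewrite powR1; exact.
Qed.

Let C31 : 1 <= C3.
Proof.
rewrite /supercritical_constant lerDl; apply: mulr_ge0 Q0.
by apply: mulr_ge0 (le_trans ler01 T21).
Qed.

Let near0 : 0 <= near. Proof. exact: near_constant_ge0. Qed.
Let far0 : 0 <= far. Proof. exact: far_constant_ge0. Qed.

Lemma near_scale_le rho tau : r <= rho -> rho < tau -> tau <= rad ->
  ((rho + tau) / 2) `^ ((1 - s) * p) / ((rho + tau) / 2 - rho) `^ p <=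
  2 `^ p * rad `^ ((1 - s) * p) / (tau - rho) `^ p.
Proof.
move=> rrho rhotau taurad; have d0 : 0 < tau - rho by rewrite subr_gt0.
have m0 : 0 <= (rho + tau) / 2 by have := r_gt0; lra.
have mr : (rho + tau) / 2 <= rad by lra.
have e0 : 0 <= (1 - s) * p by exact: mulr_ge0 (ltW s1) (ltW p0).
have -> : (rho + tau) / 2 - rho = (tau - rho) / 2 by lra.
rewrite (half_powRV _ d0) mulrAC mulrC; apply: ler_wpM2l.
  exact: divr_ge0 (powR_ge0 _ _) (powR_ge0 _ _).
exact: ler_powR2r e0 m0 mr.
Qed.

Lemma far_scale_le rho tau : r <= rho -> rho < tau -> tau <= rad ->
  ((rho + tau) / 2) `^ a / ((rho + tau) / 2 - rho) `^ a <= T2 * rad `^ a / (tau - rho) `^ a.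
Proof.
move=> rrho rhotau taurad; have d0 : 0 < tau - rho by rewrite subr_gt0.
have m0 : 0 <= (rho + tau) / 2 by have := r_gt0; lra.
have mr : (rho + tau) / 2 <= rad by lra.
have -> : (rho + tau) / 2 - rho = (tau - rho) / 2 by lra.
rewrite (half_powRV _ d0) mulrA; apply: ler_wpM2r; first by rewrite invr_ge0 powR_ge0.
rewrite mulrC; apply: ler_pM; [exact: powR_ge0|exact: powR_ge0| |exact: ler_powR2r a0 m0 mr].
by apply: ler_powR aN; exact: ler1n.
Qed.

(** The factor 1-s is kept on purpose: the iteration absorbs (1-s) times the seminorm, and (2
    2^(n+p))^(-1) is the admissible coefficient. *)
Lemma gradient_coefficient_le rho tau : r <= rho -> rho < tau -> tau <= rad ->
  2 * Lambda * (4 * p) * c *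
    (lc * M `^ (q - p) * (((tau - rho) / 2) `^ delta / (1 - 2^-1 `^ delta)) * (1 - s))
  <= (2 * T2)^-1 * (1 - s).
Proof.
move=> rrho rhotau taurad.
have t0 : 0 < (tau - rho) / 2 by lra.
have tR : (tau - rho) / 2 <= R0 by have := r_gt0; have := rad_R0; lra.
have := @small_radius_geometric R n s p q P M R0 dmin C3 R01 dmin0 dmin_le C31 hC _ t0 tR.
set g := M `^ (q - p) * _ => h.
have g0 : 0 <= g.
  have dl0 : 0 < delta by exact: lt_le_trans dmin_le.
  apply: mulr_ge0 (powR_ge0 _ _) (divr_ge0 (powR_ge0 _ _) _).
  by rewrite subr_ge0 ltW//; have /andP[] := half_powR_lt1 dl0.
rewrite mulrA; apply: ler_wpM2r; first exact: ltW.
have T20 : 0 < 2 * T2 :> R by apply: mulr_gt0 => //; exact: lt_le_trans T21.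
rewrite -[leRHS]mul1r ler_pdivlMr//.
apply: le_trans h; rewrite /supercritical_constant.
rewrite (_ : _ * _ * (2 * T2) = 2 * T2 * (2 * Lambda * (4 * p) * c * lc) * g); last first.
  rewrite /g; move: (2 `^ _) (M `^ _) (_ / _) c lc => x1 x2 x3 x4 x5; ring.
by apply: ler_wpM2r => //; rewrite lerDr.
Qed.

Lemma mass_coefficient_le rho tau : r <= rho -> rho < tau -> tau <= rad ->
  2 * Lambda * (4 * p) * c *
    (lc * M `^ (q - p) * ((tau - rho) / 2) `^ (- (n%:R * (q - p) / P)))
  <= 2 `^ p * rad `^ ((1 - s) * p) / (tau - rho) `^ p.
Proof.
move=> rrho rhotau taurad.
have t0 : 0 < (tau - rho) / 2 by lra.
have tR : (tau - rho) / 2 <= R0 by have := r_gt0; have := rad_R0; lra.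
have trad : (tau - rho) / 2 <= rad by have := r_gt0; lra.
have d0 : 0 < tau - rho by rewrite subr_gt0.
have h1 := @small_radius R n s p q P M R0 dmin C3 R01 dmin0 dmin_le C31 hC _ t0 tR.
have h2 := @powR_level_exponent R n s p q P s01 p1 _ _ t0 trad.
rewrite (half_powRV _ d0) in h2.
have Mq : 0 <= M `^ (q - p) by exact: powR_ge0.
apply: (@le_trans _ _ (2 * Lambda * (4 * p) * c * lc * (M `^ (q - p) * ((tau - rho) / 2) `^ delta) *
   (rad `^ ((1 - s) * p) * (2 `^ p / (tau - rho) `^ p)))).
  have := ler_wpM2l (mulr_ge0 Q0 Mq) h2.
  move: (2 * Lambda * (4 * p)) c lc (M `^ _) => x1 x2 x3 x4.
  move: (_ `^ (- _)) (_ `^ delta) (_ * (_ / _)) => y1 y2 y3 h.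
  have -> : x1 * x2 * (x3 * x4 * y1) = x1 * x2 * x3 * x4 * y1 by ring.
  by have -> : x1 * x2 * x3 * (x4 * y2) * y3 = x1 * x2 * x3 * x4 * (y2 * y3) by ring.
have X0 : 0 <= rad `^ ((1 - s) * p) * (2 `^ p / (tau - rho) `^ p).
  exact: mulr_ge0 (powR_ge0 _ _) (divr_ge0 (powR_ge0 _ _) (powR_ge0 _ _)).
have -> : 2 `^ p * rad `^ ((1 - s) * p) / (tau - rho) `^ p =
   1 * (rad `^ ((1 - s) * p) * (2 `^ p / (tau - rho) `^ p)).
  by move: (2 `^ p) (rad `^ _) (_^-1) => x1 x2 x3; ring.
apply: ler_wpM2r => //; apply: le_trans h1.
apply: ler_wpM2r; first exact: mulr_ge0 Mq (powR_ge0 _ _).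
rewrite /supercritical_constant; apply: le_trans (_ : _ <= 2 * T2 * (2 * Lambda * (4 * p) * c * lc)) _.
  by apply: ler_peMl => //; have := T21; lra.
by rewrite lerDr.
Qed.

(** Two enlargements of the ball: the Caccioppoli inequality goes from [rho] to the midradius, and
    the level estimate bounds the integral of w^q there by the energy on the ball of radius [tau].
    All other quantities are frozen at the radii [r] and [rad], as the iteration requires. *)
Lemma caccioppoli_step rho tau (alpha z2 z3 : R) : r <= rho -> rho < tau -> tau <= rad ->
  leb (A rad) = alpha%:E -> Wp rad = z2%:E -> (W1 rad * Tl r = z3%:E)%E ->
  ((1 - s)%:E * (S rho + Nx rho) <= (2 * T2)^-1%:E * ((1 - s)%:E * S tau) +
    (2 * Lambda * (4 * p) * ((d1 + c * `|k| `^ q) * alpha) +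
     (1 + 2 * Lambda * near) * (2 `^ p * rad `^ ((1 - s) * p)) * z2 / (tau - rho) `^ p +
     2 * Lambda * far * (T2 * rad `^ a) * z3 / (tau - rho) `^ a)%:E)%E.
Proof.
move=> rrho rhotau taurad alE z2E z3E.
have rho0 : 0 < rho by exact: lt_le_trans rrho.
set m := (rho + tau) / 2.
have rhom : rho < m by rewrite /m; lra.
have mrad : m <= rad by rewrite /m; lra.
have mR0 : m <= R0 by exact: le_trans rad_R0.
have BmO : B m `<=` Omega.
  by move=> x; rewrite eballE/= => xm; apply: BO; rewrite eballE/=; exact: lt_le_trans mrad.
have gi : growth_integrable d2 q Omega u.
  right; split; first exact: ltW.
  exists P; last by apply: le_lt_trans uM _; exact: ltry.
  by split; [exact: lt_trans p1 (lt_trans pq qP)|exact: ltW].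
have h := growth_caccioppoli s01 p1 L1 hK oO bO mF d10 d20 hF hu k gi rho0 rhom mR0 R0r0 BmO.
have hG x : k < u x ->
    growth_bound d1 d2 q u k x <= d1 + c * `|k| `^ q + c * w x `^ q.
  move=> ku; rewrite /growth_bound -addrA lerD2l -mulrDr -mulrA.
  apply: ler_wpM2l => //; apply: superlevel_powR_le k0 ku; exact: lt_trans pq.
have G1 := superlevel_growth_integral d10 d20 hu x0 m c0 hG.
have lv := trunc_level_bound rrho rhotau taurad.
rewrite -/m in lv.
have [f f0 Sf] := seminorm_fin.
have S0 t : (0 <= S t)%E by apply: integral_ge0 => z _; rewrite lee_fin; exact: difference_quotient_ge0.
have [sg sgE] : exists sg : R, S tau = sg%:E.
  exists (fine (S tau)); rewrite fineK// ge0_fin_numE//.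
  by apply: le_lt_trans (Sf _ taurad) _; exact: ltry.
have sg0 : 0 <= sg by rewrite -lee_fin -sgE.
have Wpm : (Wp m <= z2%:E)%E.
  rewrite -z2E; apply: (ge0_subset_integral leb (measurable_eball _ _) (measurable_eball _ _) (@mwe p _)).
    by move=> x _; rewrite lee_fin; exact: powR_ge0.
  by move=> x; rewrite !eballE/= => xm; exact: lt_le_trans mrad.
have Wp0 t : (0 <= Wp t)%E by apply: integral_ge0 => x _; rewrite lee_fin; exact: powR_ge0.
have z20 : 0 <= z2 by rewrite -lee_fin -z2E.
have mw1 D : measurable_fun D (fun x => (w x)%:E) by apply/measurable_EFinP; exact: measurable_funTS mw.
have W10 t : (0 <= W1 t)%E by apply: integral_ge0 => x _; rewrite lee_fin.
have Tf0 x : 0 <= w x `^ (p - 1) / enorm (x - x0) `^ a by exact: divr_ge0 (powR_ge0 _ _) (powR_ge0 _ _).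
have Tl0 t : (0 <= Tl t)%E.
  apply: mule_ge0; first by rewrite lee_fin ltW.
  by apply: integral_ge0 => x _; rewrite lee_fin.
have z30 : 0 <= z3 by rewrite -lee_fin -z3E; exact: mule_ge0.
have WTm : (W1 m * Tl rho <= z3%:E)%E.
  rewrite -z3E; apply: lee_pmul => //.
    apply: (ge0_subset_integral leb (measurable_eball _ _) (measurable_eball _ _) (@mw1 _)).
      by move=> x _; rewrite lee_fin.
    by move=> x; rewrite !eballE/= => xm; exact: lt_le_trans mrad.
  apply: lee_wpmul2l; first by rewrite lee_fin ltW.
  rewrite integral_mkcond [leRHS]integral_mkcond; apply: le_integral_ge0 => x _.
    by rewrite patchE; case: ifP => _ //; rewrite lee_fin.
  rewrite !patchE; case: ifPn => [|_]; last by case: ifP => _ //; rewrite lee_fin.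
  rewrite inE => xr; rewrite mem_set//.
  by move=> xr'; apply: xr; move: xr'; rewrite !eballE/= => xr'; exact: lt_le_trans rrho.
have al0 : 0 <= alpha by rewrite -lee_fin -alE; exact: measure_ge0.
have Am : (leb (A m) <= alpha%:E)%E by rewrite -alE; exact: superlevel_le.
have dk0 : 0 <= d1 + c * `|k| `^ q by exact: addr_ge0 d10 (mulr_ge0 c0 (powR_ge0 _ _)).
have := mass_coefficient_le rrho rhotau taurad.
have := gradient_coefficient_le rrho rhotau taurad.
have := near_scale_le rrho rhotau taurad.
have := far_scale_le rrho rhotau taurad.
have cf10 : 0 <= lc * M `^ (q - p) * ((tau - rho) / 2) `^ (- (n%:R * (q - p) / P)).
  exact: mulr_ge0 (mulr_ge0 (ltW lc0) (powR_ge0 _ _)) (powR_ge0 _ _).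
rewrite -/m; move: lv; rewrite sgE; move: cf10.
set cf1 := lc * _ * _ `^ (- _); set cf2 := lc * _ * _ * (1 - s).
set xn := m `^ ((1 - s) * p) / _; set xf := m `^ a / _.
move=> cf10 lv hxf hxn hcf2 hcf1.
have G2 : (\int[leb]_(x in A m) (growth_bound d1 d2 q u k x)%:E <=
    ((d1 + c * `|k| `^ q) * alpha + c * (cf1 * z2 + cf2 * sg))%:E)%E.
  apply: le_trans G1 _.
  apply: (@le_trans _ _ ((d1 + c * `|k| `^ q)%:E * alpha%:E +
      c%:E * (cf1%:E * z2%:E + cf2%:E * sg%:E))%E); last exact: lexx.
  apply: leeD; apply: lee_wpmul2l; rewrite ?lee_fin//.
  by apply: le_trans lv _; apply: leeD (lexx _); apply: lee_wpmul2l; rewrite ?lee_fin.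
have ls : (caccioppoli_loss s p Lambda x0 rho m k u <= (near * xn * z2 + far * xf * z3)%:E)%E.
  rewrite /caccioppoli_loss.
  apply: (@le_trans _ _ ((near * xn)%:E * z2%:E + (far * xf)%:E * z3%:E)%E); last exact: lexx.
  apply: leeD.
    apply: lee_wpmul2l Wpm; rewrite lee_fin.
    exact: mulr_ge0 near0 (divr_ge0 (powR_ge0 _ _) (powR_ge0 _ _)).
  rewrite -muleA; apply: lee_wpmul2l WTm; rewrite lee_fin.
  exact: mulr_ge0 far0 (divr_ge0 (powR_ge0 _ _) (powR_ge0 _ _)).
have p40 : 0 <= 4 * p by exact: mulr_ge0 (ltW p0).
have L20 : 0 <= 2 * Lambda by exact: mulr_ge0 (ltW L0).
have s10 : 0 <= 1 - s by exact: ltW.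
have b1 : ((1 - s)%:E * (S rho + Nx rho) <=
   (2 * Lambda * (4 * p * ((d1 + c * `|k| `^ q) * alpha + c * (cf1 * z2 + cf2 * sg)) +
     (near * xn * z2 + far * xf * z3)))%:E)%E.
  apply: le_trans (lee_wpmul2l (_ : (0 <= (1 - s)%:E)%E) h) _; first by rewrite lee_fin.
  rewrite muleA -EFinM (_ : (1 - s) * (2 * Lambda / (1 - s)) = 2 * Lambda); last first.
    by field; rewrite gt_eqF.
  apply: (@le_trans _ _ ((2 * Lambda)%:E * ((4 * p)%:E *
      ((d1 + c * `|k| `^ q) * alpha + c * (cf1 * z2 + cf2 * sg))%:E +
      (near * xn * z2 + far * xf * z3)%:E))%E); last exact: lexx.
  apply: lee_wpmul2l; first by rewrite lee_fin.
  by apply: leeD ls; apply: lee_wpmul2l G2; rewrite lee_fin.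
apply: le_trans b1 _; rewrite -!EFinM -EFinD lee_fin.
move: hxf hxn hcf2 hcf1.
have -> : (1 + 2 * Lambda * near) * (2 `^ p * rad `^ ((1 - s) * p)) * z2 / (tau - rho) `^ p =
  (1 + 2 * Lambda * near) * (2 `^ p * rad `^ ((1 - s) * p) / (tau - rho) `^ p) * z2.
  by move: (2 `^ p * _) (_^-1) => x1 x2; ring.
have -> : 2 * Lambda * far * (T2 * rad `^ a) * z3 / (tau - rho) `^ a =
  2 * Lambda * far * (T2 * rad `^ a / (tau - rho) `^ a) * z3.
  by move: (T2 * _) far (_^-1) => x1 x2 x3; ring.
move: ((T2 * _) / _) ((2 `^ p * _) / _) (2 * T2)^-1 => yf yn kap hxf hxn hcf2 hcf1.
have t1 := ler_wpM2r sg0 hcf2.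
have t2 := ler_wpM2r z20 hcf1.
have t3 := ler_wpM2r z20 (ler_wpM2l (mulr_ge0 L20 near0) hxn).
have t4 := ler_wpM2r z30 (ler_wpM2l (mulr_ge0 L20 far0) hxf).
move: t1 t2 t3 t4 {h hG G1 lv G2 ls hxf hxn hcf2 hcf1 dk0 al0 alE Am}.
move: c near far (d1 + _) => c' ne fa y t1 t2 t3 t4.
have -> : 2 * Lambda * (4 * p * (y * alpha + c' * (cf1 * z2 + cf2 * sg)) +
     (ne * xn * z2 + fa * xf * z3)) =
  2 * Lambda * (4 * p) * (y * alpha) + 2 * Lambda * (4 * p) * c' * cf1 * z2 +
  2 * Lambda * (4 * p) * c' * cf2 * sg + 2 * Lambda * ne * xn * z2 + 2 * Lambda * fa * xf * z3.
  by ring.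
have -> : (1 + 2 * Lambda * ne) * yn * z2 = yn * z2 + 2 * Lambda * ne * yn * z2 by ring.
rewrite (mulrA kap).
move: t1 t2 t3 t4.
by move: (2 * Lambda * (4 * p) * (y * alpha)) (_ * cf1 * z2) (_ * cf2 * sg) (_ * xn * z2)
  (_ * xf * z3) (yn * z2) (_ * yn * z2) (_ * yf * z3) (kap * _ * _) => *; lra.
Qed.

Local Notation H3 := (supercritical_caccioppoli_constant n p q Lambda d2).

Lemma supercritical_caccioppoli_constant_ge1 : 1 <= H3.
Proof.
have L20 : 0 <= 2 * Lambda by exact: mulr_ge0 (ltW L0).
have p40 : 0 <= 4 * p by exact: mulr_ge0 (ltW p0).
have T0 : 0 <= T2 :> R by exact: powR_ge0.
have P2 : 0 <= 2 `^ p :> R by exact: powR_ge0.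
rewrite /supercritical_caccioppoli_constant lerDr; apply: mulr_ge0; first exact: mulr_ge0.
apply: addr_ge0; last by apply: mulr_ge0 T0; exact: mulr_ge0 far0.
apply: addr_ge0; first by apply: mulr_ge0 (mulr_ge0 L20 p40) _; apply: mulr_ge0 P2; exact: addr_ge0.
by apply: mulr_ge0 P2; apply: addr_ge0 => //; exact: mulr_ge0 near0.
Qed.

(** The part with d1 uses only the size of the ball; the part with k^q uses Chebyshev, and the small
    radius bounds M^(q-p) rad^delta by 1. *)
Lemma superlevel_real_bound (alpha : R) : leb (A rad) = alpha%:E ->
  (d1 + c * `|k| `^ q) * alpha <= (1 + c) * 2 `^ p *
    ((d1 + `|k| `^ p / rad `^ (n%:R * eps)) * alpha `^ (1 - s * p / n%:R + eps)).
Proof.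
move=> alE.
have al0 : 0 <= alpha by rewrite -lee_fin -alE; exact: measure_ge0.
have alr : alpha <= (2 * rad) ^+ n by rewrite -lee_fin -alE; exact: superlevel_measure_le.
have cheb : k `^ P * alpha <= M `^ P by rewrite -lee_fin EFinM -alE; exact: superlevel_chebyshev.
have e0 : 0 <= eps by rewrite subr_ge0 ler_pdivrMr// mul1r ltW.
have h1 := measure_le_powR n0 s01 p1 e0 epsle rad0 rad1 al0 alr.
have h2 := level_measure_le n0 s01 p1 pq P0 e0 epsd rad0 al0 alr cheb.
have h3 := @small_radius R n s p q P M R0 dmin C3 R01 dmin0 dmin_le C31 hC _ rad0 rad_R0.
rewrite (ger0_norm k0).
have m0 : 0 <= M `^ (q - p) * rad `^ delta by exact: mulr_ge0 (powR_ge0 _ _) (powR_ge0 _ _).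
have m1 : M `^ (q - p) * rad `^ delta <= 1.
  by apply: le_trans h3; exact: ler_peMl.
have K0 : 0 <= k `^ p / rad `^ (n%:R * eps) by exact: divr_ge0 (powR_ge0 _ _) (powR_ge0 _ _).
have ae0 := powR_ge0 alpha (1 - s * p / n%:R + eps).
have P2 := powR_ge0 (2 : R) p.
move: h1 h2 m0 m1 K0 ae0 P2.
move: (_ / rad `^ _) (alpha `^ _) (2 `^ p) (M `^ _ * _) c c0 (k `^ q).
move=> K' ae t mm c' c'0 kq h1 h2 m0 m1 K0 ae0 P2.
have KA0 : 0 <= t * (K' * ae) by exact: mulr_ge0 P2 (mulr_ge0 K0 ae0).
have h4 : kq * alpha <= t * (K' * ae) by apply: le_trans h2 _; exact: ler_piMl.
have h5 := ler_wpM2l d10 h1; have h6 := ler_wpM2l c'0 h4.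
have h7 : 0 <= c' * (d1 * (t * ae)) by rewrite !mulr_ge0.
have -> : (d1 + c' * kq) * alpha = d1 * alpha + c' * (kq * alpha) by ring.
have -> : (1 + c') * t * ((d1 + K') * ae) =
  d1 * (t * ae) + t * (K' * ae) + c' * (d1 * (t * ae)) + c' * (t * (K' * ae)) by ring.
lra.
Qed.

Lemma caccioppoli_supercritical :
  (\int[leb]_(x in Omega) (`|u x| `^ p)%:E < +oo)%E ->
  DG_ineq_plus s p d1 H3 eps R0%:E x0 r rad k u.
Proof.
move=> up; rewrite /DG_ineq_plus (DG_ineqE _ _ _ _ _ _ _ _ _ _ s01 p1 w0).
have Wp0 t : (0 <= Wp t)%E by apply: integral_ge0 => x _; rewrite lee_fin; exact: powR_ge0.
have W10 t : (0 <= W1 t)%E by apply: integral_ge0 => x _; rewrite lee_fin.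
have Tl0 t : (0 <= Tl t)%E.
  apply: mule_ge0; first by rewrite lee_fin ltW.
  by apply: integral_ge0 => x _; rewrite lee_fin; exact: divr_ge0 (powR_ge0 _ _) (powR_ge0 _ _).
have H1 := supercritical_caccioppoli_constant_ge1.
have H0 : 0 < H3 / (1 - s) by apply: divr_gt0 s1; exact: lt_le_trans H1.
have rr : 0 < rad - r by rewrite subr_gt0.
have Y0 : 0 < rad `^ a / (rad - r) `^ a by apply: divr_gt0; exact: powR_gt0.
have X0 : 0 <= rad `^ ((1 - s) * p) / (rad - r) `^ p by exact: divr_ge0 (powR_ge0 _ _) (powR_ge0 _ _).
have dk0 : 0 <= d1 + `|k| `^ p / rad `^ (n%:R * eps).
  exact: addr_ge0 d10 (divr_ge0 (powR_ge0 _ _) (powR_ge0 _ _)).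
(* If the tail term is infinite, so is the right-hand side, because its weights are positive. *)
have [LTfin|] := ltP (W1 rad * Tl r)%E +oo%E; last first.
  rewrite leye_eq => /eqP LTy; rewrite -(muleA _ (W1 rad)) LTy (gt0_muley (_ : (0 < _%:E)%E)) ?lte_fin//.
  rewrite addey; last first.
    rewrite gt_eqF//; apply: lt_le_trans (ltNyr 0) _; apply: adde_ge0; apply: mule_ge0.
    - by rewrite lee_fin.
    - exact: poweR_ge0.
    - by rewrite lee_fin.
    - exact: Wp0.
  by rewrite gt0_muley ?lte_fin// leey.
have LT0 : (0 <= W1 rad * Tl r)%E by exact: mule_ge0.
have z3E : (W1 rad * Tl r = (fine (W1 rad * Tl r))%:E)%E by rewrite fineK// ge0_fin_numE.
have Wpfin : (Wp rad < +oo)%E by apply: le_lt_trans up; exact: trunc_powR_integral_le (ltW p0) (lexx _).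
have z2E : (Wp rad = (fine (Wp rad))%:E)%E by rewrite fineK// ge0_fin_numE.
have Afin : (leb (A rad) < +oo)%E by apply: le_lt_trans superlevel_measure_le _; exact: ltry.
have alE : (leb (A rad) = (fine (leb (A rad)))%:E)%E by rewrite fineK// ge0_fin_numE//; exact: measure_ge0.
move: (fine (leb (A rad))) (fine (Wp rad)) (fine (W1 rad * Tl r)%E) alE z2E z3E => alpha z2 z3 alE z2E z3E.
have al0 : 0 <= alpha by rewrite -lee_fin -alE; exact: measure_ge0.
have z20 : 0 <= z2 by rewrite -lee_fin -z2E.
have z30 : 0 <= z3 by rewrite -lee_fin -z3E.
have [f f0 Sf] := seminorm_fin.
have S0 t : (0 <= S t)%E by apply: integral_ge0 => z _; rewrite lee_fin; exact: difference_quotient_ge0.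
have Nx0 t : (0 <= Nx t)%E.
  apply: integral_ge0 => x _; apply: mule_ge0; first by rewrite lee_fin.
  by apply: integral_ge0 => y _; rewrite lee_fin; exact: divr_ge0 (powR_ge0 _ _) (powR_ge0 _ _).
have s1E : (0 <= (1 - s)%:E)%E by rewrite lee_fin ltW.
have L20 : 0 <= 2 * Lambda by exact: mulr_ge0 (ltW L0).
have a10 : 0 <= 2 * Lambda * (4 * p) * ((d1 + c * `|k| `^ q) * alpha).
  apply: mulr_ge0; first exact: mulr_ge0 L20 (mulr_ge0 (ler0n _ 4) (ltW p0)).
  by apply: mulr_ge0 al0; exact: addr_ge0 d10 (mulr_ge0 c0 (powR_ge0 _ _)).
have a20 : 0 <= (1 + 2 * Lambda * near) * (2 `^ p * rad `^ ((1 - s) * p)) * z2.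
  apply: mulr_ge0 z20; apply: mulr_ge0; first exact: addr_ge0 ler01 (mulr_ge0 L20 near0).
  exact: mulr_ge0 (powR_ge0 _ _) (powR_ge0 _ _).
have a30 : 0 <= 2 * Lambda * far * (T2 * rad `^ a) * z3.
  apply: mulr_ge0 z30; apply: mulr_ge0; first exact: mulr_ge0 L20 far0.
  exact: mulr_ge0 (powR_ge0 _ _) (powR_ge0 _ _).
have T20 : 0 < T2 :> R by exact: lt_le_trans T21.
have kap0 : 0 <= (2 * T2)^-1 :> R by rewrite invr_ge0; exact: mulr_ge0 (ltW T20).
have kapN : (2 * T2)^-1 * T2 <= 2^-1 :> R by rewrite invfM mulfVK ?gt_eqF.
have pN : p <= n%:R + p by rewrite lerDr.
have f10 : 0 <= (1 - s) * f by exact: mulr_ge0 (ltW s1) f0.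
(* [Phi] keeps only the seminorm, whose finiteness is known; the mixed term joins it in [Psi], for
   which no bound is available beforehand. *)
have := @absorption_iteration R (fun t => (1 - s)%:E * S t)%E (fun t => (1 - s)%:E * (S t + Nx t))%E
  (n%:R + p) a p (2 * T2)^-1 _ _ _ ((1 - s) * f) r rad (ltW p0) pN a0 aN kap0 kapN a10 a20 a30 f10 r_rad.
move=> /(_ (fun t => lee_wpmul2l s1E (leeDl _ (Nx0 t)))) it.
have {}it := it _ _.
have h : ((1 - s)%:E * (S r + Nx r) <= (2 * T2 *
   (2 * Lambda * (4 * p) * ((d1 + c * `|k| `^ q) * alpha) +
    (1 + 2 * Lambda * near) * (2 `^ p * rad `^ ((1 - s) * p)) * z2 / (rad - r) `^ p +
    2 * Lambda * far * (T2 * rad `^ a) * z3 / (rad - r) `^ a))%:E)%E.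
  apply: it => [rho rrho rhorad|rho tau rrho rhotau taurad].
    by rewrite EFinM; apply: lee_wpmul2l => //; exact: Sf (ltW rhorad).
  exact: caccioppoli_step rrho rhotau (ltW taurad) alE z2E z3E.
have i0 : (0 <= ((1 - s)^-1)%:E)%E by rewrite lee_fin invr_ge0 ltW.
have := lee_wpmul2l i0 h; rewrite muleA -EFinM mulVf ?gt_eqF// mul1e => {}h.
apply: le_trans h _; rewrite alE poweR_EFin z2E -(muleA _ (W1 rad)) z3E.
apply: (@le_trans _ _ ((1 - s)^-1 * (H3 *
    ((d1 + `|k| `^ p / rad `^ (n%:R * eps)) * alpha `^ (1 - s * p / n%:R + eps) +
     rad `^ ((1 - s) * p) / (rad - r) `^ p * z2 + rad `^ a / (rad - r) `^ a * z3)))%:E); last first.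
  by rewrite mulrA (mulrC _ H3); exact: lexx.
rewrite [leRHS]EFinM; apply: (lee_wpmul2l i0); rewrite lee_fin.
have sb := superlevel_real_bound alE.
have Q'0 : 0 <= (d1 + `|k| `^ p / rad `^ (n%:R * eps)) * alpha `^ (1 - s * p / n%:R + eps).
  exact: mulr_ge0 dk0 (powR_ge0 _ _).
have L4 : 0 <= 2 * T2 * (2 * Lambda * (4 * p)) :> R.
  apply: mulr_ge0; first exact: mulr_ge0 (ltW T20).
  exact: mulr_ge0 L20 (mulr_ge0 (ler0n _ 4) (ltW p0)).
have := ler_wpM2l L4 sb.
have Xz := mulr_ge0 X0 z20; have Yz := mulr_ge0 (ltW Y0) z30.
have f1 : 0 <= 2 * T2 * ((1 + 2 * Lambda * near) * 2 `^ p) :> R.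
  apply: mulr_ge0; first exact: mulr_ge0 (ltW T20).
  by apply: mulr_ge0 (powR_ge0 _ _); exact: addr_ge0 ler01 (mulr_ge0 L20 near0).
have f2 : 0 <= 2 * T2 * (2 * Lambda * far * T2) :> R.
  apply: mulr_ge0; first exact: mulr_ge0 (ltW T20).
  by apply: mulr_ge0 (ltW T20); exact: mulr_ge0 L20 far0.
have f3 : 0 <= 2 * T2 * (2 * Lambda * (4 * p) * ((1 + c) * 2 `^ p)) :> R.
  rewrite mulrA; apply: mulr_ge0 L4 _; apply: mulr_ge0 (powR_ge0 _ _); exact: addr_ge0 ler01 c0.
rewrite /supercritical_caccioppoli_constant.
have -> : (1 + 2 * Lambda * near) * (2 `^ p * rad `^ ((1 - s) * p)) * z2 / (rad - r) `^ p =
  (1 + 2 * Lambda * near) * 2 `^ p * (rad `^ ((1 - s) * p) / (rad - r) `^ p * z2).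
  by move: (2 `^ p) (rad `^ _) (_^-1) => x1 x2 x3; ring.
have -> : 2 * Lambda * far * (T2 * rad `^ a) * z3 / (rad - r) `^ a =
  2 * Lambda * far * T2 * (rad `^ a / (rad - r) `^ a * z3).
  by move: T2 far (rad `^ a) (_^-1) => x1 x2 x3 x4; ring.
move: Xz Yz f1 f2 f3 Q'0.
move: (_ / _ * z2) (_ / _ * z3) ((d1 + _ / _) * _) ((d1 + c * _) * _) => Xz Yz Q' D.
move: T2 far near (2 `^ p) c => T fa ne t c' Xz0 Yz0 f1 f2 f3 Q'0 hD.
(* Each of the three terms needs only its own part of the constant; [g1], [g2] and [g3] are the
   surplus products. *)
have g1 : 0 <= 2 * T * (2 * Lambda * (4 * p) * ((1 + c') * t)) * (Xz + Yz).
  by apply: mulr_ge0 f3 _; exact: addr_ge0.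
have g2 : 0 <= 2 * T * ((1 + 2 * Lambda * ne) * t) * (Q' + Yz).
  by apply: mulr_ge0 f1 _; exact: addr_ge0.
have g3 : 0 <= 2 * T * (2 * Lambda * fa * T) * (Q' + Xz).
  by apply: mulr_ge0 f2 _; exact: addr_ge0.
have -> : 2 * T * (2 * Lambda * (4 * p) * D + (1 + 2 * Lambda * ne) * t * Xz +
    2 * Lambda * fa * T * Yz) = 2 * T * (2 * Lambda * (4 * p)) * D +
    2 * T * ((1 + 2 * Lambda * ne) * t) * Xz + 2 * T * (2 * Lambda * fa * T) * Yz by ring.
have e1 : 2 * T * (2 * Lambda * (4 * p)) * ((1 + c') * t * Q') =
  2 * T * (2 * Lambda * (4 * p) * ((1 + c') * t)) * Q' by ring.
rewrite e1 in hD.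
have -> : (2 * T * (2 * Lambda * (4 * p) * ((1 + c') * t) + (1 + 2 * Lambda * ne) * t +
    2 * Lambda * fa * T) + 1) * (Q' + Xz + Yz) =
  2 * T * (2 * Lambda * (4 * p) * ((1 + c') * t)) * Q' +
  2 * T * ((1 + 2 * Lambda * ne) * t) * Xz + 2 * T * (2 * Lambda * fa * T) * Yz +
  2 * T * (2 * Lambda * (4 * p) * ((1 + c') * t)) * (Xz + Yz) +
  2 * T * ((1 + 2 * Lambda * ne) * t) * (Q' + Yz) +
  2 * T * (2 * Lambda * fa * T) * (Q' + Xz) + (Q' + Xz + Yz) by ring.
lra.
Qed.

End supercritical_growth.

Section radius.
Variables (R : realType) (n : nat) (s p q Lambda d2 r0 M : R).
Hypotheses (p1 : 1 < p) (pq : p < q) (L1 : 1 <= Lambda) (d20 : 0 <= d2) (r00 : 0 < r0) (M0 : 0 <= M).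
Hypothesis cs : critical_order n p q < s.

Local Notation d := (p * (s - critical_order n p q)).
Local Notation C3 := (supercritical_constant n p q Lambda d2).
Local Notation R0 := (supercritical_radius n s p q Lambda d2 r0 M).
Local Notation x := ((1 - 2^-1 `^ d) / (C3 * (M + 1) `^ (q - p))).

Let p0 : 0 < p. Proof. exact: lt_trans ltr01 p1. Qed.
Let d0 : 0 < d. Proof. by apply: (mulr_gt0 p0); rewrite subr_gt0. Qed.

Lemma supercritical_constant_ge1 : 1 <= C3.
Proof.
rewrite /supercritical_constant lerDl; apply: mulr_ge0; first exact: mulr_ge0 (powR_ge0 _ _).
apply: mulr_ge0; last exact: ltW (level_constant_gt0 _ _).
apply: mulr_ge0; last exact: mulr_ge0 d20 (powR_ge0 _ _).
by apply: mulr_ge0 (mulr_ge0 (ler0n _ 4) (ltW p0)); apply: mulr_ge0 (le_trans ler01 L1).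
Qed.

Let D0 : 0 < C3 * (M + 1) `^ (q - p).
Proof.
apply: mulr_gt0; first exact: lt_le_trans ltr01 supercritical_constant_ge1.
by apply: powR_gt0; apply: ltr_wpDl.
Qed.

Let x0 : 0 < x.
Proof.
by apply: divr_gt0 D0; rewrite subr_gt0; have /andP[] := half_powR_lt1 d0.
Qed.

Lemma supercritical_radius_gt0 : 0 < R0.
Proof. by rewrite /supercritical_radius !lt_min ltr01 powR_gt0// andbT divr_gt0. Qed.

Lemma supercritical_radius_le1 : R0 <= 1.
Proof. by rewrite /supercritical_radius !ge_min lexx !orbT. Qed.

Lemma supercritical_radius_le_half : R0 <= r0 / 2.
Proof. by rewrite /supercritical_radius ge_min lexx. Qed.

Lemma supercritical_radius_small : C3 * ((M + 1) `^ (q - p) * R0 `^ d) <= 1 - 2^-1 `^ d.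
Proof.
have : R0 `^ d <= x.
  have h : R0 <= x `^ d^-1 by rewrite /supercritical_radius !ge_min lexx !orbT.
  have := ler_powR2r (ltW d0) (ltW supercritical_radius_gt0) h.
  by rewrite -powRrM mulVf ?gt_eqF// powRr1// ltW.
by rewrite ler_pdivlMr// mulrC mulrA.
Qed.

End radius.

(** The critical order does not involve [s]. For [s] above the mean of that order and 1, the
    exponent is at least a fixed [dm], and the radius is at least its value for [dm]. *)
Lemma supercritical_radius_near1 (R : realType) (n : nat) (p q Lambda d2 r0 M : R) :
  1 < p -> 1 <= Lambda -> 0 < r0 -> 0 <= M ->
  exists2 c : R, 0 < c & \forall s \near (1 : R)^'-, growth_case_iii n s p d2 q ->
    c <= supercritical_radius n s p q Lambda d2 r0 M.
Proof.
move=> p1 L1 r00 M0; have p0 : 0 < p by exact: lt_trans p1.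
have [h|nh] := pselect (0 < d2 /\ p < q /\ critical_order n p q < 1); last first.
  (* If these conditions fail, case (iii) holds for no [s] in (0,1), and any positive constant will
     do. *)
  exists 1 => //; near=> s => -[d20 spn pq qP]; exfalso; apply: nh; split => //; split => //.
  have s01 : 0 < s < 1.
    apply/andP; split; near: s; [exact: nbhs_left_gt|exact: nbhs_left_lt].
  by have /andP[_ s1] := s01; apply: lt_trans s1; exact: (critical_order_lt s01 p1 pq spn qP).
have [d20 [pq c1]] := h.
set c0 := critical_order n p q in c1 *.
pose C := supercritical_constant n p q Lambda d2 * (M + 1) `^ (q - p).
pose dm := p * ((1 - c0) / 2).
have C1 : 1 <= C.
  have C31 := supercritical_constant_ge1 n q p1 L1 (ltW d20).
  apply: (le_trans C31); apply: ler_peMr; first exact: le_trans C31.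
  have e : 0 <= q - p by rewrite subr_ge0 ltW.
  by have := ler_powR2r e ler01 (_ : 1 <= M + 1); rewrite powR1; apply; rewrite lerDr.
have C0 : 0 < C by exact: lt_le_trans C1.
have dm0 : 0 < dm by apply: (mulr_gt0 p0); rewrite divr_gt0// subr_gt0.
have /andP[hp hl] := half_powR_lt1 dm0.
pose x := (1 - 2^-1 `^ dm) / C.
have x0 : 0 < x by rewrite divr_gt0// subr_gt0.
have x1 : x <= 1 by rewrite ler_pdivrMr// mul1r; apply: le_trans C1; rewrite gerBl ltW.
exists (Num.min (r0 / 2) (Num.min 1 (x `^ dm^-1))).
  by rewrite !lt_min ltr01 powR_gt0// andbT divr_gt0.
near=> s => -[_ spn _ qP].
have s_gt : (1 + c0) / 2 < s by near: s; apply: nbhs_left_gt; lra.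
have ds : dm <= p * (s - c0) by rewrite /dm ler_pM2l//; lra.
have d0 : 0 < p * (s - c0) by exact: lt_le_trans ds.
have xs : x <= (1 - 2^-1 `^ (p * (s - c0))) / C.
  apply: ler_wpM2r; first by rewrite invr_ge0 ltW.
  rewrite lerD2l lerN2; apply: ger_powR ds.
  by rewrite invr_gt0 ltr0n invf_le1 ?ler1n.
(* Since x <= 1, lowering the outer exponent from 1/dm to 1/d increases the power; a larger d also
   increases 1 - 2^(-d). *)
have key : x `^ dm^-1 <= ((1 - 2^-1 `^ (p * (s - c0))) / C) `^ (p * (s - c0))^-1.
  apply: (@le_trans _ _ (x `^ (p * (s - c0))^-1)).
    apply: ger_powR; first by rewrite x0.
    by rewrite lef_pV2 ?posrE.
  by apply: ler_powR2r (ltW x0) xs; rewrite invr_ge0 ltW.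
rewrite /supercritical_radius -/c0 -/C !le_min; apply/andP; split.
  by rewrite ge_min lexx.
apply/andP; split; first by rewrite !ge_min lexx orbT.
by rewrite !ge_min key !orbT.
Unshelve. all: by end_near.
Qed.

Section subminimizers.
Context {R : realType} {n : nat}.
Local Notation E := (Rn R n).
Local Notation leb := (@lebesgue R n).
Variables (s p Lambda r0 d1 d2 q : R) (Omega : set E).
Variables (K : E -> E -> \bar R) (F : E -> R -> R) (u : E -> R).
Hypotheses (n0 : (0 < n)%N) (s01 : 0 < s < 1) (p1 : 1 < p) (L1 : 1 <= Lambda).
Hypothesis r00 : 0 < r0.
Hypothesis hK : kernel_assumption s p Lambda r0 K.
Hypotheses (oO : open Omega) (bO : bounded_set Omega).
Hypothesis mF : forall v : E -> R, measurable_fun setT v -> measurable_fun setT (fun x => F x (v x)).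
Hypotheses (d10 : 0 <= d1) (d20 : 0 <= d2).
Hypothesis hF : growth_assumption Omega F d1 d2 q.
Hypothesis hu : subminimizer s p K F Omega u.

Let p0 : 0 < p. Proof. exact: lt_trans ltr01 p1. Qed.

Lemma energy_space_powR_fin : (\int[leb]_(x in Omega) (`|u x| `^ p)%:E < +oo)%E.
Proof.
have [[_ fin _] _ _] := hu.
by rewrite -(Lp_norm_powR _ _ p0); exact: poweR_lty.
Qed.

Lemma caccioppoli_case_iii tau M : growth_case_iii n s p d2 q ->
  critical_order n p q < tau -> tau <= s -> tau * p < n%:R ->
  Lp_norm (pstar n tau p) Omega u = M%:E ->
  caccioppoli_plus s p Omega d1 (supercritical_caccioppoli_constant n p q Lambda d2) 0
    (1 - q / fine (pstar n tau p)) (supercritical_radius n s p q Lambda d2 r0 M)%:E u.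
Proof.
move=> [d20' spn pq qP] ct ts tpn uM x0 r rho k Ox0 r_gt0 r_rho.
rewrite le_min => /andP[rhoR0 rhod]; rewrite !lee_fin in rhoR0 * => k0.
have BO := eball_sub_dist_boundary oO Ox0 rhod.
have M0 : 0 <= M by rewrite -lee_fin -uM; exact: Lnorm_ge0.
have cs := critical_order_lt s01 p1 pq spn qP.
rewrite (fine_pstar tpn) in uM * => /=; set P := _ / _ in uM *.
have P0 : 0 < P by exact: pstar_gt0.
have M10 : 0 < M + 1 by apply: ltr_wpDl.
have uP : (\int[leb]_(x in Omega) (`|u x| `^ P)%:E <= ((M + 1) `^ P)%:E)%E.
  rewrite -(Lp_norm_powR _ _ P0) uM poweR_EFin lee_fin.
  by apply: ler_powR2r (ltW P0) M0 _; rewrite lerDl.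
have epsd : n%:R * (1 - q / P) <= s * p - n%:R * (q - p) / P.
  rewrite -subr_ge0 (exponent_gap s q n0 p1 tpn); apply: mulr_ge0 (ltW p0) _.
  by rewrite subr_ge0.
have d0 : 0 < p * (s - critical_order n p q) by apply: (mulr_gt0 p0); rewrite subr_gt0.
have R0r0 : 2 * supercritical_radius n s p q Lambda d2 r0 M <= r0.
  by rewrite mulrC -ler_pdivlMr//; exact: supercritical_radius_le_half.
exact: (caccioppoli_supercritical n0 s01 p1 L1 hK oO bO mF d10 d20 hF hu pq
  (lt_pstar n0 p1 pq ct tpn) M10 uP (supercritical_radius_le1 _ _ _ _ _ _ _ _) R0r0 d0
  (level_exponent_ge s n0 p1 pq ct tpn) epsd (deficit_exponent_le n0 p1 pq tpn ts)
  (supercritical_radius_small p1 L1 d20 r00 M0 cs) r_gt0 r_rho rhoR0 BO k0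
  energy_space_powR_fin).
Qed.

End subminimizers.

(** * De Giorgi classes *)

Section De_Giorgi_membership.
Context {R : realType} {n : nat}.
Local Notation E := (Rn R n).
Variables (s p d1 H eps R0 : R) (k0 : \bar R) (Omega : set E) (u : E -> R).
Hypotheses (n0 : (0 < n)%N) (s01 : 0 < s < 1) (p1 : 1 < p).
Hypotheses (oO : open Omega) (O0 : Omega !=set0) (hu : in_energy_space s p Omega u).
Hypotheses (d10 : 0 <= d1) (H1 : 1 <= H) (k0y : (k0 < +oo)%E).
Hypotheses (eps0 : 0 < eps <= s * p / n%:R) (R00 : 0 < R0).

Let parameters : @DG_parameters R n s p (d1 `^ p^-1) H k0 eps 0 R0%:E.
Proof. by split => //; rewrite powR_ge0. Qed.

Let root_powR rho : rho `^ 0 * (d1 `^ p^-1) `^ p = d1.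
Proof.
by rewrite powRr0 mul1r -powRrM mulVf ?powRr1// gt_eqF// (lt_trans _ p1).
Qed.

Lemma DG_plus_of_caccioppoli : caccioppoli_plus s p Omega d1 H k0 eps R0%:E u ->
  DG_plus s p Omega (d1 `^ p^-1) H k0 eps 0 R0%:E u.
Proof.
move=> cac; split; [exact: parameters|exact: (energy_space_in_tail_space n0 s01 p1 oO O0 hu)
  |exact: energy_space_in_Wsp hu|].
by move=> x0 r rho k Ox0 r0 rrho rhoR k0k; rewrite root_powR; apply: cac => //; exact: ltW.
Qed.

Lemma DG_minus_of_caccioppoli : caccioppoli_minus s p Omega d1 H k0 eps R0%:E u ->
  DG_minus s p Omega (d1 `^ p^-1) H k0 eps 0 R0%:E u.
Proof.
move=> cac; split; [exact: parameters|exact: (energy_space_in_tail_space n0 s01 p1 oO O0 hu)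
  |exact: energy_space_in_Wsp hu|].
by move=> x0 r rho k Ox0 r0 rrho rhoR k0k; rewrite root_powR; apply: cac => //; exact: ltW.
Qed.

End De_Giorgi_membership.

(** * Reduction of superminimizers by reflection *)

Section reflection.
Context {R : realType} {n : nat}.
Local Notation E := (Rn R n).
Local Notation leb := (@lebesgue R n).
Local Notation lebleb := (leb \x leb)%E.
Variables (s p : R) (Omega : set E).
Implicit Types (u : E -> R) (F : E -> R -> R) (K : E -> E -> \bar R).

Lemma Lp_normN (e : \bar R) u : Lp_norm e Omega (\- u) = Lp_norm e Omega u.
Proof.
rewrite /Lp_norm -[RHS]oppe_Lnorm; congr Lnorm; apply/funext => x.
by rewrite /= !patchE; case: ifP => _ /=; rewrite ?oppr0.
Qed.

Lemma difference_quotientN u z : difference_quotient s p (\- u) z = difference_quotient s p u z.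
Proof. by rewrite /difference_quotient /= opprK addrC distrC. Qed.

Lemma in_energy_spaceN u : in_energy_space s p Omega u -> in_energy_space s p Omega (\- u).
Proof.
move=> [mu lp fin]; split; [|by rewrite Lp_normN|].
  exact: measurableT_comp (@oppr_measurable R setT) mu.
apply: le_lt_trans fin; rewrite le_eqVlt; apply/orP; left; apply/eqP.
by apply: eq_integral => z _; rewrite difference_quotientN.
Qed.

Lemma DG_ineq_reflect c H eps R0 x0 r rho k u :
  DG_ineq_plus s p c H eps R0 x0 r rho (- k) (\- u) ->
  DG_ineq_minus s p c H eps R0 x0 r rho k u.
Proof.
rewrite /DG_ineq_plus /DG_ineq_minus /DG_ineq normrN.
have -> : ((\- u) \- cst (- k))^\+ = (u \- cst k)^\-.
  have e x : Num.max (- u x - - k) 0 = Num.max (- (u x - k)) 0 by congr Num.max; ring.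
  exact/funext/e.
have -> : ((\- u) \- cst (- k))^\- = (u \- cst k)^\+.
  have e x : Num.max (- (- u x - - k)) 0 = Num.max (u x - k) 0 by congr Num.max; ring.
  exact/funext/e.
have -> : [set x | - k < (\- u) x] = [set x | u x < k].
  by apply/seteqP; split => x /=; rewrite ltrN2.
by [].
Qed.

Lemma caccioppoli_reflect d1 H k0 eps R0 u :
  caccioppoli_plus s p Omega d1 H k0 eps R0 (\- u) ->
  caccioppoli_minus s p Omega d1 H k0 eps R0 u.
Proof.
move=> cac x0 r rho k Ox0 r0 rrho rhoR kk0; apply: DG_ineq_reflect; apply: cac => //.
by rewrite EFinN leeNr.
Qed.

Lemma interactionN K u : interaction p K Omega (\- u) = interaction p K Omega u.
Proof.
apply: (congr1 (mule _)); apply: eq_integral => z _.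
by rewrite /= opprK addrC distrC.
Qed.

Lemma energyN K F u :
  energy p K (fun x t => F x (- t)) Omega (\- u) = energy p K F Omega u.
Proof.
rewrite /energy interactionN; congr (_ + _)%E.
by apply: eq_integral => x _; rewrite /= opprK.
Qed.

Lemma energy_definedN K F u :
  energy_defined p K (fun x t => F x (- t)) Omega (\- u) = energy_defined p K F Omega u.
Proof.
rewrite /energy_defined interactionN.
by have -> : (fun x => F x (- (\- u) x)) = (fun x => F x (u x)) by apply/funext => x /=; rewrite opprK.
Qed.

Lemma superminimizer_reflect K F u : superminimizer s p K F Omega u ->
  subminimizer s p K (fun x t => F x (- t)) Omega (\- u).
Proof.
move=> [hes def min]; split; [exact: in_energy_spaceN|by rewrite energy_definedN|].
move=> phi mphi phi0 sup.
have -> : (\- u) \+ phi = \- (u \+ (\- phi)) by apply/funext => x /=; ring.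
rewrite energy_definedN !energyN; apply: min.
- exact: measurableT_comp (@oppr_measurable R setT) mphi.
- by move=> x /=; rewrite oppr_ge0.
- apply: subset_trans sup; apply: closure_subset => x /=.
  by rewrite oppr_eq0.
Qed.

End reflection.

Section conclusion.
Context {R : realType} {n : nat}.
Local Notation E := (Rn R n).
Variables (s p Lambda r0 d1 d2 q : R) (Omega : set E).
Variables (K : E -> E -> \bar R) (F : E -> R -> R) (u : E -> R).
Hypotheses (n0 : (0 < n)%N) (s01 : 0 < s < 1) (p1 : 1 < p) (L1 : 1 <= Lambda).
Hypothesis r00 : 0 < r0.
Hypothesis hK : kernel_assumption s p Lambda r0 K.
Hypotheses (oO : open Omega) (bO : bounded_set Omega) (O0 : Omega !=set0).
Hypothesis mF : forall v : E -> R, measurable_fun setT v -> measurable_fun setT (fun x => F x (v x)).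
Hypotheses (d10 : 0 <= d1) (d20 : 0 <= d2).
Hypothesis hF : growth_assumption Omega F d1 d2 q.

Local Notation sigma := ((s + critical_order n p q) / 2).
Local Notation H1 := (caccioppoli_constant n p Lambda 1).
Local Notation H2 := (caccioppoli_constant n p Lambda (1 + d2 * 4 `^ p)).
Local Notation H3 := (supercritical_caccioppoli_constant n p q Lambda d2).
Local Notation radius M := (supercritical_radius n s p q Lambda d2 r0 M).

Let sp0 : 0 < s * p / n%:R.
Proof.
by rewrite divr_gt0 ?ltr0n// mulr_gt0 ?(lt_trans _ p1)//; have /andP[] := s01.
Qed.

Let r20 : 0 < r0 / 2. Proof. by rewrite divr_gt0. Qed.

(** Halfway between the critical order and [s], the order is subcritical even when n = s p, and its
    Sobolev exponent is still larger than [q]. *)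
Lemma sobolev_order_itv tau : growth_case_iii n s p d2 q ->
  tau = sigma \/ (s * p < n%:R /\ tau = s) ->
  [/\ critical_order n p q < tau, tau <= s & tau * p < n%:R].
Proof.
move=> [_ spn pq qP] h; have cs := critical_order_lt s01 p1 pq spn qP.
case: h => [->|[spn' ->]]; last by split.
have h : sigma < s by lra.
split; [lra|exact: ltW|].
by apply: lt_le_trans spn; rewrite ltr_pM2r// (lt_trans _ p1).
Qed.

Lemma deficit_exponent_itv tau : growth_case_iii n s p d2 q ->
  tau = sigma \/ (s * p < n%:R /\ tau = s) ->
  0 < 1 - q / fine (pstar n tau p) <= s * p / n%:R.
Proof.
move=> c3 h; have [ct ts tpn] := sobolev_order_itv c3 h; have [_ _ pq _] := c3.
rewrite (fine_pstar tpn)/=; apply/andP; split.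
  exact: (deficit_exponent_gt0 n0 p1 pq ct tpn).
exact: (deficit_exponent_le n0 p1 pq tpn ts).
Qed.

Let H11 : 1 <= H1. Proof. exact: caccioppoli_constant_ge1. Qed.
Let H21 : 1 <= H2.
Proof. by apply: caccioppoli_constant_ge1 => //; exact: addr_ge0 ler01 (mulr_ge0 d20 (powR_ge0 _ _)). Qed.
Let H31 : 1 <= H3. Proof. exact: supercritical_caccioppoli_constant_ge1. Qed.
Let rm0 : 0 < Num.min 1 (r0 / 2). Proof. by rewrite lt_min ltr01. Qed.

Lemma radius_gt0 M : growth_case_iii n s p d2 q -> 0 <= M -> 0 < radius M.
Proof.
move=> [_ spn pq qP] M0.
exact: (supercritical_radius_gt0 p1 L1 d20 r00 M0 (critical_order_lt s01 p1 pq spn qP)).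
Qed.

Hypothesis case : growth_case_i d2 \/ growth_case_ii p d2 q \/ growth_case_iii n s p d2 q.
Hypothesis fin : growth_case_iii n s p d2 q -> (Lp_norm (pstar n sigma p) Omega u < +oo)%E.

(** Parametrized by the inequality and the class, so that one derivation covers both signs. *)
Definition De_Giorgi_conclusion
    (cac : R -> R -> \bar R -> R -> \bar R -> (E -> R) -> Prop)
    (DG : R -> R -> \bar R -> R -> R -> \bar R -> (E -> R) -> Prop) : Prop :=
  (exists (R1 : R) (k0 : \bar R) (H eps : R),
     [/\ 0 < R1 <= r0 / 2, (k0 <= 1)%E, 1 <= H, 0 < eps <= s * p / n%:R
       & cac d1 H k0 eps R1%:E u]) /\
  (growth_case_i d2 -> DG (d1 `^ p^-1) H1 -oo%E (s * p / n%:R) 0 (r0 / 2)%:E u) /\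
  (growth_case_ii p d2 q ->
     DG (d1 `^ p^-1) H2 1%E (s * p / n%:R) 0 (Num.min 1 (r0 / 2))%:E u) /\
  (growth_case_iii n s p d2 q -> forall tau M : R,
     tau = sigma \/ (s * p < n%:R /\ tau = s) ->
     Lp_norm (pstar n tau p) Omega u = M%:E ->
     radius M <= r0 / 2 /\
     DG (d1 `^ p^-1) H3 0%E (1 - q / fine (pstar n tau p)) 0 (radius M)%:E u).

Lemma conclude cac DG :
  (forall H k0 eps R0, 1 <= H -> (k0 < +oo)%E -> 0 < eps <= s * p / n%:R -> 0 < R0 ->
     cac d1 H k0 eps R0%:E u -> DG (d1 `^ p^-1) H k0 eps 0 R0%:E u) ->
  (growth_case_i d2 -> cac d1 H1 -oo%E (s * p / n%:R) (r0 / 2)%:E u) ->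
  (growth_case_ii p d2 q -> cac d1 H2 1%E (s * p / n%:R) (Num.min 1 (r0 / 2))%:E u) ->
  (growth_case_iii n s p d2 q -> forall tau M : R,
     tau = sigma \/ (s * p < n%:R /\ tau = s) ->
     Lp_norm (pstar n tau p) Omega u = M%:E ->
     cac d1 H3 0%E (1 - q / fine (pstar n tau p)) (radius M)%:E u) ->
  De_Giorgi_conclusion cac DG.
Proof.
move=> toDG c1 c2 c3.
have e0 : 0 < s * p / n%:R <= s * p / n%:R by rewrite sp0 lexx.
have M0 tau M : Lp_norm (pstar n tau p) Omega u = M%:E -> 0 <= M.
  by move=> uM; rewrite -lee_fin -uM; exact: Lnorm_ge0.
split; [|split; [|split]].
- case: case => [h|[h|h]].
  + exists (r0 / 2), -oo%E, H1, (s * p / n%:R); split; rewrite ?leNye//; last exact: c1.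
    by rewrite r20 lexx.
  + exists (Num.min 1 (r0 / 2)), 1%E, H2, (s * p / n%:R); split => //; last exact: c2.
    by rewrite rm0 ge_min lexx orbT.
  + have uM : Lp_norm (pstar n sigma p) Omega u = (fine (Lp_norm (pstar n sigma p) Omega u))%:E.
      by rewrite fineK// ge0_fin_numE; [exact: fin|exact: Lnorm_ge0].
    move: (fine _) uM => M uM.
    exists (radius M), 0%E, H3, (1 - q / fine (pstar n sigma p)); split => //.
    * by rewrite (radius_gt0 h (M0 _ _ uM)) supercritical_radius_le_half.
    * by apply: deficit_exponent_itv => //; left.
    * by apply: c3 uM => //; left.
- by move=> h; apply: toDG; rewrite ?ltNyr//; exact: c1.
- by move=> h; apply: toDG; rewrite ?ltry//; exact: c2.
- move=> h tau M tE uM; split; first exact: supercritical_radius_le_half.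
  apply: toDG => //; first exact: deficit_exponent_itv.
    exact: radius_gt0 (M0 _ _ uM).
  exact: c3 uM.
Qed.

Lemma subminimizer_conclusion : subminimizer s p K F Omega u ->
  De_Giorgi_conclusion (@caccioppoli_plus R n s p Omega) (@DG_plus R n s p Omega).
Proof.
move=> hu; have [hes _ _] := hu.
apply: conclude.
- move=> H k0 eps R0 H1' k0y eps0 R00.
  exact: (DG_plus_of_caccioppoli n0 s01 p1 oO O0 hes d10 H1' k0y eps0 R00).
- by move=> h; exact: (caccioppoli_case_i s01 p1 L1 hK oO bO mF d10 d20 hF hu h).
- move=> [_ h]; apply: (caccioppoli_case_ii s01 p1 L1 hK oO bO mF d10 d20 hF hu h).
  exact: (energy_space_powR_fin p1 hu).
- move=> h tau M tE uM; have [ct ts tpn] := sobolev_order_itv h tE.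
  exact: (caccioppoli_case_iii n0 s01 p1 L1 r00 hK oO bO mF d10 d20 hF hu h ct ts tpn uM).
Qed.

End conclusion.

Lemma superminimizer_conclusion (R : realType) (n : nat)
    (s p Lambda r0 d1 d2 q : R) (Omega : set (Rn R n))
    (K : Rn R n -> Rn R n -> \bar R) (F : Rn R n -> R -> R) (u : Rn R n -> R) :
  (0 < n)%N -> 0 < s < 1 -> 1 < p -> 1 <= Lambda -> 0 < r0 ->
  kernel_assumption s p Lambda r0 K -> open Omega -> bounded_set Omega -> Omega !=set0 ->
  (forall v : Rn R n -> R, measurable_fun setT v -> measurable_fun setT (fun x => F x (v x))) ->
  0 <= d1 -> 0 <= d2 -> growth_assumption Omega F d1 d2 q ->
  growth_case_i d2 \/ growth_case_ii p d2 q \/ growth_case_iii n s p d2 q ->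
  (growth_case_iii n s p d2 q ->
    (Lp_norm (pstar n ((s + critical_order n p q) / 2) p) Omega u < +oo)%E) ->
  superminimizer s p K F Omega u ->
  De_Giorgi_conclusion s p Lambda r0 d1 d2 q Omega u
    (@caccioppoli_minus R n s p Omega) (@DG_minus R n s p Omega).
Proof.
move=> n0 s01 p1 L1 r00 hK oO bO O0 mF d10 d20 hF case fin hu; have [hes _ _] := hu.
have hu' := superminimizer_reflect hu.
have mF' (v : Rn R n -> R) : measurable_fun setT v -> measurable_fun setT (fun x => F x (- v x)).
  by move=> mv; apply: mF; exact: measurableT_comp (@oppr_measurable R setT) mv.
have hF' : growth_assumption Omega (fun x t => F x (- t)) d1 d2 q.
  by apply: filterS hF => x h Ox t; rewrite -(normrN t); exact: h.
apply: conclude => //.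
- move=> H k0 eps R0 H1' k0y eps0 R00.
  exact: (DG_minus_of_caccioppoli n0 s01 p1 oO O0 hes d10 H1' k0y eps0 R00).
- move=> h; apply: caccioppoli_reflect.
  exact: (caccioppoli_case_i s01 p1 L1 hK oO bO mF' d10 d20 hF' hu' h).
- move=> [_ h]; apply: caccioppoli_reflect.
  apply: (caccioppoli_case_ii s01 p1 L1 hK oO bO mF' d10 d20 hF' hu' h).
  exact: (energy_space_powR_fin p1 hu').
- move=> h tau M tE uM; have [ct ts tpn] := sobolev_order_itv s01 p1 h tE.
  apply: caccioppoli_reflect.
  rewrite -Lp_normN in uM.
  exact: (caccioppoli_case_iii n0 s01 p1 L1 r00 hK oO bO mF' d10 d20 hF' hu' h ct ts tpn uM).
Qed.
Theorem proposition7p5 (R : realType) :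
  exists (H1 : nat -> R -> R -> R)
         (H2 : nat -> R -> R -> R -> R)
         (H3 : nat -> R -> R -> R -> R -> R)
         (sigma : nat -> R -> R -> R -> R)
         (R0 : R -> nat -> R -> R -> R -> R -> R -> R -> R -> R),
  (* sigma lies in (0,s) *)
  (forall (n : nat) (s p q d2 : R), (0 < n)%N -> 0 < s < 1 -> 1 < p ->
     growth_case_iii n s p d2 q -> 0 < sigma n s p q < s) /\
  (* if n > p, then R0 does not degenerate as s tends to 1 from the left *)
  (forall (n : nat) (p q Lambda d2 r0 M : R),
     1 < p -> p < n%:R -> 1 <= Lambda -> 0 < r0 -> 0 <= M ->
     exists2 c : R, 0 < c & \forall s \near (1 : R)^'-,
       growth_case_iii n s p d2 q -> forall tau : R,
         tau = sigma n s p q \/ tau = s ->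
         c <= R0 tau n s p q Lambda d2 r0 M) /\
  (forall (n : nat) (s p : R) (K : Rn R n -> Rn R n -> \bar R) (Lambda r0 : R)
     (Omega : set (Rn R n)) (F : Rn R n -> R -> R) (d1 d2 q : R)
     (u : Rn R n -> R),
   (0 < n)%N -> 0 < s < 1 -> 1 < p ->
   1 <= Lambda -> 0 < r0 -> kernel_assumption s p Lambda r0 K ->
   open Omega -> bounded_set Omega -> Omega !=set0 ->
   potential_assumption F ->
   0 <= d1 -> 0 <= d2 -> growth_assumption Omega F d1 d2 q ->
   growth_case_i d2 \/ growth_case_ii p d2 q \/ growth_case_iii n s p d2 q ->
   (* in case (iii), the norm of u on which R0 depends is finite *)
   (growth_case_iii n s p d2 q ->
      (Lp_norm (pstar n (sigma n s p q) p) Omega u < +oo)%E) ->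
   (subminimizer s p K F Omega u ->
     (exists (R1 : R) (k0 : \bar R) (H eps : R),
        [/\ 0 < R1 <= r0 / 2, (k0 <= 1)%E, 1 <= H, 0 < eps <= s * p / n%:R
          & caccioppoli_plus s p Omega d1 H k0 eps R1%:E u]) /\
     (growth_case_i d2 ->
        DG_plus s p Omega (d1 `^ p^-1) (H1 n p Lambda) -oo
          (s * p / n%:R) 0 (r0 / 2)%:E u) /\
     (growth_case_ii p d2 q ->
        DG_plus s p Omega (d1 `^ p^-1) (H2 n p Lambda d2) 1
          (s * p / n%:R) 0 (Num.min 1 (r0 / 2))%:E u) /\
     (growth_case_iii n s p d2 q -> forall tau M : R,
        tau = sigma n s p q \/ (s * p < n%:R /\ tau = s) ->
        Lp_norm (pstar n tau p) Omega u = M%:E ->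
        R0 tau n s p q Lambda d2 r0 M <= r0 / 2 /\
        DG_plus s p Omega (d1 `^ p^-1) (H3 n p q Lambda d2) 0
          (1 - q / fine (pstar n tau p)) 0
          (R0 tau n s p q Lambda d2 r0 M)%:E u)) /\
   (superminimizer s p K F Omega u ->
     (exists (R1 : R) (k0 : \bar R) (H eps : R),
        [/\ 0 < R1 <= r0 / 2, (k0 <= 1)%E, 1 <= H, 0 < eps <= s * p / n%:R
          & caccioppoli_minus s p Omega d1 H k0 eps R1%:E u]) /\
     (growth_case_i d2 ->
        DG_minus s p Omega (d1 `^ p^-1) (H1 n p Lambda) -oo
          (s * p / n%:R) 0 (r0 / 2)%:E u) /\
     (growth_case_ii p d2 q ->
        DG_minus s p Omega (d1 `^ p^-1) (H2 n p Lambda d2) 1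
          (s * p / n%:R) 0 (Num.min 1 (r0 / 2))%:E u) /\
     (growth_case_iii n s p d2 q -> forall tau M : R,
        tau = sigma n s p q \/ (s * p < n%:R /\ tau = s) ->
        Lp_norm (pstar n tau p) Omega u = M%:E ->
        R0 tau n s p q Lambda d2 r0 M <= r0 / 2 /\
        DG_minus s p Omega (d1 `^ p^-1) (H3 n p q Lambda d2) 0
          (1 - q / fine (pstar n tau p)) 0
          (R0 tau n s p q Lambda d2 r0 M)%:E u))).
Proof.
(* The same radius is used for the order [sigma] and for the order [s], since [level_exponent_ge]
   bounds the exponent for both. *)
exists (fun n p Lambda => caccioppoli_constant n p Lambda 1),
  (fun n p Lambda d2 => caccioppoli_constant n p Lambda (1 + d2 * 4 `^ p)),
  (fun n p q Lambda d2 => supercritical_caccioppoli_constant n p q Lambda d2),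
  (fun n s p q => (s + critical_order n p q) / 2),
  (fun _ n s p q Lambda d2 r0 M => supercritical_radius n s p q Lambda d2 r0 M).
split; [|split].
- move=> n s p q d2 n0 s01 p1 [_ spn pq qP].
  have cs := critical_order_lt s01 p1 pq spn qP.
  have c0 := critical_order_gt0 n0 p1 pq.
  by have /andP[s0 _] := s01; apply/andP; split; lra.
- move=> n p q Lambda d2 r0 M p1 _ L1 r00 M0.
  have [c c0 h] := @supercritical_radius_near1 R n p q Lambda d2 r0 M p1 L1 r00 M0.
  by exists c => //; apply: filterS h => s h c3 tau _; exact: h.
- move=> n s p K Lambda r0 Omega F d1 d2 q u n0 s01 p1 L1 r00 hK oO bO O0 [_ mF] d10 d20 hF
    case fin; split => hu.
    exact: (subminimizer_conclusion n0 s01 p1 L1 r00 hK oO bO O0 mF d10 d20 hF case fin hu).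
  exact: (superminimizer_conclusion n0 s01 p1 L1 r00 hK oO bO O0 mF d10 d20 hF case fin hu).
Qed.
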